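(* Let $N\ge1$. There is a constant $C_N^{(2)}$ depending only on $N$ such that for every real symmetric positive definite $N\times N$ matrix $S$ there exists $J_{opt}\in\mathcal{A}_N(\mathbb{R})$, attaining $\max_{J\in\mathcal{A}_N(\mathbb{R})}\min\mathrm{Re}\,(\sigma(-\mathcal{L}_J)\setminus\{0\})=\mathrm{Tr}(S)/N$ and satisfying $$\left\|e^{t\mathcal{L}_{J_{opt}}}u-\int_{\mathbb{R}^N}u\,\psi_\infty dx\right\|_{L^2(\psi_\infty)}\le C_N^{(2)}\kappa(S)^{7/2}e^{-\frac{\mathrm{Tr}(S)}{N}t}\left\|u-\int_{\mathbb{R}^N}u\,\psi_\infty dx\right\|_{L^2(\psi_\infty)}$$ for all $u\in L^2(\mathbb{R}^N,\psi_\infty dx;\mathbb{C})$, $t\ge0$; and for any such $J_{opt}$, setting $J=-J_{opt}$, the following holds. If $\psi_0^J\in L^2(\mathbb{R}^N,\psi_\infty^{-1}dx)$ is a probability density and $\psi_t^J$ is the solution in $L^2(\mathbb{R}^N,\psi_\infty^{-1}dx)$ of the Fokker-Planck equation $$\partial_t\psi_t^J=\nabla\cdot\left(B_Jx\,\psi_t^J+\nabla\psi_t^J\right),\qquad B_J=(I+J)S,$$ with initial datum $\psi_0^J$, then for all $t\ge0$ $$\left\|\psi_t^J-\psi_\infty\right\|_{L^2(\psi_\infty^{-1})}\le C_N^{(2)}\kappa(S)^{7/2}\exp\left(-\frac{\mathrm{Tr}(S)}{N}t\right)\left\|\psi_0^J-\psi_\infty\right\|_{L^2(\psi_\infty^{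-1})}.$$
   Context: $\mathcal{A}_N(\mathbb{R})$ is the set of real antisymmetric $N\times N$ matrices. $\psi_\infty(x)=\frac{\det(S)^{1/2}}{(2\pi)^{N/2}}\exp\left(-\frac{x^TSx}{2}\right)$. $\|f\|^2_{L^2(\psi_\infty)}=\int|f|^2\psi_\infty dx$ and $\|f\|^2_{L^2(\psi_\infty^{-1})}=\int|f|^2\psi_\infty^{-1}dx$. For $J\in\mathcal{A}_N(\mathbb{R})$, $\mathcal{L}_J=-(B_Jx)\cdot\nabla+\Delta$ with $B_J=(I+J)S$, acting in $L^2(\mathbb{R}^N,\psi_\infty dx;\mathbb{C})$ with domain $\{u:\mathcal{L}_Ju\in L^2(\mathbb{R}^N,\psi_\infty dx;\mathbb{C})\}$; it generates a contraction semigroup $(e^{t\mathcal{L}_J})_{t\ge0}$. $\kappa(M)=\|M\|\,\|M^{-1}\|$ for the matrix norm induced by the Euclidean norm. *)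

(* Defs.v *)
From HB Require Import structures.
From mathcomp Require Import all_boot all_order all_algebra.
From mathcomp Require Import all_classical all_reals all_analysis.
From mathcomp Require Import complex.

Set Implicit Arguments.
Unset Strict Implicit.
Unset Printing Implicit Defensive.
Import Order.TTheory GRing.Theory Num.Theory.
Import numFieldNormedType.Exports.

Local Open Scope classical_set_scope.
Local Open Scope complex_scope.
Local Open Scope ring_scope.

(* R^N is the space 'cV[R]_N of column vectors with its library topology.  The *)
(* library has neither a sigma-algebra nor a Lebesgue measure on it: the       *)
(* sigma-algebra below is generated by the coordinates (the Borel one), and    *)
(* lebesgue_cV is the product of N copies of the measure on the line, carried  *)
(* by the identification R * R^n = R^(n+1).                                    *)

Section Borel_cV.
Context {R : realType}.
Variable n : nat.

Let coors : 'I_n -> 'cV[R]_n -> measurableTypeR R := fun i x => x i 0.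

Let cV_set0 : g_sigma_preimage coors set0.
Proof. exact: sigma_algebra0. Qed.

Let cV_setC A : g_sigma_preimage coors A -> g_sigma_preimage coors (~` A).
Proof. exact: sigma_algebraC. Qed.

Let cV_bigcup (F : _^nat) : (forall i, g_sigma_preimage coors (F i)) ->
  g_sigma_preimage coors (\bigcup_i (F i)).
Proof. exact: sigma_algebra_bigcup. Qed.

HB.instance Definition _ := @isMeasurable.Build default_measure_display
  'cV[R]_n (g_sigma_preimage coors) cV_set0 cV_setC cV_bigcup.

Lemma measurable_coord (i : 'I_n) :
  measurable_fun [set: 'cV[R]_n] (fun x => x i 0 : measurableTypeR R).
Proof.
move=> _ Y mY; rewrite setTI; apply: sub_sigma_algebra => /=.
rewrite -bigcup_seq/=; exists i => /=; first by rewrite mem_index_enum.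
by exists Y => //; rewrite setTI.
Qed.

Lemma measurable_fun_cV d (T : measurableType d) (f : T -> 'cV[R]_n) :
  (forall i, measurable_fun [set: T] (fun t => f t i 0 : measurableTypeR R)) ->
  measurable_fun [set: T] f.
Proof.
move=> mf; suff : preimage_set_system [set: T] f (g_sigma_preimage coors) `<=`
    measurable.
  by move=> sub _ A mA; apply: sub; exists A.
rewrite -g_sigma_preimageE; apply: smallest_sub.
  exact: sigma_algebra_measurable.
move=> _ [A + <-]; rewrite -bigcup_seq => -[i _ [B mB <-]].
by rewrite setTI; exact: mf.
Qed.

End Borel_cV.

Section Lebesgue_cV.
Context {R : realType}.

Definition cV_cons n (p : measurableTypeR R * 'cV[R]_n) : 'cV[R]_n.+1 :=
  \col_(i < n.+1) oapp (fun j => p.2 j 0) p.1 (unlift ord0 i).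

Definition cV_uncons n (x : 'cV[R]_n.+1) : measurableTypeR R * 'cV[R]_n :=
  (x ord0 0, \col_(j < n) x (lift ord0 j) 0).

Lemma cV_consK n : cancel (@cV_cons n) (@cV_uncons n).
Proof.
case=> a x; congr pair; first by rewrite mxE unlift_none.
by apply/colP => j; rewrite !mxE liftK.
Qed.

Lemma measurable_cV_cons n : measurable_fun setT (@cV_cons n).
Proof.
apply: measurable_fun_cV => i; rewrite /cV_cons.
under eq_fun do rewrite mxE.
case: unliftP => [j _|_] /=; last exact: measurable_fst.
exact: (measurableT_comp (measurable_coord j)).
Qed.

Lemma measurable_cV_uncons n : measurable_fun setT (@cV_uncons n).
Proof.
apply/measurable_fun_pairP; split; first exact: measurable_coord.
apply: measurable_fun_cV => i; rewrite /cV_uncons/=.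
under eq_fun do rewrite mxE.
exact: measurable_coord.
Qed.

Section lebesgue_cV_step.
Variables (n : nat) (m : {sigma_finite_measure set 'cV[R]_n -> \bar R}).

Let step : set 'cV[R]_n.+1 -> \bar R :=
  pushforward (@lebesgue_measure R \x m)%E (@cV_cons n).

Let step0 : step set0 = 0%E.
Proof. by rewrite /step /pushforward preimage_set0 measure0. Qed.

Let step_ge0 A : (0 <= step A)%E.
Proof. by rewrite /step /pushforward; exact: measure_ge0. Qed.

Let mpre A : measurable A -> measurable (@cV_cons n @^-1` A).
Proof.
by move=> mA; rewrite -[X in measurable X]setTI; exact: measurable_cV_cons.
Qed.

Let step_sigma_additive : semi_sigma_additive step.
Proof.
move=> F mF tF mUF; rewrite /step /pushforward preimage_bigcup.
apply: measure_semi_sigma_additive.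
- by move=> i; exact: mpre.
- apply/trivIsetP => /= i j _ _ ij; rewrite -preimage_setI.
  by move/trivIsetP : tF => /(_ _ _ _ _ ij) ->//; rewrite preimage_set0.
- by rewrite -preimage_bigcup; exact: mpre.
Qed.

HB.instance Definition _ :=
  isMeasure.Build _ _ _ step step0 step_ge0 step_sigma_additive.

Let step_sigma_finite : sigma_finite setT step.
Proof.
have /sigma_finiteP[F [TF ndF Foo]] := sigma_finiteT (@lebesgue_measure R).
have /sigma_finiteP[G [TG ndG Goo]] := sigma_finiteT m.
exists (fun i => @cV_uncons n @^-1` (F i `*` G i)).
  rewrite -preimage_bigcup; suff <- : setT = \bigcup_i (F i `*` G i).
    by rewrite preimage_setT.
  rewrite -setXTT TF TG predeqE => -[x y]; split.
    move=> [/= [i _ Fix] [j _ Gjy]]; exists (maxn i j) => //; split.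
    - by move: x Fix; exact/subsetPset/ndF/leq_maxl.
    - by move: y Gjy; exact/subsetPset/ndG/leq_maxr.
  by move=> [i _ []/= ? ?]; split; exists i.
move=> i; have [mF Fi] := Foo i; have [mG Gi] := Goo i; split.
  rewrite -[X in measurable X]setTI; apply: measurable_cV_uncons => //.
  exact: measurableX.
rewrite /step /pushforward -comp_preimage.
suff -> : (@cV_uncons n \o @cV_cons n) @^-1` (F i `*` G i) = F i `*` G i.
  by rewrite product_measure1E// lte_mul_pinfty// ge0_fin_numE.
by have -> : @cV_uncons n \o @cV_cons n = id by apply/funext; exact: cV_consK.
Qed.

HB.instance Definition _ :=
  @Measure_isSigmaFinite.Build _ _ _ step step_sigma_finite.

Definition lebesgue_cV_step : {sigma_finite_measure set 'cV[R]_n.+1 -> \bar R} :=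
  step.

End lebesgue_cV_step.

Fixpoint lebesgue_cV n : {sigma_finite_measure set 'cV[R]_n -> \bar R} :=
  match n with
  | 0%N => dirac (0 : 'cV[R]_0)
  | n'.+1 => lebesgue_cV_step (lebesgue_cV n')
  end.

End Lebesgue_cV.
Arguments lebesgue_cV {R} n.


Section matrices.
Context {R : realType} {N : nat}.
Implicit Types (S J M : 'M[R]_N) (x : 'cV[R]_N).

Definition antisymmetric_mx J := J^T = - J.

Definition sym_posdef S :=
  S^T = S /\ forall x, x != 0 -> 0 < (x^T *m S *m x) 0 0.

Definition enorm x : R := Num.sqrt (\sum_i x i 0 ^+ 2).

Definition opnorm M : R := sup [set enorm (M *m x) | x in [set x | enorm x <= 1]].

Definition kappa M : R := opnorm M * opnorm (invmx M).

Definition drift S J : 'M[R]_N := (1%:M + J) *m S.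

Definition psi_inf S x : R :=
  Num.sqrt (\det S) / (2 * pi) `^ (N%:R / 2) * expR (- (x^T *m S *m x) 0 0 / 2).

End matrices.

Section differential_operators.
Context {R : realType} {N : nat}.
Implicit Types (phi : 'cV[R]_N -> R) (B : 'M[R]_N) (x : 'cV[R]_N).

Definition partial (i : 'I_N) phi : 'cV[R]_N -> R :=
  fun x => 'D_(delta_mx i 0) phi x.

(* Smoothness is differentiability of all iterated partial derivatives. *)
Definition test_function phi :=
  (forall (s : seq 'I_N) x, differentiable (foldr partial phi s) x) /\
  compact (closure [set x | phi x != 0]).

Definition kolmogorov B phi x : R :=
  - (\sum_i (B *m x) i 0 * partial i phi x) + \sum_i partial i (partial i phi) x.

(* The formal adjoint of kolmogorov B for the Lebesgue measure. *)
Definition fokker_planck B phi x : R :=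
  \sum_i partial i (fun y => (B *m y) i 0 * phi y + partial i phi y) x.

End differential_operators.

Section L2.
Context {R : realType} {N : nat}.
Implicit Types (w : 'cV[R]_N -> R) (u f : 'cV[R]_N -> R[i]).

Definition ae_eq_fun u f := {ae lebesgue_cV N, forall x, u x = f x}.

Definition sqnorm w u : \bar R :=
  (\int[lebesgue_cV N]_x (Normc.normc (u x) ^+ 2 * w x)%:E)%E.

(* The square-integrable functions for w dx (representatives, not classes      *)
(* modulo a.e. equality); L2norm is meaningful on L2 only.                     *)
Definition L2 w : set ('cV[R]_N -> R[i]) :=
  [set u | [/\ measurable_fun setT (fun x => complex.Re (u x)),
               measurable_fun setT (fun x => complex.Im (u x)) &
               (sqnorm w u < +oo)%E]].

Definition L2norm w u : R := Num.sqrt (fine (sqnorm w u)).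

Definition intC f : R[i] :=
  (\int[lebesgue_cV N]_x complex.Re (f x)) +i*
  (\int[lebesgue_cV N]_x complex.Im (f x)).

End L2.

(* An unbounded operator on L2 w is given by its graph A: A u f means that u   *)
(* is in the domain and A u = f, up to a.e. equality.                          *)
Section operators.
Context {R : realType} {N : nat} (w : 'cV[R]_N -> R).
Local Notation fct := ('cV[R]_N -> R[i]).
Implicit Types (A : fct -> fct -> Prop) (u f v : fct) (z : R[i]).

Definition opp_graph A : fct -> fct -> Prop := fun u f => A u (fun x => - f x).

(* A - z is a bijection from its domain to L2 w, with bounded inverse. *)
Definition resolvent_set A : set R[i] :=
  [set z | exists M : R, forall f, L2 w f ->
    exists u, [/\ A u (fun x => f x + z * u x),
                  L2norm w u <= M * L2norm w f &
                  forall v, A v (fun x => f x + z * v x) -> ae_eq_fun v u]].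

Definition spectrum A : set R[i] := ~` resolvent_set A.

Record generates_contraction_semigroup A (T : R -> fct -> fct) : Prop := {
  semigroup_L2 : forall (t : R) u, 0 <= t -> L2 w u -> L2 w (T t u) ;
  semigroup_ae : forall (t : R) u v, 0 <= t -> L2 w u -> L2 w v ->
    ae_eq_fun u v -> ae_eq_fun (T t u) (T t v) ;
  semigroup_linear : forall (t : R) z u v, 0 <= t -> L2 w u -> L2 w v ->
    ae_eq_fun (T t (fun x => z * u x + v x)) (fun x => z * T t u x + T t v x) ;
  semigroup_0 : forall u, L2 w u -> ae_eq_fun (T 0 u) u ;
  semigroup_add : forall (s t : R) u, 0 <= s -> 0 <= t -> L2 w u ->
    ae_eq_fun (T (s + t) u) (T s (T t u)) ;
  semigroup_contraction : forall (t : R) u, 0 <= t -> L2 w u ->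
    L2norm w (T t u) <= L2norm w u ;
  semigroup_continuous : forall u, L2 w u ->
    L2norm w (fun x => T t u x - u x) @[t --> 0^'+] --> (0 : R) ;
  semigroup_generator : forall u f, L2 w u -> L2 w f ->
    A u f <->
    L2norm w (fun x => (T t u x - u x) / t%:C - f x) @[t --> 0^'+] --> (0 : R)
}.

(* The semigroup e^{tA}.  It is determined by A up to a.e. equality; the       *)
(* default value is taken only if A generates no contraction semigroup.        *)
Definition semigroup A : R -> fct -> fct :=
  xget (fun _ u => u) [set T | generates_contraction_semigroup A T].

End operators.

Section langevin.
Context {R : realType} {N : nat}.
Implicit Types (S J : 'M[R]_N) (u f : 'cV[R]_N -> R[i]).

(* The operator L_J on L2(psi_inf dx; C) with its maximal domain, where        *)
(* L_J u is computed in the sense of distributions.                            *)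
Definition L_graph S J u f :=
  [/\ L2 (psi_inf S) u, L2 (psi_inf S) f &
      forall phi, test_function phi ->
        intC (fun x => u x * (fokker_planck (drift S J) phi x)%:C) =
        intC (fun x => f x * (phi x)%:C)].

Definition minimum (A : set R) : set R := [set m | A m /\ lbound A m].

Definition spectral_gap S J (m : R) :=
  minimum [set complex.Re z |
    z in spectrum (psi_inf S) (opp_graph (L_graph S J)) `\ 0] m.

(* Part of the claim is that the minimum defining the spectral gap exists for  *)
(* every antisymmetric matrix.                                                 *)
Definition attains_max_spectral_gap S J (m : R) :=
  [/\ antisymmetric_mx J, spectral_gap S J m &
      forall J', antisymmetric_mx J' ->
        exists2 m', spectral_gap S J' m' & m' <= m].

Definition mean S u : R[i] := intC (fun x => u x * (psi_inf S x)%:C).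

Definition semigroup_decay (C : R) S J :=
  forall u (t : R), L2 (psi_inf S) u -> 0 <= t ->
    L2norm (psi_inf S)
      (fun x => semigroup (psi_inf S) (L_graph S J) t u x - mean S u)
    <= C * kappa S `^ (7 / 2) * expR (- (\tr S / N%:R) * t)
       * L2norm (psi_inf S) (fun x => u x - mean S u).

Definition optimal (C : R) S J :=
  attains_max_spectral_gap S J (\tr S / N%:R) /\ semigroup_decay C S J.

Definition toC (psi : 'cV[R]_N -> R) : 'cV[R]_N -> R[i] := fun x => (psi x)%:C.

Definition probability_density (psi : 'cV[R]_N -> R) :=
  [/\ measurable_fun setT psi,
      {ae lebesgue_cV N, forall x, 0 <= psi x} &
      (\int[lebesgue_cV N]_x (psi x)%:E = 1)%E].

Definition psi_inf_inv S (x : 'cV[R]_N) : R := (psi_inf S x)^-1.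

(* psi is in C([0, +oo[; L2(psi_inf^-1 dx)), has initial datum psi0, and       *)
(* satisfies d/dt psi_t = div (B_J x psi_t + grad psi_t) for t > 0 in the      *)
(* sense of distributions on R^N.                                              *)
Record fokker_planck_solution S J (psi0 : 'cV[R]_N -> R)
    (psi : R -> 'cV[R]_N -> R) : Prop := {
  fp_L2 : forall t : R, 0 <= t -> L2 (psi_inf_inv S) (toC (psi t)) ;
  fp_init : {ae lebesgue_cV N, forall x, psi 0 x = psi0 x} ;
  fp_continuous : forall t : R, 0 <= t ->
    L2norm (psi_inf_inv S) (toC (fun x => psi s x - psi t x))
      @[s --> within [set s | 0 <= s] (nbhs t)] --> (0 : R) ;
  fp_eq : forall (phi : 'cV[R]_N -> R) (t : R), test_function phi -> 0 < t ->
    is_derive t (1 : R) (fun s => \int[lebesgue_cV N]_x (psi s x * phi x))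
      (\int[lebesgue_cV N]_x (psi t x * kolmogorov (drift S J) phi x))
}.

End langevin.

(* Main.v *)
From HB Require Import structures.
From mathcomp Require Import all_boot all_order all_algebra.
From mathcomp Require Import ring lra.
Set Implicit Arguments.
Unset Strict Implicit.
Unset Printing Implicit Defensive.
Import Order.TTheory GRing.Theory Num.Theory.
Local Open Scope ring_scope.

(* Write S = A^T A, where A is chosen (Cholesky factor followed by plane         *)
(* rotations) so that A A^T has constant diagonal tr S / N.  In the coordinates  *)
(* y = A x the invariant measure is the standard Gaussian, and the drift matrix  *)
(* becomes H_J = A (1 - J) A^T, i.e. A A^T plus an arbitrary antisymmetric       *)
(* matrix.  On the coefficients b(w) = <u, h_w> of u on the Hermite functions,   *)
(* indexed by words w in the N coordinates, -L_J acts on each chaos as the sum   *)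
(* over the tensor slots of H_J; since sum_w b(w)^2 / |w|! is the squared norm   *)
(* of u, the semigroup is the tensor power of exp(- t H_J), and the spectrum is  *)
(* governed by the eigenvalues of H_J, whose real parts have mean tr S / N.      *)
(* With the weights q_i = i + 1, the antisymmetric part can be chosen so that    *)
(* sum_i q_i x_i (H_J x)_i = (tr S / N) sum_i q_i x_i^2: all eigenvalues then    *)
(* have real part tr S / N, and |exp(- t H_J)| <= sqrt N exp(- t tr S / N).      *)
(* Hence C = sqrt N suffices, as kappa S >= 1.  Finally psi_t / psi_inf has the  *)
(* Hermite coefficients of the semigroup of the opposite antisymmetric matrix.   *)

(** * Factorization with constant diagonal *)

(** In the coordinates y = A x, where S = A^T A, the invariant measure is the standard Gaussian and
    L_J is an Ornstein-Uhlenbeck operator governed by the single matrix H = A (1 - J) A^T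
    ([hdrift]). It preserves the degree of Hermite polynomials; on the coefficients of degree n,
    seen as a symmetric n-tensor, -L_J is the derivation [dtens H] ([L_graphE]) and the semigroup is
    the tensor power of exp(- t H) ([semigroup_coef]). So every question about L_J becomes one about
    H.

    Spectrum. Degree one puts the eigenvalues of H in the spectrum ([eigenvalue_spectrum]). In
    degree n the derivation can only produce sums of n eigenvalues of H, all of positive real part,
    so no other nonzero point lies further left ([dtens_spectrum]); coercivity, which grows like n,
    makes the inverse bounded uniformly in n ([level_solve], [resolvent_low]). Hence the gap is the
    least real part of an eigenvalue of H ([spectral_gap_min_root]). As J only changes the
    antisymmetric part of H, the trace of H is tr S and the gap is at most tr S / N
    ([exists_min_root]).

    Optimum. Choose A so that A A^T has constant diagonal ([equidiagonal_factor]). For distinct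
    weights q_i, an antisymmetric part can then be prescribed so that diag(q) H has symmetric part
    (tr S / N) diag(q) ([optimal_weighted]). All eigenvalues get real part tr S / N, and the
    q-weighted norm decays exactly at that rate; passing to the Euclidean norm costs sqrt N for q_i
    = i + 1 ([mexp_decay]). On tensors that price is paid in one slot only, the other slots being
    contractions ([le_nrm_tpowS]), so the bound is uniform in the degree, and Parseval's identity
    sums it ([semigroup_mean_decay]). Since kappa S >= 1 ([kappa_ge1]), the stated estimate follows.

    Analysis. Hermite functions are complete ([hermite_complete]); cutoffs show that the maximal
    distributional domain is the domain described by coefficients; and coefficients of any solution
    satisfy a finite linear system in each degree, whose solution is unique ([tflow_unique]). The
    last fact also applies to the Fokker-Planck equation: for -J, division by psi_inf turns it into
    the evolution of L_J ([fp_coef]), so the decay of the semigroup passes to densities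
    ([fp_decay]). *)

Section factorization.
Context {R : rcfType}.

(** Induction on the size: once the first entry a and the rest r of the first row are split off, the
    Schur complement C - r^T r / a is again positive definite. The triangular shape is what
    [gauss_integral_triangular] needs. *)
Lemma cholesky n (S : 'M[R]_n) : S^T = S ->
  (forall x : 'cV_n, x != 0 -> 0 < (x^T *m S *m x) 0 0) ->
  exists A : 'M_n, [/\ S = A^T *m A,
    forall i j : 'I_n, (j < i)%N -> A i j = 0 & forall i, 0 < A i i].
Proof.
elim: n S => [|n IH] S symS posS.
  by exists 0; split; [apply/matrixP => -[] | case | case].
pose S' : 'M_(1 + n) := S.
have symS' : S'^T = S' by exact: symS.
have posS' (x : 'cV_(1 + n)) : x != 0 -> 0 < (x^T *m S' *m x) 0 0 by exact: posS.
pose a := ulsubmx S' 0 0; pose r := ursubmx S'; pose C := drsubmx S'.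
have ulE : ulsubmx S' = a%:M by apply: mx11_scalar.
have symC : C^T = C by rewrite /C trmx_drsub symS'.
have dlE : dlsubmx S' = r^T by rewrite /r trmx_ursub symS'.
have SE : S' = block_mx a%:M r r^T C by rewrite -dlE -ulE submxK.
have a_gt0 : 0 < a.
  have e0 : (col_mx 1%:M 0 : 'cV[R]_(1 + n)) != 0.
    apply/eqP => /matrixP/(_ (lshift n 0) 0).
    by rewrite col_mxEu !mxE/= => /eqP; rewrite oner_eq0.
  have := posS' _ e0.
  rewrite SE tr_col_mx mul_row_block mul_row_col !trmx0 trmx1.
  by rewrite !mul0mx !mul1mx !addr0 mulmx1 mulmx0 addr0 mxE eqxx mulr1n.
have a_neq0 : a != 0 by rewrite gt_eqF.
pose C' := C - a^-1 *: (r^T *m r).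
have symC' : C'^T = C'.
  by rewrite /C' linearB/= linearZ/= trmx_mul trmxK symC.
have posC' (x : 'cV_n) : x != 0 -> 0 < (x^T *m C' *m x) 0 0.
  move=> x0.
  (* The first coordinate is the one that minimizes the form of S' for given x; the minimum is the
     form of the Schur complement. *)
  pose y : 'cV_(1 + n) := col_mx (- a^-1 *: (r *m x)) x.
  have y0 : y != 0.
    apply: contra_neq x0 => y0.
    by rewrite -[x](col_mxKd (- a^-1 *: (r *m x))) -/y y0; apply/colP => i; rewrite !mxE.
  have := posS' _ y0.
  suff -> : y^T *m S' *m y = x^T *m C' *m x by [].
  rewrite SE /y tr_col_mx mul_row_block mul_row_col.
  have -> : (- a^-1 *: (r *m x))^T = - a^-1 *: (x^T *m r^T).
    by rewrite linearZ/= trmx_mul.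
  rewrite mul_mx_scalar scalerA mulrN mulfV// scaleN1r addNr.
  rewrite mul0mx add0r /C' mulmxBr mulmxBl mulmxDl addrC; congr (_ + _).
  by rewrite -!scalemxAl -scalemxAr scaleNr -scalemxAl !mulmxA.
have [A' [C'E A'tri A'pos]] := IH C' symC' posC'.
pose s := Num.sqrt a.
have s_gt0 : 0 < s by rewrite sqrtr_gt0.
have s_neq0 : s != 0 by rewrite gt_eqF.
have ssE : s * s = a by rewrite -expr2 sqr_sqrtr// ltW.
pose A : 'M_(1 + n) := block_mx s%:M (s^-1 *: r) 0 A'.
have SA : S' = A^T *m A.
  rewrite SE /A tr_block_mx mulmx_block trmx0 !mul0mx !mulmx0 !addr0.
  rewrite tr_scalar_mx -scalar_mxM ssE mul_scalar_mx scalerA mulfV// scale1r.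
  rewrite linearZ/= mul_mx_scalar scalerA mulfV// scale1r -C'E.
  rewrite -scalemxAl -scalemxAr scalerA -invfM ssE /C'; congr block_mx.
  by rewrite addrC subrK.
exists A; split; first exact: SA.
- move=> i j.
  case: (@split_ordP 1 n i) => i' ->; case: (@split_ordP 1 n j) => j' -> /=.
  + by rewrite !ord1.
  + by rewrite !ord1.
  + by move=> _; rewrite [LHS](block_mxEdl (s%:M) (s^-1 *: r) 0 A') mxE.
  + by rewrite ltn_add2l [A _ _](block_mxEdr s%:M (s^-1 *: r) 0 A') => /A'tri.
- move=> i; case: (@split_ordP 1 n i) => i' ->.
  + by rewrite ord1 [A _ _](block_mxEul s%:M (s^-1 *: r) 0 A') mxE eqxx mulr1n.
  + by rewrite [A _ _](block_mxEdr s%:M (s^-1 *: r) 0 A').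
Qed.

(* One entry of the diagonal is corrected at a time, by a rotation in a plane *)
(* spanned by two basis vectors on which the diagonal lies on either side of  *)
(* its mean.                                                                   *)
Lemma orthogonal_const_diag n (M : 'M[R]_n.+1) : M^T = M ->
  exists2 U : 'M_n.+1, U *m U^T = 1%:M &
    forall i, (U *m M *m U^T) i i = \tr M / n.+1%:R.
Proof.
set c := \tr M / n.+1%:R.
have [k] := ubnP #|[pred i | M i i != c]|.
have : \tr M = c *+ n.+1 by rewrite /c -mulr_natr divfK// pnatr_eq0.
elim: k M @c => // k IH M c trM cardM symM.
have [all_eq|] := boolP [forall i, M i i == c].
  exists 1%:M; first by rewrite trmx1 mul1mx.
  by move=> i; rewrite trmx1 mul1mx mulmx1; apply/eqP; move/forallP: all_eq.
rewrite negb_forall => /existsP[i0 i0c].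
have sum0 : \sum_i (M i i - c) = 0.
  by rewrite sumrB -/(\tr M) trM sumr_const card_ord subrr.
have [i ic] : exists i, M i i < c.
  apply/existsP; apply: contraT; rewrite negb_exists => /forallP ge_c.
  have /eqP := sum0; rewrite psumr_eq0; last first.
    by move=> j _; rewrite subr_ge0 leNgt.
  by move=> /allP/(_ i0 (mem_index_enum _)); rewrite /= subr_eq0 (negPf i0c).
have [j jc] : exists j, c < M j j.
  apply/existsP; apply: contraT; rewrite negb_exists => /forallP le_c.
  have /eqP : \sum_i (c - M i i) = 0.
    by under eq_bigr do rewrite -opprB; rewrite sumrN sum0 oppr0.
  rewrite psumr_eq0; last by move=> l _; rewrite subr_ge0 leNgt.
  by move=> /allP/(_ i0 (mem_index_enum _)); rewrite /= subr_eq0 eq_sym (negPf i0c).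
have ij : i != j by apply: contraTneq ic => ->; rewrite -leNgt ltW.
have ji : (j == i) = false by rewrite eq_sym (negPf ij).
have Mij : M j i = M i j by rewrite -[in LHS]symM mxE.
pose p := M j j - c; pose q := M i j; pose m := M i i - c.
have p_gt0 : 0 < p by rewrite subr_gt0.
have m_lt0 : m < 0 by rewrite subr_lt0.
(* t is the tangent of the rotation angle: the new i-th diagonal entry is c exactly when p t^2 + 2 q
   t + m = 0, and p > 0 > m makes the roots real. *)
pose t := (- q + Num.sqrt (q ^+ 2 - p * m)) / p.
have tE : p * t ^+ 2 + 2 * q * t + m = 0.
  have disc : 0 <= q ^+ 2 - p * m by nra.
  have := sqr_sqrtr disc; rewrite /t; set s := Num.sqrt _ => sE.
  have p_neq0 : p != 0 by rewrite gt_eqF.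
  have -> : p * ((- q + s) / p) ^+ 2 + 2 * q * ((- q + s) / p) + m =
    (s ^+ 2 - q ^+ 2 + p * m) / p by field.
  by rewrite sE [X in X / p](_ : _ = 0) ?mul0r//; ring.
pose d := (Num.sqrt (1 + t ^+ 2))^-1.
have dE : d ^+ 2 * (1 + t ^+ 2) = 1.
  have pos : 0 < 1 + t ^+ 2 by nra.
  by rewrite /d exprVn sqr_sqrtr ?ltW// mulVf// gt_eqF.
pose co := d; pose si := d * t.
have cs1 : co ^+ 2 + si ^+ 2 = 1 by rewrite /co /si -dE; ring.
have csM : co ^+ 2 * M i i + 2 * co * si * M i j + si ^+ 2 * M j j = c.
  have -> : M i i = m + c by rewrite /m subrK.
  have -> : M j j = p + c by rewrite /p subrK.
  rewrite -/q /co /si.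
  have -> : d ^+ 2 * (m + c) + 2 * d * (d * t) * q + (d * t) ^+ 2 * (p + c) =
     d ^+ 2 * (p * t ^+ 2 + 2 * q * t + m) + (d ^+ 2 * (1 + t ^+ 2)) * c by ring.
  by rewrite tE dE mulr0 add0r mul1r.
pose u (l : 'I_n.+1) : 'rV[R]_n.+1 :=
  if l == i then co *: delta_mx 0 i + si *: delta_mx 0 j
  else if l == j then - si *: delta_mx 0 i + co *: delta_mx 0 j
  else delta_mx 0 l.
pose G : 'M_n.+1 := \matrix_l u l.
pose bf (X : 'M[R]_n.+1) (v w : 'rV_n.+1) := (v *m X *m w^T) 0 0.
have bfDl X v v' w : bf X (v + v') w = bf X v w + bf X v' w.
  by rewrite /bf !mulmxDl mxE.
have bfDr X v w w' : bf X v (w + w') = bf X v w + bf X v w'.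
  by rewrite /bf linearD/= mulmxDr mxE.
have bfZl X e v w : bf X (e *: v) w = e * bf X v w.
  by rewrite /bf -!scalemxAl mxE.
have bfZr X e v w : bf X v (e *: w) = e * bf X v w.
  by rewrite /bf linearZ/= -scalemxAr mxE.
have bfd X l l' : bf X (delta_mx 0 l) (delta_mx 0 l') = X l l'.
  by rewrite /bf -rowE trmx_delta -colE !mxE.
have GXE (X : 'M[R]_n.+1) l l' : (G *m X *m G^T) l l' = bf X (u l) (u l').
  rewrite -bfd /bf -!mulmxA -[(delta_mx 0 l')^T]trmxK -!trmx_mul trmxK.
  by rewrite !mulmxA -!rowE !rowK.
have GG : G *m G^T = 1%:M.
  apply/matrixP => l l'; rewrite -[X in X *m _]mulmx1 GXE.
  rewrite [RHS]mxE /u; case: (eqVneq l i) => [?|li]; last case: (eqVneq l j) => [?|lj];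
  (case: (eqVneq l' i) => [?|l'i]; last case: (eqVneq l' j) => [?|l'j]); subst;
    rewrite ?bfDl ?bfDr ?bfZl ?bfZr ?bfd ?mxE ?eqxx ?ji ?(negPf ij) ?(negPf li)
    ?(negPf lj) ?(negPf l'i) ?(negPf l'j)
    1?[i == l']eq_sym 1?[j == l']eq_sym ?(negPf l'i) ?(negPf l'j)
    ?mulr1 ?mulr0 ?mulr1n ?mulr0n ?addr0 ?add0r ?mulNr //.
  - ring.
  - ring.
  - by rewrite -cs1; ring.
pose M' := G *m M *m G^T.
have M'ii : M' i i = c.
  rewrite GXE /u eqxx !bfDl !bfDr !bfZl !bfZr !bfd Mij -csM; ring.
have M'll l : l != i -> l != j -> M' l l = M l l.
  by move=> li lj; rewrite GXE /u (negPf li) (negPf lj) bfd.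
have trM' : \tr M' = \tr M.
  by rewrite /M' mxtrace_mulC mulmxA (mulmx1C GG) mul1mx.
have symM' : M'^T = M' by rewrite /M' !trmx_mul trmxK symM mulmxA.
have [||//|U UU Ui] := IH M'.
- by rewrite trM'.
(* Entry i now equals c; entry j, which may have changed, was already counted, and all others are
   untouched. *)
- rewrite trM'; apply: leq_trans (cardM : (_ <= k)%N); apply: proper_card.
  apply/properP; split; last first.
    by exists i; rewrite ?inE; [rewrite lt_eqF | rewrite -/c M'ii eqxx].
  apply/subsetP => l; rewrite !inE -/c; case: (eqVneq l i) => [->|li].
    by rewrite M'ii eqxx.
  case: (eqVneq l j) => [-> _|lj]; first by rewrite gt_eqF.
  by rewrite M'll.
exists (U *m G); first by rewrite trmx_mul mulmxA -(mulmxA U) GG mulmx1.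
by move=> l; rewrite trmx_mul !mulmxA -(mulmxA U) -(mulmxA U) Ui trM'.
Qed.

(** A factor A may be replaced by U A with U orthogonal: A^T A does not change, while A A^T is
    conjugated by U. The constant diagonal is what lets all eigenvalues of the drift be brought to
    the same real part. *)
Lemma equidiagonal_factor n (S : 'M[R]_n.+1) : S^T = S ->
  (forall x : 'cV_n.+1, x != 0 -> 0 < (x^T *m S *m x) 0 0) ->
  exists A : 'M_n.+1, [/\ S = A^T *m A, A \in unitmx &
    forall i, (A *m A^T) i i = \tr S / n.+1%:R].
Proof.
move=> symS posS; have [A [SE Atri Apos]] := cholesky symS posS.
have Aunit : A \in unitmx.
  rewrite -unitmx_tr unitmxE det_trig; last first.
    by apply/is_trig_mxP => i j ij; rewrite mxE Atri.
  rewrite unitfE prodf_seq_neq0; apply/allP => i _ /=.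
  by rewrite mxE gt_eqF.
have symAA : (A *m A^T)^T = A *m A^T by rewrite trmx_mul trmxK.
have [U UU Ui] := orthogonal_const_diag symAA.
exists (U *m A); split.
- by rewrite trmx_mul mulmxA -(mulmxA A^T) (mulmx1C UU) mulmx1.
- by rewrite unitmx_mul Aunit andbT; case: (mulmx1_unit UU).
- by move=> i; rewrite trmx_mul !mulmxA -(mulmxA U) Ui mxtrace_mulC -SE.
Qed.

End factorization.

From mathcomp Require Import complex.

(** * Operators on tensors indexed by words *)

Section tensors.
Context {F : comNzRingType} {N : nat}.
Implicit Types (M E : 'M[F]_N) (w v : seq 'I_N) (a b f g : seq 'I_N -> F).

(** Words of length n index the coordinates of the n-th tensor power of F^N. Working with words
    instead of multi-indices makes the operators below structural recursions; repeated words are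
    compensated by factors 1 / n! in the Hermite expansions. *)
Fixpoint wsum n f : F :=
  if n is n'.+1 then \sum_i wsum n' (fun w => f (i :: w)) else f [::].

(** The derivation of the tensor algebra induced by M, that is, the sum over the slots of M acting
    in one slot. *)
Fixpoint dtens M w b : F :=
  if w is i :: w' then
    \sum_j M i j * b (j :: w') + dtens M w' (fun v => b (i :: v))
  else 0.

(** The tensor power of E, acting in all slots at once; [dtens M] is the derivative at t = 0 of the
    tensor powers of exp(t M). *)
Fixpoint tpow E w b : F :=
  if w is i :: w' then \sum_j E i j * tpow E w' (fun v => b (j :: v)) else b [::].

Definition symm b := forall w v, perm_eq w v -> b w = b v.

Lemma eq_wsum n f g : (forall w, size w = n -> f w = g w) -> wsum n f = wsum n g.
Proof.
elim: n f g => [|n IH] f g fg /=; first exact: fg.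
by apply: eq_bigr => i _; apply: IH => w sw; apply: fg; rewrite /= sw.
Qed.

Lemma wsumD n f g : wsum n (fun w => f w + g w) = wsum n f + wsum n g.
Proof.
elim: n f g => [|n IH] f g //=; rewrite -big_split/=.
by apply: eq_bigr => i _; exact: IH.
Qed.

Lemma wsumZ n c f : wsum n (fun w => c * f w) = c * wsum n f.
Proof.
elim: n f => [|n IH] f //=; rewrite mulr_sumr.
by apply: eq_bigr => i _; exact: IH.
Qed.

Lemma wsum0 n : wsum n (fun=> 0) = 0.
Proof. by elim: n => //= n IH; rewrite big1. Qed.

Lemma wsumB n f g : wsum n (fun w => f w - g w) = wsum n f - wsum n g.
Proof.
rewrite -[- _]mulN1r -wsumZ -wsumD; apply: eq_wsum => w _.
by rewrite mulN1r.
Qed.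

Lemma wsum_sum n I (r : seq I) (P : pred I) (h : I -> seq 'I_N -> F) :
  wsum n (fun w => \sum_(k <- r | P k) h k w) = \sum_(k <- r | P k) wsum n (h k).
Proof.
elim: r => [|k r IH].
  by rewrite big_nil; under eq_wsum do rewrite big_nil; rewrite wsum0.
rewrite big_cons -IH; case: ifP => Pk.
  by rewrite -wsumD; apply: eq_wsum => w _; rewrite big_cons Pk.
by apply: eq_wsum => w _; rewrite big_cons Pk.
Qed.

Lemma eq_dtens M w a b : (forall v, size v = size w -> a v = b v) ->
  dtens M w a = dtens M w b.
Proof.
elim: w a b => [//|i w IH] a b ab /=; congr (_ + _).
  by apply: eq_bigr => j _; rewrite ab.
by apply: IH => v sv; rewrite ab //= sv.
Qed.

Lemma dtensD M w a b :
  dtens M w (fun v => a v + b v) = dtens M w a + dtens M w b.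
Proof.
elim: w a b => [|i w IH] a b /=; first by rewrite addr0.
rewrite IH addrACA -big_split/=; congr (_ + _).
by apply: eq_bigr => j _; rewrite mulrDr.
Qed.

Lemma dtensZ M w c a : dtens M w (fun v => c * a v) = c * dtens M w a.
Proof.
elim: w a => [|i w IH] a /=; first by rewrite mulr0.
rewrite IH mulrDr mulr_sumr; congr (_ + _).
by apply: eq_bigr => j _; rewrite mulrCA.
Qed.

Lemma dtens0 M w : dtens M w (fun=> 0) = 0.
Proof. by rewrite -[RHS](mul0r (dtens M w (fun=> 0))) -dtensZ; apply: eq_dtens => v _; rewrite mul0r. Qed.

Lemma dtensN M w a : dtens M w (fun v => - a v) = - dtens M w a.
Proof. by rewrite -mulN1r -dtensZ; apply: eq_dtens => v _; rewrite mulN1r. Qed.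

Lemma dtensB M w a b :
  dtens M w (fun v => a v - b v) = dtens M w a - dtens M w b.
Proof. by rewrite dtensD dtensN. Qed.

Lemma dtens_sum M w I (r : seq I) (P : pred I) (h : I -> seq 'I_N -> F) :
  dtens M w (fun v => \sum_(k <- r | P k) h k v) =
  \sum_(k <- r | P k) dtens M w (h k).
Proof.
elim: r => [|k r IH].
  rewrite big_nil -[RHS](dtens0 M w); apply: eq_dtens => v _.
  by rewrite big_nil.
rewrite big_cons -IH; case: ifP => Pk.
  by rewrite -dtensD; apply: eq_dtens => v _; rewrite big_cons Pk.
by apply: eq_dtens => v _; rewrite big_cons Pk.
Qed.

Lemma dtens_oppmx M w a : dtens (- M) w a = - dtens M w a.
Proof.
elim: w a => [|i w IH] a /=; first by rewrite oppr0.
rewrite IH opprD -sumrN; congr (_ + _).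
by apply: eq_bigr => j _; rewrite mxE mulNr.
Qed.

Lemma eq_tpow E w a b : (forall v, size v = size w -> a v = b v) ->
  tpow E w a = tpow E w b.
Proof.
elim: w a b => [|i w IH] a b ab /=; first exact: ab.
by apply: eq_bigr => j _; congr (_ * _); apply: IH => v sv; rewrite ab //= sv.
Qed.

Lemma tpowD E w a b : tpow E w (fun v => a v + b v) = tpow E w a + tpow E w b.
Proof.
elim: w a b => [//|i w IH] a b /=; rewrite -big_split/=.
by apply: eq_bigr => j _; rewrite IH mulrDr.
Qed.

Lemma tpowZ E w c a : tpow E w (fun v => c * a v) = c * tpow E w a.
Proof.
elim: w a => [//|i w IH] a /=; rewrite mulr_sumr.
by apply: eq_bigr => j _; rewrite IH mulrCA.
Qed.

Lemma tpow0 E w : tpow E w (fun=> 0) = 0.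
Proof. by rewrite -[RHS](mul0r (tpow E w (fun=> 0))) -tpowZ; apply: eq_tpow => v _; rewrite mul0r. Qed.

Lemma tpow_sum E w I (r : seq I) (P : pred I) (h : I -> seq 'I_N -> F) :
  tpow E w (fun v => \sum_(k <- r | P k) h k v) =
  \sum_(k <- r | P k) tpow E w (h k).
Proof.
elim: r => [|k r IH].
  rewrite big_nil -[RHS](tpow0 E w); apply: eq_tpow => v _.
  by rewrite big_nil.
rewrite big_cons -IH; case: ifP => Pk.
  by rewrite -tpowD; apply: eq_tpow => v _; rewrite big_cons Pk.
by apply: eq_tpow => v _; rewrite big_cons Pk.
Qed.

Lemma tpow1 w b : tpow 1%:M w b = b w.
Proof.
elim: w b => [//|i w IH] b /=; rewrite (bigD1 i)//= mxE eqxx mul1r IH.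
rewrite big1 ?addr0// => j ji; by rewrite mxE eq_sym (negPf ji) mul0r.
Qed.

Lemma tpowM E E' w b : tpow (E *m E') w b = tpow E w (fun v => tpow E' v b).
Proof.
elim: w b => [//|i w IH] b /=.
under [RHS]eq_bigr do rewrite tpow_sum mulr_sumr.
rewrite exchange_big/=; apply: eq_bigr => j _.
rewrite mxE mulr_suml; apply: eq_bigr => k _.
by rewrite IH tpowZ mulrA.
Qed.

Lemma symm_cons b i : symm b -> symm (fun w => b (i :: w)).
Proof. by move=> sb w v wv; apply: sb; rewrite perm_cons. Qed.

Lemma symm_adjacent b :
  (forall u i j w, b (u ++ i :: j :: w) = b (u ++ j :: i :: w)) -> symm b.
Proof.
move=> adj w; elim: w b adj => [|i w IH] b adj v.
  by rewrite perm_sym => /perm_nilP ->.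
move=> wv; have iv : i \in v by rewrite -(perm_mem wv) mem_head.
case/splitPr: iv wv => v1 v2 wv.
have -> : b (v1 ++ i :: v2) = b (i :: v1 ++ v2).
  elim: v1 {wv} b adj => [//|j v1 IHv] b adj /=.
  rewrite (IHv (fun x => b (j :: x))); first exact: (adj [::]).
  by move=> u k l x; exact: (adj (j :: u)).
apply: (IH (fun x => b (i :: x))) => [u k l x|]; first exact: (adj (i :: u)).
rewrite -(perm_cons i); apply: (perm_trans wv).
by rewrite -[i :: v2]cat1s -[i :: v1 ++ v2]cat1s perm_catCA.
Qed.

Lemma symm_tpow E b : symm b -> symm (fun w => tpow E w b).
Proof.
move=> sb; apply: symm_adjacent => u i j w.
elim: u b sb => [|k u IH] b sb /=.
  under eq_bigr do rewrite mulr_sumr.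
  under [RHS]eq_bigr do rewrite mulr_sumr.
  rewrite exchange_big/=; apply: eq_bigr => k _; apply: eq_bigr => l _.
  rewrite mulrCA; congr (_ * (_ * _)); apply: eq_tpow => v _.
  by apply: sb; rewrite -![_ :: _ :: v]/([:: _] ++ [:: _] ++ v) perm_catCA.
by apply: eq_bigr => l _; congr (_ * _); apply: IH; exact: symm_cons.
Qed.

(** For a symmetric tensor the position of a slot does not matter, so the slots can be grouped by
    their letter. The same factor [count_mem i w] and word [rem i w] come out of differentiating a
    Hermite function, which is how the two calculi meet. *)
Lemma dtens_count M w b : symm b ->
  dtens M w b =
  \sum_i \sum_j (count_mem i w)%:R * (M i j * b (j :: rem i w)).
Proof.
elim: w b => [|k w IH] b sb /=.
  by rewrite big1// => i _; rewrite big1// => j _; rewrite mul0r.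
rewrite (IH (fun v => b (k :: v))); last exact: symm_cons.
rewrite [X in _ + X](bigD1 k)//= [RHS](bigD1 k)//= addrA.
congr (_ + _); last first.
  apply: eq_bigr => i ik; apply: eq_bigr => j _.
  rewrite eq_sym (negPf ik) add0n; congr (_ * (_ * _)).
  by apply: sb; rewrite -[k :: j :: _]/([:: _] ++ [:: _] ++ _) perm_catCA.
rewrite -big_split/=; apply: eq_bigr => j _; rewrite eqxx natrD mulrDl mul1r.
congr (_ + _); case: (boolP (k \in w)) => [kw|/count_memPn ->]; last by rewrite !mul0r.
congr (_ * (_ * _)); apply: sb.
rewrite -[k :: j :: _]/([:: _] ++ [:: _] ++ _) perm_catCA /=.
by rewrite perm_cons perm_sym perm_to_rem.
Qed.

Lemma symm_dtens M b : symm b -> symm (fun w => dtens M w b).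
Proof.
move=> sb w v wv; rewrite !dtens_count//; apply: eq_bigr => i _.
apply: eq_bigr => j _; rewrite (permP wv); congr (_ * (_ * _)).
apply: sb; rewrite perm_cons.
case: (boolP (i \in w)) => iw; last first.
  by rewrite !rem_id// -?(perm_mem wv).
rewrite -(perm_cons i); apply: perm_trans (_ : perm_eq w _); first by rewrite perm_sym perm_to_rem.
by apply: (perm_trans wv); rewrite perm_to_rem// -(perm_mem wv).
Qed.

(** Double counting of the pairs formed by a word and a position of j in it: by symmetry each of the
    n + 1 positions contributes equally. *)
Lemma wsum_count n G (j : 'I_N) : symm G ->
  wsum n.+1 (fun w => (count_mem j w)%:R * G w) =
  n.+1%:R * wsum n (fun v => G (j :: v)).
Proof.
elim: n G => [|n IH] G sG.
  rewrite /= (bigD1 j)//= eqxx big1 ?addr0// => i ij.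
  by rewrite (negPf ij) mul0r.
have step i : wsum n.+1 (fun w => (count_mem j (i :: w))%:R * G (i :: w)) =
    wsum n.+1 (fun w => (i == j)%:R * G (i :: w)) +
    n.+1%:R * wsum n (fun v => G (i :: j :: v)).
  rewrite -(IH (fun w => G (i :: w))); last exact: symm_cons.
  by rewrite -wsumD; apply: eq_wsum => w _; rewrite /= natrD mulrDl.
transitivity (\sum_i (wsum n.+1 (fun w => (i == j)%:R * G (i :: w)) +
    n.+1%:R * wsum n (fun v => G (i :: j :: v)))).
  by apply: eq_bigr => i _; exact: step.
have swap i : wsum n (fun v => G (i :: j :: v)) = wsum n (fun v => G (j :: i :: v)).
  apply: eq_wsum => v _; apply: sG.
  by rewrite -![_ :: _ :: v]/([:: _] ++ [:: _] ++ v) perm_catCA.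
under eq_bigr do rewrite swap.
transitivity (\sum_i wsum n.+1 (fun w => (i == j)%:R * G (i :: w)) +
    n.+1%:R * wsum n.+1 (fun v => G (j :: v))).
  by rewrite /= mulr_sumr -big_split.
rewrite -wsum_sum [n.+2%:R]mulrSr mulrDl mul1r addrC.
congr (_ + _); apply: eq_wsum => w _.
rewrite (bigD1 j)//= eqxx mul1r big1 ?addr0// => i ij.
by rewrite (negPf ij) mul0r.
Qed.

End tensors.

(** * Norm estimates on real tensors *)

Section real_tensors.
Context {R : rcfType} {N : nat}.
Implicit Types (M E : 'M[R]_N) (w v : seq 'I_N) (a b f g : seq 'I_N -> R).

Definition nrm n b : R := wsum n (fun w => b w ^+ 2).

Lemma le_wsum n f g : (forall w, size w = n -> f w <= g w) -> wsum n f <= wsum n g.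
Proof.
elim: n f g => [|n IH] f g fg /=; first exact: fg.
by apply: ler_sum => i _; apply: IH => w sw; apply: fg; rewrite /= sw.
Qed.

Lemma wsum_ge0 n f : (forall w, size w = n -> 0 <= f w) -> 0 <= wsum n f.
Proof. by move=> f0; rewrite -(@wsum0 R N n); exact: le_wsum. Qed.

Lemma le_wsum_term n f w : (forall v, size v = n -> 0 <= f v) -> size w = n ->
  f w <= wsum n f.
Proof.
elim: n f w => [|n IH] f [|i w]//= f0 [sw].
rewrite (bigD1 i)//= ler_wpDr//.
  by apply: sumr_ge0 => j _; apply: wsum_ge0 => v sv; apply: f0; rewrite /= sv.
by apply: (IH (fun v => f (i :: v))) => // v sv; apply: f0; rewrite /= sv.
Qed.

Lemma nrm_ge0 n b : 0 <= nrm n b.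
Proof. by apply: wsum_ge0 => w _; exact: sqr_ge0. Qed.

Lemma nrm_term n b w : size w = n -> b w ^+ 2 <= nrm n b.
Proof. by apply: (@le_wsum_term n (fun v => b v ^+ 2)) => v _; exact: sqr_ge0. Qed.

Lemma eq_nrm n a b : (forall w, size w = n -> a w = b w) -> nrm n a = nrm n b.
Proof. by move=> ab; apply: eq_wsum => w sw; rewrite ab. Qed.

Lemma nrmZ n c b : nrm n (fun w => c * b w) = c ^+ 2 * nrm n b.
Proof. by rewrite -wsumZ; apply: eq_wsum => w _; rewrite exprMn. Qed.

Lemma le_nrmB n a b : nrm n (fun w => a w - b w) <= 2 * nrm n a + 2 * nrm n b.
Proof.
rewrite -!wsumZ -wsumD; apply: le_wsum => w _.
rewrite -subr_ge0 (_ : _ - _ = (a w + b w) ^+ 2); [exact: sqr_ge0|by ring].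
Qed.

Lemma wsum_cauchy_schwarz n a b :
  wsum n (fun w => a w * b w) ^+ 2 <= nrm n a * nrm n b.
Proof.
have [b0|bn0] := eqVneq (nrm n b) 0.
  rewrite b0 mulr0 (_ : wsum _ _ = 0) ?expr0n//.
  rewrite -(@wsum0 R N n); apply: eq_wsum => w sw.
  have := nrm_term b sw; rewrite b0 => bw.
  have /eqP : b w ^+ 2 = 0 by apply/le_anti; rewrite bw sqr_ge0.
  by rewrite sqrf_eq0 => /eqP ->; rewrite mulr0.
have b_gt0 : 0 < nrm n b by rewrite lt_neqAle eq_sym bn0 nrm_ge0.
set s := wsum _ _.
have := nrm_ge0 n (fun w => a w - (s / nrm n b) * b w).
rewrite [nrm n (fun _ => _)](_ : _ = nrm n a - 2 * (s / nrm n b) * s + (s / nrm n b) ^+ 2 * nrm n b).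
  have -> : nrm n a - 2 * (s / nrm n b) * s + (s / nrm n b) ^+ 2 * nrm n b =
     (nrm n a * nrm n b - s ^+ 2) / nrm n b by field.
  by rewrite pmulr_lge0 ?invr_gt0// subr_ge0.
rewrite -!wsumZ -wsumB -wsumD; apply: eq_wsum => w _; ring.
Qed.

(** Each of the n slots contributes l times the norm. The growth in n is what later bounds the
    resolvent uniformly in high degree. *)
Lemma dtens_coercive M (l : R) n b :
  (forall x : 'I_N -> R,
    l * \sum_i x i ^+ 2 <= \sum_i \sum_j x i * (M i j * x j)) ->
  n%:R * l * nrm n b <= wsum n (fun w => b w * dtens M w b).
Proof.
move=> Ml; elim: n b => [|n IH] b; first by rewrite !mul0r /= mulr0.
rewrite /nrm [in leRHS]/=.
under [leRHS]eq_bigr => i _.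
  under eq_wsum do rewrite mulrDr.
  rewrite wsumD; over.
rewrite big_split/= mulrSr mulrDl mulrDl mul1r addrC lerD//.
  by rewrite mulr_sumr; apply: ler_sum => i _; exact: IH.
rewrite -!wsum_sum -wsumZ; apply: le_wsum => w _.
apply: le_trans (Ml (fun i => b (i :: w))) _; apply: ler_sum => i _.
by rewrite mulr_sumr.
Qed.

Lemma le_nrm_tpow_cons E (r : R) n b :
  (forall x : 'I_N -> R,
    \sum_i (\sum_j E i j * x j) ^+ 2 <= r * \sum_i x i ^+ 2) ->
  nrm n.+1 (fun w => tpow E w b) <=
    r * \sum_i nrm n (fun w => tpow E w (fun v => b (i :: v))).
Proof.
move=> Er; rewrite /nrm /= -!wsum_sum -wsumZ.
by apply: le_wsum => w _; exact: Er.
Qed.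

Lemma le_nrm_tpow E n b :
  (forall x : 'I_N -> R,
    \sum_i (\sum_j E i j * x j) ^+ 2 <= \sum_i x i ^+ 2) ->
  nrm n (fun w => tpow E w b) <= nrm n b.
Proof.
move=> E1; elim: n b => [//|n IH] b.
have E1' x : \sum_i (\sum_j E i j * x j) ^+ 2 <= 1 * \sum_i x i ^+ 2.
  by rewrite mul1r E1.
apply: le_trans (le_nrm_tpow_cons n b E1') _; rewrite mul1r /nrm /=.
by apply: ler_sum => i _; exact: IH.
Qed.

(** The factor r is taken from the first slot and the other slots are contractions. Thus r appears
    to the first power in every degree n + 1, and a rate with constant larger than one survives
    tensor powers. *)
Lemma le_nrm_tpowS E (r : R) n b :
  (forall x : 'I_N -> R,
    \sum_i (\sum_j E i j * x j) ^+ 2 <= \sum_i x i ^+ 2) ->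
  (forall x : 'I_N -> R,
    \sum_i (\sum_j E i j * x j) ^+ 2 <= r * \sum_i x i ^+ 2) ->
  0 <= r ->
  nrm n.+1 (fun w => tpow E w b) <= r * nrm n.+1 b.
Proof.
move=> E1 Er r0; apply: le_trans (le_nrm_tpow_cons n b Er) _.
by rewrite ler_wpM2l// /nrm /=; apply: ler_sum => i _; exact: le_nrm_tpow.
Qed.

End real_tensors.

(** * Eigenvalues and resolvents on complex tensors *)

Section complex_tensors.
Context {R : rcfType} {N : nat}.
Local Notation C := R[i].
Local Notation MC := (map_mx (real_complex R)).
Implicit Types (M : 'M[R]_N) (w v : seq 'I_N) (b f : seq 'I_N -> C) (z : C).

Lemma cReD z z' : complex.Re (z + z') = complex.Re z + complex.Re z'.
Proof. by case: z z' => [? ?] []. Qed.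
Lemma cImD z z' : complex.Im (z + z') = complex.Im z + complex.Im z'.
Proof. by case: z z' => [? ?] []. Qed.
Lemma cReN z : complex.Re (- z) = - complex.Re z.
Proof. by case: z. Qed.
Lemma cImN z : complex.Im (- z) = - complex.Im z.
Proof. by case: z. Qed.
Lemma cReM z z' : complex.Re (z * z') =
  complex.Re z * complex.Re z' - complex.Im z * complex.Im z'.
Proof. by case: z z' => [? ?] []. Qed.
Lemma cImM z z' : complex.Im (z * z') =
  complex.Re z * complex.Im z' + complex.Im z * complex.Re z'.
Proof. by case: z z' => [? ?] []. Qed.
Definition cE := (cReD, cImD, cReN, cImN, cReM, cImM).

Lemma cRe_sum I (r : seq I) (P : pred I) (h : I -> C) :
  complex.Re (\sum_(k <- r | P k) h k) = \sum_(k <- r | P k) complex.Re (h k).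
Proof. exact: (big_morph _ cReD). Qed.
Lemma cIm_sum I (r : seq I) (P : pred I) (h : I -> C) :
  complex.Im (\sum_(k <- r | P k) h k) = \sum_(k <- r | P k) complex.Im (h k).
Proof. exact: (big_morph _ cImD). Qed.

Definition sqc z : R := complex.Re z ^+ 2 + complex.Im z ^+ 2.

Lemma sqc_ge0 z : 0 <= sqc z.
Proof. by rewrite addr_ge0 ?sqr_ge0. Qed.

Lemma sqcM z z' : sqc (z * z') = sqc z * sqc z'.
Proof. rewrite /sqc !cE; ring. Qed.

Lemma sqc_eq0 z : sqc z = 0 -> z = 0.
Proof.
move=> /eqP; rewrite paddr_eq0 ?sqr_ge0// !sqrf_eq0 => /andP[/eqP r0 /eqP i0].
by case: z r0 i0 => a c /= -> ->.
Qed.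

Lemma sqcD z z' : sqc (z + z') <= 2 * sqc z + 2 * sqc z'.
Proof.
rewrite -subr_ge0 /sqc !cE (_ : _ - _ =
  (complex.Re z - complex.Re z') ^+ 2 + (complex.Im z - complex.Im z') ^+ 2).
  by rewrite addr_ge0 ?sqr_ge0.
by ring.
Qed.

Lemma sqc_sum (I : finType) (h : I -> C) :
  exists K, forall k : I -> C, sqc (\sum_i h i * k i) <= K * \sum_i sqc (k i).
Proof.
suff H (r : seq I) : exists K, 0 <= K /\ forall k : I -> C,
    sqc (\sum_(i <- r) h i * k i) <= K * \sum_(i <- r) sqc (k i).
  by have [K [_ HK]] := H (index_enum I); exists K.
elim: r => [|i r [K [K0 HK]]].
  by exists 0; split=> // k; rewrite !big_nil /sqc /= expr0n addr0 mul0r.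
exists (2 * sqc (h i) + 2 * K); split.
  by rewrite addr_ge0// mulr_ge0// sqc_ge0.
move=> k; rewrite !big_cons; apply: le_trans (sqcD _ _) _; rewrite sqcM.
have := HK k; have := sqc_ge0 (k i); have := sqc_ge0 (h i).
have : 0 <= \sum_(i <- r) sqc (k i) by apply: sumr_ge0 => j _; exact: sqc_ge0.
set p := sqc _; set q := sqc _; set x := \sum_(i <- r) sqc _; set y := sqc _.
nra.
Qed.

Definition cnrm n b : R :=
  nrm n (fun w => complex.Re (b w)) + nrm n (fun w => complex.Im (b w)).

Lemma cnrmE n b : cnrm n b = wsum n (fun w => sqc (b w)).
Proof. by rewrite wsumD. Qed.

Lemma Re_dtens M w b :
  complex.Re (dtens (MC M) w b) = dtens M w (fun v => complex.Re (b v)).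
Proof.
elim: w b => [//|i w IH] b /=; rewrite cReD IH cRe_sum; congr (_ + _).
by apply: eq_bigr => j _; rewrite mxE cReM/= mul0r subr0.
Qed.

Lemma Im_dtens M w b :
  complex.Im (dtens (MC M) w b) = dtens M w (fun v => complex.Im (b v)).
Proof.
elim: w b => [//|i w IH] b /=; rewrite cImD IH cIm_sum; congr (_ + _).
by apply: eq_bigr => j _; rewrite mxE cImM/= mul0r addr0.
Qed.

Lemma cnrm_coercive M (l : R) n z b :
  (forall x : 'I_N -> R,
    l * \sum_i x i ^+ 2 <= \sum_i \sum_j x i * (M i j * x j)) ->
  (n%:R * l - complex.Re z) * cnrm n b <=
  wsum n (fun w => complex.Re (b w) * complex.Re (dtens (MC M) w b - z * b w) +
                   complex.Im (b w) * complex.Im (dtens (MC M) w b - z * b w)).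
Proof.
move=> Ml.
have HR := dtens_coercive n (fun w => complex.Re (b w)) Ml.
have HI := dtens_coercive n (fun w => complex.Im (b w)) Ml.
rewrite [leRHS](_ : _ = wsum n (fun w => complex.Re (b w) * dtens M w (fun v => complex.Re (b v))) +
  wsum n (fun w => complex.Im (b w) * dtens M w (fun v => complex.Im (b v))) -
  complex.Re z * cnrm n b).
  by rewrite mulrBl lerB// {1}/cnrm mulrDr lerD.
rewrite /cnrm mulrDr -!wsumZ -!wsumD -wsumB.
apply: eq_wsum => w _; rewrite !cE Re_dtens Im_dtens; ring.
Qed.

Lemma cnrm_term n b w : size w = n -> sqc (b w) <= cnrm n b.
Proof.
by rewrite cnrmE; apply: (@le_wsum_term _ _ n (fun v => sqc (b v))) => v _; exact: sqc_ge0.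
Qed.

Lemma cnrm_ge0 n b : 0 <= cnrm n b.
Proof. by rewrite addr_ge0 ?nrm_ge0. Qed.

(* Dissipativity for eigenvectors: the numerical range of dtens M lies in the *)
(* right half-plane.                                                           *)
Lemma dtens_eigen_eq0 M n z b :
  (forall x : 'I_N -> R, 0 <= \sum_i \sum_j x i * (M i j * x j)) ->
  complex.Re z < 0 ->
  (forall w, size w = n -> dtens (MC M) w b = z * b w) ->
  forall w, size w = n -> b w = 0.
Proof.
move=> M0 z0 eig w sw.
have M0' x : 0 * \sum_i x i ^+ 2 <= \sum_i \sum_j x i * (M i j * x j).
  by rewrite mul0r.
have := cnrm_coercive n z b M0'.
rewrite [leRHS](_ : _ = 0); last first.
  rewrite -(@wsum0 R N n); apply: eq_wsum => v sv.
  by rewrite eig// subrr/= !mulr0 addr0.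
rewrite mulr0 sub0r pmulr_rle0 ?oppr_gt0// => b0.
by apply: sqc_eq0; apply/le_anti; rewrite sqc_ge0 (le_trans (cnrm_term b sw)).
Qed.

(** Pairing the equation with b, coercivity bounds one side below by [cnrm n b] and Young's
    inequality bounds the other above by half of [cnrm n b + cnrm n f]. The constant is one,
    whatever n. *)
Lemma resolvent_coercive M (l : R) n z b f :
  (forall x : 'I_N -> R,
    l * \sum_i x i ^+ 2 <= \sum_i \sum_j x i * (M i j * x j)) ->
  1 <= n%:R * l - complex.Re z ->
  (forall w, size w = n -> dtens (MC M) w b - z * b w = f w) ->
  cnrm n b <= cnrm n f.
Proof.
move=> Ml nl bf; have := cnrm_coercive n z b Ml.
rewrite [leRHS](_ : _ = wsum n (fun w => complex.Re (b w) * complex.Re (f w) +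
                   complex.Im (b w) * complex.Im (f w))); last first.
  by apply: eq_wsum => w sw; rewrite bf.
move=> le1.
have : cnrm n b <= wsum n (fun w => complex.Re (b w) * complex.Re (f w) +
                   complex.Im (b w) * complex.Im (f w)).
  by apply: le_trans le1; rewrite ler_peMl ?cnrm_ge0.
have : wsum n (fun w => complex.Re (b w) * complex.Re (f w) +
                   complex.Im (b w) * complex.Im (f w)) <= 2^-1 * (cnrm n b + cnrm n f).
  rewrite !cnrmE -wsumD -wsumZ; apply: le_wsum => w _; rewrite /sqc.
  rewrite -subr_ge0 (_ : _ - _ =
    2^-1 * ((complex.Re (b w) - complex.Re (f w)) ^+ 2 +
            (complex.Im (b w) - complex.Im (f w)) ^+ 2)); last by field.
  by rewrite mulr_ge0 ?invr_ge0// addr_ge0 ?sqr_ge0.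
lra.
Qed.

(* The image of a tensor g : 'I_N -> (seq 'I_N -> C) under X acting on its first slot. *)
Definition act (X : 'M[C]_N) (g : 'I_N -> seq 'I_N -> C) i w := \sum_j X i j * g j w.

Lemma act_mul X Y g i w : act (X *m Y) g i w = act X (act Y g) i w.
Proof.
rewrite /act; under [RHS]eq_bigr do rewrite mulr_sumr.
rewrite exchange_big/=; apply: eq_bigr => j _; rewrite mxE mulr_suml.
by apply: eq_bigr => k _; rewrite mulrA.
Qed.

Lemma char_poly_annihil (X : 'M[C]_N) rs :
  char_poly X = \prod_(r <- rs) ('X - r%:P) -> \prod_(r <- rs) (X - r%:M) = 0.
Proof.
case: N X => [|n] X rsE; first by rewrite [LHS]flatmx0 [RHS]flatmx0.
rewrite -[RHS](Cayley_Hamilton X) rsE rmorph_prod/=; apply: eq_bigr => r _.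
by rewrite rmorphB/= horner_mx_X horner_mx_C.
Qed.

(* By Cayley-Hamilton a first-slot eigenvector for M can be reached from any   *)
(* eigentensor; it is then an eigenvector of the remaining slots, whose        *)
(* eigenvalue z - r has nonnegative real part by dissipativity.                *)
Lemma dtens_spectrum M (m : R) n z b :
  (forall x : 'I_N -> R, 0 <= \sum_i \sum_j x i * (M i j * x j)) ->
  (forall r, root (char_poly (MC M)) r -> m <= complex.Re r) ->
  complex.Re z < m ->
  (forall w, size w = n.+1 -> dtens (MC M) w b = z * b w) ->
  forall w, size w = n.+1 -> b w = 0.
Proof.
move=> M0 Mm zm eig.
have [rs rsE] := closed_field_poly_normal (char_poly (MC M)).
rewrite (monicP (char_poly_monic _)) scale1r in rsE.
have rsm : forall r, r \in rs -> m <= complex.Re r.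
  by move=> r rrs; apply: Mm; rewrite rsE root_prod_XsubC.
suff H : forall g : 'I_N -> seq 'I_N -> C,
    (forall i w, size w = n ->
      act (MC M) g i w + dtens (MC M) w (g i) = z * g i w) ->
    (forall i w, size w = n ->
      act (\prod_(r <- rs) (MC M - r%:M)) g i w = 0) ->
    forall i w, size w = n -> g i w = 0.
  move=> [//|i w] [sw]; apply: (H (fun i v => b (i :: v))) => //.
    by move=> j v sv; rewrite -eig//= sv.
  move=> j v _; rewrite /act big1// => k _.
  by rewrite char_poly_annihil// mxE mul0r.
elim/last_ind: rs rsm {rsE} => [|rs r IH] rsm g eg.
  move=> g0 i w sw; rewrite -(g0 i w sw) big_nil /act (bigD1 i)//= mxE eqxx mul1r.
  by rewrite big1 ?addr0// => j ji; rewrite mxE eq_sym (negPf ji) mul0r.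
rewrite -cats1 big_cat big_seq1 => g0.
have actB h i w : act (MC M - r%:M) h i w = act (MC M) h i w - r * h i w.
  rewrite /act; under eq_bigr do rewrite mxE mulrDl.
  rewrite big_split/=; congr (_ + _).
  rewrite (bigD1 i)//= !mxE eqxx mulr1n mulNr big1 ?addr0// => j ji.
  by rewrite !mxE eq_sym (negPf ji) oppr0 mul0r.
have rm : m <= complex.Re r by apply: rsm; rewrite mem_rcons mem_head.
pose g' := act (MC M - r%:M) g.
(* M - r commutes with M in the first slot and with the action on the other slots, so g' is an
   eigentensor for the same z, and it is annihilated by one factor less. *)
have g'0 i w : size w = n -> g' i w = 0.
  apply: (IH _ g') => [s srs|j v sv|j v sv].
  - by apply: rsm; rewrite mem_rcons inE srs orbT.
  - have -> : dtens (MC M) v (g' j) =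
        \sum_k (MC M - r%:M) j k * dtens (MC M) v (g k).
      by rewrite dtens_sum; apply: eq_bigr => k _; rewrite dtensZ.
    have gE k : dtens (MC M) v (g k) = z * g k v - act (MC M) g k v.
      by rewrite -eg// addrAC subrr add0r.
    under eq_bigr do rewrite gE mulrBr mulrCA.
    rewrite sumrB -mulr_sumr -/(act _ g j v) -/(act _ (act _ g) j v).
    rewrite -!act_mul addrCA [X in _ + X](_ : _ = 0) ?addr0//.
    by rewrite mulmxBl mulmxBr scalar_mxC subrr.
  - by rewrite -act_mul; exact: g0.
(* Now M multiplies the first slot of g by r, hence g i is an eigentensor of the remaining slots for
   z - r, whose real part is negative. *)
move=> i w; apply: (dtens_eigen_eq0 (z := z - r) M0) => [|v sv].
  by rewrite cReD cReN subr_lt0 (lt_le_trans zm).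
have := g'0 i v sv; rewrite /g' actB => /eqP; rewrite subr_eq0 => /eqP Mg.
by rewrite mulrBl -eg// Mg addrAC subrr add0r.
Qed.

Definition wsort w := sort (fun i j : 'I_N => (i <= j)%N) w.

Lemma perm_wsort w : perm_eq (wsort w) w.
Proof. by rewrite perm_sort. Qed.

Lemma wsort_perm w v : perm_eq w v -> wsort w = wsort v.
Proof.
move=> wv; apply/perm_sortP => //.
- by move=> i j; exact: leq_total.
- by move=> j i k; exact: leq_trans.
- by move=> i j /anti_leq /val_inj.
Qed.

Lemma size_wsort w : size (wsort w) = size w.
Proof. exact: size_sort. Qed.

(** Only the value at the sorted rearrangement is read, so that functions on n-tuples, a
    finite-dimensional space, parametrize symmetric tensors. *)
Definition wext n (x : n.-tuple 'I_N -> C) w : C := oapp x 0 (insub (wsort w)).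

Lemma symm_wext n (x : n.-tuple 'I_N -> C) : symm (wext x).
Proof. by move=> w v wv; rewrite /wext (wsort_perm wv). Qed.

(* On tensors that are not symmetric the operator is completed by the         *)
(* identity, so that it can be inverted on the space of all tensors.          *)
Lemma resolvent_solve M n z :
  (forall b, (forall w, size w = n -> dtens (MC M) w b = z * b w) ->
    forall w, size w = n -> b w = 0) ->
  exists K, 0 <= K /\ forall f, symm f -> exists b, [/\ symm b,
    forall w, size w = n -> dtens (MC M) w b - z * b w = f w &
    cnrm n b <= K * cnrm n f].
Proof.
move=> inj.
pose T := n.-tuple 'I_N; pose d := #|{: T}|.
pose Fm (x : T -> C) (t : T) :=
  dtens (MC M) t (wext x) - z * wext x t + (x t - wext x t).
have FmE (x : T -> C) t : x t = wext x t -> Fm x t = dtens (MC M) t (wext x) - z * wext x t.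
  by move=> xt; rewrite /Fm xt subrr addr0.
have sorted_ext (x : T -> C) w : size w = n ->
    exists t : T, [/\ perm_eq t w, x t = wext x t & wext x w = x t].
  move=> sw; have st : size (wsort w) == n by rewrite size_wsort sw.
  exists (Tuple st); rewrite perm_wsort /wext.
  have -> : wsort (Tuple st) = wsort w by apply: wsort_perm; exact: perm_wsort.
  by rewrite (insubT (fun s : seq 'I_N => size s == n) st).
have resolvent (x : T -> C) f : symm f -> (forall t, Fm x t = f t) ->
    forall w, size w = n -> dtens (MC M) w (wext x) - z * wext x w = f w.
  move=> sf xf w sw; have [t [tw xt _]] := sorted_ext x w sw.
  rewrite -(sf _ _ tw) -xf FmE// -(symm_wext x tw).
  by rewrite (symm_dtens (MC M) (symm_wext x) tw).
pose X : 'M[C]_d := \matrix_(i, j) Fm (fun t => (t == enum_val i)%:R) (enum_val j).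
have XE (v : 'rV[C]_d) j : (v *m X) 0 j = Fm (fun t => v 0 (enum_rank t)) (enum_val j).
  have vE t : v 0 (enum_rank t) = \sum_i v 0 i * (t == enum_val i)%:R.
    rewrite (bigD1 (enum_rank t))//= enum_rankK eqxx mulr1 big1 ?addr0// => i it.
    case: eqP => [ti|]; last by rewrite mulr0.
    by rewrite ti enum_valK eqxx in it.
  have extE w : wext (fun t => v 0 (enum_rank t)) w =
      \sum_i v 0 i * wext (fun t => (t == enum_val i)%:R) w.
    rewrite /wext; case: insub => [t|] /=; first exact: vE.
    by rewrite big1// => i _; rewrite mulr0.
  rewrite mxE /Fm extE vE (@eq_dtens _ _ _ _ _ (fun w =>
    \sum_i v 0 i * wext (fun t => (t == enum_val i)%:R) w)); last by move=> w _; exact: extE.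
  rewrite dtens_sum mulr_sumr -!sumrB -big_split/=.
  by apply: eq_bigr => i _; rewrite mxE dtensZ /Fm; ring.
have Xunit : X \in unitmx.
  rewrite -row_free_unit; apply: inj_row_free => v vX0.
  pose x t := v 0 (enum_rank t).
  have Fx0 t : Fm x t = 0 by rewrite -[t]enum_rankK -XE vX0 mxE.
  have ext0 w : size w = n -> wext x w = 0.
    apply: inj => {}w sw; apply/eqP; rewrite -subr_eq0.
    by apply/eqP; apply: (resolvent x (fun=> 0)).
  apply/rowP => j; rewrite mxE -[j]enum_valK -/(x (enum_val j)).
  have := Fx0 (enum_val j); rewrite /Fm ext0 ?size_tuple// mulr0 !subr0.
  rewrite (@eq_dtens _ _ _ _ _ (fun=> 0)) ?dtens0 ?add0r// => v' sv'.
  by rewrite ext0// sv' size_tuple.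
have /fin_all_exists[K0 HK0] : forall j : 'I_d, exists K, forall k : 'I_d -> C,
    sqc (\sum_i invmx X i j * k i) <= K * \sum_i sqc (k i).
  by move=> j; exact: sqc_sum.
pose K1 : R := \sum_j `|K0 j|.
(* A crude bound: the square of every coordinate of the solution is at most K1 times a sum of d
   values of [sqc (f _)], each below [cnrm n f]; the sum over all words gives K. *)
pose K : R := @wsum R N n (fun=> K1 * d%:R).
have K1_ge0 : 0 <= K1 by apply: sumr_ge0.
exists K; split; first by apply: wsum_ge0 => w _; rewrite mulr_ge0.
move=> f sf.
pose v := (\row_j f (enum_val (j : 'I_d) : T)) *m invmx X.
pose x t := v 0 (enum_rank t).
have xf t : Fm x t = f t.
  by rewrite -[t]enum_rankK -XE /v mulmxKV// mxE.
exists (wext x); split; [exact: symm_wext|exact: resolvent|].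
rewrite cnrmE mulrC /K -wsumZ; apply: le_wsum => w sw.
have [t [_ _ ->]] := sorted_ext x w sw.
rewrite /x /v mxE; under eq_bigr do rewrite mulrC.
apply: le_trans (HK0 _ _) _.
rewrite [leRHS]mulrC -mulrA; under eq_bigr do rewrite mxE.
apply: (@le_trans _ _ (K1 * \sum_(i < d) sqc (f (enum_val i : T)))).
  rewrite ler_wpM2r ?sumr_ge0// => [i _|]; first exact: sqc_ge0.
  rewrite /K1 (bigD1 (enum_rank t))//= (le_trans (ler_norm _))// lerDl.
  by rewrite sumr_ge0.
rewrite ler_wpM2l//; apply: (@le_trans _ _ (\sum_(i < d) cnrm n f)).
  by apply: ler_sum => i _; apply: cnrm_term; rewrite size_tuple.
by rewrite sumr_const card_ord mulr_natl.
Qed.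

End complex_tensors.

From mathcomp Require Import all_boot all_order all_algebra.
From mathcomp Require Import all_classical all_reals all_analysis measurable_realfun.
From mathcomp Require Import complex ring lra.
Require Import Defs.
Import Order.TTheory GRing.Theory Num.Theory.
Import numFieldNormedType.Exports.
Local Open Scope classical_set_scope.
Local Open Scope ring_scope.

(** * The flow on tensors *)

Section derive_rules.
Context {R : realType} {V : normedModType R}.
Implicit Types (f g : V -> R) (x v : V).

Lemma derM f g (df dg : R) x v : is_derive x v f df -> is_derive x v g dg ->
  is_derive x v (fun t => f t * g t) (f x * dg + g x * df).
Proof. by move=> Hf Hg; apply: is_derive_eq (is_deriveM Hf Hg) _. Qed.

Lemma derD f g (df dg : R) x v : is_derive x v f df -> is_derive x v g dg ->
  is_derive x v (fun t => f t + g t) (df + dg).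
Proof. by move=> Hf Hg; apply: is_derive_eq (is_deriveD Hf Hg) _. Qed.

Lemma derB f g (df dg : R) x v : is_derive x v f df -> is_derive x v g dg ->
  is_derive x v (fun t => f t - g t) (df - dg).
Proof. by move=> Hf Hg; apply: is_derive_eq (is_deriveB Hf Hg) _. Qed.

Lemma derZ f (c df : R) x v : is_derive x v f df ->
  is_derive x v (fun t => c * f t) (c * df).
Proof. by move=> Hf; apply: is_derive_eq (is_deriveZ c Hf) _. Qed.

Lemma derC (c : R) x v : is_derive x v (fun=> c) 0.
Proof. exact: is_derive_cst. Qed.

Lemma der_sum I (r : seq I) (P : pred I) (h : I -> V -> R) (dh : I -> R) x v :
  (forall i, is_derive x v (h i) (dh i)) ->
  is_derive x v (fun t => \sum_(i <- r | P i) h i t) (\sum_(i <- r | P i) dh i).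
Proof.
move=> H; elim: r => [|i r IH].
  rewrite big_nil (_ : (fun t => _) = (fun=> 0)); first exact: derC.
  by apply/funext => t; rewrite big_nil.
rewrite big_cons (_ : (fun t => _) = (fun t => if P i then
    h i t + \sum_(i <- r | P i) h i t else \sum_(i <- r | P i) h i t)).
  by case: ifP => // Pi; exact: derD.
by apply/funext => t; rewrite big_cons.
Qed.

Lemma der_wsum N n (h : V -> seq 'I_N -> R) (dh : seq 'I_N -> R) x v :
  (forall w, size w = n -> is_derive x v (fun t => h t w) (dh w)) ->
  is_derive x v (fun t => wsum n (h t)) (wsum n dh).
Proof.
elim: n h dh => [|n IH] h dh H /=; first exact: H.
apply: der_sum => i; apply: IH => w sw; apply: H; by rewrite /= sw.
Qed.

End derive_rules.

Section real_functions.
Context {R : realType}.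
Implicit Types f df : R -> R.

Lemma der_continuous f (df x : R) : is_derive x (1 : R) f df -> {for x, continuous f}.
Proof.
by move=> Hf; apply: differentiable_continuous; apply/derivable1_diffP; exact: ex_derive.
Qed.

Lemma der_shift f (c df x : R) : is_derive (x + c) (1 : R) f df ->
  is_derive x (1 : R) (fun t => f (t + c)) df.
Proof.
move=> Hf; rewrite -[df]mulr1.
exact: (@is_derive1_comp _ f (shift c) x df 1 Hf (is_derive_shift x 1 c)).
Qed.

Lemma le_der_le0 f df (a b : R) : a <= b ->
  (forall x, a < x < b -> is_derive x (1 : R) f (df x)) ->
  {within `[a, b], continuous f} ->
  (forall x, a < x < b -> df x <= 0) -> f b <= f a.
Proof.
rewrite le_eqVlt => /orP[/eqP -> //|ab] Hf cf Hdf.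
have Hf' x : x \in `]a, b[ -> is_derive x (1 : R) f (df x).
  by rewrite in_itv/=; exact: Hf.
have [c] := MVT ab Hf' cf; rewrite in_itv/= => cab fE.
rewrite -subr_le0 fE mulr_le0_ge0// ?Hdf// subr_ge0; exact: ltW.
Qed.

Lemma eq_der0 f (a b : R) : a <= b ->
  (forall x, a < x < b -> is_derive x (1 : R) f 0) ->
  {within `[a, b], continuous f} -> f b = f a.
Proof.
move=> ab Hf cf; apply/le_anti/andP; split.
  exact: (@le_der_le0 _ (fun=> 0) _ _ ab Hf cf).
rewrite -lerN2; apply: (@le_der_le0 (fun x => - f x) (fun=> 0)) => //.
  by move=> x /Hf H; apply: is_derive_eq (is_deriveN H) _; rewrite oppr0.
by move=> x; apply: continuousN; exact: cf.
Qed.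

Lemma der_continuous_within f df (a b : R) :
  (forall x, is_derive x (1 : R) f (df x)) -> {within `[a, b], continuous f}.
Proof.
move=> Hf; apply: continuous_subspaceT => x; exact: der_continuous (Hf x).
Qed.

End real_functions.

(** * The matrix exponential and its tensor powers *)

Section matrix_exponential.
Context {R : realType} {N : nat}.
Variable M : 'M[R]_N.

Let mpow k : 'M[R]_N := iter k (mulmx M) 1%:M.
Let coef i j k : R := mpow k i j / k`!%:R.
Let a : R := 1 + \sum_i \sum_j `|M i j|.

Let a_ge1 : 1 <= a.
Proof. by rewrite lerDl sumr_ge0// => i _; rewrite sumr_ge0. Qed.

Let mpow_bound k i j : `|mpow k i j| <= a ^+ k.
Proof.
elim: k i j => [|k IH] i j.
  by rewrite /mpow /= mxE expr0; case: eqP; rewrite /= ?mulr1n ?mulr0n ?normr1 ?normr0.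
rewrite /mpow iterS -/(mpow k) mxE exprS.
apply: le_trans (ler_norm_sum _ _ _) _.
apply: (@le_trans _ _ ((\sum_j `|M i j|) * a ^+ k)).
  by rewrite mulr_suml; apply: ler_sum => l _; rewrite normrM ler_wpM2l.
rewrite ler_wpM2r ?exprn_ge0 ?(le_trans ler01)//.
rewrite /a [X in 1 + X](bigD1 i)//= addrCA lerDl addr_ge0// sumr_ge0// => l _.
by rewrite sumr_ge0.
Qed.

Let cvg_pseries_bounded (c : R^nat) (B K : R) : 0 <= B ->
  (forall k, `|c k| <= B * a ^+ k / k`!%:R) -> cvgn (pseries c K).
Proof.
move=> B0 cB; apply: normed_cvg.
have exp_cvg : cvgn (series (B *: exp_coeff (a * `|K|))).
  by apply: is_cvg_seriesZ; exact: is_cvg_series_exp_coeff.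
apply: series_le_cvg exp_cvg => n /=.
- exact: normr_ge0.
- apply: mulr_ge0 => //; apply: exp_coeff_ge0.
  by rewrite mulr_ge0// (le_trans ler01).
- rewrite normrM normrX; apply: le_trans (ler_wpM2r (exprn_ge0 _ (normr_ge0 K)) (cB n)) _.
  have -> : (B *: exp_coeff (a * `|K|)) n = B * ((a * `|K|) ^+ n / n`!%:R) by [].
  rewrite exprMn le_eqVlt; apply/orP; left; apply/eqP; ring.
Qed.

Let cvg_coef i j K : cvgn (pseries (coef i j) K).
Proof.
apply: (@cvg_pseries_bounded _ 1) => // k.
by rewrite normrM mul1r normfV [`|_%:R|]normr_nat ler_wpM2r.
Qed.

Let diffs_coef i j : pseries_diffs (coef i j) = fun k => \sum_l M i l * coef l j k.
Proof.
apply/funext => k; rewrite /pseries_diffs /coef factS natrM invfM.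
rewrite mulrCA mulVKf ?pnatr_eq0// /mpow iterS mxE mulr_suml.
by apply: eq_bigr => l _; rewrite mulrA.
Qed.

(** exp(t M), summed entry by entry so that real power series can be differentiated term by term. *)
Definition mexp (t : R) : 'M[R]_N := \matrix_(i, j) limn (pseries (coef i j) t).

Let lim_diffs i j t : pseries (pseries_diffs (coef i j)) t @ \oo --> (M *m mexp t) i j.
Proof.
rewrite mxE diffs_coef.
rewrite (_ : pseries _ t = fun n => \sum_l M i l * pseries (coef l j) t n); last first.
  apply/funext => n; rewrite /pseries /series/=.
  under [RHS]eq_bigr do rewrite mulr_sumr.
  rewrite [RHS]exchange_big/=; apply: eq_bigr => k _; rewrite mulr_suml.
  by apply: eq_bigr => l _; rewrite mulrA.
apply: cvg_big => [|l _]; [exact: add_continuous|rewrite mxE].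
apply: cvgMl_tmp; exact: cvg_coef.
Qed.

Lemma mexp_derive t i j : is_derive t (1 : R) (fun s => mexp s i j) ((M *m mexp t) i j).
Proof.
rewrite -[X in is_derive _ _ _ X](cvg_lim _ (@lim_diffs i j t))//.
rewrite (_ : (fun s => mexp s i j) = (fun s => limn (pseries (coef i j) s))); last first.
  by apply/funext => s; rewrite mxE.
apply: (@pseries_snd_diffs _ _ (`|t| + 1)).
- exact: cvg_coef.
- by apply/cvg_ex; eexists; exact: lim_diffs.
(* The coefficients of the twice differentiated series are entries of M^(k+2) divided by k!, of size
   at most a^2 a^k / k!. *)
- apply: (@cvg_pseries_bounded _ (a * a)).
    by rewrite mulr_ge0// (le_trans ler01).
  move=> k; rewrite /pseries_diffs /coef.
  have -> : k.+1%:R * (k.+2%:R * (mpow k.+2 i j / (k.+2)`!%:R)) = mpow k.+2 i j / k`!%:R.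
    by rewrite !factS !natrM !invfM [k.+2%:R * _]mulrCA mulVKf ?pnatr_eq0// mulrCA mulVKf ?pnatr_eq0.
  rewrite normrM normfV [`|_%:R|]normr_nat ler_wpM2r// -mulrA -!exprS.
  exact: mpow_bound.
- by rewrite [ltRHS]ger0_norm ?addr_ge0// ltrDl.
Qed.

Lemma mexp0 : mexp 0 = 1%:M.
Proof.
apply/matrixP => i j; rewrite mxE -[RHS]/(mpow 0 i j).
apply/cvg_lim => //; rewrite -(cvg_shiftn 1).
rewrite (_ : (fun _ => _) = fun=> mpow 0 i j); first exact: cvg_cst.
apply/funext => n; rewrite /pseries /series/= addn1 big_nat_recl//=.
rewrite /coef expr0 fact0 divr1 mulr1 big1 ?addr0// => k _.
by rewrite expr0n mulr0.
Qed.

Lemma mexp_sum_derive (y : 'I_N -> R) t i :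
  is_derive t (1 : R) (fun s => \sum_j mexp s i j * y j)
    (\sum_j M i j * \sum_k mexp t j k * y k).
Proof.
have H j := derM (mexp_derive t i j) (derC (y j) t (1 : R)).
apply: is_derive_eq; first exact: (der_sum _ _ H).
under eq_bigr do rewrite mulr0 add0r mxE mulr_sumr.
under [RHS]eq_bigr do rewrite mulr_sumr.
rewrite exchange_big/=; apply: eq_bigr => j _; apply: eq_bigr => k _; ring.
Qed.

(* Uniqueness and contraction both come from the decay of the energy. *)
Section dissipative.
Hypothesis M0 : forall x : 'I_N -> R, \sum_i \sum_j x i * (M i j * x j) <= 0.

Lemma le_energy (x : R -> 'I_N -> R) (t : R) : 0 <= t ->
  (forall s i, is_derive s (1 : R) (fun s => x s i) (\sum_j M i j * x s j)) ->
  \sum_i x t i ^+ 2 <= \sum_i x 0 i ^+ 2.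
Proof.
move=> t0 xM; pose de s := 2 * \sum_i \sum_j x s i * (M i j * x s j).
have Hde s : is_derive s (1 : R) (fun s => \sum_i x s i ^+ 2) (de s).
  rewrite (_ : (fun _ => _) = (fun s => \sum_i x s i * x s i)); last first.
    by apply/funext => s'; apply: eq_bigr => i _; rewrite expr2.
  have H i := derM (xM s i) (xM s i).
  apply: is_derive_eq; first exact: (der_sum _ _ H).
  rewrite /de mulr_sumr; apply: eq_bigr => i _; rewrite -mulr_sumr; ring.
apply: (@le_der_le0 _ _ de) => //; first exact: der_continuous_within Hde.
by move=> s _; rewrite /de pmulr_rle0.
Qed.

Lemma mexp_contraction t (y : 'I_N -> R) : 0 <= t ->
  \sum_i (\sum_j mexp t i j * y j) ^+ 2 <= \sum_i y i ^+ 2.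
Proof.
move=> t0; have := @le_energy (fun s i => \sum_j mexp s i j * y j) t t0.
rewrite mexp0 => /(_ (fun s i => mexp_sum_derive y s i)) /le_trans; apply.
apply: ler_sum => i _; rewrite (bigD1 i)//= mxE eqxx mul1r big1 ?addr0// => j ji.
by rewrite mxE eq_sym (negPf ji) mul0r.
Qed.

Lemma mexpD s t : 0 <= t -> mexp (t + s) = mexp t *m mexp s.
Proof.
move=> t0; apply/matrixP => i k; apply/eqP; rewrite -subr_eq0 -sqrf_eq0; apply/eqP.
pose x (t : R) i := mexp (t + s) i k - (mexp t *m mexp s) i k.
have xM r l : is_derive r (1 : R) (fun r => x r l) (\sum_j M l j * x r j).
  have D1 := der_shift (mexp_derive (r + s) l k).
  have D2 := mexp_sum_derive (fun j => mexp s j k) r l.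
  rewrite /x (_ : (fun _ => _) = (fun r => mexp (r + s) l k - \sum_j mexp r l j * mexp s j k)); last first.
    by apply/funext => u; rewrite [X in _ - X]mxE.
  apply: (is_derive_eq (derB D1 D2)).
  rewrite mxE -sumrB; apply: eq_bigr => j _; rewrite -mulrBr; congr (_ * (_ - _)).
  by rewrite mxE.
have := le_energy t0 xM; rewrite [leRHS]big1 => [le0|l _]; last first.
  by rewrite /x add0r mexp0 mul1mx subrr expr0n.
apply/le_anti; rewrite sqr_ge0 andbT; apply: le_trans le0.
rewrite [leRHS](bigD1 i)//= lerDl sumr_ge0// => j _; exact: sqr_ge0.
Qed.

End dissipative.

Definition tflow t (b : seq 'I_N -> R) w := tpow (mexp t) w b.

Lemma tflow0 b w : tflow 0 b w = b w.
Proof. by rewrite /tflow mexp0 tpow1. Qed.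

Lemma tflow_derive b w t :
  is_derive t (1 : R) (fun s => tflow s b w) (dtens M w (tflow t b)).
Proof.
elim: w b => [|i w IH] b; first exact: derC.
have H j := derM (mexp_derive t i j) (IH (fun v => b (j :: v))).
apply: is_derive_eq; first exact: (der_sum _ _ H).
rewrite big_split/= addrC; congr (_ + _).
  under [RHS]eq_bigr do rewrite mulr_sumr.
  rewrite [RHS]exchange_big/=; apply: eq_bigr => j _.
  rewrite mxE mulr_sumr; apply: eq_bigr => l _.
  by rewrite mulrC -mulrA.
rewrite dtens_sum; apply: eq_bigr => j _.
by rewrite dtensZ.
Qed.

Section dissipative_flow.
Hypothesis M0 : forall x : 'I_N -> R, \sum_i \sum_j x i * (M i j * x j) <= 0.

Lemma wsum_dtens_le0 n b : wsum n (fun w => b w * dtens M w b) <= 0.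
Proof.
have M0' (x : 'I_N -> R) : 0 * \sum_i x i ^+ 2 <= \sum_i \sum_j x i * ((- M) i j * x j).
  rewrite mul0r -oppr_le0 -sumrN; apply: le_trans (M0 x).
  rewrite le_eqVlt; apply/orP; left; apply/eqP; apply: eq_bigr => i _.
  by rewrite -sumrN; apply: eq_bigr => j _; rewrite mxE mulNr mulrN opprK.
have := dtens_coercive n b M0'; rewrite mulr0 mul0r.
rewrite -oppr_ge0 -[X in _ -> 0 <= X]mulN1r -wsumZ => /le_trans; apply.
rewrite le_eqVlt; apply/orP; left; apply/eqP; apply: eq_wsum => w _.
by rewrite dtens_oppmx mulrN mulN1r.
Qed.

Lemma tflow_contraction n b t : 0 <= t -> nrm n (tflow t b) <= nrm n b.
Proof. by move=> t0; apply: le_nrm_tpow => x; exact: mexp_contraction. Qed.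

Lemma tflowD s t b w : 0 <= t -> tflow (t + s) b w = tflow t (tflow s b) w.
Proof. by move=> t0; rewrite /tflow mexpD// tpowM. Qed.

(** The two sides are the derivatives at s = 0 of exp((s + t) M), read once directly and once
    through the semigroup law. *)
Lemma mexp_comm t : 0 <= t -> M *m mexp t = mexp t *m M.
Proof.
move=> t0; apply/matrixP => i j.
have H1 : is_derive (0 : R) (1 : R) (fun s => mexp (s + t) i j) ((M *m mexp t) i j).
  by have := der_shift (mexp_derive (0 + t) i j); rewrite add0r.
have H2 : is_derive (0 : R) (1 : R) (fun s => \sum_k mexp t i k * mexp s k j) ((mexp t *m M) i j).
  have H k := derZ (mexp t i k) (mexp_derive 0 k j).
  apply: is_derive_eq; first exact: (der_sum _ _ H).
  by rewrite mexp0 mulmx1 mxE.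
have E : (fun s => mexp (s + t) i j) = (fun s => \sum_k mexp t i k * mexp s k j).
  by apply/funext => s; rewrite addrC mexpD// mxE.
by rewrite -(@derive_val _ _ _ _ _ _ _ H1) -(@derive_val _ _ _ _ _ _ _ H2) E.
Qed.

Lemma dtens_tpow (E : 'M[R]_N) w b : M *m E = E *m M ->
  dtens M w (fun v => tpow E v b) = tpow E w (fun v => dtens M v b).
Proof.
move=> ME; elim: w b => [//|i w IH] b /=.
rewrite dtens_sum; under eq_bigr do rewrite mulr_sumr.
under [RHS]eq_bigr do rewrite tpowD mulrDr -IH.
rewrite exchange_big big_split/=; congr (_ + _); last first.
  by apply: eq_bigr => j _; rewrite dtensZ.
under [RHS]eq_bigr do rewrite tpow_sum mulr_sumr.
rewrite [RHS]exchange_big/=; apply: eq_bigr => k _.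
under eq_bigr do rewrite mulrA.
under [RHS]eq_bigr do rewrite tpowZ mulrA.
rewrite -!mulr_suml; congr (_ * _).
by move/matrixP/(_ i k): ME; rewrite !mxE.
Qed.

Lemma dtens_tflow t w b : 0 <= t ->
  dtens M w (tflow t b) = tflow t (fun v => dtens M v b) w.
Proof. by move=> t0; apply: dtens_tpow; exact: mexp_comm. Qed.

(** A mean value inequality for tensors, made scalar by pairing the flow with the increment d
    itself; the derivative is controlled by Cauchy-Schwarz, because [dtens M] commutes with the flow
    and the flow contracts. It dominates the difference quotients when the generator is
    identified. *)
Lemma le_nrm_tflowB n b t : 0 <= t ->
  nrm n (fun w => tflow t b w - b w) <= t ^+ 2 * nrm n (fun w => dtens M w b).
Proof.
move=> t0; set d := (fun w => tflow t b w - b w); set g := (fun w => dtens M w b).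
pose phi s := wsum n (fun w => d w * tflow s b w).
pose dphi s := wsum n (fun w => d w * dtens M w (tflow s b)).
have Hphi s : is_derive s (1 : R) phi (dphi s).
  by apply: der_wsum => w _; apply: derZ; exact: tflow_derive.
have [t_0|tn0] := eqVneq t 0.
  rewrite [in leRHS]t_0 expr0n mul0r /d (@eq_nrm _ _ _ _ (fun=> 0)) => [|w _].
    by rewrite /nrm (@eq_wsum _ _ _ _ (fun=> 0)) ?wsum0// => w _; rewrite expr0n.
  by rewrite /= t_0 tflow0 subrr.
have t_gt0 : 0 < t by rewrite lt_neqAle eq_sym tn0.
have cphi : {within `[0, t], continuous phi} by exact: der_continuous_within Hphi.
have [x] := MVT t_gt0 (fun s _ => Hphi s) cphi.
rewrite in_itv/= subr0 => /andP[x0 _] phiE.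
have dE : nrm n d = dphi x * t.
  rewrite -phiE /phi -wsumB; apply: eq_wsum => w _.
  by rewrite -mulrBr tflow0.
have dx2 : dphi x ^+ 2 <= nrm n d * nrm n g.
  apply: le_trans (wsum_cauchy_schwarz _ _ _) _.
  rewrite ler_wpM2l ?nrm_ge0//.
  rewrite (@eq_nrm _ _ _ _ (tflow x g)) => [|w _]; last by rewrite dtens_tflow// ltW.
  by apply: tflow_contraction; exact: ltW.
have := nrm_ge0 n d; rewrite le_eqVlt => /orP[/eqP <-|d0].
  by rewrite mulr_ge0 ?sqr_ge0 ?nrm_ge0.
rewrite -(ler_pM2l d0) mulrCA -[leLHS]expr2 dE exprMn mulrC ler_wpM2l ?sqr_ge0//.
by rewrite -dE.
Qed.

(** The energy of the difference with the flow does not increase. Differentiability is asked for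
    inside the interval only: the evolutions to which this applies are differentiable at positive
    times and continuous at 0. *)
Lemma tflow_unique n (c : R -> seq 'I_N -> R) t : 0 <= t ->
  (forall w, size w = n -> {within `[0, t], continuous (fun s => c s w)}) ->
  (forall s w, 0 < s < t -> size w = n ->
    is_derive s (1 : R) (fun s => c s w) (dtens M w (c s))) ->
  forall w, size w = n -> c t w = tflow t (c 0) w.
Proof.
move=> t0 cc dc w sw; apply/eqP; rewrite -subr_eq0 -sqrf_eq0; apply/eqP.
pose d s w := c s w - tflow s (c 0) w.
pose de s := wsum n (fun w => d s w * dtens M w (d s) + d s w * dtens M w (d s)).
have dd s v : 0 < s < t -> size v = n ->
    is_derive s (1 : R) (fun s => d s v) (dtens M v (d s)).
  move=> st sv; rewrite dtensB; apply: derB; first exact: dc.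
  exact: tflow_derive.
have Hde s : 0 < s < t -> is_derive s (1 : R) (fun s => nrm n (d s)) (de s).
  move=> st; apply: der_wsum => v sv.
  rewrite (_ : (fun _ => _) = (fun s => d s v * d s v)); last first.
    by apply/funext => u; rewrite -expr2.
  by apply: derM; exact: dd.
have cd v : size v = n -> {within `[0, t], continuous (fun s => d s v)}.
  move=> sv x; apply: continuousB; first exact: cc.
  by apply: (@der_continuous_within _ _ (fun s => dtens M v (tflow s (c 0)))) => s; exact: tflow_derive.
have ce : {within `[0, t], continuous (fun s => nrm n (d s))}.
  have cwsum m (h : R -> seq 'I_N -> R) :
      (forall v, size v = m -> {within `[0, t], continuous (fun s => h s v)}) ->
      {within `[0, t], continuous (fun s => wsum m (h s))}.
    elim: m h => [|m IH] h ch /=; first exact: ch.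
    move=> x; apply: cvg_big => [|i _]; first exact: add_continuous.
    by apply: (IH (fun s v => h s (i :: v))) => v sv; apply: ch; rewrite /= sv.
  apply: cwsum => v sv.
  rewrite (_ : (fun _ => _) = (fun s => d s v * d s v)); last first.
    by apply/funext => u; rewrite -expr2.
  by move=> x; apply: cvgM; exact: cd.
have le0 : nrm n (d t) <= nrm n (d 0).
  apply: (le_der_le0 t0 Hde ce) => s _.
  by rewrite /de wsumD -mulr2n -mulr_natl pmulr_rle0// wsum_dtens_le0.
apply/le_anti; rewrite sqr_ge0 andbT (le_trans (nrm_term (d t) sw))//.
apply: le_trans le0 _; rewrite /nrm le_eqVlt; apply/orP; left; apply/eqP.
rewrite -[RHS](@wsum0 R N n); apply: eq_wsum => v sv.
by rewrite /= /d tflow0 subrr expr0n.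
Qed.

End dissipative_flow.

Section weighted_decay.
Variables (q : 'I_N -> R) (c K : R).
Hypothesis q1 : forall i, 1 <= q i <= K.
Hypothesis Mq : forall x : 'I_N -> R,
  \sum_i q i * x i * \sum_j M i j * x j = - c * \sum_i q i * x i ^+ 2.

(** The weighted energy sum_i q_i x_i^2 multiplied by exp(2 c t) is constant along the flow. Weights
    between 1 and K turn this equality into Euclidean decay with constant K. *)
Lemma mexp_decay t (y : 'I_N -> R) : 0 <= t ->
  \sum_i (\sum_j mexp t i j * y j) ^+ 2 <=
    K * expR (- (2 * c) * t) * \sum_i y i ^+ 2.
Proof.
move=> t0; pose x s i := \sum_j mexp s i j * y j.
have xM s i : is_derive s (1 : R) (fun s => x s i) (\sum_j M i j * x s j).
  exact: mexp_sum_derive.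
pose f s := expR (2 * c * s) * \sum_i q i * (x s i * x s i).
have Hf s : is_derive s (1 : R) f 0.
  have D1 : is_derive s (1 : R) (fun s => expR (2 * c * s)) (expR (2 * c * s) * (2 * c)).
    have D0 : is_derive s (1 : R) (fun s => 2 * c * s) (2 * c).
      by apply: (is_derive_eq (derZ (2 * c) (is_derive_id s 1))); rewrite mulr1.
    exact: (@is_derive1_comp _ expR (fun s => 2 * c * s)).
  have D2 i := derZ (q i) (derM (xM s i) (xM s i)).
  apply: (is_derive_eq (derM D1 (der_sum _ _ D2))).
  have -> : \sum_i q i * (x s i * (\sum_j M i j * x s j) + x s i * (\sum_j M i j * x s j)) =
      2 * \sum_i q i * x s i * \sum_j M i j * x s j.
    by rewrite mulr_sumr; apply: eq_bigr => i _; ring.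
  have -> : \sum_i q i * (x s i * x s i) = \sum_i q i * x s i ^+ 2.
    by apply: eq_bigr => i _; rewrite expr2.
  rewrite Mq; ring.
have cf : {within `[0, t], continuous f} by exact: der_continuous_within Hf.
have := eq_der0 t0 (fun s _ => Hf s) cf.
rewrite /f mulr0 expR0 mul1r => ftE.
have x0 i : x 0 i = y i.
  rewrite /x mexp0 (bigD1 i)//= mxE eqxx mul1r big1 ?addr0// => j ji.
  by rewrite mxE eq_sym (negPf ji) mul0r.
rewrite mulrAC mulNr expRN ler_pdivlMr ?expR_gt0//.
apply: (@le_trans _ _ (\sum_i q i * (x t i * x t i) * expR (2 * c * t))).
  rewrite mulr_suml; apply: ler_sum => i _.
  rewrite ler_wpM2r ?expR_ge0// -expr2 ler_peMl ?sqr_ge0//.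
  by case/andP: (q1 i).
rewrite -mulr_suml mulrC ftE mulr_sumr; apply: ler_sum => i _.
rewrite x0 -expr2 ler_wpM2r ?sqr_ge0//.
by case/andP: (q1 i).
Qed.

End weighted_decay.

End matrix_exponential.

(** * Lebesgue measure on column vectors *)

Section iterated_integrals.
Context {R : realType}.
Local Notation leb := (@lebesgue_measure R).

Lemma tonelli_cV n (f : 'cV[R]_n.+1 -> \bar R) :
  measurable_fun setT f -> (forall x, 0 <= f x)%E ->
  (\int[lebesgue_cV n.+1]_x f x =
   \int[leb]_t \int[lebesgue_cV n]_y f (cV_cons (t, y)))%E.
Proof.
move=> mf f0.
transitivity (\int[pushforward (leb \x lebesgue_cV n)%E (@cV_cons R n)]_x f x)%E.
  by apply: eq_measure_integral; first exact: measurable_cV_cons.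
rewrite ge0_integral_pushforward//; last exact: measurable_cV_cons.
rewrite preimage_setT fubini_tonelli1//=.
exact: (measurableT_comp mf (@measurable_cV_cons R n)).
Qed.

Lemma lebesgue_measure_shift (a : R) (A : set R) : measurable A ->
  leb ((fun t => t + a) @^-1` A) = leb A.
Proof.
move=> mA.
have mshift : measurable_fun setT (fun t : measurableTypeR R => t + a : measurableTypeR R).
  exact: measurable_funD.
apply/esym; apply: (@lebesgue_measure_unique _ (pushforward leb (fun t => t + a : measurableTypeR R))) => //.
move=> _ [[x y] _ <-] /=.
have E : (fun t : R => t + a) @^-1` `]x, y]%classic = `]x - a, y - a]%classic.
  by apply/seteqP; split => t /=; rewrite !in_itv/= ltrBlDr lerBrDr.
rewrite /pushforward E.
rewrite !lebesgue_measure_itv/= !lte_fin ltrD2r.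
by case: ifPn => // _; congr (_%:E); ring.
Qed.

Lemma integral_shift1 (a : R) (f : R -> \bar R) :
  measurable_fun setT f -> (forall x, 0 <= f x)%E ->
  (\int[leb]_t f (t + a)%R = \int[leb]_t f t)%E.
Proof.
move=> mf f0.
have mshift : measurable_fun setT (fun t : measurableTypeR R => t + a : measurableTypeR R).
  exact: measurable_funD.
transitivity (\int[pushforward leb (fun t => (t + a)%R : measurableTypeR R)]_t f t)%E.
  by rewrite ge0_integral_pushforward.
apply: eq_measure_integral => A mA _; exact: lebesgue_measure_shift.
Qed.

Lemma cV_consE0 n (t : R) (y : 'cV[R]_n) : cV_cons (t, y) ord0 0 = t.
Proof. by rewrite /cV_cons mxE unlift_none. Qed.

Lemma cV_consES n (t : R) (y : 'cV[R]_n) i : cV_cons (t, y) (lift ord0 i) 0 = y i 0.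
Proof. by rewrite /cV_cons mxE liftK. Qed.

Lemma cV_consD n (t s : R) (y z : 'cV[R]_n) :
  cV_cons (t, y) + cV_cons (s, z) = cV_cons (t + s, y + z).
Proof.
apply/colP => i; rewrite mxE; case: (unliftP ord0 i) => [j|] ->.
  by rewrite !cV_consES mxE.
by rewrite !cV_consE0.
Qed.

Lemma measurable_shift n (h : 'cV[R]_n) : measurable_fun setT (fun x : 'cV[R]_n => x + h).
Proof.
apply: measurable_fun_cV => i; under eq_fun do rewrite mxE.
by apply: measurable_funD => //; exact: measurable_coord.
Qed.

Lemma measurable_cV_cons_slice n (t : R) :
  measurable_fun setT (fun y : 'cV[R]_n => cV_cons (t, y)).
Proof. exact: (measurableT_comp (@measurable_cV_cons R n) (@measurable_pair1 _ _ _ _ t)). Qed.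

(** One coordinate at a time, by Tonelli and translation invariance on the line. Integration by
    parts rests on this invariance. *)
Lemma integral_shift n (h : 'cV[R]_n) (f : 'cV[R]_n -> \bar R) :
  measurable_fun setT f -> (forall x, 0 <= f x)%E ->
  (\int[lebesgue_cV n]_x f (x + h)%R = \int[lebesgue_cV n]_x f x)%E.
Proof.
elim: n h f => [|n IH] h f mf f0.
  by apply: eq_integral => x _; congr f; apply/colP => -[].
pose a := h ord0 0; pose k : 'cV[R]_n := \col_j h (lift ord0 j) 0.
have hE : h = cV_cons (a, k) by rewrite -[h]/(id h); apply/colP => i;
  case: (unliftP ord0 i) => [j|] ->; rewrite ?cV_consES ?cV_consE0// mxE.
rewrite !tonelli_cV//; last exact: (measurableT_comp mf (@measurable_shift _ h)).
transitivity (\int[leb]_t \int[lebesgue_cV n]_y f (cV_cons ((t + a)%R, y)))%E.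
  apply: eq_integral => t _.
  rewrite -(IH k (fun y => f (cV_cons (t + a, y))))//; last first.
    exact: (measurableT_comp mf (measurable_cV_cons_slice _ )).
  by apply: eq_integral => y _; rewrite hE cV_consD.
rewrite (integral_shift1 a (f := fun t => \int[lebesgue_cV n]_y f (cV_cons (t, y)))%E)//.
- apply: (@measurable_fun_fubini_tonelli_F _ _ _ _ _ (lebesgue_cV n) (fun p => f (cV_cons p))) => //.
  exact: (measurableT_comp mf (@measurable_cV_cons R n)).
- by move=> t; exact: integral_ge0.
Qed.

End iterated_integrals.

(** * Gaussian integrals, exponential decay and Borel sets *)

Section gaussian_integrals.
Context {R : realType}.
Local Notation leb := (@lebesgue_measure R).

Lemma measurable_sum_cV d (T : measurableType d) n (h : 'I_n -> T -> R) :
  (forall i, measurable_fun setT (h i)) ->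
  measurable_fun setT (fun x => \sum_i h i x).
Proof. by move=> mh; exact: measurable_sum. Qed.

Lemma measurable_mulmx n m (A : 'M[R]_(m, n)) i :
  measurable_fun setT (fun x : 'cV[R]_n => (A *m x) i 0).
Proof.
rewrite (_ : (fun x => _) = fun x : 'cV[R]_n => \sum_j A i j * x j 0).
  apply: measurable_sum_cV => j; apply: measurable_funM => //.
  exact: measurable_coord.
by apply/funext => x; rewrite mxE.
Qed.

Lemma gauss_integral1 (a b : R) : 0 < a ->
  (\int[leb]_t (expR (- (a * t + b) ^+ 2 / 2))%:E = (Num.sqrt (2 * pi) / a)%:E)%E.
Proof.
move=> a0; have a_neq0 : a != 0 by rewrite gt_eqF.
have ia0 : a^-1 != 0 by rewrite invr_eq0.
pose p := @normal_peak R a^-1.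
have p_gt0 : 0 < p by exact: normal_peak_gt0.
have pE : p^-1 = Num.sqrt (2 * pi) / a.
  rewrite /p /normal_peak invrK (_ : _ *+ 2 = a^-1 ^+ 2 * (2 * pi)); last by rewrite -mulr_natl; ring.
  by rewrite sqrtrM ?sqr_ge0// sqrtr_sqr ger0_norm ?invr_ge0 ?(ltW a0)// mulrC.
have fE t : expR (- (a * t + b) ^+ 2 / 2) = p^-1 * normal_pdf (- b / a) a^-1 t.
  rewrite normal_pdfE// -/p mulKf ?gt_eqF// /normal_fun; congr expR.
  rewrite -[(a^-1 ^+ 2) *+ 2]mulr_natr; field.
  by rewrite a_neq0.
under eq_integral do rewrite fE EFinM.
rewrite integralZl//=; last exact: integrable_normal_pdf.
by rewrite integral_normal_pdf mule1 pE.
Qed.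

Lemma measurable_gauss n m (A : 'M[R]_(m, n)) :
  measurable_fun setT (fun x : 'cV[R]_n => expR (- (\sum_i (A *m x) i 0 ^+ 2) / 2)).
Proof.
apply: measurableT_comp => //; apply: measurable_funM => //.
apply: measurableT_comp => //; apply: measurable_sum_cV => i.
by apply: measurable_funX; exact: measurable_mulmx.
Qed.

(** Only the first row of A involves the first coordinate, and the other coordinates merely shift
    that one-dimensional Gaussian; integrating it out leaves the lower right block. *)
Lemma gauss_integral_triangular n (A : 'M[R]_n) :
  (forall i j : 'I_n, (j < i)%N -> A i j = 0) -> (forall i, 0 < A i i) ->
  (\int[lebesgue_cV n]_x (expR (- (\sum_i (A *m x) i 0 ^+ 2) / 2))%:E =
   (\prod_i (Num.sqrt (2 * pi) / A i i))%:E)%E.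
Proof.
elim: n A => [|n IH] A Atri Apos.
  rewrite big_ord0; under eq_integral do rewrite big_ord0 oppr0 mul0r expR0.
  by rewrite integral_cst//= mul1e diracT.
pose A' : 'M[R]_n := \matrix_(i, j) A (lift ord0 i) (lift ord0 j).
pose beta (y : 'cV[R]_n) : R := \sum_j A ord0 (lift ord0 j) * y j 0.
have row0 t y : (A *m cV_cons (t, y)) ord0 0 = A ord0 ord0 * t + beta y.
  rewrite mxE big_ord_recl cV_consE0; congr (_ + _).
  by apply: eq_bigr => j _; rewrite cV_consES.
have rowS t y i : (A *m cV_cons (t, y)) (lift ord0 i) 0 = (A' *m y) i 0.
  rewrite !mxE big_ord_recl Atri// mul0r add0r.
  by apply: eq_bigr => j _; rewrite cV_consES mxE.
have splitE t y : expR (- (\sum_i (A *m cV_cons (t, y)) i 0 ^+ 2) / 2) =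
    expR (- (A ord0 ord0 * t + beta y) ^+ 2 / 2) *
    expR (- (\sum_i (A' *m y) i 0 ^+ 2) / 2).
  rewrite big_ord_recl row0 -expRD opprD mulrDl; congr expR; congr (_ + - _ / _).
  by apply: eq_bigr => i _; rewrite rowS.
rewrite tonelli_cV//; last by apply/measurable_EFinP; exact: measurable_gauss.
rewrite (fubini_tonelli (fun p => (expR (- (\sum_i (A *m cV_cons p) i 0 ^+ 2) / 2))%:E))//=; last first.
  apply/measurable_EFinP.
  exact: (measurableT_comp (@measurable_gauss _ _ A) (@measurable_cV_cons R n)).
transitivity (\int[lebesgue_cV n]_y ((Num.sqrt (2 * pi) / A ord0 ord0)%:E *
    (expR (- (\sum_i (A' *m y) i 0 ^+ 2) / 2))%:E))%E.
  apply: eq_integral => y _.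
  under eq_integral do rewrite splitE mulrC EFinM.
  rewrite ge0_integralZl//=; first by rewrite gauss_integral1// muleC.
  apply/measurable_EFinP; apply: measurableT_comp => //.
  apply: measurable_funM => //; apply: measurableT_comp => //.
  by apply: measurable_funX; apply: measurable_funD => //; exact: measurable_funM.
rewrite ge0_integralZl//=; last 2 first.
- by apply/measurable_EFinP; exact: measurable_gauss.
- by rewrite lee_fin divr_ge0 ?sqrtr_ge0// ltW.
rewrite IH; last 2 first.
- by move=> i j ij; rewrite mxE Atri.
- by move=> i; rewrite mxE.
rewrite -EFinM big_ord_recl; congr (_ * _)%:E.
by apply: eq_bigr => i _; rewrite mxE.
Qed.

Lemma exp_decay1 : (\int[leb]_t (expR (- `|t|))%:E < +oo)%E.
Proof.
have cf : continuous (fun t : R => expR (- `|t|)).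
  move=> t; apply: continuous_comp; last exact: continuous_expR.
  by apply: continuousN; exact: norm_continuous.
rewrite ge0_symfun_integralT//=; last by move=> t; rewrite /= normrN.
have mf : measurable_fun setT (fun t : R => expR (- `|t|)) by exact: continuous_measurable_fun.
have mpos : measurable [set x : R | 0 <= x]%R by rewrite -set_itvcy.
apply: lte_mul_pinfty => //; apply: (@le_lt_trans _ _ (\int[leb]_x (exponential_pdf 1 x)%:E)%E).
  apply: (@le_trans _ _ (\int[leb]_(x in [set x : R | 0 <= x]%R) (exponential_pdf 1 x)%:E)%E).
    rewrite le_eqVlt; apply/orP; left; apply/eqP; apply: eq_integral => x; rewrite inE/= => x0.
    by rewrite exponential_pdfE// mul1r mulN1r ger0_norm.
  apply: ge0_subset_integral => //.
    by apply/measurable_EFinP; exact: measurable_exponential_pdf.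
  by move=> x _; rewrite lee_fin exponential_pdf_ge0.
by rewrite integral_exponential_pdf// ltry.
Qed.

Definition l1 n (x : 'cV[R]_n) : R := \sum_i `|x i 0|.

Lemma measurable_l1 n : measurable_fun setT (@l1 n).
Proof.
by apply: measurable_sum_cV => i; apply: measurableT_comp => //; exact: measurable_coord.
Qed.

(** The integrand is a product over the coordinates. It serves as the common dominating function for
    rapidly decreasing integrands. *)
Lemma exp_decay n : (\int[lebesgue_cV n]_x (expR (- l1 x))%:E < +oo)%E.
Proof.
elim: n => [|n IH].
  under eq_integral do rewrite /l1 big_ord0 oppr0 expR0.
  by rewrite integral_cst//= mul1e diracT ltry.
rewrite tonelli_cV//; last first.
  apply/measurable_EFinP; apply: measurableT_comp => //.
  by apply: measurableT_comp => //; exact: measurable_l1.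
have splitE t y : expR (- l1 (cV_cons (t, y) : 'cV[R]_n.+1)) = expR (- `|t|) * expR (- l1 y).
  rewrite -expRD -opprD /l1 big_ord_recl cV_consE0; congr (expR (- (_ + _))).
  by apply: eq_bigr => i _; rewrite cV_consES.
have mexp_norm : measurable_fun setT (fun t : R => expR (- `|t|)).
  by apply: measurableT_comp => //; apply: measurableT_comp => //; exact: measurableT_comp.
pose c := (\int[lebesgue_cV n]_y (expR (- l1 y))%:E)%E.
have c0 : (0 <= c)%E by apply: integral_ge0 => y _; rewrite lee_fin expR_ge0.
have -> : (\int[leb]_t \int[lebesgue_cV n]_y (expR (- l1 (cV_cons (t, y) : 'cV[R]_n.+1)))%:E =
    \int[leb]_t ((expR (- `|t|))%:E * c))%E.
  apply: eq_integral => t _; under eq_integral do rewrite splitE EFinM.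
  rewrite ge0_integralZl//=.
  apply/measurable_EFinP; apply: measurableT_comp => //.
  by apply: measurableT_comp => //; exact: measurable_l1.
rewrite ge0_integralZr//=; last exact/measurable_EFinP.
have d0 : (0 <= \int[leb]_t (expR (- `|t|))%:E)%E.
  by apply: integral_ge0 => t _; rewrite lee_fin expR_ge0.
by apply: lte_mul_pinfty => //; rewrite ge0_fin_numE// exp_decay1.
Qed.

(** An open set is the countable union of the boxes with rational centre and radius 1 / (k + 1) that
    it contains, and boxes are cut out by coordinates. *)
Lemma open_measurable_cV n (U : set 'cV[R]_n) : open U -> measurable U.
Proof.
move=> oU.
pose B (p : 'cV[rat]_n * nat) : set 'cV[R]_n :=
  [set x | forall i, `|x i 0 - ratr (p.1 i 0)| < p.2.+1%:R^-1].
have mB p : measurable (B p).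
  rewrite (_ : B p = \bigcap_(i in [set: 'I_n])
      [set x | `|x i 0 - ratr (p.1 i 0)| < p.2.+1%:R^-1]); last first.
    by apply/seteqP; split => x /= H i; [move=> _|]; exact: H.
  apply: fin_bigcap_measurable => [|i _]; first exact: finite_finset.
  have mi : measurable_fun setT (fun x : 'cV[R]_n => `|x i 0 - ratr (p.1 i 0)|).
    apply: measurableT_comp => //; apply: measurable_funB => //.
    exact: measurable_coord.
  have := mi measurableT `]-oo, p.2.+1%:R^-1[%classic (measurable_itv _).
  by rewrite setTI; congr measurable; apply/seteqP; split => x /=; rewrite in_itv.
pose F p := if `[< B p `<=` U >] then B p else set0.
rewrite (_ : U = \bigcup_p F p).
  apply: countable_bigcupT_measurable => [|p]; first exact: countableP.
  by rewrite /F; case: ifP.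
apply/seteqP; split => x; last first.
  by move=> [p _]; rewrite /F; case: asboolP => // BU; exact: BU.
move=> Ux; have /nbhs_ballP[e /= e0 eU] : nbhs x U by exact: oU.
have [k ke] : exists k : nat, k.+1%:R^-1 < e / 2.
  have := @cvg_harmonic R => /cvgrPdist_lt/(_ (e / 2)).
  rewrite divr_gt0// => /(_ isT)[k _ /(_ k (leqnn _))] /=.
  by rewrite sub0r normrN ger0_norm// => H; exists k.
have kpos : (0 : R) < k.+1%:R^-1 by rewrite invr_gt0.
have H i : exists q : rat, `|x i 0 - ratr q| < k.+1%:R^-1.
  have /rat_in_itvoo[q] : x i 0 - k.+1%:R^-1 < x i 0 + k.+1%:R^-1.
    by rewrite ltrD2l (lt_trans _ kpos)// oppr_lt0.
  rewrite in_itv/= => /andP[q1 q2]; exists q.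
  by rewrite ltr_distlC q1 q2.
have [q Hq] := choice H.
exists (\col_i q i, k) => //; rewrite /F; case: asboolP => [_|nBU].
  by move=> i; rewrite /= mxE; exact: Hq.
exfalso; apply: nBU => y By; apply: eU; split=> // i j; rewrite ord1.
rewrite /ball/= -(subrK (ratr (q i)) (x i 0)) -addrA.
apply: (le_lt_trans (ler_normD _ _)).
have := By i; rewrite /= mxE distrC => yq.
have := ltrD (Hq i) yq => /lt_trans; apply.
by rewrite [ltRHS]splitr ltrD.
Qed.

Lemma continuous_measurable_cV n (f : 'cV[R]_n -> R) : continuous f -> measurable_fun setT f.
Proof.
move=> cf; apply: (measurability _ (RGenOpens.measurableE R)) => /= _ [_ [a [b ->] <-]].
rewrite setTI; apply: open_measurable_cV; apply: open_comp => [x _|]; first exact: cf.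
exact: interval_open.
Qed.

End gaussian_integrals.

(** * Integrals and weighted L2 spaces *)

Section integration.
Context {R : realType} {N : nat}.
Local Notation E := 'cV[R]_N.
Implicit Types (f g : E -> R) (x v h : E).

Definition itg f := (@lebesgue_cV R N).-integrable setT (EFin \o f).
Local Notation "'Int' f" := (\int[@lebesgue_cV R N]_x f x) (at level 10, f at level 9).

Lemma itg_ge0P f : measurable_fun setT f -> (forall x, 0 <= f x) ->
  (\int[@lebesgue_cV R N]_x (f x)%:E < +oo)%E -> itg f.
Proof.
move=> mf f0 foo; apply/integrableP; split; first exact/measurable_EFinP.
by under eq_integral do rewrite /= ger0_norm//.
Qed.

Lemma itg_lty f : itg f -> (forall x, 0 <= f x) ->
  (\int[@lebesgue_cV R N]_x (f x)%:E < +oo)%E.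
Proof.
move=> /integrableP[_ +] f0.
by under eq_integral do rewrite /= ger0_norm//.
Qed.

Lemma itg_le f g : measurable_fun setT f -> itg g ->
  (forall x, `|f x| <= g x) -> itg f.
Proof.
move=> mf ig fg; apply: (le_integrable _ _ _ ig) => //; first exact/measurable_EFinP.
by move=> x _ /=; rewrite lee_fin (le_trans (fg x))// ler_norm.
Qed.

Lemma itgD f g : itg f -> itg g -> itg (fun x => f x + g x).
Proof. by move=> i_f ig; exact: (integrableD measurableT i_f ig). Qed.

Lemma itgZ (c : R) f : itg f -> itg (fun x => c * f x).
Proof. by move=> i_f; exact: (integrableZl measurableT c i_f). Qed.

Lemma itgB f g : itg f -> itg g -> itg (fun x => f x - g x).
Proof. by move=> i_f ig; exact: (integrableB measurableT i_f ig). Qed.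

Lemma itg0 : itg (fun=> 0).
Proof. exact: integrable0. Qed.

Lemma itg_sum I (r : seq I) (P : pred I) (h : I -> E -> R) :
  (forall i, itg (h i)) -> itg (fun x => \sum_(i <- r | P i) h i x).
Proof.
move=> ih; elim: r => [|i r IH].
  by under eq_fun do rewrite big_nil; exact: itg0.
case Pi: (P i); last by under eq_fun do rewrite big_cons Pi.
by under eq_fun do rewrite big_cons Pi; exact: itgD.
Qed.

Lemma IntD f g : itg f -> itg g -> Int (fun x => f x + g x) = Int f + Int g.
Proof. by move=> i_f ig; exact: (RintegralD measurableT i_f ig). Qed.

Lemma IntB f g : itg f -> itg g -> Int (fun x => f x - g x) = Int f - Int g.
Proof. by move=> i_f ig; exact: (RintegralB measurableT i_f ig). Qed.

Lemma IntZ (c : R) f : itg f -> Int (fun x => c * f x) = c * Int f.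
Proof. by move=> i_f; by rewrite -RintegralZl. Qed.

Lemma Int0 : Int (fun=> 0) = 0.
Proof. by rewrite /Rintegral integral0. Qed.

Lemma Int_sum I (r : seq I) (P : pred I) (h : I -> E -> R) :
  (forall i, itg (h i)) ->
  Int (fun x => \sum_(i <- r | P i) h i x) = \sum_(i <- r | P i) Int (h i).
Proof.
move=> ih; elim: r => [|i r IH].
  by rewrite big_nil; under eq_Rintegral do rewrite big_nil; exact: Int0.
rewrite big_cons; case Pi: (P i); last by under eq_Rintegral do rewrite big_cons Pi.
under eq_Rintegral do rewrite big_cons Pi.
by rewrite IntD ?IH//; exact: itg_sum.
Qed.

Lemma Int_ge0 f : (forall x, 0 <= f x) -> 0 <= Int f.
Proof. by move=> f0; exact: Rintegral_ge0. Qed.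

Lemma le_Int f g : itg f -> itg g -> (forall x, f x <= g x) -> Int f <= Int g.
Proof. by move=> i_f ig fg; exact: le_Rintegral. Qed.

Lemma EFin_Int f : itg f -> (Int f)%:E = (\int[@lebesgue_cV R N]_x (f x)%:E)%E.
Proof. by move=> i_f; rewrite /Rintegral fineK//; exact: integrable_fin_num. Qed.

Lemma ae_eq_Int f g : measurable_fun setT f -> measurable_fun setT g ->
  {ae (@lebesgue_cV R N), forall x, f x = g x} -> Int f = Int g.
Proof.
move=> mf mg fg; rewrite /Rintegral; congr fine; apply: ae_eq_integral => //.
- exact/measurable_EFinP.
- exact/measurable_EFinP.
- by apply: filterS fg => x /= + _ => ->.
Qed.

Lemma Int_dominated_cvg (f_ : (E -> R)^nat) f g :
  (forall n, measurable_fun setT (f_ n)) -> measurable_fun setT f -> itg g ->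
  (forall x, f_ ^~ x @ \oo --> f x) -> (forall n x, `|f_ n x| <= g x) ->
  (fun n => Int (f_ n)) @ \oo --> Int f.
Proof.
move=> mf_ mf ig f_f f_g.
have cvgE : {ae (@lebesgue_cV R N), forall x, setT x ->
    (fun n => (f_ n x)%:E) @ \oo --> (EFin \o f) x}.
  by apply: aeW => x _; apply/fine_cvgP; split; [exact: nearW|exact: f_f].
have domE : {ae (@lebesgue_cV R N), forall x n, setT x -> (`|(f_ n x)%:E| <= (EFin \o g) x)%E}.
  by apply: aeW => x n _; rewrite lee_fin.
have [i_f _ cvgI] := @dominated_convergence _ _ _ (@lebesgue_cV R N) setT measurableT
  (fun n x => (f_ n x)%:E) (EFin \o f) (EFin \o g)
  (fun n => (measurable_EFinP _ _).2 (mf_ n)) ((measurable_EFinP _ _).2 mf) cvgE ig domE.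
apply: fine_cvg; rewrite (EFin_Int i_f); exact: cvgI.
Qed.

Lemma Int_shift h f : measurable_fun setT f -> Int (fun x => f (x + h)) = Int f.
Proof.
move=> mf; rewrite /Rintegral; congr fine; rewrite [LHS]integralE [RHS]integralE; congr (_ - _)%E.
- transitivity (\int[@lebesgue_cV R N]_x (EFin \o f)^\+ (x + h)%R)%E.
    by apply: eq_integral => x _; rewrite !(funeposE, funenegE).
  apply: (@integral_shift _ _ h ((EFin \o f)^\+)%E) => //.
  by apply: measurable_funepos; exact/measurable_EFinP.
- transitivity (\int[@lebesgue_cV R N]_x (EFin \o f)^\- (x + h)%R)%E.
    by apply: eq_integral => x _; rewrite !(funeposE, funenegE).
  apply: (@integral_shift _ _ h ((EFin \o f)^\-)%E) => //.
  by apply: measurable_funeneg; exact/measurable_EFinP.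
Qed.

Lemma itg_shift h f : itg f -> itg (fun x => f (x + h)).
Proof.
move=> /integrableP[/measurable_EFinP mf foo]; apply/integrableP; split.
  apply/measurable_EFinP; exact: (measurableT_comp mf (@measurable_shift _ _ h)).
rewrite /= (@integral_shift _ _ h (fun x => (`|f x|)%:E))//.
by apply/measurable_EFinP; exact: measurableT_comp.
Qed.

Lemma l1_ge0 x : 0 <= l1 x.
Proof. exact: sumr_ge0. Qed.

Lemma le_l1D x y : l1 (x + y) <= l1 x + l1 y.
Proof.
rewrite /l1 -big_split/=; apply: ler_sum => i _.
by rewrite mxE ler_normD.
Qed.

Lemma l1Z (c : R) x : l1 (c *: x) = `|c| * l1 x.
Proof. by rewrite /l1 mulr_sumr; apply: eq_bigr => i _; rewrite mxE normrM. Qed.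

Lemma coord_le_l1 x i : `|x i 0| <= l1 x.
Proof. by rewrite /l1 (bigD1 i)//= lerDl sumr_ge0. Qed.

Lemma itg_exp_decay : itg (fun x => expR (- l1 x)).
Proof.
apply: itg_ge0P; last exact: exp_decay.
  by apply: measurableT_comp => //; apply: measurableT_comp => //; exact: measurable_l1.
by move=> x; exact: expR_ge0.
Qed.

Lemma is_derive_line (F : E -> R) (d : R) x v (s : R) : is_derive (s *: v + x) v F d ->
  is_derive s (1 : R) (fun t : R => F (t *: v + x)) d.
Proof.
have E0 : (fun h : R => h^-1 *: (F (h *: v + (s *: v + x)) - F (s *: v + x))) =
    (fun h : R => h^-1 *: (F ((h *: 1 + s) *: v + x) - F (s *: v + x))).
  by apply/funext => h; rewrite [h *: 1]mulr1 scalerDl addrA.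
move=> [dF <-]; split; first by move: dF; rewrite /derivable E0.
by rewrite /derive E0.
Qed.

(* Integration by parts: translation invariance kills the integral of the     *)
(* difference quotients of F, which converge to dF dominatedly.               *)
Lemma Int_derive0 (F dF : E -> R) v (K : R) : measurable_fun setT F -> measurable_fun setT dF ->
  (forall x, is_derive x v F (dF x)) ->
  (forall x, `|F x| <= K * expR (- l1 x)) ->
  (forall x, `|dF x| <= K * expR (- l1 x)) -> Int dF = 0.
Proof.
move=> mF mdF HF FK dFK.
have K0 : 0 <= K.
  by have := le_trans (normr_ge0 _) (FK 0); rewrite pmulr_lge0 ?expR_gt0.
have iF : itg F by apply: itg_le mF (itgZ K itg_exp_decay) FK.
pose hh (n : nat) : R := n.+1%:R^-1.
have hh_gt0 n : 0 < hh n by rewrite invr_gt0.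
pose q n x := (hh n)^-1 * (F (x + hh n *: v) - F x).
have q0 n : Int (q n) = 0.
  rewrite IntZ; last by apply: itgB => //; exact: itg_shift.
  by rewrite IntB//; [rewrite Int_shift// subrr mulr0|exact: itg_shift].
have mq n : measurable_fun setT (q n).
  apply: measurable_funM => //; apply: measurable_funB => //.
  exact: (measurableT_comp mF (@measurable_shift _ _ _)).
have ig : itg (fun x => K * expR (l1 v) * expR (- l1 x)) by apply: itgZ; exact: itg_exp_decay.
(* The quotient is the value of dF at a point x + c v with 0 < c < hh n <= 1, where [l1] differs
   from [l1 x] by at most [l1 v]. *)
have qg n x : `|q n x| <= K * expR (l1 v) * expR (- l1 x).
  have Hline (s : R) : is_derive s (1 : R) (fun t : R => F (t *: v + x)) (dF (s *: v + x)).
    exact: is_derive_line.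
  have cline : {within `[0, hh n], continuous (fun t : R => F (t *: v + x))}.
    exact: der_continuous_within Hline.
  have [c] := MVT (hh_gt0 n) (fun s _ => Hline s) cline.
  rewrite in_itv/= scale0r add0r subr0 => /andP[c0 ch] FE.
  rewrite /q [x + _]addrC FE mulrC mulfK ?gt_eqF//.
  apply: le_trans (dFK _) _; rewrite -mulrA ler_wpM2l// -expRD ler_expR.
  have c1 : `|c| <= 1.
    rewrite ger0_norm ?(ltW c0)// (le_trans (ltW ch))// /hh invf_le1//.
    by rewrite ler1n.
  have : l1 x <= l1 (c *: v + x) + l1 v.
    have {1}-> : x = (c *: v + x) + (- c) *: v by rewrite scaleNr addrAC subrr add0r.
    apply: le_trans (le_l1D _ _) _; rewrite lerD2l l1Z normrN.
    by rewrite -[leRHS]mul1r ler_wpM2r ?l1_ge0.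
  by lra.
have qcvg x : q ^~ x @ \oo --> dF x.
  have [dFx <-] := HF x.
  have /cvgr_dnbhsP/(_ hh) := (dFx : cvg _).
  rewrite /q => H; rewrite (_ : (fun n => _) =
      (fun n => (hh n)^-1 *: (F (hh n *: v + x) - F x))); last first.
    by apply/funext => n; rewrite [x + _]addrC.
  by apply: H; split => [n|]; [rewrite gt_eqF|exact: cvg_harmonic].
have := Int_dominated_cvg mq mdF ig qcvg qg.
under eq_fun do rewrite q0.
by move=> /(cvg_unique _ (cvg_cst (0 : R))) <-.
Qed.

End integration.

(** * Growth classes of functions *)

Section tempered_functions.
Context {R : realType} {N : nat}.
Local Notation E := 'cV[R]_N.
Implicit Types (f g : E -> R).

Definition rapid f := forall k : R, exists C : R, forall x, `|f x| <= C * expR (- (k * l1 x)).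

(** Exponential growth is allowed, not just polynomial growth: the partial sums of the sine series
    must be dominated within this class. A rapid weight times a tempered function is integrable. *)
Definition tempered f := measurable_fun setT f /\
  exists C k : R, forall x, `|f x| <= C * expR (k * l1 x).

Lemma tempered_measurable f : tempered f -> measurable_fun setT f.
Proof. by case. Qed.

Lemma tempered_bound f : tempered f ->
  exists C k : R, [/\ 0 <= C, 0 <= k & forall x, `|f x| <= C * expR (k * l1 x)].
Proof.
move=> [_ [C [k Ck]]]; have C0 : 0 <= C.
  by have := le_trans (normr_ge0 _) (Ck 0); rewrite pmulr_lge0 ?expR_gt0.
exists C, `|k|; split=> // x; apply: le_trans (Ck x) _.
by rewrite ler_wpM2l// ler_expR ler_wpM2r ?l1_ge0// ler_norm.
Qed.

Lemma temperedD f g : tempered f -> tempered g -> tempered (fun x => f x + g x).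
Proof.
move=> tf tg; split.
  by apply: measurable_funD; [case: tf|case: tg].
have [C [k [C0 k0 Ck]]] := tempered_bound tf.
have [D [l [D0 l0 Dl]]] := tempered_bound tg.
exists (C + D), (k + l) => x; apply: (le_trans (ler_normD _ _)); rewrite mulrDl lerD//.
  by apply: le_trans (Ck x) _; rewrite ler_wpM2l// ler_expR ler_wpM2r ?l1_ge0// lerDl.
by apply: le_trans (Dl x) _; rewrite ler_wpM2l// ler_expR ler_wpM2r ?l1_ge0// lerDr.
Qed.

Lemma temperedM f g : tempered f -> tempered g -> tempered (fun x => f x * g x).
Proof.
move=> tf tg; split.
  by apply: measurable_funM; [case: tf|case: tg].
have [C [k [C0 k0 Ck]]] := tempered_bound tf.
have [D [l [D0 l0 Dl]]] := tempered_bound tg.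
exists (C * D), (k + l) => x; rewrite normrM mulrDl expRD mulrACA.
exact: ler_pM.
Qed.

Lemma tempered_cst (c : R) : tempered (fun=> c).
Proof.
split; first exact: measurable_cst.
by exists `|c|, 0 => x; rewrite mul0r expR0 mulr1.
Qed.

Lemma temperedZ (c : R) f : tempered f -> tempered (fun x => c * f x).
Proof. by move=> tf; apply: temperedM => //; exact: tempered_cst. Qed.

Lemma temperedN f : tempered f -> tempered (fun x => - f x).
Proof. by move=> tf; under eq_fun do rewrite -mulN1r; exact: temperedZ. Qed.

Lemma temperedB f g : tempered f -> tempered g -> tempered (fun x => f x - g x).
Proof. by move=> tf tg; apply: temperedD => //; exact: temperedN. Qed.

Lemma tempered_coord i : tempered (fun x : E => x i 0).
Proof.
split; first exact: measurable_coord.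
exists 1, 1 => x; rewrite !mul1r; apply: le_trans (coord_le_l1 x i) _.
by apply: le_trans (expR_ge1Dx _); rewrite lerDr.
Qed.

Lemma tempered_sum I (r : seq I) (P : pred I) (h : I -> E -> R) :
  (forall i, tempered (h i)) -> tempered (fun x => \sum_(i <- r | P i) h i x).
Proof.
move=> th; elim: r => [|i r IH].
  by under eq_fun do rewrite big_nil; exact: tempered_cst.
case Pi: (P i); last by under eq_fun do rewrite big_cons Pi.
by under eq_fun do rewrite big_cons Pi; exact: temperedD.
Qed.

Lemma tempered_prod I (r : seq I) (P : pred I) (h : I -> E -> R) :
  (forall i, tempered (h i)) -> tempered (fun x => \prod_(i <- r | P i) h i x).
Proof.
move=> th; elim: r => [|i r IH].
  by under eq_fun do rewrite big_nil; exact: tempered_cst.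
case Pi: (P i); last by under eq_fun do rewrite big_cons Pi.
by under eq_fun do rewrite big_cons Pi; exact: temperedM.
Qed.

Lemma tempered_exp (k : R) : tempered (fun x => expR (k * l1 x)).
Proof.
split.
  by apply: measurableT_comp => //; apply: measurable_funM => //; exact: measurable_l1.
by exists 1, k => x; rewrite mul1r ger0_norm ?expR_ge0.
Qed.

End tempered_functions.

(** * Real weighted L2 spaces *)

Section weighted_L2.
Context {R : realType} {N : nat}.
Local Notation E := 'cV[R]_N.
Implicit Types (f g u v : E -> R).
Local Notation "'Int' f" := (\int[@lebesgue_cV R N]_x f x) (at level 10, f at level 9).
Variable w : E -> R.
Hypotheses (mw : measurable_fun setT w) (w_gt0 : forall x, 0 < w x) (rw : rapid w).

Definition L2r u := measurable_fun setT u /\ itg (fun x => u x ^+ 2 * w x).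
Definition ip u v : R := Int (fun x => u x * v x * w x).

Lemma L2r_measurable u : L2r u -> measurable_fun setT u.
Proof. by case. Qed.

Lemma itg_tempered f : tempered f -> itg (fun x => f x * w x).
Proof.
move=> tf; have [C [k [C0 k0 Ck]]] := tempered_bound tf.
have [D Dk] := rw (k + 1).
apply: (@itg_le _ _ _ (fun x => (C * D) * expR (- l1 x))).
- by apply: measurable_funM => //; case: tf.
- by apply: itgZ; exact: itg_exp_decay.
move=> x; rewrite normrM.
apply: le_trans (ler_pM _ _ (Ck x) (Dk x)) _ => //.
rewrite mulrACA -expRD le_eqVlt; apply/orP; left; apply/eqP; congr (_ * expR _); ring.
Qed.

Lemma tempered_L2r f : tempered f -> L2r f.
Proof.
move=> tf; split; first by case: tf.
by under eq_fun do rewrite expr2; apply: itg_tempered; exact: temperedM.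
Qed.

Lemma itg_ip u v : L2r u -> L2r v -> itg (fun x => u x * v x * w x).
Proof.
move=> [mu iu] [mv iv].
apply: (@itg_le _ _ _ (fun x => u x ^+ 2 * w x + v x ^+ 2 * w x)).
- by apply: measurable_funM => //; exact: measurable_funM.
- exact: itgD.
move=> x; rewrite -mulrDl normrM [`|w x|]gtr0_norm// ler_wpM2r ?(ltW (w_gt0 _))//.
rewrite ler_norml; apply/andP; split; nra.
Qed.

Lemma L2rZ (c : R) u : L2r u -> L2r (fun x => c * u x).
Proof.
move=> [mu iu]; split; first exact: measurable_funM.
rewrite (_ : (fun x => _) = (fun x => c ^+ 2 * (u x ^+ 2 * w x))); first exact: itgZ.
by apply/funext => x; rewrite exprMn mulrA.
Qed.

Lemma L2rD u v : L2r u -> L2r v -> L2r (fun x => u x + v x).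
Proof.
move=> Lu Lv; have [mu iu] := Lu; have [mv iv] := Lv; split; first exact: measurable_funD.
rewrite (_ : (fun x => _) = (fun x => u x ^+ 2 * w x + (2 * (u x * v x * w x) + v x ^+ 2 * w x))).
  by apply: itgD => //; apply: itgD => //; apply: itgZ; exact: itg_ip.
by apply/funext => x; ring.
Qed.

Lemma L2rB u v : L2r u -> L2r v -> L2r (fun x => u x - v x).
Proof.
move=> Lu Lv; rewrite (_ : (fun x => _) = (fun x => u x + -1 * v x)).
  by apply: L2rD => //; exact: L2rZ.
by apply/funext => x; rewrite mulN1r.
Qed.

Lemma L2r_cst (c : R) : L2r (fun=> c).
Proof. by apply: tempered_L2r; exact: tempered_cst. Qed.

Lemma L2r_sum I (r : seq I) (P : pred I) (h : I -> E -> R) :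
  (forall i, L2r (h i)) -> L2r (fun x => \sum_(i <- r | P i) h i x).
Proof.
move=> Lh; elim: r => [|i r IH].
  by under eq_fun do rewrite big_nil; exact: L2r_cst.
case Pi: (P i); last by under eq_fun do rewrite big_cons Pi.
by under eq_fun do rewrite big_cons Pi; exact: L2rD.
Qed.

Lemma L2r_itg u : L2r u -> itg (fun x => u x * w x).
Proof.
by move=> Lu; have := itg_ip Lu (L2r_cst 1); under eq_fun do rewrite mulr1.
Qed.

Lemma ipC u v : ip u v = ip v u.
Proof. by congr Rintegral; apply/funext => x; rewrite [u x * _]mulrC. Qed.

Lemma ipDl u u' v : L2r u -> L2r u' -> L2r v ->
  ip (fun x => u x + u' x) v = ip u v + ip u' v.
Proof.
move=> Lu Lu' Lv; rewrite /ip -IntD; [|exact: itg_ip..].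
by congr Rintegral; apply/funext => x; rewrite !mulrDl.
Qed.

Lemma ipZl (c : R) u v : L2r u -> L2r v -> ip (fun x => c * u x) v = c * ip u v.
Proof.
move=> Lu Lv; rewrite /ip -IntZ; last exact: itg_ip.
by congr Rintegral; apply/funext => x; rewrite !mulrA.
Qed.

Lemma ipBl u u' v : L2r u -> L2r u' -> L2r v ->
  ip (fun x => u x - u' x) v = ip u v - ip u' v.
Proof.
move=> Lu Lu' Lv; rewrite /ip -IntB; [|exact: itg_ip..].
by congr Rintegral; apply/funext => x; rewrite !mulrBl.
Qed.

Lemma ipBr u v v' : L2r u -> L2r v -> L2r v' ->
  ip u (fun x => v x - v' x) = ip u v - ip u v'.
Proof. by move=> Lu Lv Lv'; rewrite ipC ipBl// ipC [ip v' u]ipC. Qed.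

Lemma ip_suml I (r : seq I) (P : pred I) (h : I -> E -> R) v :
  (forall i, L2r (h i)) -> L2r v ->
  ip (fun x => \sum_(i <- r | P i) h i x) v = \sum_(i <- r | P i) ip (h i) v.
Proof.
move=> Lh Lv; rewrite /ip -Int_sum => [|i]; last exact: itg_ip.
by congr Rintegral; apply/funext => x; rewrite !mulr_suml.
Qed.

Lemma ip_ge0 u : 0 <= ip u u.
Proof.
by apply: Int_ge0 => x; rewrite mulr_ge0 ?(ltW (w_gt0 _))// -expr2 sqr_ge0.
Qed.

Lemma ipxx u : ip u u = Int (fun x => u x ^+ 2 * w x).
Proof. by congr Rintegral; apply/funext => x; rewrite expr2. Qed.

Lemma ip_expand (t : R) u v : L2r u -> L2r v ->
  ip (fun x => u x + t * v x) (fun x => u x + t * v x) =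
  ip u u + 2 * t * ip u v + t ^+ 2 * ip v v.
Proof.
move=> Lu Lv; have i1 := itg_ip Lu Lu.
have i2 := itgZ (2 * t) (itg_ip Lu Lv); have i3 := itgZ (t ^+ 2) (itg_ip Lv Lv).
rewrite /ip -(IntZ _ (itg_ip Lu Lv)) -(IntZ _ (itg_ip Lv Lv)).
rewrite -(IntD i1 i2) -(IntD (itgD i1 i2) i3).
by congr Rintegral; apply/funext => x; ring.
Qed.

Lemma ip_cauchy_schwarz u v : L2r u -> L2r v -> ip u v ^+ 2 <= ip u u * ip v v.
Proof.
move=> Lu Lv.
have quad (t : R) : 0 <= ip u u + 2 * t * ip u v + t ^+ 2 * ip v v.
  by rewrite -ip_expand//; exact: ip_ge0.
have := ip_ge0 v; rewrite le_eqVlt => /orP[/eqP v0|v_gt0].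
  rewrite -v0 mulr0.
  have {}quad (t : R) : 0 <= ip u u + 2 * t * ip u v.
    by have := quad t; rewrite -v0 mulr0 addr0.
  have [->|uv0] := eqVneq (ip u v) 0; first by rewrite expr0n.
  have := quad (- (ip u u + 1) / (2 * ip u v)).
  rewrite (_ : _ + _ = -1); last by field.
  by rewrite oppr_ge0 ler10.
have := quad (- ip u v / ip v v).
rewrite (_ : _ + _ = (ip u u * ip v v - ip u v ^+ 2) / ip v v); last by field; rewrite gt_eqF.
by rewrite pmulr_lge0 ?invr_gt0// subr_ge0.
Qed.

Lemma le_ipB u v : L2r u -> L2r v ->
  ip (fun x => u x - v x) (fun x => u x - v x) <= 2 * ip u u + 2 * ip v v.
Proof.
move=> Lu Lv; have := ip_ge0 (fun x => u x + 1 * v x); rewrite ip_expand//.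
have -> : (fun x => u x - v x) = (fun x => u x + -1 * v x).
  by apply/funext => x; rewrite mulN1r.
rewrite ip_expand//; lra.
Qed.

Lemma ip_sym u v : ip (fun x => u x - v x) (fun x => u x - v x) =
  ip (fun x => v x - u x) (fun x => v x - u x).
Proof. by congr Rintegral; apply/funext => x; ring. Qed.

Lemma ip_triangle u v z : L2r u -> L2r v -> L2r z ->
  ip (fun x => u x - z x) (fun x => u x - z x) <=
  2 * ip (fun x => u x - v x) (fun x => u x - v x) +
  2 * ip (fun x => v x - z x) (fun x => v x - z x).
Proof.
move=> Lu Lv Lz; rewrite [X in _ <= _ + 2 * X]ip_sym.
have := le_ipB (L2rB Lu Lv) (L2rB Lz Lv); congr (_ <= _); congr ip.
  by apply/funext => x; ring.
by apply/funext => x; ring.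
Qed.

Lemma ae_eq_ip u u' v v' :
  {ae (@lebesgue_cV R N), forall x, u x = u' x} ->
  {ae (@lebesgue_cV R N), forall x, v x = v' x} ->
  measurable_fun setT u -> measurable_fun setT u' ->
  measurable_fun setT v -> measurable_fun setT v' -> ip u v = ip u' v'.
Proof.
move=> uu vv mu mu' mv mv'; apply: ae_eq_Int.
- by apply: measurable_funM => //; exact: measurable_funM.
- by apply: measurable_funM => //; exact: measurable_funM.
- by apply: filterS2 uu vv => x -> ->.
Qed.

Lemma ip0_ae u : L2r u -> ip u u = 0 -> {ae (@lebesgue_cV R N), forall x, u x = 0}.
Proof.
move=> [mu iu]; rewrite ipxx => I0.
have m2 : measurable_fun setT (fun x => (u x ^+ 2 * w x)%:E).
  by apply/measurable_EFinP; apply: measurable_funM => //; exact: measurable_funX.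
have : (\int[@lebesgue_cV R N]_x `|(u x ^+ 2 * w x)%:E| = 0)%E.
  transitivity (\int[@lebesgue_cV R N]_x (u x ^+ 2 * w x)%:E)%E.
    apply: eq_integral => x _; rewrite gee0_abs// lee_fin mulr_ge0 ?sqr_ge0//.
    exact: ltW.
  by rewrite -EFin_Int// I0.
move/(ae_eq_integral_abs (lebesgue_cV N) measurableT m2).1.
apply: filterS => x /(_ I) /= [] /eqP.
by rewrite mulf_eq0 (gt_eqF (w_gt0 x)) orbF sqrf_eq0 => /eqP.
Qed.

End weighted_L2.

(** * Completeness of weighted L2 *)

Section completeness.
Context {R : realType} {N : nat}.
Local Notation E := 'cV[R]_N.
Implicit Types (f g u v : E -> R).
Local Notation "'Int' f" := (\int[@lebesgue_cV R N]_x f x) (at level 10, f at level 9).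
Variable w : E -> R.
Hypotheses (mw : measurable_fun setT w) (w_gt0 : forall x, 0 < w x) (rw : rapid w).
Local Notation L2r := (L2r w).
Local Notation ip := (ip w).
Local Notation dist2 u v := (ip (fun x => u x - v x) (fun x => u x - v x)).

Let sum_half (a : R) n : 0 <= a -> \sum_(0 <= k < n) a / 2 ^+ k <= 2 * a.
Proof.
move=> a0; suff -> : \sum_(0 <= k < n) a / 2 ^+ k = 2 * a - 2 * a / 2 ^+ n.
  by rewrite gerBl divr_ge0 ?mulr_ge0 ?exprn_ge0.
elim: n => [|n IH]; first by rewrite big_nil expr0 divr1 subrr.
rewrite big_nat_recr//= IH exprS; field.
by rewrite expf_neq0.
Qed.

(* A sequence with geometrically decreasing increments is dominated by a      *)
(* square-integrable function, hence converges almost everywhere and in L2.   *)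
Lemma L2_fast_cvg (s : nat -> E -> R) : (forall n, L2r (s n)) ->
  (forall k, dist2 (s k.+1) (s k) <= (16 ^+ k)^-1) ->
  exists u, L2r u /\ (fun k => dist2 (s k) u) @ \oo --> (0 : R).
Proof.
move=> Ls fast; pose g k x := s k.+1 x - s k x.
have Lg k : L2r (g k) by exact: L2rB.
have mg k : measurable_fun setT (g k) by case: (Lg k).
(* The integral of hk k is at most 4^k / 16^k, hence summable, while the factor 4^k still forces
   pointwise geometric decrease of g k wherever the sum H is finite. *)
pose hk k x : R := 4 ^+ k * (g k x ^+ 2 * w x).
have hk_ge0 k x : 0 <= hk k x by rewrite /hk mulr_ge0 ?exprn_ge0// mulr_ge0 ?sqr_ge0// ltW.
have mhk k : measurable_fun setT (fun x => (hk k x)%:E).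
  apply/measurable_EFinP; apply: measurable_funM => //; apply: measurable_funM => //.
  exact: measurable_funX.
pose H x : \bar R := (\sum_(k <oo) (hk k x)%:E)%E.
have H_ge0 x : (0 <= H x)%E by apply: nneseries_ge0 => k _ _; rewrite lee_fin.
have mH : measurable_fun setT H.
  apply: ge0_emeasurable_sum => // k x _ _; by rewrite lee_fin.
have iH : (lebesgue_cV N).-integrable setT H.
  apply/integrableP; split=> //.
  under eq_integral do rewrite gee0_abs//.
  rewrite integral_nneseries//; last by move=> k x _; rewrite lee_fin.
  apply: (@le_lt_trans _ _ 2%:E); last exact: ltry.
  apply: lime_le; first by apply: is_cvg_nneseries => k _ _; apply: integral_ge0 => x _; rewrite lee_fin.
  apply: nearW => n.
  have Ihk k : (\int[lebesgue_cV N]_x (hk k x)%:E <= (1 / 2 ^+ k)%:E)%E.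
    have i2 : itg (fun x => g k x ^+ 2 * w x) by case: (Lg k).
    rewrite -EFin_Int; last exact: itgZ.
    rewrite lee_fin IntZ// -ipxx.
    apply: le_trans (ler_wpM2l _ (fast k)) _; first by rewrite exprn_ge0.
    rewrite (_ : (16 : R) = 4 * 4); last by rewrite -natrM.
    rewrite exprMn invfM mulVKf ?expf_neq0// -[leLHS]div1r ler_pdivrMr ?exprn_gt0//.
    rewrite mulrAC mul1r ler_pdivlMr ?exprn_gt0// mul1r.
    by rewrite lerXn2r// ?nnegrE// ler_nat.
  apply: (@le_trans _ _ (\sum_(0 <= k < n) (1 / 2 ^+ k)%:E)%E).
    by apply: lee_sum => k _; exact: Ihk.
  rewrite sumEFin lee_fin; apply: le_trans (sum_half n ler01) _.
  by rewrite mulr1.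
pose A : set E := [set x | (H x < +oo)%E].
have mA : measurable A.
  rewrite -[A]setTI; exact: (emeasurable_fun_infty_o measurableT mH).
have aeA : {ae (@lebesgue_cV R N), forall x, A x}.
  have := integrable_ae measurableT iH; apply: filterS => x /(_ I) Hx.
  by rewrite /A /= -ge0_fin_numE.
pose h x := fine (H x).
have ih : itg h.
  apply: (le_integrable _ _ _ iH) => //.
    by apply/measurable_EFinP; apply: measurableT_comp.
  move=> x _ /=; rewrite /h; have := H_ge0 x; case: (H x) => [r||] //= _.
  by rewrite normr0 leey.
have h_ge0 x : 0 <= h x by rewrite fine_ge0.
have hk_h k x : A x -> hk k x <= h x.
  move=> Ax; rewrite -lee_fin /h fineK ?ge0_fin_numE//.
  apply: (@le_trans _ _ (\sum_(0 <= j < k.+1) (hk j x)%:E)%E).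
    rewrite big_nat_recr//= leeDr// sume_ge0// => j _; by rewrite lee_fin.
  by apply: nneseries_lim_ge => j _ _; rewrite lee_fin.
(* Each 4^k (g k)^2 w is at most h, whence |g k| <= b / 2^k. *)
pose b x := Num.sqrt (h x / w x).
have b_ge0 x : 0 <= b x by exact: sqrtr_ge0.
have gb k x : A x -> `|g k x| <= b x / 2 ^+ k.
  move=> Ax; rewrite ler_pdivlMr ?exprn_gt0//.
  have -> : `|g k x| * 2 ^+ k = Num.sqrt ((g k x * 2 ^+ k) ^+ 2).
    by rewrite sqrtr_sqr normrM [`|2 ^+ k|]ger0_norm ?exprn_ge0.
  rewrite ler_wsqrtr// ler_pdivlMr//; apply: le_trans (hk_h k x Ax).
  rewrite /hk exprMn -exprM mulnC exprM (_ : (2 : R) ^+ 2 = 4); last by rewrite -natrX.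
  rewrite le_eqVlt; apply/orP; left; apply/eqP; ring.
have sE k n x : s (k + n)%N x - s k x = \sum_(k <= j < k + n) g j x.
  elim: n => [|n IH]; first by rewrite addn0 subrr big_geq.
  rewrite addnS big_nat_recr ?leq_addr//= -IH /g; ring.
have sB k n x : A x -> `|s (k + n)%N x - s k x| <= 2 * b x.
  move=> Ax; rewrite sE; apply: le_trans (ler_norm_sum _ _ _) _.
  apply: le_trans (sum_half (k + n) (b_ge0 x)).
  apply: (@le_trans _ _ (\sum_(0 <= j < k + n) `|g j x|)).
    by rewrite [leRHS](@big_cat_nat _ _ _ k)//= ?leq_addr// lerDr sumr_ge0.
  by apply: ler_sum => j _; exact: gb.
pose s' k x := \1_A x * s k x.
have ms k : measurable_fun setT (s k) by case: (Ls k).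
have ms' k : measurable_fun setT (s' k).
  by apply: measurable_funM => //; exact: measurable_indic.
pose u x := limn (s' ^~ x).
have cvg_s' x : s' ^~ x @ \oo --> u x.
  have [Ax|nAx] := pselect (A x); last first.
    have s'0 : s' ^~ x = fun=> 0.
      by apply/funext => k; rewrite /s' indicE memNset// mul0r.
    by rewrite /u s'0 lim_cst//; exact: cvg_cst.
  have s'E k : s' k x = s 0%N x + series (g ^~ x) k.
    rewrite /s' indicE mem_set// mul1r; have := sE 0%N k x.
    by rewrite !add0n => /eqP; rewrite subr_eq addrC => /eqP.
  suff : cvgn (s' ^~ x) by [].
  under eq_fun do rewrite s'E.
  apply: is_cvgD; first exact: is_cvg_cst.
  apply: normed_cvg; rewrite /normed_series_of /=.
  apply: (@series_le_cvg _ _ (geometric (b x) 2^-1)) => [k|k|k|].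
  - exact: normr_ge0.
  - by rewrite mulr_ge0// exprn_ge0 ?invr_ge0.
  - by rewrite /geometric/= exprVn; exact: gb.
  - by apply: is_cvg_geometric_series; rewrite ger0_norm ?invr_ge0// invf_lt1// ltr1n.
have mu : measurable_fun setT u by apply: measurable_fun_cvg ms' _ => x _; exact: cvg_s'.
have dom k x : `|(s' k x - u x) ^+ 2 * w x| <= 4 * h x.
  have [Ax|nAx] := pselect (A x); last first.
    have s'0 : s' ^~ x = fun=> 0 by apply/funext => j; rewrite /s' indicE memNset// mul0r.
    have -> : u x = 0 by rewrite /u s'0; exact: lim_cst.
    by rewrite [s' k x](congr1 (@^~ k) s'0) subr0 expr0n mul0r normr0 mulr_ge0.
  rewrite ger0_norm; last by rewrite mulr_ge0 ?sqr_ge0// ltW.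
  have su : `|s' k x - u x| <= 2 * b x.
    have cvg_n : (fun n => `|s' k x - s' (k + n)%N x|) @ \oo --> `|s' k x - u x|.
      apply: cvg_norm; apply: cvgB; first exact: cvg_cst.
      have := cvg_s' x; rewrite -(cvg_shiftn k).
      by under [X in X @ _ --> _ -> _]eq_fun do rewrite addnC.
    apply: (cvgr_to_le cvg_n); apply: nearW => n.
    by rewrite /s' indicE mem_set// !mul1r distrC; exact: sB.
  rewrite -[(_ - _) ^+ 2]real_normK ?num_real//.
  apply: (@le_trans _ _ ((2 * b x) ^+ 2 * w x)).
    by rewrite ler_wpM2r ?(ltW (w_gt0 x))// lerXn2r// nnegrE mulr_ge0.
  rewrite exprMn sqr_sqrtr ?divr_ge0 ?(ltW (w_gt0 x))// -mulrA divfK ?gt_eqF//.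
  by rewrite -natrX.
have Ls' k : L2r (s' k).
  split=> //; apply: (@itg_le _ _ _ (fun x => s k x ^+ 2 * w x)).
  - by apply: measurable_funM => //; exact: measurable_funX.
  - by case: (Ls k).
  - move=> x; rewrite /s' indicE; case: (x \in A).
      by rewrite mul1r ger0_norm// mulr_ge0 ?sqr_ge0// ltW.
    by rewrite mul0r expr0n mul0r normr0 mulr_ge0 ?sqr_ge0// ltW.
have Ld k : L2r (fun x => s' k x - u x).
  split; first exact: measurable_funB.
  apply: (@itg_le _ _ _ (fun x => 4 * h x)) => //; last exact: itgZ.
  by apply: measurable_funM => //; apply: measurable_funX; exact: measurable_funB.
have Lu : L2r u.
  rewrite (_ : u = (fun x => s' 0%N x - (s' 0%N x - u x))).
    by apply: L2rB.
  by apply/funext => x; rewrite subKr.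
exists u; split=> //.
have -> : (fun k => dist2 (s k) u) = (fun k => Int (fun x => (s' k x - u x) ^+ 2 * w x)).
  apply/funext => k; rewrite -ipxx; apply: ae_eq_ip => //; try exact: measurable_funB.
    by apply: filterS aeA => x Ax; rewrite /s' indicE mem_set// mul1r.
  by apply: filterS aeA => x Ax; rewrite /s' indicE mem_set// mul1r.
rewrite -(Int0 (N := N)).
apply: (Int_dominated_cvg (g := fun x => 4 * h x)) => //.
- move=> k; apply: measurable_funM => //; apply: measurable_funX; exact: measurable_funB.
- exact: itgZ.
- move=> x; rewrite -(mul0r (w x)); apply: cvgMr_tmp.
  have c0 : (fun k => s' k x - u x) @ \oo --> (0 : R).
    by rewrite -(subrr (u x)); apply: cvgB; [exact: cvg_s'|exact: cvg_cst].
  rewrite (_ : (fun k => _) = (fun k => (s' k x - u x) * (s' k x - u x))).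
    by rewrite -[X in _ --> X](mulr0 0); exact: (cvgM c0 c0).
  by apply/funext => k; rewrite expr2.
Qed.

(** A subsequence has increments small enough for [L2_fast_cvg], and a Cauchy sequence converges to
    the limit of its subsequence. *)
Lemma L2_complete (s : nat -> E -> R) : (forall n, L2r (s n)) ->
  (forall e, 0 < e -> exists M, forall m n, (M <= m)%N -> (M <= n)%N -> dist2 (s m) (s n) <= e) ->
  exists u, L2r u /\ (fun n => dist2 (s n) u) @ \oo --> (0 : R).
Proof.
move=> Ls cauchy.
have /choice[idx Hidx] k : exists M, forall m n, (M <= m)%N -> (M <= n)%N ->
    dist2 (s m) (s n) <= (16 ^+ k)^-1.
  by apply: cauchy; rewrite invr_gt0 exprn_gt0.
(* The partial sums exceed idx j for every j <= k, and also exceed k, so they can index a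
   subsequence without assuming idx monotone. *)
pose ix k := (\sum_(j < k.+1) (idx j).+1)%N.
have idx_ix k m : (k <= m)%N -> (idx k <= ix m)%N.
  move=> km; rewrite /ix (bigD1 (Ordinal (km : (k < m.+1)%N)))//=.
  by rewrite addSn ltnW// ltnS leq_addr.
have ix_ge k : (k < ix k)%N.
  rewrite /ix -[X in (X <= _)%N]card_ord -sum1_card; exact: leq_sum.
have [u [Lu cvgu]] := @L2_fast_cvg (fun k => s (ix k)) (fun k => Ls (ix k))
  (fun k => Hidx k _ _ (idx_ix k k.+1 (leqnSn k)) (idx_ix k k (leqnn k))).
exists u; split=> //; apply/cvgrPdist_le => e e0.
have e4 : 0 < e / 4 by rewrite divr_gt0.
have [M HM] := cauchy _ e4.
have /cvgrPdist_le/(_ _ e4)[K _ HK] := cvgu.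
exists M => // n Mn /=; rewrite sub0r normrN ger0_norm ?ip_ge0//.
pose m := maxn M K.
have := HK m (leq_maxr _ _); rewrite /= sub0r normrN ger0_norm ?ip_ge0// => mu.
have nm : dist2 (s n) (s (ix m)) <= e / 4.
  by apply: HM => //; apply: leq_trans (ltnW (ix_ge m)); exact: leq_maxl.
have T := ip_triangle mw w_gt0 (Ls n) (Ls (ix m)) Lu.
by apply: (le_trans T); lra.
Qed.

End completeness.

(** * Smooth functions *)

Section smooth_functions.
Context {R : realType} {N : nat}.
Local Notation E := 'cV[R]_N.
Implicit Types (f g p : E -> R) (x : E).

Definition smooth f := forall (s : seq 'I_N) x, differentiable (foldr partial f s) x.

Lemma smooth_differentiable f x : smooth f -> differentiable f x.
Proof. by move=> /(_ [::] x). Qed.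

Lemma smooth_continuous f : smooth f -> continuous f.
Proof. by move=> sf x; apply: differentiable_continuous; exact: smooth_differentiable. Qed.

Lemma smooth_partial i f : smooth f -> smooth (partial i f).
Proof.
by move=> sf s x; rewrite -[partial i f]/(foldr partial f [:: i]) -foldr_cat; exact: sf.
Qed.

Lemma smooth_is_derive f i x : smooth f ->
  is_derive x (delta_mx i 0) f (partial i f x).
Proof. by move=> sf; apply: derivableP; apply: diff_derivable; exact: smooth_differentiable. Qed.

Lemma is_derive_partial f i x (d : R) : is_derive x (delta_mx i 0) f d -> partial i f x = d.
Proof. by move=> Hf; rewrite /partial derive_val. Qed.

(** Smoothness by invariance: a class of differentiable functions stable under partial derivatives
    consists of smooth functions. This spares formulas for iterated derivatives. *)
Lemma smooth_class (P : (E -> R) -> Prop) :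
  (forall f, P f -> (forall x, differentiable f x) /\ forall i, P (partial i f)) ->
  forall f, P f -> smooth f.
Proof.
move=> HP f Pf s x; suff : P (foldr partial f s) by case/HP => + _; exact.
by elim: s => [//|i s IH] /=; case: (HP _ IH) => _; exact.
Qed.

Lemma partialD f g i : (forall x, differentiable f x) -> (forall x, differentiable g x) ->
  partial i (fun x => f x + g x) = (fun x => partial i f x + partial i g x).
Proof.
move=> df dg; apply/funext => x; apply: is_derive_partial.
by apply: derD; apply: derivableP; exact: diff_derivable.
Qed.

Lemma partialM f g i : (forall x, differentiable f x) -> (forall x, differentiable g x) ->
  partial i (fun x => f x * g x) = (fun x => partial i f x * g x + f x * partial i g x).
Proof.
move=> df dg; apply/funext => x; apply: is_derive_partial.
apply: is_derive_eq.
  by apply: derM; apply: derivableP; exact: diff_derivable.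
by rewrite addrC mulrC.
Qed.

Lemma partial_cst (c : R) i : partial i (fun _ : E => c) = fun=> 0.
Proof. by apply/funext => x; apply: is_derive_partial; exact: derC. Qed.

Lemma smooth_cst (c : R) : smooth (fun=> c).
Proof.
apply: (@smooth_class (fun f => exists c, f = fun=> c)); last by exists c.
move=> _ [{}c ->]; split=> [x|i]; first exact: differentiable_cst.
by exists 0; rewrite partial_cst.
Qed.

(** The product and chain rules produce sums of members of a class; closing the class under sums
    restores stability. *)
Inductive sum_closure (P : (E -> R) -> Prop) : (E -> R) -> Prop :=
| sum_gen f : P f -> sum_closure P f
| sum_add f g : sum_closure P f -> sum_closure P g ->
    sum_closure P (fun x => f x + g x).

Lemma smooth_sum_class (P : (E -> R) -> Prop) :
  (forall f, P f -> (forall x, differentiable f x) /\ forall i, sum_closure P (partial i f)) ->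
  forall f, P f -> smooth f.
Proof.
move=> HP f Pf; apply: (@smooth_class (sum_closure P)); last exact: sum_gen.
move=> {Pf}f; elim=> [g /HP[]|g h _ [dg Pg] _ [dh Ph]]; first by split.
split=> [x|i]; first exact: differentiableD.
by rewrite partialD//; exact: sum_add.
Qed.

Lemma smoothD f g : smooth f -> smooth g -> smooth (fun x => f x + g x).
Proof.
move=> sf sg; apply: (@smooth_class (sum_closure smooth)); last by apply: sum_add; exact: sum_gen.
move=> {sf sg}h; elim=> [k sk|k l _ [dk Pk] _ [dl Pl]]; split=> [x|i].
- exact: smooth_differentiable.
- by apply: sum_gen; exact: smooth_partial.
- exact: differentiableD.
- by rewrite partialD//; exact: sum_add.
Qed.

Lemma smoothM f g : smooth f -> smooth g -> smooth (fun x => f x * g x).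
Proof.
move=> sf sg; apply: (@smooth_sum_class (fun h => exists f' g',
  [/\ smooth f', smooth g' & h = fun x => f' x * g' x])); last by exists f, g.
move=> _ [k [l [sk sl ->]]]; split=> [x|i].
  by apply: differentiableM; exact: smooth_differentiable.
rewrite partialM; [|by move=> x; exact: smooth_differentiable..].
apply: sum_add; apply: sum_gen.
  by exists (partial i k), l; split=> //; exact: smooth_partial.
by exists k, (partial i l); split=> //; exact: smooth_partial.
Qed.

Lemma smoothZ (c : R) f : smooth f -> smooth (fun x => c * f x).
Proof. by move=> sf; apply: smoothM => //; exact: smooth_cst. Qed.

Lemma smooth_sum I (r : seq I) (h : I -> E -> R) :
  (forall i, smooth (h i)) -> smooth (fun x => \sum_(i <- r) h i x).
Proof.
move=> sh; elim: r => [|i r IH].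
  by under eq_fun do rewrite big_nil; exact: smooth_cst.
by under eq_fun do rewrite big_cons; exact: smoothD.
Qed.

Lemma smooth_prod I (r : seq I) (h : I -> E -> R) :
  (forall i, smooth (h i)) -> smooth (fun x => \prod_(i <- r) h i x).
Proof.
move=> sh; elim: r => [|i r IH].
  by under eq_fun do rewrite big_nil; exact: smooth_cst.
by under eq_fun do rewrite big_cons; exact: smoothM.
Qed.

Lemma is_derive_coord i x v : is_derive x v (fun y : E => y i 0) (v i 0).
Proof.
have dx : differentiable (fun y : E => y i 0) x by exact: differentiable_coord.
apply: DeriveDef; first exact: diff_derivable.
rewrite deriveE//.
have L : linear (fun y : E => y i 0) by move=> c y z; rewrite !mxE.
pose f : {linear E -> R} := HB.pack (fun y : E => y i 0) (GRing.isLinear.Build _ _ _ _ _ L).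
have cf : continuous f by exact: coord_continuous.
by rewrite (_ : (fun y : E => y i 0) = f)// diff_lin.
Qed.

Lemma smooth_coord i : smooth (fun x : E => x i 0).
Proof.
apply: (@smooth_class (fun f => f = (fun x : E => x i 0) \/ exists c, f = fun=> c)); last by left.
move=> _ [->|[c ->]]; split.
- by move=> x; exact: differentiable_coord.
- move=> j; right; exists ((delta_mx j 0 : E) i 0).
  by apply/funext => x; apply: is_derive_partial; exact: is_derive_coord.
- by move=> x; exact: differentiable_cst.
- by move=> j; right; exists 0; exact: partial_cst.
Qed.

Lemma der_comp (c : R -> R) (dc : R) f (df : R) x v :
  differentiable f x -> is_derive (f x) (1 : R) c dc -> is_derive x v f df ->
  is_derive x v (fun y => c (f y)) (dc * df).
Proof.
move=> dfx Hc Hf.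
have dcx : differentiable c (f x) by apply/derivable1_diffP; exact: ex_derive.
have dcf : differentiable (c \o f) x by exact: differentiable_comp.
apply: DeriveDef; first exact: (@diff_derivable _ _ _ (c \o f)).
have Hd : 'd f x v = df by rewrite -deriveE// derive_val.
rewrite -[fun y => _]/(c \o f) deriveE// diff_comp//= Hd deriv1E; last exact: ex_derive.
by rewrite derive1E derive_val mulrC.
Qed.

(** The sequence c lists the successive derivatives of the outer function; sums of functions p(x)
    c_m(f(x)) with p smooth are stable under partial derivatives. *)
Lemma smooth_comp (c : nat -> R -> R) f :
  (forall m s, is_derive s (1 : R) (c m) (c m.+1 s)) -> smooth f ->
  smooth (fun x => c 0%N (f x)).
Proof.
move=> Hc sf; apply: (@smooth_sum_class (fun h => exists m p,
  smooth p /\ h = fun x => p x * c m (f x))); last first.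
  by exists 0%N, (fun=> 1); split; [exact: smooth_cst|apply/funext => x; rewrite mul1r].
move=> _ [m [p [sp ->]]].
have dcm x : differentiable (fun x => c m (f x)) x.
  apply: (@differentiable_comp _ _ _ _ f (c m)); first exact: smooth_differentiable.
  by apply/derivable1_diffP; have [] := Hc m (f x).
split=> [x|i].
  by apply: differentiableM => //; exact: smooth_differentiable.
rewrite partialM//; last by move=> x; exact: smooth_differentiable.
apply: sum_add; apply: sum_gen.
  by exists m, (partial i p); split=> //; exact: smooth_partial.
exists m.+1, (fun x => p x * partial i f x); split.
  by apply: smoothM => //; exact: smooth_partial.
apply/funext => x; rewrite -mulrA; congr (_ * _); apply: is_derive_partial.
rewrite mulrC; apply: der_comp => //; first exact: smooth_differentiable.
exact: smooth_is_derive.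
Qed.

End smooth_functions.

(** * A flat function of one variable *)

Section bump.
Context {R : realType}.
Implicit Types (P : {poly R}) (s r : R).

Lemma poly_exp_bound P : exists C, 0 <= C /\ forall r, 0 <= r -> `|P.[r]| * expR (- r) <= C.
Proof.
have mono n r : 0 <= r -> r ^+ n * expR (- r) <= n`!%:R.
  move=> r0; case: n => [|n].
    by rewrite mul1r -(@expR0 R) ler_expR oppr_le0.
  rewrite expRN ler_pdivrMr ?expR_gt0// mulrC -ler_pdivrMr ?ltr0n ?fact_gt0//.
  by apply: le_trans (expR_ge1Dxn n r0); rewrite lerDr.
exists (\sum_(i < size P) `|P`_i| * i`!%:R); split.
  by apply: sumr_ge0 => i _; rewrite mulr_ge0.
move=> r r0; rewrite horner_coef.
apply: (@le_trans _ _ ((\sum_(i < size P) `|P`_i| * r ^+ i) * expR (- r))).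
  rewrite ler_wpM2r ?expR_ge0//; apply: le_trans (ler_norm_sum _ _ _) _.
  by apply: ler_sum => i _; rewrite normrM normrX (ger0_norm r0).
rewrite mulr_suml; apply: ler_sum => i _.
by rewrite -mulrA ler_wpM2l// mono.
Qed.

(** With r = 1 / (1 - s), this is P(r) exp(- r) continued by zero. Since r' = r^2, differentiation
    sends P to r^2 (P' - P), so all derivatives stay in this family; composed with a multiple of
    |x|^2 it gives cutoffs. *)
Definition bump P s : R :=
  if s < 1 then P.[(1 - s)^-1] * expR (- (1 - s)^-1) else 0.

Lemma bump_bound P : exists C, 0 <= C /\ forall s, `|bump P s| <= C.
Proof.
have [C [C0 HC]] := poly_exp_bound P; exists C; split=> // s; rewrite /bump.
case: ifPn => [s1|_]; last by rewrite normr0.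
by rewrite normrM [`|expR _|]ger0_norm ?expR_ge0// HC// invr_ge0 subr_ge0 ltW.
Qed.

(** [bump_bound] applied to X^2 P. Quadratic vanishing at s = 1 makes the derivative there zero,
    which glues the two branches in [bump_derive]. *)
Lemma bump_flat P : exists C, 0 <= C /\ forall s, `|bump P s| <= C * (1 - s) ^+ 2.
Proof.
have [C [C0 HC]] := bump_bound ('X^2 * P); exists C; split=> // s.
have := HC s; rewrite /bump; case: ifPn => [s1|_]; last first.
  by rewrite normr0 => _; rewrite mulr_ge0 ?sqr_ge0.
have p : 0 < 1 - s by rewrite subr_gt0.
have E : `|(1 - s)^-1 ^+ 2| = ((1 - s) ^+ 2)^-1.
  by rewrite exprVn ger0_norm// invr_ge0 sqr_ge0.
by rewrite hornerM hornerXn -mulrA normrM E mulrC ler_pdivrMr ?exprn_gt0.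
Qed.

Definition bump_step P : {poly R} := 'X^2 * (P^`() - P).

Lemma bump_derive P s : is_derive s (1 : R) (bump P) (bump (bump_step P) s).
Proof.
have [s1|s1|->] := ltgtP s 1.
- pose f t : R := P.[(1 - t)^-1] * expR (- (1 - t)^-1).
  apply: (@near_eq_is_derive _ _ _ f).
    near=> t; rewrite /f /bump ifT//; near: t; exact: (open_nbhs_nbhs (conj (@open_lt R 1) s1)).
  have p : 1 - s != 0 by rewrite subr_eq0 gt_eqF.
  have D0 : is_derive s (1 : R) (fun t : R => 1 - t) (- 1).
    by apply: (is_derive_eq (derB (derC 1 s (1 : R)) (is_derive_id s (1 : R)))); rewrite sub0r.
  have D1 : is_derive s (1 : R) (fun t : R => (1 - t)^-1) ((1 - s)^-1 ^+ 2).
    apply: (is_derive_eq (@is_deriveV _ (fun t : R => 1 - t) s (-1) 1 p D0)).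
    by rewrite /GRing.scale/= mulrN1 opprK exprVn.
  have D2 := @is_derive1_comp _ (horner P) (fun t : R => (1 - t)^-1) s _ _ (is_derive_poly P _) D1.
  have D3 : is_derive s (1 : R) (fun t : R => - (1 - t)^-1) (- (1 - s)^-1 ^+ 2).
    exact: is_deriveN.
  have D4 := @is_derive1_comp _ expR (fun t : R => - (1 - t)^-1) s _ _ (is_derive_expR _) D3.
  apply: (is_derive_eq (derM D2 D4)).
  rewrite /bump ifT// /bump_step hornerM hornerXn hornerD hornerN /=; ring.
- apply: (@near_eq_is_derive _ _ _ (fun=> 0)).
    near=> t; rewrite /bump ifF//; apply/negbTE; rewrite -leNgt ltW//; near: t; exact: (open_nbhs_nbhs (conj (@open_gt R 1) s1)).
  by rewrite /bump ifF ?ltNge ?(ltW s1)//; exact: derC.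
have b1 Q : bump Q 1 = 0 by rewrite /bump ltxx.
rewrite b1; have [C [C0 HC]] := bump_flat P.
have lim0 : (fun h : R => h^-1 *: (bump P (h *: 1 + 1) - bump P 1)) @ 0^' --> (0 : R).
  apply/cvgrPdist_le => e e0; near=> h.
  rewrite b1 subr0 sub0r normrN /GRing.scale/= mulr1 normrM normfV.
  have hn0 : 0 < `|h| by rewrite normr_gt0; near: h; exists 1 => /=.
  rewrite mulrC ler_pdivrMr//; apply: le_trans (HC _) _.
  rewrite (_ : (1 - (h + 1)) ^+ 2 = `|h| * `|h|); last by rewrite -expr2 real_normK ?num_real//; ring.
  rewrite mulrA ler_wpM2r//.
  apply: (@le_trans _ _ ((C + 1) * `|h|)); first by rewrite ler_wpM2r// lerDl.
  rewrite mulrC -ler_pdivlMr ?ltr_wpDl//; near: h.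
  apply: dnbhs0_le; by rewrite divr_gt0 ?ltr_wpDl.
by apply: DeriveDef; [apply/cvg_ex; exists 0|exact: cvg_lim].
Unshelve. all: by end_near. Qed.

End bump.

(** * Compact supports *)

Section compact_support.
Context {R : realType} {N : nat}.
Local Notation E := 'cV[R]_N.
Implicit Types (f : E -> R).

Lemma coord_le_norm (x : E) i : `|x i 0| <= `|x|.
Proof.
rewrite [leRHS]mx_normrE; apply: le_trans (_ : `|x (i, 0).1 (i, 0).2| <= _) => //.
exact: (@le_bigmax _ _ _ 0 (fun ij : 'I_N * 'I_1 => `|x ij.1 ij.2|) (i, 0)).
Qed.

Lemma compact_box (r : R) : compact [set x : E | forall i, `|x i 0| <= r].
Proof.
have cT : continuous (trmx : 'rV[R]_N -> E).
  move=> x A /nbhs_ballP[e /= e0 eA]; apply/nbhs_ballP; exists e => //= y [_ xy].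
  by apply: eA; split=> // i j; rewrite !mxE; exact: xy.
have cb : forall i : 'I_N, compact `[- r, r]%classic by move=> i; exact: segment_compact.
have := continuous_compact (continuous_subspaceT cT) (rV_compact cb).
congr compact; apply/seteqP; split => [_ /= [y Hy <-] i|x /= Hx].
  by have := Hy i; rewrite mxE /= in_itv/= ler_norml.
exists x^T; last by rewrite trmxK.
by move=> i; rewrite mxE /= in_itv/= -ler_norml; exact: Hx.
Unshelve. all: by end_near. Qed.

Lemma compact_supportP f : (exists r : R, forall x, f x != 0 -> forall i, `|x i 0| <= r) ->
  compact (closure [set x | f x != 0]).
Proof.
move=> [r Hr].
have cb : closed [set x : E | forall i, `|x i 0| <= r].
  by apply: compact_closed => //; exact: compact_box.
apply: subclosed_compact (@compact_box r) _; first exact: closed_closure.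
rewrite closureE => x; apply; split=> //.
Qed.

Lemma test_function_support f : test_function f ->
  exists r : R, forall x, f x != 0 -> forall i, `|x i 0| <= r.
Proof.
move=> [_ /compact_bounded[M [_ HM]]]; exists (M + 1) => x fx i.
apply: le_trans (coord_le_norm x i) _; apply: (HM (M + 1)); first by rewrite ltrDl.
exact: subset_closure.
Qed.

End compact_support.

(** * The Gaussian weight *)

Section gaussian_weight.
Context {R : realType} {N : nat}.
Local Notation E := 'cV[R]_N.
Local Notation "'Int' f" := (\int[@lebesgue_cV R N]_x f x) (at level 10, f at level 9).
Implicit Types (x v : E).
Variables (S A : 'M[R]_N).
Hypotheses (SA : S = A^T *m A) (Aunit : A \in unitmx).

Let psi := @psi_inf R N S.

Lemma quad_factor x : (x^T *m S *m x) 0 0 = \sum_i (A *m x) i 0 ^+ 2.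
Proof.
rewrite SA !mulmxA -trmx_mul -mulmxA mxE; apply: eq_bigr => i _.
by rewrite mxE expr2.
Qed.

Let detS : \det S = \det A ^+ 2.
Proof. by rewrite SA det_mulmx det_tr expr2. Qed.

Let detS_gt0 : 0 < \det S.
Proof. by rewrite detS exprn_even_gt0//= -unitfE -unitmxE. Qed.

Let cst : R := Num.sqrt (\det S) / (2 * pi) `^ (N%:R / 2).

Let cst_gt0 : 0 < cst.
Proof. by rewrite divr_gt0 ?sqrtr_gt0// powR_gt0// mulr_gt0// pi_gt0. Qed.

Lemma psiE x : psi x = cst * expR (- (\sum_i (A *m x) i 0 ^+ 2) / 2).
Proof. by rewrite /psi /psi_inf quad_factor. Qed.

Lemma psi_gt0 x : 0 < psi x.
Proof. by rewrite psiE mulr_gt0// expR_gt0. Qed.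

Lemma smooth_mulmx i : smooth (fun x : E => (A *m x) i 0).
Proof.
under eq_fun do rewrite mxE; apply: smooth_sum => j.
by apply: smoothZ; exact: smooth_coord.
Qed.

Lemma is_derive_mulmx i x v : is_derive x v (fun y : E => (A *m y) i 0) ((A *m v) i 0).
Proof.
under eq_fun do rewrite mxE; rewrite mxE.
by apply: der_sum => j; apply: derZ; exact: is_derive_coord.
Qed.

Let sumsq x : \sum_i (A *m x) i 0 ^+ 2 = \sum_i (A *m x) i 0 * (A *m x) i 0.
Proof. by apply: eq_bigr => i _; rewrite expr2. Qed.

Lemma is_derive_psi x v :
  is_derive x v psi (- (\sum_i (A *m x) i 0 * (A *m v) i 0) * psi x).
Proof.
rewrite (_ : psi = fun x => cst * expR (- (\sum_i (A *m x) i 0 ^+ 2) / 2)); last first.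
  by apply/funext => y; exact: psiE.
pose q (y : E) := - (\sum_i (A *m y) i 0 ^+ 2) / 2.
have Hq : is_derive x v q (- (\sum_i (A *m x) i 0 * (A *m v) i 0)).
  have H i := derM (is_derive_mulmx i x v) (is_derive_mulmx i x v).
  rewrite (_ : q = fun y => - 2^-1 * \sum_i (A *m y) i 0 * (A *m y) i 0); last first.
    by apply/funext => y; rewrite /q sumsq; ring.
  apply: (is_derive_eq (derZ (- 2^-1) (der_sum _ _ H))).
  rewrite -sumrN mulr_sumr; apply: eq_bigr => k _; by field.
have sq : smooth q.
  rewrite (_ : q = fun y => - 2^-1 * \sum_i (A *m y) i 0 * (A *m y) i 0); last first.
    by apply/funext => y; rewrite /q sumsq; ring.
  apply: smoothZ; apply: smooth_sum => k; apply: smoothM; exact: smooth_mulmx.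
have He := der_comp (smooth_differentiable x sq) (is_derive_expR (q x)) Hq.
apply: (is_derive_eq (derZ cst He)); rewrite /q; ring.
Qed.

Lemma smooth_psi : smooth psi.
Proof.
rewrite (_ : psi = fun x => cst * expR (- 2^-1 * \sum_i (A *m x) i 0 * (A *m x) i 0)); last first.
  by apply/funext => y; rewrite psiE sumsq; congr (_ * expR _); ring.
apply: smoothZ; apply: (@smooth_comp _ _ (fun _ : nat => @expR R)).
by apply: smoothZ; apply: smooth_sum => i; apply: smoothM; exact: smooth_mulmx.
Qed.

Lemma measurable_psi : measurable_fun setT psi.
Proof. by apply: continuous_measurable_cV; apply: smooth_continuous; exact: smooth_psi. Qed.

(** A x controls x because A is invertible, and in each coordinate a |t| <= t^2 / 2 + a^2 / 2; the N
    terms a^2 / 2 go into the constant. *)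
Lemma rapid_psi : rapid psi.
Proof.
move=> k; pose B := invmx A.
pose K := \sum_i \sum_j `|B i j|.
have l1x x : l1 x <= K * l1 (A *m x).
  rewrite /l1 mulr_suml; apply: ler_sum => i _.
  rewrite -{1}(mulKmx Aunit x) mxE; apply: le_trans (ler_norm_sum _ _ _) _.
  rewrite mulr_suml; apply: ler_sum => j _.
  by rewrite normrM ler_wpM2l//; exact: (@coord_le_l1 _ _ (A *m x)).
have K0 : 0 <= K by apply: sumr_ge0 => i _; exact: sumr_ge0.
pose a := `|k| * K.
exists (cst * expR (N%:R * (a ^+ 2 / 2))) => x.
rewrite ger0_norm ?(ltW (psi_gt0 _))// psiE -mulrA ler_wpM2l ?(ltW cst_gt0)// -expRD ler_expR.
have kl : k * l1 x <= a * l1 (A *m x).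
  apply: (@le_trans _ _ (`|k| * l1 x)); first by rewrite ler_wpM2r ?l1_ge0// ler_norm.
  by rewrite /a -mulrA ler_wpM2l.
apply: (@le_trans _ _ (N%:R * (a ^+ 2 / 2) - a * l1 (A *m x))); last by rewrite lerD2l lerN2.
have -> : N%:R * (a ^+ 2 / 2) = \sum_(i < N) a ^+ 2 / 2 :> R.
  by rewrite sumr_const card_ord mulr_natl.
rewrite /l1 mulr_sumr -sumrB mulNr mulr_suml -sumrN; apply: ler_sum => i _.
rewrite -[(A *m x) i 0 ^+ 2]real_normK ?num_real//; set t := `|_|.
have := sqr_ge0 (t - a); lra.
Qed.

End gaussian_weight.

(** * Total mass of the Gaussian *)

Section gaussian_normalization.
Context {R : realType} {N : nat}.
Local Notation E := 'cV[R]_N.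

(** The integral is computed with the triangular factor of S, since it can then be done coordinate
    by coordinate; the result no longer mentions a factor and is combined with the equidiagonal one
    elsewhere. *)
Lemma Int_psi (S : 'M[R]_N) : sym_posdef S ->
  \int[@lebesgue_cV R N]_x (psi_inf S x) = 1.
Proof.
move=> [symS posS]; have [A [SA Atri Apos]] := cholesky symS posS.
have detA : \det A = \prod_i A i i.
  rewrite -det_tr det_trig; last by apply/is_trig_mxP => i j ij; rewrite mxE Atri.
  by apply: eq_bigr => i _; rewrite mxE.
have detA_gt0 : 0 < \det A by rewrite detA; apply: prodr_gt0 => i _.
have Aunit : A \in unitmx by rewrite unitmxE unitfE gt_eqF.
have iI : (\int[@lebesgue_cV R N]_x (expR (- (\sum_i (A *m x) i 0 ^+ 2) / 2))%:E =
   (\prod_i (Num.sqrt (2 * pi) / A i i))%:E)%E by exact: gauss_integral_triangular.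
have iG : itg (fun x : E => expR (- (\sum_i (A *m x) i 0 ^+ 2) / 2)).
  apply: itg_ge0P; [exact: measurable_gauss|by move=> x; exact: expR_ge0|].
  by rewrite iI ltry.
under eq_Rintegral do rewrite (psiE SA).
rewrite IntZ//.
have -> : \int[@lebesgue_cV R N]_x expR (- (\sum_i (A *m x) i 0 ^+ 2) / 2) =
   \prod_i (Num.sqrt (2 * pi) / A i i) by rewrite /Rintegral iI.
rewrite big_split/= prodr_const card_ord prodfV -detA SA det_mulmx det_tr -expr2.
rewrite sqrtr_sqr gtr0_norm//.
have pi2 : 0 < 2 * pi :> R by rewrite mulr_gt0// pi_gt0.
have -> : (2 * pi) `^ (N%:R / 2) = Num.sqrt (2 * pi) ^+ N :> R.
  by rewrite [N%:R / 2]mulrC powRrM powR12_sqrt ?(ltW pi2)// powR_mulrn ?sqrtr_ge0.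
by rewrite mulrA divfK ?divff ?gt_eqF// exprn_gt0// sqrtr_gt0.
Qed.

End gaussian_normalization.

(** * Hermite functions *)

Section hermite_polynomials.
Context {R : realType}.

(** Probabilists' Hermite polynomials, generated by the Gaussian adjoint of differentiation. *)
Fixpoint He n : {poly R} := if n is m.+1 then 'X * He m - (He m)^`() else 1.

Lemma deriv_He n : (He n.+1)^`() = n.+1%:R *: He n.
Proof.
elim: n => [|n IH]; first by rewrite /= mulr1 derivB derivX -[1]/(1%:P) !derivC subr0 scale1r.
rewrite -[He n.+2]/('X * He n.+1 - (He n.+1)^`()) derivB derivM derivX mul1r IH.
rewrite derivZ -scalerAr addrC addrA [X in X + _]addrC -addrA.
rewrite -[n.+2]addn1 natrD scalerDl scale1r addrC; congr (_ + _).
by rewrite addrC -scalerBr.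
Qed.

End hermite_polynomials.

Section product_rule.
Context {R : realType} {V : normedModType R}.

Lemma der_prod (I : eqType) (r : seq I) (f : I -> V -> R) (df : I -> R) x v : uniq r ->
  (forall i, is_derive x v (f i) (df i)) ->
  is_derive x v (fun t => \prod_(i <- r) f i t)
    (\sum_(j <- r) df j * \prod_(i <- r | i != j) f i x).
Proof.
move=> + Hf; elim: r => [_|k r IH /= /andP[kr ur]].
  rewrite big_nil; under eq_fun do rewrite big_nil; exact: is_derive_cst.
under eq_fun do rewrite big_cons; rewrite big_cons.
have neq j : j \in r -> k != j by apply: contraTneq => <-.
apply: is_derive_eq (derM (Hf k) (IH ur)) _; rewrite addrC; congr (_ + _).
  rewrite mulrC big_cons eqxx/=; congr (_ * _); rewrite big_seq [RHS]big_seq_cond.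
  by apply: eq_bigl => i; case ir: (i \in r) => //=; rewrite eq_sym neq.
rewrite mulr_sumr; apply: eq_big_seq => j jr.
by rewrite big_cons neq// mulrCA.
Qed.

End product_rule.

Section hermite_functions.
Context {R : realType} {N : nat}.
Local Notation E := 'cV[R]_N.
Implicit Types (x v : E) (w : seq 'I_N).
Variable A : 'M[R]_N.
Local Notation y x i := ((A *m x) i 0).

(** The word w enters through its letter counts alone. The functions are not normalized: adding a
    letter j is then exactly the raising operator y_j - d/dy_j ([herm_cons]). *)
Definition herm w x : R := \prod_i (He (count_mem i w)).[y x i].

(** The derivative of [herm w] in the coordinate y_j; when j does not occur in w the count is zero
    and [rem j w] is harmless. *)
Definition dherm j w x : R := (count_mem j w)%:R * herm (rem j w) x.

Let dhermE j w x : dherm j w x =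
  ((He (count_mem j w))^`()).[y x j] * \prod_(i | i != j) (He (count_mem i w)).[y x i].
Proof.
rewrite /dherm /herm (bigD1 j)//= count_mem_rem eqxx.
rewrite (eq_bigr (fun i => (He (count_mem i w)).[y x i])); last first.
  by move=> i ij; rewrite count_mem_rem eq_sym (negbTE ij) subn0.
case: (count_mem j w) => [|n]; first by rewrite /= mul0r -[1]/(1%:P) derivC horner0 mul0r.
by rewrite deriv_He hornerZ subn1 mulrA.
Qed.

Lemma herm_nil x : herm [::] x = 1.
Proof. by rewrite /herm big1// => i _ /=; rewrite -[1]/(1%:P) hornerC. Qed.

Lemma herm_cons j w x : herm (j :: w) x = y x j * herm w x - dherm j w x.
Proof.
rewrite dhermE /herm (bigD1 j)//= [in RHS](bigD1 j)//= eqxx.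
rewrite (eq_bigr (fun i => (He (count_mem i w)).[y x i])); last first.
  by move=> i ij; rewrite eq_sym (negbTE ij).
by rewrite /= !hornerE mulrBl.
Qed.

Lemma is_derive_herm x v w :
  is_derive x v (herm w) (\sum_j y v j * dherm j w x).
Proof.
have H i : is_derive x v (fun t : E => (He (count_mem i w)).[y t i])
    (((He (count_mem i w))^`()).[y x i] * y v i).
  apply: (@der_comp _ _ (horner (He (count_mem i w))) _ (fun t : E => y t i)).
    by apply: smooth_differentiable; exact: smooth_mulmx.
  exact: is_derive_mulmx.
apply: is_derive_eq (der_prod (index_enum_uniq _) H) _.
by apply: eq_bigr => j _; rewrite dhermE mulrCA mulrA.
Qed.

Lemma symm_herm x : symm (herm^~ x).
Proof. by move=> w v /permP wv; apply: eq_bigr => i _; rewrite wv. Qed.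

Lemma smooth_herm w : smooth (herm w).
Proof.
have Hp (p : {poly R}) i : smooth (fun x : E => p.[y x i]).
  by apply: (@smooth_comp _ _ (fun n => horner (p^`(n)))); exact: smooth_mulmx.
by apply: smooth_prod => i; exact: Hp.
Qed.

Lemma tempered_mulmx i : tempered (fun x : E => y x i).
Proof.
under eq_fun do rewrite mxE; apply: tempered_sum => j.
by apply: temperedZ; exact: tempered_coord.
Qed.

Lemma tempered_herm w : tempered (herm w).
Proof.
apply: tempered_prod => i; set p := He _.
under eq_fun do rewrite horner_coef; apply: tempered_sum => j.
apply: temperedZ; under eq_fun do rewrite -[X in _ ^+ X]card_ord -prodr_const.
by apply: tempered_prod => k; exact: tempered_mulmx.
Qed.

Lemma tempered_dherm j w : tempered (dherm j w).
Proof. by apply: temperedZ; exact: tempered_herm. Qed.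

(** Read as a differential operator in y, the derivation is sum_ij M_ij (y_j d_i - d_i d_j), of
    Ornstein-Uhlenbeck type. This is the bridge between tensors and L_J. *)
Lemma dtens_herm M w x : dtens M w (herm^~ x) =
  \sum_i \sum_j M i j *
    (y x j * dherm i w x - (count_mem i w)%:R * dherm j (rem i w) x).
Proof.
rewrite dtens_count; last exact: symm_herm.
apply: eq_bigr => i _; apply: eq_bigr => j _.
rewrite herm_cons /dherm; ring.
Qed.

End hermite_functions.

Section gaussian_ibp.
Context {R : realType} {N : nat}.
Local Notation E := 'cV[R]_N.
Implicit Types (x v : E) (w : seq 'I_N).
Variables (S A : 'M[R]_N).
Hypotheses (SA : S = A^T *m A) (Aunit : A \in unitmx).
Local Notation y x i := ((A *m x) i 0).
Let psi := @psi_inf R N S.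
Local Notation ipp := (ip psi).

(** The basis dual to the coordinates y: differentiating along [frame j] is d/dy_j. *)
Definition frame j : E := invmx A *m delta_mx j 0.

Lemma mul_frame j i : y (frame j) i = (i == j)%:R.
Proof. by rewrite mulKVmx// mxE eqxx andbT. Qed.

(* [f |-> y_j f - df] is the adjoint of [d/dy_j] in [L2(psi)]. *)
Lemma gaussian_ibp j (f g df dg : E -> R) :
  tempered f -> tempered g -> tempered df -> tempered dg ->
  (forall x, is_derive x (frame j) f (df x)) ->
  (forall x, is_derive x (frame j) g (dg x)) ->
  ipp (fun x => y x j * f x - df x) g = ipp f dg.
Proof.
move=> tf tg tdf tdg Df Dg.
have mpsi := measurable_psi SA; have psi0 := psi_gt0 SA Aunit; have rpsi := rapid_psi SA Aunit.
pose dF x := (f x * dg x - (y x j * f x - df x) * g x) * psi x.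
have bnd h : tempered h -> exists2 K : R, 0 <= K & forall x, `|h x * psi x| <= K * expR (- l1 x).
  move=> /tempered_bound[C [k [C0 k0 hC]]]; have [D HD] := rpsi (k + 1).
  have D0 : 0 <= D.
    by have := le_trans (normr_ge0 _) (HD 0); rewrite pmulr_lge0 ?expR_gt0.
  exists (C * D) => [|x]; first exact: mulr_ge0.
  rewrite normrM; apply: le_trans (ler_pM _ _ (hC x) (HD x)) _ => //.
  by rewrite mulrACA -expRD ler_wpM2l ?mulr_ge0// ler_expR; lra.
have tH : tempered (fun x => f x * g x) by exact: temperedM.
have tdH : tempered (fun x => f x * dg x - (y x j * f x - df x) * g x).
  apply: temperedB; apply: temperedM => //; apply: temperedB => //; apply: temperedM => //.
  exact: tempered_mulmx.
have [K1 K10 HK1] := bnd _ tH; have [K2 K20 HK2] := bnd _ tdH.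
have : \int[@lebesgue_cV R N]_x dF x = 0.
  apply: (@Int_derive0 _ _ (fun x => f x * g x * psi x) _ (frame j) (K1 + K2)).
  - by apply: measurable_funM => //; exact: tempered_measurable.
  - by apply: measurable_funM => //; exact: tempered_measurable.
  - move=> x; apply: is_derive_eq (derM (derM (Df x) (Dg x)) (is_derive_psi SA x (frame j))) _.
    rewrite (bigD1 j)//= big1 => [|i ij]; last by rewrite mul_frame (negbTE ij) mulr0.
    by rewrite mul_frame eqxx /dF -/psi mulr1 addr0; ring.
  - by move=> x; apply: le_trans (HK1 x) _; rewrite ler_wpM2r ?expR_ge0// lerDl.
  - by move=> x; apply: le_trans (HK2 x) _; rewrite ler_wpM2r ?expR_ge0// lerDr.
have -> : \int[@lebesgue_cV R N]_x dF x =
    ipp f dg - ipp (fun x => y x j * f x - df x) g.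
  have L h : tempered h -> L2r psi h by exact: tempered_L2r.
  rewrite -IntB; first by apply: eq_Rintegral => x _; rewrite /dF; ring.
    by apply: (itg_ip mpsi) => //; exact: L.
  apply: (itg_ip mpsi) => //; apply: L => //; apply: temperedB => //.
  by apply: temperedM => //; exact: tempered_mulmx.
by move/subr0_eq.
Qed.

Lemma is_derive_frame_herm j x w :
  is_derive x (frame j) (herm A w) (dherm A j w x).
Proof.
apply: is_derive_eq (is_derive_herm A x _ w) _.
rewrite (bigD1 j)//= big1 => [|i ij]; last by rewrite mul_frame (negbTE ij) mul0r.
by rewrite mul_frame eqxx mul1r addr0.
Qed.

(** Raising the Hermite function is adjoint to differentiating g, so coefficients of derivatives are
    shifted coefficients. *)
Lemma ip_herm_cons j w (g dg : E -> R) : tempered g -> tempered dg ->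
  (forall x, is_derive x (frame j) g (dg x)) ->
  ipp g (herm A (j :: w)) = ipp dg (herm A w).
Proof.
move=> tg tdg Dg; rewrite ipC [RHS]ipC.
have <- := gaussian_ibp (tempered_herm A w) tg (tempered_dherm A j w) tdg
  (fun x => is_derive_frame_herm j x w) Dg.
by congr ipp; apply/funext => x; rewrite herm_cons.
Qed.

End gaussian_ibp.

(** * Hermite expansions *)

Section hermite_expansion.
Context {R : realType} {N : nat}.
Local Notation E := 'cV[R]_N.
Implicit Types (x : E) (w : seq 'I_N) (u : E -> R) (b : seq 'I_N -> R).
Variables (S A : 'M[R]_N).
Hypotheses (SA : S = A^T *m A) (Aunit : A \in unitmx).
Let psi := @psi_inf R N S.
Hypothesis Ipsi : \int[@lebesgue_cV R N]_x psi x = 1.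
Local Notation ipp := (ip psi).
Local Notation herm := (herm A).
Local Notation L2p := (L2r psi).

Let mpsi : measurable_fun setT psi := measurable_psi SA.
Let psi0 x : 0 < psi x := psi_gt0 SA Aunit x.
Let rpsi : rapid psi := rapid_psi SA Aunit.

Definition hcoef u w := ipp u (herm w).
Local Notation coef := hcoef.

Lemma L2r_herm w : L2p (herm w).
Proof. by apply: tempered_L2r => //; exact: tempered_herm. Qed.

Lemma symm_coef u : symm (coef u).
Proof.
move=> w w' ww; rewrite /coef; congr ipp; apply/funext => x.
exact: symm_herm.
Qed.

Lemma coefD u v w : L2p u -> L2p v -> coef (fun x => u x + v x) w = coef u w + coef v w.
Proof. by move=> Lu Lv; rewrite /coef ipDl//; exact: L2r_herm. Qed.

Lemma coefB u v w : L2p u -> L2p v -> coef (fun x => u x - v x) w = coef u w - coef v w.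
Proof. by move=> Lu Lv; rewrite /coef ipBl//; exact: L2r_herm. Qed.

Lemma coefZ (c : R) u w : L2p u -> coef (fun x => c * u x) w = c * coef u w.
Proof. by move=> Lu; rewrite /coef ipZl//; exact: L2r_herm. Qed.

Lemma ae_eq_coef u v w : L2p u -> L2p v -> {ae @lebesgue_cV R N, forall x, u x = v x} ->
  coef u w = coef v w.
Proof.
move=> Lu Lv uv; apply: ae_eq_ip => //.
- exact: aeW.
- exact: L2r_measurable Lu.
- exact: L2r_measurable Lv.
- exact: tempered_measurable (tempered_herm A w).
- exact: tempered_measurable (tempered_herm A w).
Qed.

Lemma tempered_wsum n (h : seq 'I_N -> E -> R) : (forall w, tempered (h w)) ->
  tempered (fun x => wsum n (fun w => h w x)).
Proof.
elim: n h => [|n IH] h th /=; first exact: th.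
by apply: tempered_sum => i; exact: (IH (fun w => h (i :: w))).
Qed.

Lemma ip_wsuml n (h : seq 'I_N -> E -> R) u : (forall w, tempered (h w)) -> L2p u ->
  ipp (fun x => wsum n (fun w => h w x)) u = wsum n (fun w => ipp (h w) u).
Proof.
elim: n h => [|n IH] h th Lu //=.
rewrite ip_suml// => [|i].
  by apply: eq_bigr => i _; exact: (IH (fun w => h (i :: w))).
apply: tempered_L2r => //; exact: (@tempered_wsum n (fun w => h (i :: w))).
Qed.

(** A multi-index alpha of degree n is represented by n! / alpha! words, and [herm] at alpha has
    squared norm alpha!; the factor 1 / n! thus makes this the degree n part of the expansion with
    coefficients b. *)
Definition hpart n b x : R := (n`!%:R)^-1 * wsum n (fun w => b w * herm w x).

Lemma tempered_hpart n b : tempered (hpart n b).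
Proof.
apply: temperedZ; apply: tempered_wsum => w; apply: temperedZ.
exact: tempered_herm.
Qed.

Lemma ip_hpart n b u : L2p u ->
  ipp u (hpart n b) = (n`!%:R)^-1 * wsum n (fun w => b w * coef u w).
Proof.
move=> Lu.
have th w : tempered (fun x => b w * herm w x) by apply: temperedZ; exact: tempered_herm.
rewrite ipC /hpart ipZl//; last first.
  by apply: tempered_L2r => //; exact: tempered_wsum.
rewrite ip_wsuml//; congr (_ * _); apply: eq_wsum => w _.
by rewrite ipZl//; [rewrite ipC|exact: L2r_herm].
Qed.

(** Orthogonality, by removing one letter of w at a time: the letter j moves to the other factor as
    d/dy_j, which lowers the degree and replaces b by b (j :: _). *)
Lemma coef_hpart n b w : symm b -> coef (hpart n b) w = (size w == n)%:R * b w.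
Proof.
elim: w n b => [|j w IH] n b sb.
  have h0 (v : seq 'I_N) : coef (herm [::]) v = (v == [::])%:R.
    rewrite /coef; case: v => [|j v].
      rewrite eqxx -Ipsi; apply: eq_Rintegral => x _.
      by rewrite !herm_nil !mul1r.
    have D1 x : is_derive x (frame A j) (herm [::]) 0.
      rewrite (_ : herm [::] = fun=> 1); first exact: is_derive_cst.
      by apply/funext => z; exact: herm_nil.
    rewrite (ip_herm_cons SA Aunit v (tempered_herm A [::]) (tempered_cst 0) D1).
    by rewrite /ip; under eq_Rintegral do rewrite !mul0r; exact: Int0.
  rewrite [LHS]ipC ip_hpart; last exact: L2r_herm.
  case: n => [|n]; first by rewrite /= h0 fact0 invr1 eqxx !mul1r mulr1.
  rewrite mul0r (@eq_wsum _ _ _ _ (fun=> 0)) ?wsum0 ?mulr0// => v sv.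
  by rewrite h0; case: v sv => // i v _; rewrite mulr0.
(* The derivative of [hpart n b] in y_j. By [wsum_count], for n + 1 in place of n, the factor (n +
   1) / (n + 1)! turns it into a part of degree n. *)
pose D x := (n`!%:R)^-1 * wsum n (fun v => b v * dherm A j v x).
have tD : tempered D.
  apply: temperedZ; apply: tempered_wsum => v; apply: temperedZ.
  exact: tempered_dherm.
have DD x : is_derive x (frame A j) (hpart n b) (D x).
  have Dw (v : seq 'I_N) (_ : size v = n) := derZ (b v) (is_derive_frame_herm Aunit j x v).
  exact: (derZ _ (der_wsum (h := fun t v => b v * herm v t) Dw)).
rewrite /coef (ip_herm_cons SA Aunit w (tempered_hpart n b) tD DD) {DD}.
case: n @D tD => [|n] D tD.
  rewrite mul0r (_ : D = fun=> 0).
    by rewrite /ip; under eq_Rintegral do rewrite !mul0r; exact: Int0.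
  by apply/funext => x; rewrite /D /= /dherm /= mul0r !mulr0.
rewrite (_ : D = hpart n (fun v => b (j :: v))); first by rewrite -/(coef _ _) IH//; exact: symm_cons.
apply/funext => x; rewrite /D /hpart.
have sG : symm (fun v => b v * herm (rem j v) x).
  move=> v v' vv'; congr (_ * _); first exact: sb.
  apply: symm_herm; apply/permP => a; rewrite !count_rem (perm_mem vv').
  by move/permP: vv' => ->.
rewrite (@eq_wsum _ _ _ _ (fun v => (count_mem j v)%:R * (b v * herm (rem j v) x))); last first.
  by move=> v _; rewrite /dherm mulrCA.
rewrite wsum_count// mulrA factS natrM invfM -[_ / _ * _]mulrA mulrCA mulrA mulfVK ?pnatr_eq0//.
by congr (_ * _); apply: eq_wsum => v _; rewrite /= eqxx.
Qed.

Definition hser k m b x : R := \sum_(k <= n < m) hpart n b x.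

Lemma tempered_hser k m b : tempered (hser k m b).
Proof. by apply: tempered_sum => n; exact: tempered_hpart. Qed.

Lemma L2r_hser k m b : L2p (hser k m b).
Proof. by apply: tempered_L2r => //; exact: tempered_hser. Qed.

Lemma coef_hser k m b w : symm b -> coef (hser k m b) w = (k <= size w < m)%:R * b w.
Proof.
move=> sb; rewrite /coef ip_suml// => [|n|]; last exact: L2r_herm.
  under eq_bigr do rewrite -/(coef _ _) coef_hpart//.
  rewrite -mulr_suml; congr (_ * _); rewrite -mem_index_iota.
  have := iota_uniq k (m - k); rewrite -/(index_iota k m).
  elim: (index_iota k m) => [|n r IH]; first by rewrite big_nil.
  move=> /= /andP[nr ur]; rewrite big_cons in_cons IH//.
  by case: eqVneq => [->|_]; rewrite ?(negbTE nr) ?addr0 ?add0r.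
by apply: tempered_L2r => //; exact: tempered_hpart.
Qed.

Lemma ip_hser k m b u : L2p u ->
  ipp u (hser k m b) = \sum_(k <= n < m) (n`!%:R)^-1 * wsum n (fun w => b w * coef u w).
Proof.
move=> Lu; rewrite ipC ip_suml// => [|n].
  by apply: eq_bigr => n _; rewrite ipC ip_hpart.
by apply: tempered_L2r => //; exact: tempered_hpart.
Qed.

Definition hnorm k m b : R := \sum_(k <= n < m) (n`!%:R)^-1 * nrm n b.

Lemma ip_hser_hser k m b : symm b -> ipp (hser k m b) (hser k m b) = hnorm k m b.
Proof.
move=> sb; rewrite ip_hser; last exact: L2r_hser.
rewrite big_nat [RHS]big_nat; apply: eq_bigr => n knm; congr (_ * _).
by apply: eq_wsum => w sw; rewrite coef_hser// sw knm mul1r expr2.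
Qed.

Lemma ip_sub_hser u m : L2p u ->
  ipp (fun x => u x - hser 0 m (coef u) x) (fun x => u x - hser 0 m (coef u) x) =
  ipp u u - hnorm 0 m (coef u).
Proof.
move=> Lu; have LQ := L2r_hser 0 m (coef u); set Q := hser _ _ _ in LQ *.
have QQ : ipp Q Q = hnorm 0 m (coef u) by apply: ip_hser_hser; exact: symm_coef.
have uQ : ipp u Q = hnorm 0 m (coef u).
  by rewrite ip_hser.
have LuQ : L2p (fun x => u x - Q x) by exact: L2rB.
by rewrite ipBl// ipBr// ipBr// [ipp Q u]ipC uQ QQ subrr subr0.
Qed.

Lemma hnorm_ge0 k m b : 0 <= hnorm k m b.
Proof. by apply: sumr_ge0 => n _; rewrite mulr_ge0 ?invr_ge0// nrm_ge0. Qed.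

Lemma hnorm_cat k l m b : (k <= l)%N -> (l <= m)%N ->
  hnorm k m b = hnorm k l b + hnorm l m b.
Proof. by move=> kl lm; rewrite /hnorm (big_cat_nat kl lm). Qed.

Lemma le_hnorm0 k m b : (k <= m)%N -> hnorm 0 k b <= hnorm 0 m b.
Proof. by move=> km; rewrite (hnorm_cat _ (leq0n k) km) lerDl hnorm_ge0. Qed.

Lemma bessel u m : L2p u -> hnorm 0 m (coef u) <= ipp u u.
Proof. by move=> Lu; rewrite -subr_ge0 -ip_sub_hser//; exact: ip_ge0. Qed.

Lemma coef_norm_le u w : L2p u ->
  `|coef u w| <= Num.sqrt (ipp u u) * Num.sqrt (ipp (herm w) (herm w)).
Proof.
move=> Lu; rewrite -sqrtrM ?ip_ge0// -sqrtr_sqr; apply: ler_wsqrtr.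
by apply: ip_cauchy_schwarz => //; exact: L2r_herm.
Qed.

Lemma ip_cvg0_coef (s : nat -> E -> R) u w : (forall n, L2p (s n)) -> L2p u ->
  (fun n => ipp (fun x => s n x - u x) (fun x => s n x - u x)) @ \oo --> (0 : R) ->
  (fun n => coef (s n) w) @ \oo --> coef u w.
Proof.
move=> Ls Lu su0; apply/subr_cvg0; apply: norm_cvg0.
set d := (fun n => ipp _ _) in su0; pose K := Num.sqrt (ipp (herm w) (herm w)).
apply: (@squeeze_cvgr _ _ _ _ (fun=> 0) (fun n => Num.sqrt (d n) * K)).
- apply: nearW => n; rewrite normr_ge0/= -coefB//.
  by apply: coef_norm_le; exact: L2rB.
- exact: cvg_cst.
- rewrite -[X in _ --> X](mul0r K); apply: cvgMl.
  rewrite -[X in _ --> X]sqrtr0.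
  by apply: cvg_comp su0 _; exact: sqrt_continuous.
Qed.

Lemma hser_sub k m b x : (k <= m)%N -> hser 0 m b x - hser 0 k b x = hser k m b x.
Proof. by move=> km; rewrite /hser (big_cat_nat (leq0n k) km)/= [LHS]addrC addKr. Qed.

(** By orthogonality the distance of two partial sums is a difference of bounded nondecreasing
    numbers, so the sums are Cauchy; their coefficient at w is constant once the cut exceeds the
    length of w. *)
Lemma riesz_fischer b (B : R) : symm b -> (forall m, hnorm 0 m b <= B) ->
  exists u, [/\ L2p u, forall w, coef u w = b w &
    (fun m => ipp (fun x => hser 0 m b x - u x) (fun x => hser 0 m b x - u x)) @ \oo --> (0 : R)].
Proof.
move=> sb bB.
have cb : cvgn (fun m => hnorm 0 m b).
  apply: nondecreasing_is_cvgn; first by move=> k m; exact: le_hnorm0.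
  by exists B => _ [m _ <-]; exact: bB.
have dist k m : (k <= m)%N -> ipp (fun x => hser 0 m b x - hser 0 k b x)
     (fun x => hser 0 m b x - hser 0 k b x) = hnorm 0 m b - hnorm 0 k b.
  move=> km; rewrite (_ : (fun x => _) = hser k m b).
    by rewrite ip_hser_hser// (hnorm_cat _ (leq0n k) km) [RHS]addrC addKr.
  by apply/funext => x; rewrite hser_sub.
have [|u [Lu uB]] := @L2_complete _ _ _ mpsi psi0 (fun m => hser 0 m b) (fun m => L2r_hser 0 m b).
  move=> e e0; have /cvgrPdist_lt/(_ _ e0)[M _ HM] : (fun m => hnorm 0 m b) @ \oo --> limn (fun m => hnorm 0 m b) by [].
  have hM m : (M <= m)%N -> hnorm 0 m b <= limn (fun m => hnorm 0 m b) < hnorm 0 m b + e.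
    move=> Mm; rewrite nondecreasing_cvgn_le//; last by move=> k l; exact: le_hnorm0.
    by have := HM m Mm; rewrite /= ltr_norml => /andP[_]; rewrite ltrBlDl.
  exists M => m n Mm Mn; wlog mn : m n Mm Mn / (n <= m)%N.
    by move=> W; case/orP: (leq_total n m) => nm; [exact: W|rewrite ip_sym; exact: W].
  rewrite dist//; have /andP[h1 _] := hM m Mm; have /andP[_ h2] := hM n Mn.
  by rewrite lerBlDl ltW// (le_lt_trans h1).
exists u; split=> // w.
have c := @ip_cvg0_coef _ _ w (fun m => L2r_hser 0 m b) Lu uB.
have <- := @cvg_lim _ (@norm_hausdorff _ _) _ _ _ _ _ c.
apply: cvg_lim; first exact: norm_hausdorff.
apply: cvg_near_cst.
by exists (size w).+1 => // m /= sm; rewrite coef_hser//= sm mul1r.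
Qed.

End hermite_expansion.

(** * Completeness of the Hermite functions *)

Section sign_iteration.
Context {R : realType}.
Implicit Types s t : R.

(** An odd polynomial preserving [-1, 1] whose iterates converge there to the sign. It produces
    discontinuous multipliers as bounded limits of polynomials in a multiplier. *)
Definition smoothstep t := (3 * t - t ^+ 3) / 2.

Lemma smoothstep_itv s t : 0 <= s -> s <= t <= 1 -> s <= t <= smoothstep t /\ smoothstep t <= 1.
Proof.
move=> s0 /andP[st t1]; have t0 := le_trans s0 st; rewrite /smoothstep st/=; split.
  have : 0 <= t * ((1 - t) * (1 + t)) by rewrite !mulr_ge0//; lra.
  by move=> h; lra.
have : 0 <= (1 - t) ^+ 2 * (t + 2) by rewrite mulr_ge0 ?sqr_ge0//; lra.
by move=> h; lra.
Qed.

Lemma iter_smoothstep_itv s n : 0 <= s -> s <= 1 -> s <= iter n smoothstep s <= 1.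
Proof.
move=> s0 s1; elim: n => [|n IH] /=; first by rewrite lexx.
by have [/andP[h1 h2] ->] := smoothstep_itv s0 IH; rewrite (le_trans h1 h2).
Qed.

Lemma iter_smoothstepN s n : iter n smoothstep (- s) = - iter n smoothstep s.
Proof. by elim: n => //= n ->; rewrite /smoothstep; ring. Qed.

Lemma iter_smoothstep_norm s n : `|s| <= 1 -> `|iter n smoothstep s| <= 1.
Proof.
wlog s0 : s / 0 <= s => [W|].
  case: (leP 0 s) => [|s0] s1; first by move=> /W; exact.
  by rewrite -normrN -iter_smoothstepN W ?normrN// oppr_ge0 ltW.
rewrite [in X in X -> _]ger0_norm// => s1; have /andP[h1 h2] := iter_smoothstep_itv n s0 s1.
by rewrite ger0_norm// (le_trans s0).
Qed.

Lemma iter_smoothstep_cvg s : `|s| <= 1 ->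
  (fun n => iter n smoothstep s) @ \oo --> Num.sg s.
Proof.
wlog s0 : s / 0 <= s => [W|].
  case: (leP 0 s) => [|s0] s1; first by move=> /W; exact.
  rewrite -[s]opprK sgrN; under eq_fun do rewrite iter_smoothstepN.
  by apply: cvgN; apply: W; rewrite ?normrN// oppr_ge0 ltW.
rewrite ger0_norm// => s1; have [->|sn0] := eqVneq s 0.
  rewrite sgr0 (_ : (fun _ => _) = fun=> 0); first exact: cvg_cst.
  by apply/funext; elim=> //= n ->; rewrite /smoothstep mulr0 expr0n/= subr0 mul0r.
have {sn0} s0' : 0 < s by rewrite lt_neqAle eq_sym sn0.
rewrite gtr0_sg//; set a := fun n => _.
have aitv n : s <= a n <= 1 by exact: iter_smoothstep_itv.
have ca : cvgn a.
  apply: nondecreasing_is_cvgn; last by exists 1 => _ [n _ <-]; case/andP: (aitv n).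
  by apply/nondecreasing_seqP => n; have [/andP[_ ->]] := smoothstep_itv s0 (aitv n).
set L := limn a in ca.
have sL : s <= L by apply: limr_ge => //; apply: nearW => n; case/andP: (aitv n).
have c1 : (fun n => a n.+1) @ \oo --> L by rewrite (cvg_shiftS a).
have c2 : (fun n => a n.+1) @ \oo --> smoothstep L.
  rewrite (_ : (fun n => _) = fun n => (3 * a n - a n * (a n * a n)) / 2); last first.
    by apply/funext => n; rewrite /= /smoothstep -/(a n); ring.
  rewrite (_ : smoothstep L = (3 * L - L * (L * L)) / 2); last by rewrite /smoothstep; ring.
  by apply: cvgMl; apply: cvgB; [exact: cvgMr|apply: cvgM => //; exact: cvgM].
have : L = smoothstep L := etrans (esym (cvg_lim (@norm_hausdorff _ _) c1)) (cvg_lim (@norm_hausdorff _ _) c2).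
rewrite /smoothstep => LE; have : L * ((L - 1) * (L + 1)) = 0.
  rewrite (_ : L * _ = 2 * (L - (3 * L - L ^+ 3) / 2)); last by field.
  by rewrite -LE subrr mulr0.
have L0 := lt_le_trans s0' sL.
move/eqP; rewrite !mulf_eq0 gt_eqF//= [L + 1 == 0]gt_eqF ?addr_gt0// orbF subr_eq0.
by move=> /eqP <-.
Qed.

Lemma sin_series_bound (x : R) n : `|series (sin_coeff x) n| <= expR `|x|.
Proof.
apply: le_trans (ler_norm_sum _ _ _) _.
apply: (@le_trans _ _ (series (exp_coeff `|x|) n)).
  rewrite /series /=; apply: ler_sum => k _; rewrite /sin_coeff /exp_coeff /= !normrM normfV.
  rewrite normrX normrX normrN1 expr1n mulr1 [`|k`!%:R|]ger0_norm// ler_wpM2r ?invr_ge0//.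
  rewrite -[leRHS]mul1r ler_wpM2r ?exprn_ge0//.
  by case: (odd k); rewrite ?normr1 ?normr0.
rewrite /expR; apply: nondecreasing_cvgn_le; last exact: is_cvg_series_exp_coeff.
by apply: nondecreasing_series => k _ _; exact: exp_coeff_ge0.
Qed.

Lemma sg_sin_near t : \forall M \near \oo, Num.sg (sin (M.+1%:R^-1 * t)) = Num.sg t.
Proof.
wlog t0 : t / 0 <= t => [W|].
  case: (leP 0 t) => [|t0]; first exact: W.
  apply: filterS (W (- t) _) => [M|]; last by rewrite oppr_ge0 ltW.
  by rewrite mulrN sinN !sgrN => /oppr_inj.
have [->|tn0] := eqVneq t 0; first by apply: nearW => M; rewrite mulr0 sin0.
apply: filterS (nbhs_infty_ger t) => M tM.
have tgt : 0 < t by rewrite lt_neqAle eq_sym tn0.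
rewrite !gtr0_sg// sin_gt0_pi// mulr_gt0 ?invr_gt0//=.
rewrite mulrC ltr_pdivrMr//; apply: (@le_lt_trans _ _ M%:R) => //.
apply: (@lt_le_trans _ _ M.+1%:R); first by rewrite ltr_nat.
by rewrite ler_peMl// (le_trans _ (pi_ge2 R))// ler1n.
Qed.

End sign_iteration.

Section hermite_complete.
Context {R : realType} {N : nat}.
Local Notation E := 'cV[R]_N.
Implicit Types (x : E) (w : seq 'I_N) (g phi : E -> R).
Variables (S A : 'M[R]_N).
Hypotheses (SA : S = A^T *m A) (Aunit : A \in unitmx).
Let psi := @psi_inf R N S.
Local Notation ipp := (ip psi).
Local Notation herm := (herm A).
Local Notation L2p := (L2r psi).

Let mpsi : measurable_fun setT psi := measurable_psi SA.
Let psi0 x : 0 < psi x := psi_gt0 SA Aunit x.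
Let rpsi : rapid psi := rapid_psi SA Aunit.

Variable u : E -> R.
Hypotheses (Lu : L2p u) (cu : forall w, ipp u (herm w) = 0).

Let Int_dominated_eq0 (f_ : (E -> R)^nat) (f g : E -> R) :
  (forall n, \int[@lebesgue_cV R N]_x f_ n x = 0) ->
  (forall n, measurable_fun setT (f_ n)) -> measurable_fun setT f -> itg g ->
  (forall x, f_ ^~ x @ \oo --> f x) -> (forall n x, `|f_ n x| <= g x) ->
  \int[@lebesgue_cV R N]_x f x = 0.
Proof.
move=> f0 mf_ mf ig fc fg; have c := Int_dominated_cvg mf_ mf ig fc fg.
rewrite -(cvg_lim (@norm_hausdorff _ _) c).
apply: cvg_lim; first exact: norm_hausdorff.
by apply: cvg_near_cst; exact: nearW.
Qed.

(** The aim is to reach g = sign of u: then u g = |u| is orthogonal to the constant Hermite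
    function, and u vanishes. *)
Let orth g := [/\ measurable_fun setT g, exists C : R, forall x, `|g x| <= C &
  forall w, ipp (fun x => u x * g x) (herm w) = 0].

(** Preserving [orth], rather than belonging to it, is stable under products; polynomials in a
    multiplier and intersections of sets come at once. *)
Let mult phi := forall g, orth g -> orth (fun x => g x * phi x).

Let orth_L2 g : orth g -> L2p (fun x => u x * g x).
Proof.
move=> [mg [C gC] _]; split.
  by apply: measurable_funM => //; exact: L2r_measurable Lu.
apply: (itg_le _ (itgZ (C ^+ 2) Lu.2)).
  apply: measurable_funM => //; apply: measurable_funX; apply: measurable_funM => //.
  exact: L2r_measurable Lu.
move=> x; rewrite ger0_norm; last by rewrite mulr_ge0 ?sqr_ge0// ltW.
rewrite mulrA ler_wpM2r ?(ltW (psi0 _))//.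
rewrite exprMn mulrC ler_wpM2r ?sqr_ge0//.
rewrite -[g x ^+ 2]real_normK ?num_real// lerXn2r ?nnegrE//.
exact: le_trans (normr_ge0 _) (gC x).
Qed.

Let orthD f g : orth f -> orth g -> orth (fun x => f x + g x).
Proof.
move=> of_ og; have [mf [C fC] f0] := of_; have [mg [D gD] g0] := og; split.
- exact: measurable_funD.
- by exists (C + D) => x; apply: le_trans (ler_normD _ _) _; exact: lerD.
move=> w; rewrite (_ : (fun x => _) = fun x => u x * f x + u x * g x); last first.
  by apply/funext => x; rewrite mulrDr.
rewrite ipDl ?f0 ?g0 ?addr0//; first exact: orth_L2.
  exact: orth_L2.
by apply: tempered_L2r => //; exact: tempered_herm.
Qed.

Let orthZ (c : R) g : orth g -> orth (fun x => c * g x).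
Proof.
move=> og; have [mg [C gC] g0] := og; split.
- exact: measurable_funM.
- by exists (`|c| * C) => x; rewrite normrM ler_wpM2l.
move=> w; rewrite (_ : (fun x => _) = fun x => c * (u x * g x)); last first.
  by apply/funext => x; rewrite mulrCA.
rewrite ipZl ?g0 ?mulr0//; first exact: orth_L2.
by apply: tempered_L2r => //; exact: tempered_herm.
Qed.

Let orth_lim (h : nat -> E -> R) g (C : R) : (forall n, orth (h n)) ->
  (forall n x, `|h n x| <= C) -> (forall x, h ^~ x @ \oo --> g x) -> orth g.
Proof.
move=> oh hC hg.
have mg : measurable_fun setT g.
  by apply: (measurable_fun_cvg (h := h)) => [n|x _]; [case: (oh n)|exact: hg].
split=> // [|w].
  exists C => x; have cn : (fun n => `|h n x|) @ \oo --> `|g x| by exact: cvg_norm.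
  rewrite -(cvg_lim (@norm_hausdorff _ _) cn); apply: limr_le; first by apply/cvg_ex; exists `|g x|.
  exact: nearW.
have mu : measurable_fun setT u := L2r_measurable Lu.
have mh : measurable_fun setT (herm w) := tempered_measurable (tempered_herm A w).
have Lh : L2p (herm w) by apply: tempered_L2r => //; exact: tempered_herm.
have ig : itg (fun x => C * `|u x * herm w x * psi x|).
  by apply: itgZ; exact: (integrable_abse (itg_ip mpsi psi0 Lu Lh)).
apply: (@Int_dominated_eq0 (fun n x => u x * h n x * herm w x * psi x) _ _ _ _ _ ig).
- by move=> n; case: (oh n) => _ _; exact.
- move=> n; case: (oh n) => mhn _ _; apply: measurable_funM => //; apply: measurable_funM => //.
  exact: measurable_funM.
- by apply: measurable_funM => //; apply: measurable_funM => //; exact: measurable_funM.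
- by move=> x; do 2 apply: cvgMl; apply: cvgMr; exact: hg.
- move=> n x; rewrite !normrM -!mulrA mulrCA ler_wpM2r//.
Qed.

Let multM phi1 phi2 : mult phi1 -> mult phi2 -> mult (fun x => phi1 x * phi2 x).
Proof. by move=> m1 m2 g og; under eq_fun do rewrite mulrA; apply: m2; exact: m1. Qed.

Let multD phi1 phi2 : mult phi1 -> mult phi2 -> mult (fun x => phi1 x + phi2 x).
Proof.
move=> m1 m2 g og; under eq_fun do rewrite mulrDr.
by apply: orthD; [exact: m1|exact: m2].
Qed.

Let multZ (c : R) phi : mult phi -> mult (fun x => c * phi x).
Proof. by move=> m g og; under eq_fun do rewrite mulrCA; apply: orthZ; exact: m. Qed.

Let mult1 : mult (fun=> 1).
Proof. by move=> g og; under eq_fun do rewrite mulr1. Qed.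

Let mult_lim (h : nat -> E -> R) phi (C : R) : (forall n, mult (h n)) ->
  (forall n x, `|h n x| <= C) -> (forall x, h ^~ x @ \oo --> phi x) -> mult phi.
Proof.
move=> mh hC hphi g og; have [_ [D gD] _] := og.
apply: (@orth_lim (fun n x => g x * h n x) _ (D * C)).
- by move=> n; exact: mh.
- by move=> n x; rewrite normrM; exact: ler_pM.
- by move=> x; apply: cvgMr; exact: hphi.
Qed.

(** Powers of an affine function times a Hermite function are again combinations of Hermite
    functions, so the partial sums of the sine series keep orthogonality; dominated convergence
    gives the sine, with an exponential of [l1] as bound. *)
Let mult_sin i (a c : R) : mult (fun x => sin (c * (x i 0 - a))).
Proof.
move=> g og; have [mg [C gC] g0] := og; have Lug := orth_L2 og.
pose th x := c * (x i 0 - a).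
have tth : tempered th.
  by apply: temperedZ; apply: temperedB; [exact: tempered_coord|exact: tempered_cst].
have tthk k w : tempered (fun x => th x ^+ k * herm w x).
  apply: temperedM; last exact: tempered_herm.
  under eq_fun do rewrite -[X in _ ^+ X]card_ord -prodr_const.
  by apply: tempered_prod => j.
have Lthk k w : L2p (fun x => th x ^+ k * herm w x) by exact: tempered_L2r.
have ipk k w : ipp (fun x => th x ^+ k * herm w x) (fun x => u x * g x) = 0.
  elim: k w => [|k IH] w.
    by rewrite ipC -(g0 w); congr ipp; apply/funext => x; rewrite expr0 mul1r.
  rewrite (_ : (fun x => _) = fun x => \sum_j (c * invmx A i j) *
     (th x ^+ k * herm (j :: w) x + (count_mem j w)%:R * (th x ^+ k * herm (rem j w) x)) -
     (c * a) * (th x ^+ k * herm w x)); last first.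
    apply/funext => x; rewrite exprSr -mulrA [th x * _]mulrC.
    have -> : th x = \sum_j c * invmx A i j * (A *m x) j 0 - c * a.
      rewrite /th mulrBr; congr (_ - _); rewrite -{1}(mulKmx Aunit x) mxE mulr_sumr.
      by apply: eq_bigr => j _; rewrite mulrA.
    rewrite mulrBr mulrBr mulr_sumr mulr_sumr; congr (_ - _); last by ring.
    apply: eq_bigr => j _; rewrite herm_cons /dherm; set X := (\sum_j _ - _); ring.
  rewrite ipBl//; last 2 first.
    by apply: L2r_sum => // j; apply: L2rZ => //; apply: L2rD => //; exact: L2rZ.
    exact: L2rZ.
  rewrite ipZl// IH mulr0 subr0 ip_suml// => [|j].
    apply: big1 => j _; rewrite ipZl//; last by apply: L2rD => //; exact: L2rZ.
    by rewrite ipDl// ?ipZl// ?IH ?mulr0 ?addr0 ?mulr0//; exact: L2rZ.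
  by apply: L2rZ => //; apply: L2rD => //; exact: L2rZ.
split.
- apply: measurable_funM => //; apply: measurableT_comp => //.
    by apply: continuous_measurable_fun; exact: continuous_sin.
  exact: tempered_measurable tth.
- by exists (C * 1) => x; rewrite normrM ler_pM// sin_max.
move=> w; rewrite ipC.
have mu : measurable_fun setT u := L2r_measurable Lu.
have mh : measurable_fun setT (herm w) := tempered_measurable (tempered_herm A w).
pose F n x := series (sin_coeff (th x)) n * herm w x * (u x * g x) * psi x.
have F0 n : \int[@lebesgue_cV R N]_x F n x = 0.
  transitivity (ipp (fun x => \sum_(k < n) ((odd k)%:R * (-1) ^+ k.-1./2 / k`!%:R) * (th x ^+ k * herm w x))
     (fun x => u x * g x)).
    apply: eq_Rintegral => x _; rewrite /F /series/= big_mkord mulr_suml; congr (_ * _ * _).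
    by apply: eq_bigr => k _; rewrite /sin_coeff/=; ring.
  rewrite ip_suml// => [|k]; last exact: L2rZ.
  by apply: big1 => k _; rewrite ipZl// ipk mulr0.
have mth := tempered_measurable tth.
have mF n : measurable_fun setT (F n).
  do 2 (apply: measurable_funM => //); last exact: measurable_funM.
  apply: measurable_funM => //; rewrite /series/=; apply: measurable_sum => k.
  rewrite /sin_coeff/=; apply: measurable_funM => //; apply: measurable_funM => //.
  exact: measurable_funX.
have tG : tempered (fun x => expR (`|c| * `|a|) * expR (`|c| * l1 x) * herm w x).
  apply: temperedM; last exact: tempered_herm.
  by apply: temperedZ; exact: tempered_exp.
have ig : itg (fun x => `|(expR (`|c| * `|a|) * expR (`|c| * l1 x) * herm w x) * (u x * g x) * psi x|).
  by apply: (integrable_abse (itg_ip mpsi psi0 (tempered_L2r mpsi rpsi tG) Lug)).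
apply: (@Int_dominated_eq0 F _ _ F0 mF _ ig).
- apply: measurable_funM => //; apply: measurable_funM => //; apply: measurable_funM => //.
  apply: measurable_funM => //; apply: measurableT_comp => //.
  by apply: continuous_measurable_fun; exact: continuous_sin.
- move=> x; rewrite (_ : _ * psi x = sin (th x) * herm w x * (u x * g x) * psi x); last by ring.
  do 3 apply: cvgMl; rewrite sin.unlock; exact: is_cvg_series_sin_coeff.
- move=> n x; rewrite /F !normrM; do 3 (apply: ler_wpM2r => //; rewrite ?mulr_ge0//).
  rewrite ![`|expR _|]ger0_norm ?expR_ge0// -expRD; apply: le_trans (sin_series_bound _ _) _.
  rewrite ler_expR /th normrM -mulrDr ler_wpM2l//.
  by apply: le_trans (ler_normB _ _) _; rewrite addrC lerD2l coord_le_l1.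
Qed.

(** The sign s of x_i - a is a limit of signs of sin((x_i - a) / (M + 1)), themselves limits of
    iterated [smoothstep]; the indicator is (s^2 + s) / 2. *)
Let mult_ray i (a : R) : mult (\1_[set x : E | a < x i 0]).
Proof.
have mult_iter (f : E -> R) n : mult f -> mult (fun x => iter n smoothstep (f x)).
  move=> mf; elim: n => [|n IH] //=; rewrite /smoothstep.
  rewrite (_ : (fun x => _) = fun x => 3 / 2 * iter n smoothstep (f x) +
    - 2^-1 * (iter n smoothstep (f x) * (iter n smoothstep (f x) * iter n smoothstep (f x)))).
    by apply: multD; apply: multZ => //; apply: multM => //; exact: multM.
  by apply/funext => x; rewrite /smoothstep; field.
have ms (M : nat) : mult (fun x => Num.sg (sin (M.+1%:R^-1 * (x i 0 - a)))).
  apply: (@mult_lim (fun n x => iter n smoothstep (sin (M.+1%:R^-1 * (x i 0 - a)))) _ 1).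
  - by move=> n; apply: mult_iter; exact: mult_sin.
  - by move=> n x; apply: iter_smoothstep_norm; exact: sin_max.
  - by move=> x; apply: iter_smoothstep_cvg; exact: sin_max.
have {}ms : mult (fun x => Num.sg (x i 0 - a)).
  apply: (@mult_lim (fun M x => Num.sg (sin (M.+1%:R^-1 * (x i 0 - a)))) _ 1) => //.
    by move=> n x; rewrite normr_sg lern1 leq_b1.
  by move=> x; apply: cvg_near_cst; exact: sg_sin_near.
rewrite (_ : \1_ _ = fun x => 2^-1 * (Num.sg (x i 0 - a) * Num.sg (x i 0 - a) + Num.sg (x i 0 - a))).
  by apply: multZ; apply: multD => //; exact: multM.
apply/funext => x; rewrite indicE; case: (ltgtP a (x i 0)) => h.
- rewrite mem_set//= gtr0_sg ?subr_gt0//; by field.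
- by rewrite memNset/= ?ltr0_sg ?subr_lt0 ?mulrN1 ?opprK ?subrr ?mulr0//; apply/negP; rewrite -leNgt ltW.
- by rewrite memNset/= h ?subrr ?sgr0 ?ltxx// !(mulr0,addr0).
Qed.

(** Sets whose indicator is a multiplier form a sigma-algebra: complements by linearity, countable
    unions by bounded limits of products. It contains the half-spaces, which generate the Borel
    sets. *)
Let mult_measurable : forall B, measurable B -> mult (\1_B).
Proof.
have sD : sigma_algebra setT [set B : set E | measurable B /\ mult (\1_B)].
  split.
  - split=> //; rewrite (_ : \1_ _ = fun x => 0 * 1); first exact: multZ.
    by apply/funext => x; rewrite indicE in_set0 mul0r.
  - move=> B [mB multB]; rewrite setTD; split; first exact: measurableC.
    rewrite (_ : \1_ _ = fun x => 1 + -1 * \1_B x); first exact/multD/multZ.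
    by apply/funext => x; rewrite !indicE in_setC; case: (x \in B); rewrite /= ?mulr1 ?mulr0 ?subrr ?addr0.
  - move=> F HF; split; first by apply: bigcupT_measurable => k; exact: (HF k).1.
    pose q (n : nat) (x : E) : R := \prod_(k < n) (1 + -1 * \1_(F k) x).
    have qE n x : q n x = \1_(~` \bigcup_(k < n) F k) x.
      elim: n => [|n IH].
        by rewrite /q big_ord0 bigcup_mkord big_ord0 setC0 indicT.
      rewrite /q big_ord_recr/= -/(q n x) IH !bigcup_mkord big_ord_recr/= setCU !indicE in_setI !in_setC.
      by case: (_ \in F n); rewrite /= ?andbT ?andbF mulN1r ?subrr ?subr0 ?mulr0 ?mulr1.
    rewrite (_ : \1_ _ = fun x => 1 + -1 * \1_(~` \bigcup_k F k) x); last first.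
      by apply/funext => x; rewrite !indicE in_setC; case: (x \in _); rewrite /= ?mulr1 ?mulr0 ?subrr ?addr0.
    apply: multD => //; apply: multZ; apply: (@mult_lim q _ 1).
    - elim=> [|n IH]; first by rewrite /q; under eq_fun do rewrite big_ord0; exact: mult1.
      rewrite /q; under eq_fun do rewrite big_ord_recr/=; apply: multM => //.
      by apply: multD => //; apply: multZ; exact: (HF n).2.
    - by move=> n x; rewrite qE indicE; case: (_ \in _); rewrite ?normr1 ?normr0.
    - move=> x; apply: cvg_near_cst; case: (pselect ((\bigcup_k F k) x)) => [[k _ Fkx]|nFx].
        exists k.+1 => // n /= kn; rewrite qE !indicE !in_setC !mem_set//; first by exists k.
        by exists k.
      apply: nearW => n; rewrite qE !indicE !mem_set// => -[k _ Fkx]; apply: nFx.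
      by exists k.
suff : measurable `<=` [set B : set E | measurable B /\ mult (\1_B)] by move=> sub B mB; have [] := sub B mB.
apply: smallest_sub => // B; rewrite -bigcup_seq => -[i _ [Y mY <-]].
rewrite setTI; split.
  by rewrite -[X in measurable X]setTI; exact: measurable_coord.
pose H := image_set_system setT (fun x : E => x i 0) [set B : set E | measurable B /\ mult (\1_B)].
suff : ((R.-ocitv.-measurable).-sigma.-measurable : set (set R)) `<=` H.
  by move=> HH; have := HH Y mY; rewrite /H /image_set_system /= setTI => -[].
rewrite RGenOInfty.measurableE; apply: smallest_sub.
  exact: sigma_algebra_image.
move=> _ [a ->]; rewrite /H /image_set_system /= setTI; split; last by rewrite set_itvoy; exact: mult_ray.
by rewrite -[X in measurable X]setTI; exact: measurable_coord.
Qed.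

(** The sign of u is a combination of a measurable indicator and a constant, hence a multiplier;
    pairing with the Hermite function of the empty word gives a vanishing integral of |u| psi. *)
Lemma hermite_complete : {ae @lebesgue_cV R N, forall x, u x = 0}.
Proof.
have o1 : orth (fun=> 1).
  split=> // [|w]; first by exists 1 => x; rewrite normr1.
  by rewrite -(cu w); congr ipp; apply/funext => x; rewrite mulr1.
have mu : measurable_fun setT u := L2r_measurable Lu.
have iu := L2r_itg mpsi psi0 rpsi Lu.
have m0 : measurable [set x | 0 < u x].
  rewrite (_ : [set x | _] = u @^-1` `]0, +oo[); last by rewrite set_itvoy.
  by rewrite -[X in measurable X]setTI; exact: mu.
have mabs : mult (fun x => 2 * \1_[set x | 0 < u x] x + -1 * 1).
  by apply: multD; [apply: multZ; exact: mult_measurable|exact: multZ].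
have [_ _ /(_ [::]) E0] := mabs _ o1.
have absE x : u x * (1 * (2 * \1_[set x | 0 < u x] x + -1 * 1)) = `|u x|.
  rewrite indicE; case: (ltP 0 (u x)) => h.
    rewrite mem_set// gtr0_norm//=; ring.
  rewrite memNset/=; last by apply/negP; rewrite -leNgt.
  rewrite ler0_norm//; ring.
pose v x := Num.sqrt `|u x|.
have v2 x : v x ^+ 2 = `|u x| by rewrite sqr_sqrtr.
have Lv : L2p v.
  have msq : measurable_fun setT (@Num.sqrt R).
    by apply: continuous_measurable_fun; exact: sqrt_continuous.
  split; first by apply: (measurableT_comp msq); exact: measurableT_comp.
  under eq_fun do rewrite v2; apply: (@itg_le _ _ _ (fun x => `|u x * psi x|)).
    by apply: measurable_funM => //; exact: measurableT_comp.
    exact: (integrable_abse iu).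
  by move=> x; rewrite !normrM normr_id.
have v0 : ipp v v = 0.
  rewrite -E0 ipxx; apply: eq_Rintegral => x _.
  by rewrite v2 absE herm_nil mulr1.
apply: filterS (ip0_ae mpsi psi0 Lv v0) => x /eqP.
by rewrite sqrtr_eq0 normr_le0 => /eqP.
Qed.

End hermite_complete.

(** * Parseval's identity and convergence through coefficients *)

Section parseval.
Context {R : realType} {N : nat}.
Local Notation E := 'cV[R]_N.
Implicit Types (x : E) (w : seq 'I_N) (u v : E -> R).
Variables (S A : 'M[R]_N).
Hypotheses (SA : S = A^T *m A) (Aunit : A \in unitmx).
Let psi := @psi_inf R N S.
Hypothesis Ipsi : \int[@lebesgue_cV R N]_x psi x = 1.
Local Notation ipp := (ip psi).
Local Notation L2p := (L2r psi).
Local Notation coef := (hcoef S A).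

Let mpsi : measurable_fun setT psi := measurable_psi SA.
Let psi0 x : 0 < psi x := psi_gt0 SA Aunit x.
Let rpsi : rapid psi := rapid_psi SA Aunit.

Lemma coef_inj u v : L2p u -> L2p v -> (forall w, coef u w = coef v w) ->
  {ae @lebesgue_cV R N, forall x, u x = v x}.
Proof.
move=> Lu Lv uv.
have : {ae @lebesgue_cV R N, forall x, u x - v x = 0}.
  apply: (hermite_complete SA Aunit); first exact: L2rB.
  by move=> w; rewrite -/(hcoef S A _ w) (coefB SA Aunit)// uv subrr.
by apply: filterS => x /subr0_eq.
Qed.

(** By Riesz-Fischer the series converges to some v with the coefficients of u, and completeness
    identifies v with u. *)
Lemma hser_cvg u : L2p u ->
  (fun m => ipp (fun x => hser A 0 m (coef u) x - u x) (fun x => hser A 0 m (coef u) x - u x))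
    @ \oo --> (0 : R).
Proof.
move=> Lu; have sc := symm_coef S A u.
have [v [Lv cv vB]] := riesz_fischer SA Aunit Ipsi sc (fun m => bessel SA Aunit Ipsi m Lu).
have vu := coef_inj Lv Lu cv.
rewrite (_ : (fun m => _) = (fun m => ipp (fun x => hser A 0 m (coef u) x - v x)
   (fun x => hser A 0 m (coef u) x - v x)))//.
apply/funext => m.
have Lh := L2r_hser SA Aunit 0 m (coef u).
have mm f : L2p f -> measurable_fun setT (fun x => hser A 0 m (coef u) x - f x).
  by move=> Lf; apply: (@L2r_measurable _ _ psi); apply: L2rB.
have huv : {ae @lebesgue_cV R N, forall x, hser A 0 m (coef u) x - u x = hser A 0 m (coef u) x - v x}.
  by apply: filterS vu => x ->.
by apply: (ae_eq_ip mpsi huv huv (mm _ Lu) (mm _ Lv) (mm _ Lu) (mm _ Lv)).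
Qed.

Lemma parseval u : L2p u -> hnorm 0 m (coef u) @[m --> \oo] --> ipp u u.
Proof.
move=> Lu; have := hser_cvg Lu; under eq_fun do rewrite ip_sym (ip_sub_hser SA Aunit Ipsi _ Lu).
move=> /(cvgB (cvg_cst (ipp u u))); rewrite subr0.
rewrite (_ : _ - _ = fun m => hnorm 0 m (coef u))//.
by apply/funext => m; rewrite !fctE subKr.
Qed.

Lemma parseval_ip u v : L2p u -> L2p v ->
  \sum_(0 <= n < m) (n`!%:R)^-1 * wsum n (fun w => coef v w * coef u w) @[m --> \oo] --> ipp u v.
Proof.
move=> Lu Lv.
have Lh m := L2r_hser SA Aunit 0 m (coef v).
under eq_fun do rewrite -(ip_hser SA Aunit)//.
apply/subr_cvg0; apply: norm_cvg0; have := hser_cvg Lv; set d := (fun m => _) => d0.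
apply: (@squeeze_cvgr _ _ _ _ (fun=> 0) (fun m => Num.sqrt (ipp u u) * Num.sqrt (d m))).
- apply: nearW => m; rewrite normr_ge0/= -ipBr// -sqrtrM ?ip_ge0// -sqrtr_sqr.
  by apply: ler_wsqrtr; apply: ip_cauchy_schwarz => //; exact: L2rB.
- exact: cvg_cst.
- rewrite -[X in _ --> X](mulr0 (Num.sqrt (ipp u u))); apply: cvgMr.
  rewrite -[X in _ --> X]sqrtr0.
  by apply: cvg_comp d0 _; exact: sqrt_continuous.
Qed.

Lemma le_hnorm k m (K : R) (b c : seq 'I_N -> R) : (forall n, nrm n b <= K * nrm n c) ->
  hnorm k m b <= K * hnorm k m c.
Proof.
move=> bc; rewrite mulr_sumr; apply: ler_sum => n _.
by rewrite mulrCA ler_wpM2l ?invr_ge0.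
Qed.

Lemma le_ip_coef (K : R) u v : L2p u -> L2p v ->
  (forall n, nrm n (coef u) <= K * nrm n (coef v)) -> ipp u u <= K * ipp v v.
Proof.
move=> Lu Lv uv; have pu := parseval Lu.
have pv : K * hnorm 0 m (coef v) @[m --> \oo] --> K * ipp v v by apply: cvgMr; exact: parseval.
rewrite -(cvg_lim (@norm_hausdorff _ _) pu) -(cvg_lim (@norm_hausdorff _ _) pv).
apply: ler_lim; first exact: cvgP pu.
  exact: cvgP pv.
by apply: nearW => m; exact: le_hnorm.
Qed.

Lemma coef_dominated b (K : R) v : 0 <= K -> symm b -> L2p v ->
  (forall n, nrm n b <= K * nrm n (coef v)) ->
  exists2 u, L2p u & forall w, coef u w = b w.
Proof.
move=> K0 sb Lv bv.
have [|u [Lu cu _]] := @riesz_fischer _ _ S A SA Aunit Ipsi b (K * ipp v v) sb.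
  move=> m; apply: (le_trans (le_hnorm 0 m bv)); rewrite ler_wpM2l//.
  exact: (bessel SA Aunit Ipsi).
by exists u.
Qed.

Lemma cvg_sumr (T : Type) (F : set_system T) {FF : Filter F} I (r : seq I) (f : I -> T -> R) (l : I -> R) :
  (forall i, f i t @[t --> F] --> l i) ->
  \sum_(i <- r) f i t @[t --> F] --> \sum_(i <- r) l i.
Proof.
move=> fl; elim: r => [|i r IH].
  by rewrite big_nil; under eq_fun do rewrite big_nil; exact: cvg_cst.
by rewrite big_cons; under eq_fun do rewrite big_cons; exact: cvgD.
Qed.

Lemma cvg_wsum (F : set_system R) {FF : Filter F} n (h : R -> seq 'I_N -> R) (l : seq 'I_N -> R) :
  (forall w, size w = n -> h t w @[t --> F] --> l w) ->
  wsum n (h t) @[t --> F] --> wsum n l.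
Proof.
elim: n h l => [|n IH] h l hl /=; first exact: hl.
apply: cvg_sumr => i; apply: (IH (fun t w => h t (i :: w))) => w sw.
by apply: hl; rewrite /= sw.
Qed.

Lemma cvg_nrm0 (F : set_system R) {FF : Filter F} n (h : R -> seq 'I_N -> R) :
  (forall w, size w = n -> h t w @[t --> F] --> (0 : R)) ->
  nrm n (h t) @[t --> F] --> (0 : R).
Proof.
move=> h0; rewrite -(@wsum0 R N n); apply: (@cvg_wsum F _ n (fun t w => h t w ^+ 2)) => w sw.
rewrite -[X in _ --> X](mulr0 (0 : R)).
by under eq_fun do rewrite expr2; apply: cvgM; exact: h0.
Qed.

(** Dominated convergence in the sequence space: the tails are uniformly small by comparison with v,
    and the head is a finite sum of coefficients tending to 0. *)
Lemma ip_cvg0_dominated (F : set_system R) {FF : ProperFilter F} (r : R -> E -> R) (K : R) v :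
  0 <= K -> L2p v ->
  (\forall t \near F, L2p (r t)) ->
  (\forall t \near F, forall n, nrm n (coef (r t)) <= K * nrm n (coef v)) ->
  (forall w, coef (r t) w @[t --> F] --> (0 : R)) ->
  ipp (r t) (r t) @[t --> F] --> (0 : R).
Proof.
move=> K0 Lv Lr dom c0; apply/cvgrPdist_le => e e0.
have e2 : 0 < e / 2 by rewrite divr_gt0.
have K1 : 0 < K + 1 by rewrite ltr_wpDl.
have /cvgrPdist_le/(_ (e / 2 / (K + 1)))[|m _ Hm] := parseval Lv; first by rewrite divr_gt0.
have hn0 : hnorm 0 m (coef (r t)) @[t --> F] --> (0 : R).
  rewrite [X in _ --> X](_ : _ = \sum_(n <- index_iota 0 m) (0 : R)); last by rewrite big1_eq.
  apply: cvg_sumr => n; rewrite -[X in _ --> X](mulr0 (n`!%:R^-1 : R)); apply: cvgMr.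
  by apply: cvg_nrm0 => w _; exact: c0.
have /cvgrPdist_le/(_ _ e2) hn := hn0.
near=> t; rewrite sub0r normrN ger0_norm; last by apply: ip_ge0 => //; exact: psi0.
have Lrt : L2p (r t) by near: t.
have domt n : nrm n (coef (r t)) <= K * nrm n (coef v) by move: n; near: t.
have ht : `|0 - hnorm 0 m (coef (r t))| <= e / 2 by near: t.
have pt := parseval Lrt; rewrite -(cvg_lim (@norm_hausdorff _ _) pt).
apply: limr_le; first exact: cvgP pt.
exists m => // k /= mk; rewrite (hnorm_cat _ (leq0n m) mk).
rewrite sub0r normrN ger0_norm ?hnorm_ge0// in ht.
rewrite [e]splitr; apply: lerD => //.
apply: (le_trans (le_hnorm m k domt)).
have vk : hnorm m k (coef v) <= e / 2 / (K + 1).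
  apply: (le_trans _ (le_trans (ler_norm _) (Hm m (leqnn m)))).
  rewrite lerBrDl -hnorm_cat//; exact: (bessel SA Aunit Ipsi).
apply: (@le_trans _ _ ((K + 1) * hnorm m k (coef v))).
  by rewrite ler_wpM2r ?hnorm_ge0// lerDl.
by rewrite mulrC -ler_pdivlMr.
Unshelve. all: by end_near.
Qed.

End parseval.

(** * The semigroup on Hermite coefficients *)

Section derivative_bound.
Context {R : realType}.

Lemma is_derive_bound (c : R -> R) (s g : R) :
  (forall e, 0 < e -> exists2 d : R, 0 < d &
    forall h, `|h| < d -> `|c (s + h) - c s - h * g| <= e * `|h|) ->
  is_derive s (1 : R) c g.
Proof.
move=> H.
have cv : h^-1 *: (c (h *: (1 : R) + s) - c s) @[h --> 0^'] --> g.
  apply/cvgrPdist_le => e e0; have [d d0 Hd] := H e e0.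
  near=> h.
  have h0 : h != 0 by near: h; exact: nbhs_dnbhs_neq.
  have hd : `|h| < d by near: h; apply: dnbhs0_lt.
  have := Hd h hd; rewrite -ler_pdivrMr ?normr_gt0//.
  rewrite -normfV -normrM mulrC mulrBr mulKf// distrC.
  by rewrite /GRing.scale/= mulr1 [h + s]addrC.
apply: DeriveDef; first by apply/cvg_ex; exists g.
by apply: cvg_lim cv; exact: norm_hausdorff.
Unshelve. all: by end_near.
Qed.

Lemma cvg_at_right0_small (d : R -> R) (e : R) : d h @[h --> 0^'+] --> (0 : R) -> 0 < e ->
  exists2 r : R, 0 < r & forall h, 0 < h -> h < r -> d h <= e.
Proof.
move=> /cvgrPdist_le/(_ _)/[apply] -[r /= r0 Hr]; exists r => // h h0 hr.
have := Hr h; rewrite /ball/= sub0r normrN gtr0_norm// => /(_ hr h0).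
by rewrite sub0r normrN; apply: le_trans; exact: ler_norm.
Qed.

Lemma cvg_at_right0 (c d : R -> R) :
  (forall h, 0 <= h -> `|c h - c 0| <= d h) -> d h @[h --> 0^'+] --> (0 : R) ->
  c h @[h --> 0^'+] --> c 0.
Proof.
move=> cd d0; apply/subr_cvg0; apply: norm_cvg0.
have near0 : \forall t \near 0^'+, 0 < t :> R by exact: nbhs_right_gt.
apply: (@squeeze_cvgr _ _ _ _ (fun=> 0) d) => //; last exact: cvg_cst.
by apply: filterS near0 => h /ltW h0; rewrite normr_ge0/= cd.
Qed.

Lemma within_continuous_right (c : R -> R) t : 0 < t -> (forall s, 0 < s -> derivable c s 1) ->
  c h @[h --> 0^'+] --> c 0 -> {within `[0, t], continuous c}.
Proof.
move=> t0 dc c0; apply/continuous_within_itvP => //; split => //.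
  move=> s /=; rewrite in_itv/= => /andP[s0 _].
  by apply/differentiable_continuous/derivable1_diffP; exact: dc.
apply: cvg_at_left_filter.
by apply/differentiable_continuous/derivable1_diffP; exact: dc.
Qed.

End derivative_bound.

(** * Complex L2 through real and imaginary parts *)

Section complex_L2.
Context {R : realType} {N : nat}.
Local Notation E := 'cV[R]_N.
Local Notation re u := (fun x => complex.Re (u x)).
Local Notation im u := (fun x => complex.Im (u x)).
Implicit Types (u v : E -> R[i]).
Variable w : E -> R.
Hypotheses (mw : measurable_fun setT w) (w_gt0 : forall x, 0 < w x).

Lemma sqr_normc (z : R[i]) : Normc.normc z ^+ 2 = complex.Re z * complex.Re z + complex.Im z * complex.Im z.
Proof.
by case: z => a b /=; rewrite sqr_sqrtr ?addr_ge0 ?sqr_ge0// !expr2.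
Qed.

Definition nC u : R := ip w (re u) (re u) + ip w (im u) (im u).

Lemma nC_ge0 u : 0 <= nC u.
Proof. by rewrite addr_ge0// ip_ge0. Qed.

Lemma nC_B u v : nC (fun x => u x - v x) =
  ip w (fun x => complex.Re (u x) - complex.Re (v x)) (fun x => complex.Re (u x) - complex.Re (v x)) +
  ip w (fun x => complex.Im (u x) - complex.Im (v x)) (fun x => complex.Im (u x) - complex.Im (v x)).
Proof.
by congr (ip w _ _ + ip w _ _); apply/funext => x; rewrite ?cReD ?cReN ?cImD ?cImN.
Qed.

Lemma L2P u : L2 w u <-> L2r w (re u) /\ L2r w (im u).
Proof.
split=> [[mr mi fin]|[[mr ir] [mi ii]]]; last first.
  split=> //; rewrite /sqnorm.
  rewrite (_ : (fun x => _) = (fun x => (complex.Re (u x) ^+ 2 * w x + complex.Im (u x) ^+ 2 * w x)%:E)); last first.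
    by apply/funext => x; rewrite sqr_normc -!expr2 mulrDl.
  apply: itg_lty; first exact: itgD.
  by move=> x; rewrite addr_ge0// mulr_ge0 ?sqr_ge0// ltW.
have ig : itg (fun x => Normc.normc (u x) ^+ 2 * w x).
  apply: itg_ge0P => //; last by move=> x; rewrite mulr_ge0 ?sqr_ge0// ltW.
  rewrite (_ : (fun x => _) = (fun x => (complex.Re (u x) * complex.Re (u x) + complex.Im (u x) * complex.Im (u x)) * w x)).
    by apply: measurable_funM => //; apply: measurable_funD; exact: measurable_funM.
  by apply/funext => x; rewrite sqr_normc.
have le1 (f : E -> R) : measurable_fun setT f -> (forall x, f x ^+ 2 <= Normc.normc (u x) ^+ 2) -> L2r w f.
  move=> mf fu; split=> //; apply: (itg_le _ ig).
    by apply: measurable_funM => //; exact: measurable_funX.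
  move=> x; rewrite ger0_norm; first by rewrite ler_wpM2r ?(ltW (w_gt0 x)).
  by rewrite mulr_ge0 ?sqr_ge0// ltW.
by split; apply: le1 => // x; rewrite sqr_normc -!expr2 ?lerDl ?lerDr sqr_ge0.
Qed.

Lemma L2normE u : L2 w u -> L2norm w u = Num.sqrt (nC u).
Proof.
move=> /L2P[Lr Li]; rewrite /L2norm /sqnorm -[fine _]/(\int[@lebesgue_cV R N]_x (Normc.normc (u x) ^+ 2 * w x)).
congr Num.sqrt; rewrite /nC /ip -IntD; [|exact: itg_ip..].
by apply: eq_Rintegral => x _; rewrite sqr_normc mulrDl.
Qed.

Lemma L2norm_sqr u : L2 w u -> L2norm w u ^+ 2 = nC u.
Proof. by move=> Lu; rewrite L2normE// sqr_sqrtr// nC_ge0. Qed.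

Lemma L2norm_cvg0 (F : set_system R) {FF : Filter F} (r : R -> E -> R[i]) :
  (\forall t \near F, L2 w (r t)) ->
  L2norm w (r t) @[t --> F] --> (0 : R) <-> nC (r t) @[t --> F] --> (0 : R).
Proof.
move=> Lr; split=> H.
  have : L2norm w (r t) ^+ 2 @[t --> F] --> (0 : R).
    by rewrite -[X in _ --> X](mulr0 (0 : R)); under eq_fun do rewrite expr2; exact: cvgM.
  by apply: cvg_trans; apply: near_eq_cvg; apply: filterS Lr => t Lt; rewrite L2norm_sqr.
have : Num.sqrt (nC (r t)) @[t --> F] --> (0 : R).
  by rewrite -[X in _ --> X]sqrtr0; apply: cvg_comp H _; exact: sqrt_continuous.
by apply: cvg_trans; apply: near_eq_cvg; apply: filterS Lr => t Lt; rewrite L2normE.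
Qed.

Lemma ae_re_im u v : ae_eq_fun u v <->
  {ae @lebesgue_cV R N, forall x, complex.Re (u x) = complex.Re (v x)} /\
  {ae @lebesgue_cV R N, forall x, complex.Im (u x) = complex.Im (v x)}.
Proof.
split=> [uv|[h1 h2]]; first by split; apply: filterS uv => x ->.
rewrite /ae_eq_fun; apply: filterS2 h1 h2 => x.
by case: (u x) (v x) => [a b] [c d] /= -> ->.
Qed.

Lemma ae_L2norm u v : L2 w u -> L2 w v -> ae_eq_fun u v -> L2norm w u = L2norm w v.
Proof.
move=> Lu Lv /ae_re_im[h1 h2]; rewrite !L2normE//; congr Num.sqrt.
have [[m1 _] [m2 _]] := (L2P u).1 Lu; have [[m3 _] [m4 _]] := (L2P v).1 Lv.
by congr (_ + _); apply: ae_eq_ip.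
Qed.

Lemma L2B u v : L2 w u -> L2 w v -> L2 w (fun x => u x - v x).
Proof.
move=> /L2P[a b] /L2P[c d]; apply/L2P; split.
  by under eq_fun do rewrite cReD cReN; exact: L2rB.
by under eq_fun do rewrite cImD cImN; exact: L2rB.
Qed.

Lemma L2lin (z : R[i]) u v : L2 w u -> L2 w v -> L2 w (fun x => z * u x + v x).
Proof.
move=> /L2P[a b] /L2P[c d]; apply/L2P; split.
  under eq_fun do rewrite cReD cReM; apply: L2rD => //.
  by apply: L2rB => //; exact: L2rZ.
under eq_fun do rewrite cImD cImM; apply: L2rD => //.
by apply: L2rD => //; exact: L2rZ.
Qed.

Lemma L2Z (z : R[i]) u : L2 w u -> L2 w (fun x => z * u x).
Proof.
move=> /L2P[a b]; apply/L2P; split.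
  by under eq_fun do rewrite cReM; apply: L2rB => //; exact: L2rZ.
by under eq_fun do rewrite cImM; apply: L2rD => //; exact: L2rZ.
Qed.

Lemma L2_quotient u v (t : R) f : L2 w u -> L2 w v -> L2 w f ->
  L2 w (fun x => (u x - v x) / t%:C%C - f x).
Proof.
move=> Lu Lv Lf; apply: L2B => //.
by under eq_fun do rewrite mulrC; apply: L2Z; exact: L2B.
Qed.

End complex_L2.

Lemma cRe_div (R : realType) (z : R[i]) (t : R) : complex.Re (z / t%:C%C) = t^-1 * complex.Re z.
Proof. by rewrite -fmorphV cReM /= mulr0 subr0 mulrC. Qed.

Lemma cIm_div (R : realType) (z : R[i]) (t : R) : complex.Im (z / t%:C%C) = t^-1 * complex.Im z.
Proof. by rewrite -fmorphV cImM /= mulr0 add0r mulrC. Qed.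

(** * Existence and identification of the semigroup *)

Section hermite_semigroup.
Context {R : realType} {N : nat}.
Local Notation E := 'cV[R]_N.
Local Notation fct := (E -> R[i]).
Local Notation re u := (fun x => complex.Re (u x)).
Local Notation im u := (fun x => complex.Im (u x)).
Implicit Types (x : E) (w : seq 'I_N) (u f : fct).
Variables (S A M : 'M[R]_N).
Hypotheses (SA : S = A^T *m A) (Aunit : A \in unitmx).
Let psi := @psi_inf R N S.
Hypothesis Ipsi : \int[@lebesgue_cV R N]_x psi x = 1.
Hypothesis M0 : forall x : 'I_N -> R, \sum_i \sum_j x i * (M i j * x j) <= 0.
Local Notation ipp := (ip psi).
Local Notation coef := (hcoef S A).
Local Notation L2p := (L2 psi).
Local Notation norm := (L2norm psi).
Local Notation tflow := (tflow M).

Let mpsi : measurable_fun setT psi := measurable_psi SA.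
Let psi0 x : 0 < psi x := psi_gt0 SA Aunit x.
Let rpsi : rapid psi := rapid_psi SA Aunit.

(** The operator with maximal domain, transported to Hermite coefficients. M is real, so real and
    imaginary parts are treated separately. *)
Definition coef_graph u f := [/\ L2p u, L2p f,
  forall w, coef (re f) w = dtens M w (coef (re u)) &
  forall w, coef (im f) w = dtens M w (coef (im u))].

Lemma coefC_inj u v : L2p u -> L2p v ->
  (forall w, coef (re u) w = coef (re v) w) ->
  (forall w, coef (im u) w = coef (im v) w) -> ae_eq_fun u v.
Proof.
move=> /(L2P mpsi psi0)[a b] /(L2P mpsi psi0)[c d] h1 h2.
by apply/ae_re_im; split; apply: (coef_inj SA Aunit).
Qed.

Lemma ae_coefC u v : L2p u -> L2p v -> ae_eq_fun u v ->
  (forall w, coef (re u) w = coef (re v) w) /\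
  (forall w, coef (im u) w = coef (im v) w).
Proof.
move=> /(L2P mpsi psi0)[a b] /(L2P mpsi psi0)[c d] /ae_re_im[h1 h2].
by split=> w; apply: (ae_eq_coef SA).
Qed.

Let flow_ex t (r : E -> R) : 0 <= t -> L2r psi r ->
  exists2 v : E -> R, L2r psi v & forall w, coef v w = tflow t (coef r) w.
Proof.
move=> t0 Lr; apply: (coef_dominated SA Aunit Ipsi (ler01) _ Lr).
  by apply: symm_tpow; exact: symm_coef.
by move=> n; rewrite mul1r; exact: tflow_contraction.
Qed.

(** A function is selected by its coefficients; for t >= 0 and r in L2 one exists by [flow_ex], and
    the default value is not met. *)
Let rflow t (r : E -> R) : E -> R :=
  xget (fun=> 0) [set v | L2r psi v /\ forall w, coef v w = tflow t (coef r) w].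

Let rflowP t r : 0 <= t -> L2r psi r ->
  L2r psi (rflow t r) /\ forall w, coef (rflow t r) w = tflow t (coef r) w.
Proof.
move=> t0 Lr; have [v Lv cv] := flow_ex t0 Lr.
by apply: (@xgetPex _ (fun=> 0) [set v | L2r psi v /\ forall w, coef v w = tflow t (coef r) w]); exists v.
Qed.

Definition hflow t u : fct := fun x => (rflow t (re u) x +i* rflow t (im u) x)%C.

Let L2_hflow t u : 0 <= t -> L2p u -> L2p (hflow t u).
Proof.
move=> t0 /(L2P mpsi psi0)[a b]; apply/(L2P mpsi psi0).
by split; [exact: (rflowP t0 a).1|exact: (rflowP t0 b).1].
Qed.

Let coef_re t u w : 0 <= t -> L2p u -> coef (re (hflow t u)) w = tflow t (coef (re u)) w.
Proof. by move=> t0 /(L2P mpsi psi0)[a b]; exact: (rflowP t0 a).2. Qed.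

Let coef_im t u w : 0 <= t -> L2p u -> coef (im (hflow t u)) w = tflow t (coef (im u)) w.
Proof. by move=> t0 /(L2P mpsi psi0)[a b]; exact: (rflowP t0 b).2. Qed.

Lemma coef_lin (a b : R) (p q r : E -> R) w : L2r psi p -> L2r psi q -> L2r psi r ->
  coef (fun x => a * p x + b * q x + r x) w = a * coef p w + b * coef q w + coef r w.
Proof.
move=> Lp Lq Lr; have Lap := L2rZ a Lp; have Lbq := L2rZ b Lq.
by rewrite !(coefD SA Aunit)// ?(coefZ SA Aunit)//; exact: L2rD.
Qed.

Lemma coef_quotient (t : R) (p q r : E -> R) w : L2r psi p -> L2r psi q -> L2r psi r ->
  coef (fun x => t^-1 * (p x - q x) - r x) w = t^-1 * (coef p w - coef q w) - coef r w.
Proof.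
move=> Lp Lq Lr; have Lpq := L2rB mpsi psi0 Lp Lq.
by rewrite (coefB SA Aunit)// ?(coefZ SA Aunit)// ?(coefB SA Aunit)//; exact: L2rZ.
Qed.

Let tflow_quotient_cvg b w :
  t^-1 * (tflow t b w - b w) @[t --> 0^'+] --> dtens M w b.
Proof.
have H := tflow_derive M b w 0.
have := @ex_derive _ _ _ _ _ _ _ H; rewrite /derivable => /cvg_ex[l cl].
have le : l = dtens M w b.
  transitivity (dtens M w (tflow 0 b)); last by apply: eq_dtens => v _; exact: tflow0.
  by rewrite -(@derive_val _ _ _ _ _ _ _ H) /derive (cvg_lim (@norm_hausdorff _ _) cl).
rewrite -le; have : (fun h : R => h^-1 *: (tflow (h *: (1 : R) + 0) b w - tflow 0 b w)) @ 0^'+ --> l.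
  exact: cvg_dnbhs_at_right cl.
by under eq_fun do rewrite /GRing.scale/= mulr1 addr0 tflow0.
Qed.

Let flow_cont (r : E -> R) : L2r psi r ->
  ipp (fun x => rflow t r x - r x) (fun x => rflow t r x - r x) @[t --> 0^'+] --> (0 : R).
Proof.
move=> Lr.
have near0 : \forall t \near 0^'+, 0 < t :> R by exact: nbhs_right_gt.
have c1 t w : 0 < t -> coef (fun x => rflow t r x - r x) w = tflow t (coef r) w - coef r w.
  by move=> /ltW t0; have [h1 h2] := rflowP t0 Lr; rewrite (coefB SA Aunit)// h2.
apply: (@ip_cvg0_dominated _ _ S A SA Aunit Ipsi _ _ _ 4 r) => //.
- by apply: filterS near0 => t /ltW t0; apply: L2rB => //; exact: (rflowP t0 Lr).1.
- apply: filterS near0 => t t0 n.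
  rewrite (eq_nrm (b := fun w => tflow t (coef r) w - coef r w)) => [|w _]; last exact: c1.
  apply: le_trans (le_nrmB _ _ _) _.
  have := tflow_contraction M0 n (coef r) (ltW t0); lra.
- move=> w; have h : tflow t (coef r) w @[t --> 0^'+] --> coef r w.
    rewrite -[X in _ --> X](tflow0 M (coef r) w).
    have := @ex_derive _ _ _ _ _ _ _ (tflow_derive M (coef r) w 0).
    move=> /derivable1_diffP /differentiable_continuous c.
    by apply: cvg_at_right_filter; exact: c.
  have : tflow t (coef r) w - coef r w @[t --> 0^'+] --> (0 : R).
    by rewrite -[X in _ --> X](subrr (coef r w)); apply: cvgB => //; exact: cvg_cst.
  by apply: cvg_trans; apply: near_eq_cvg; apply: filterS near0 => t t0; rewrite c1.
Qed.

(** Each coefficient of the quotient converges by [tflow_derive], and [le_nrm_tflowB] dominates the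
    quotients by f; the constant 4 comes from |a - b|^2 <= 2 |a|^2 + 2 |b|^2. *)
Let flow_gen (r f : E -> R) : L2r psi r -> L2r psi f ->
  (forall w, coef f w = dtens M w (coef r)) ->
  ipp (fun x => t^-1 * (rflow t r x - r x) - f x)
      (fun x => t^-1 * (rflow t r x - r x) - f x) @[t --> 0^'+] --> (0 : R).
Proof.
move=> Lr Lf fr.
have near0 : \forall t \near 0^'+, 0 < t :> R by exact: nbhs_right_gt.
have c1 t w : 0 < t -> coef (fun x => t^-1 * (rflow t r x - r x) - f x) w =
    t^-1 * (tflow t (coef r) w - coef r w) - coef f w.
  by move=> /ltW t0; have [h1 h2] := rflowP t0 Lr; rewrite coef_quotient// h2.
apply: (@ip_cvg0_dominated _ _ S A SA Aunit Ipsi _ _ _ 4 f) => //.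
- apply: filterS near0 => t /ltW t0; apply: L2rB => //; apply: L2rZ => //.
  by apply: L2rB => //; exact: (rflowP t0 Lr).1.
- apply: filterS near0 => t t0 n.
  rewrite (eq_nrm (b := fun w => t^-1 * (tflow t (coef r) w - coef r w) - coef f w)) => [|w _]; last exact: c1.
  apply: le_trans (le_nrmB _ _ _) _; rewrite nrmZ.
  have := le_nrm_tflowB M0 n (coef r) (ltW t0).
  have -> : nrm n (fun w => dtens M w (coef r)) = nrm n (coef f).
    by apply: eq_nrm => w _; rewrite fr.
  move=> h.
  have : t^-1 ^+ 2 * nrm n (fun w => tflow t (coef r) w - coef r w) <= nrm n (coef f).
    by rewrite exprVn mulrC ler_pdivrMr ?exprn_gt0// mulrC.
  lra.
- move=> w; have : t^-1 * (tflow t (coef r) w - coef r w) - coef f w @[t --> 0^'+] --> (0 : R).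
    rewrite -[X in _ --> X](subrr (coef f w)); apply: cvgB; last exact: cvg_cst.
    by rewrite fr; exact: tflow_quotient_cvg.
  by apply: cvg_trans; apply: near_eq_cvg; apply: filterS near0 => t t0; rewrite c1.
Qed.

Lemma coef_norm u w : L2p u ->
  `|coef (re u) w| <= norm u * Num.sqrt (ipp (herm A w) (herm A w)) /\
  `|coef (im u) w| <= norm u * Num.sqrt (ipp (herm A w) (herm A w)).
Proof.
move=> Lu; have /(L2P mpsi psi0)[a b] := Lu; rewrite (L2normE mpsi psi0)//.
split; apply: le_trans (coef_norm_le SA Aunit _ _) _ => //.
  by rewrite ler_wpM2r ?sqrtr_ge0// ler_wsqrtr// lerDl ip_ge0.
by rewrite ler_wpM2r ?sqrtr_ge0// ler_wsqrtr// lerDr ip_ge0.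
Qed.

Lemma coef_cvg (F : set_system R) {FF : Filter F} (r : R -> fct) w :
  (\forall t \near F, L2p (r t)) -> norm (r t) @[t --> F] --> (0 : R) ->
  coef (re (r t)) w @[t --> F] --> (0 : R) /\ coef (im (r t)) w @[t --> F] --> (0 : R).
Proof.
move=> Lr r0; set K := Num.sqrt (ipp (herm A w) (herm A w)).
have K0 : norm (r t) * K @[t --> F] --> (0 : R) by rewrite -[X in _ --> X](mul0r K); exact: cvgMl.
split; apply: norm_cvg0; apply: (@squeeze_cvgr _ _ _ _ (fun=> 0) (fun t => norm (r t) * K)) => //; try exact: cvg_cst.
  by apply: filterS Lr => t Lt; rewrite normr_ge0/= (coef_norm w Lt).1.
by apply: filterS Lr => t Lt; rewrite normr_ge0/= (coef_norm w Lt).2.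
Qed.

Variable G : fct -> fct -> Prop.
Hypothesis GE : forall u f, G u f <-> coef_graph u f.

Let quot_cvg u f : L2p u -> L2p f ->
  norm (fun x => (hflow t u x - u x) / t%:C%C - f x) @[t --> 0^'+] --> (0 : R) <-> coef_graph u f.
Proof.
move=> Lu Lf; have /(L2P mpsi psi0)[a b] := Lu; have /(L2P mpsi psi0)[c d] := Lf.
have near0 : \forall t \near 0^'+, 0 < t :> R by exact: nbhs_right_gt.
have Lq : \forall t \near 0^'+, L2p (fun x => (hflow t u x - u x) / t%:C%C - f x).
  by apply: filterS near0 => t /ltW t0; apply: L2_quotient => //; exact: L2_hflow.
have reE t : re (fun x => (hflow t u x - u x) / t%:C%C - f x) =
    (fun x => t^-1 * (rflow t (re u) x - complex.Re (u x)) - complex.Re (f x)).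
  by apply/funext => x; rewrite cReD cReN cRe_div cReD cReN.
have imE t : im (fun x => (hflow t u x - u x) / t%:C%C - f x) =
    (fun x => t^-1 * (rflow t (im u) x - complex.Im (u x)) - complex.Im (f x)).
  by apply/funext => x; rewrite cImD cImN cIm_div cImD cImN.
split=> [H|[_ _ hr hi]]; last first.
  apply/(L2norm_cvg0 mpsi psi0 Lq); rewrite /nC -[X in _ --> X](addr0 (0 : R)).
  under eq_fun do rewrite reE imE.
  by apply: cvgD; exact: flow_gen.
suff key w : coef (re f) w = dtens M w (coef (re u)) /\ coef (im f) w = dtens M w (coef (im u)).
  by split=> // w; have [] := key w.
have [H1 H2] := coef_cvg w Lq H.
have fin (r g : E -> R) (L : L2r psi r) (Lg : L2r psi g) :
    coef (fun x => t^-1 * (rflow t r x - r x) - g x) w @[t --> 0^'+] --> (0 : R) ->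
    coef g w = dtens M w (coef r).
  move=> h0; apply/esym/subr0_eq.
  have h1 : t^-1 * (tflow t (coef r) w - coef r w) - coef g w @[t --> 0^'+] --> dtens M w (coef r) - coef g w.
    by apply: cvgB; [exact: tflow_quotient_cvg|exact: cvg_cst].
  have h2 : t^-1 * (tflow t (coef r) w - coef r w) - coef g w @[t --> 0^'+] --> (0 : R).
    apply: cvg_trans h0; apply: near_eq_cvg; apply: filterS near0 => t /ltW t0.
    by have [Lf' cf'] := rflowP t0 L; rewrite coef_quotient// cf'.
  by rewrite -(cvg_lim (@norm_hausdorff _ _) h1) (cvg_lim (@norm_hausdorff _ _) h2).
by split; [apply: fin => //; move: H1|apply: fin => //; move: H2]; under eq_fun do rewrite ?reE ?imE.
Qed.

Lemma hflow_generates : generates_contraction_semigroup psi G hflow.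
Proof.
split.
- by move=> t u; exact: L2_hflow.
- move=> t u v t0 Lu Lv uv; have [h1 h2] := ae_coefC Lu Lv uv.
  apply: coefC_inj; try exact: L2_hflow.
    by move=> w; rewrite !coef_re//; apply: eq_tpow.
  by move=> w; rewrite !coef_im//; apply: eq_tpow.
- move=> t z u v t0 Lu Lv.
  have Lzuv := L2lin mpsi psi0 z Lu Lv.
  have Lt := L2lin mpsi psi0 z (L2_hflow t0 Lu) (L2_hflow t0 Lv).
  have /(L2P mpsi psi0)[a b] := Lu; have /(L2P mpsi psi0)[c d] := Lv.
  have /(L2P mpsi psi0)[a' b'] := L2_hflow t0 Lu; have /(L2P mpsi psi0)[c' d'] := L2_hflow t0 Lv.
  have reE (p q : fct) : re (fun x => z * p x + q x) = (fun x => complex.Re z * complex.Re (p x) + - complex.Im z * complex.Im (p x) + complex.Re (q x)).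
    by apply/funext => x; rewrite cReD cReM mulNr.
  have imE (p q : fct) : im (fun x => z * p x + q x) = (fun x => complex.Re z * complex.Im (p x) + complex.Im z * complex.Re (p x) + complex.Im (q x)).
    by apply/funext => x; rewrite cImD cImM.
  have lin (k l : R) (f1 f2 f3 : seq 'I_N -> R) w :
      tflow t (fun w' => k * f1 w' + l * f2 w' + f3 w') w = k * tflow t f1 w + l * tflow t f2 w + tflow t f3 w.
    by rewrite -[LHS]/(tpow (mexp M t) w (fun w' => k * f1 w' + l * f2 w' + f3 w')) !tpowD !tpowZ.
  apply: coefC_inj => //; first exact: L2_hflow.
    move=> w; transitivity (tflow t (coef (re (fun x => z * u x + v x))) w).
      exact: coef_re w t0 Lzuv.
    transitivity (tflow t (fun w' => complex.Re z * coef (re u) w' + - complex.Im z * coef (im u) w' + coef (re v) w') w).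
      by apply: eq_tpow => w' _; rewrite (reE u v) coef_lin.
    rewrite lin -(coef_re w t0 Lu) -(coef_im w t0 Lu) -(coef_re w t0 Lv).
    rewrite (reE (hflow t u) (hflow t v)).
    by rewrite coef_lin.
  move=> w; transitivity (tflow t (coef (im (fun x => z * u x + v x))) w).
    exact: coef_im w t0 Lzuv.
  transitivity (tflow t (fun w' => complex.Re z * coef (im u) w' + complex.Im z * coef (re u) w' + coef (im v) w') w).
    by apply: eq_tpow => w' _; rewrite (imE u v) coef_lin.
  rewrite lin -(coef_im w t0 Lu) -(coef_re w t0 Lu) -(coef_im w t0 Lv).
  rewrite (imE (hflow t u) (hflow t v)).
  by rewrite coef_lin.
- move=> u Lu; apply: coefC_inj => //; first exact: L2_hflow.
    by move=> w; rewrite coef_re// tflow0.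
  by move=> w; rewrite coef_im// tflow0.
- move=> s t u s0 t0 Lu.
  have st0 : 0 <= s + t by rewrite addr_ge0.
  have Lt := L2_hflow t0 Lu.
  apply: coefC_inj; [exact: L2_hflow|exact: L2_hflow| |].
    by move=> w; rewrite !coef_re// tflowD//; apply: eq_tpow => v _; rewrite coef_re.
  by move=> w; rewrite !coef_im// tflowD//; apply: eq_tpow => v _; rewrite coef_im.
- move=> t u t0 Lu; have Lt := L2_hflow t0 Lu.
  rewrite !(L2normE mpsi psi0)//; apply: ler_wsqrtr.
  have /(L2P mpsi psi0)[a b] := Lu; have /(L2P mpsi psi0)[a' b'] := Lt.
  apply: lerD; rewrite -[leRHS]mul1r; apply: (le_ip_coef SA Aunit Ipsi) => // n; rewrite mul1r.
    rewrite (eq_nrm (b := tflow t (coef (re u)))) => [|w _]; last exact: coef_re.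
    exact: tflow_contraction.
  rewrite (eq_nrm (b := tflow t (coef (im u)))) => [|w _]; last exact: coef_im.
  exact: tflow_contraction.
- move=> u Lu; have /(L2P mpsi psi0)[a b] := Lu.
  apply/(L2norm_cvg0 mpsi psi0).
    have near0 : \forall t \near 0^'+, 0 < t :> R by exact: nbhs_right_gt.
    by apply: filterS near0 => t /ltW t0; apply: (L2B mpsi psi0) => //; exact: L2_hflow.
  rewrite (_ : (fun t => nC psi _) = fun t =>
     ipp (fun x => rflow t (re u) x - complex.Re (u x)) (fun x => rflow t (re u) x - complex.Re (u x)) +
     ipp (fun x => rflow t (im u) x - complex.Im (u x)) (fun x => rflow t (im u) x - complex.Im (u x))).
    by rewrite -[X in _ --> X](addr0 (0 : R)); apply: cvgD; exact: flow_cont.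
  by apply/funext => t; rewrite nC_B.
- by move=> u f Lu Lf; rewrite GE quot_cvg.
Qed.

Section coefficients_of_semigroup.
Variable T : R -> fct -> fct.
Hypothesis GT : generates_contraction_semigroup psi G T.

Let LT t u : 0 <= t -> L2p u -> L2p (T t u) := fun t0 Lu => semigroup_L2 GT t0 Lu.

Let norm_ge0 u : 0 <= norm u. Proof. exact: sqrtr_ge0. Qed.

Let normTB t u v : 0 <= t -> L2p u -> L2p v ->
  norm (fun x => T t u x - T t v x) <= norm (fun x => u x - v x).
Proof.
move=> t0 Lu Lv.
have Luv : L2p (fun x => -1 * v x + u x) by exact: (L2lin mpsi psi0).
have LTuv : L2p (fun x => -1 * T t v x + T t u x).
  by apply: (L2lin mpsi psi0); exact: LT.
have h := semigroup_linear GT (-1) t0 Lv Lu.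
have e1 : (fun x => u x - v x) = (fun x => -1 * v x + u x).
  by apply/funext => x; rewrite mulN1r addrC.
have e2 : (fun x => T t u x - T t v x) = (fun x => -1 * T t v x + T t u x).
  by apply/funext => x; rewrite mulN1r addrC.
rewrite e1 e2 -(ae_L2norm mpsi psi0 (LT t0 Luv) LTuv h).
exact: (semigroup_contraction GT t0 Luv).
Qed.

Let coefB_le u v w : L2p u -> L2p v ->
  `|coef (re u) w - coef (re v) w| <= norm (fun x => u x - v x) * Num.sqrt (ipp (herm A w) (herm A w)) /\
  `|coef (im u) w - coef (im v) w| <= norm (fun x => u x - v x) * Num.sqrt (ipp (herm A w) (herm A w)).
Proof.
move=> Lu Lv; have Luv := L2B mpsi psi0 Lu Lv; have := coef_norm w Luv.
have /(L2P mpsi psi0)[a b] := Lu; have /(L2P mpsi psi0)[c d] := Lv.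
rewrite (_ : re (fun x => u x - v x) = (fun x => complex.Re (u x) - complex.Re (v x))); last first.
  by apply/funext => x; rewrite cReD cReN.
rewrite (_ : im (fun x => u x - v x) = (fun x => complex.Im (u x) - complex.Im (v x))); last first.
  by apply/funext => x; rewrite cImD cImN.
by rewrite !(coefB SA Aunit).
Qed.

Let D u f h := norm (fun x => (T h u x - u x) / h%:C%C - f x).

(** The quotient at time s is the image under T s of the quotient at time 0, and T s contracts:
    convergence is uniform in s. *)
Let quotient_le s h u f : 0 <= s -> 0 < h -> L2p u -> L2p f ->
  norm (fun x => (T (s + h) u x - T s u x) / h%:C%C - T s f x) <= D u f h.
Proof.
move=> s0 h0 Lu Lf; have h0' := ltW h0; rewrite /D.
have sh0 : 0 <= s + h by exact: addr_ge0.
have Lq : L2p (fun x => (h^-1)%:C%C * T h u x + (- (h^-1)%:C%C * u x + - 1 * f x)).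
  apply: (L2lin mpsi psi0); first exact: LT.
  by apply: (L2lin mpsi psi0) => //; exact: (L2Z mpsi psi0).
have L1 : L2p (fun x => - (h^-1)%:C%C * u x + - 1 * f x).
  by apply: (L2lin mpsi psi0) => //; exact: (L2Z mpsi psi0).
have L2' : L2p (fun x => - 1 * f x) by exact: (L2Z mpsi psi0).
have Lz : L2p (fun=> 0) by apply/(L2P mpsi psi0); split; exact: (L2r_cst mpsi rpsi).
have e : (fun x => (T h u x - u x) / h%:C%C - f x) =
    (fun x => (h^-1)%:C%C * T h u x + (- (h^-1)%:C%C * u x + - 1 * f x)).
  by apply/funext => x; rewrite fmorphV; ring.
have e' : (fun x => (T (s + h) u x - T s u x) / h%:C%C - T s f x) =
    (fun x => (h^-1)%:C%C * T (s + h) u x + (- (h^-1)%:C%C * T s u x + - 1 * T s f x)).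
  by apply/funext => x; rewrite fmorphV; ring.
rewrite e e'.
apply: le_trans (semigroup_contraction GT s0 Lq).
have -> : norm (T s (fun x => (h^-1)%:C%C * T h u x + (- (h^-1)%:C%C * u x + - 1 * f x))) =
    norm (fun x => (h^-1)%:C%C * T (s + h) u x + (- (h^-1)%:C%C * T s u x + - 1 * T s f x)).
  apply: (ae_L2norm mpsi psi0); first exact: LT.
    apply: (L2lin mpsi psi0); first exact: LT.
    by apply: (L2lin mpsi psi0) => //; [exact: LT|apply: (L2Z mpsi psi0); exact: LT].
  have a1 := semigroup_linear GT (h^-1)%:C%C s0 (LT h0' Lu) L1.
  have a2 := semigroup_linear GT (- (h^-1)%:C%C) s0 Lu L2'.
  have a3 := semigroup_linear GT (-1) s0 Lf Lz.
  have a4 := semigroup_add GT s0 h0' Lu.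
  have a5 := semigroup_linear GT (-1) s0 Lz Lz.
  have e3 : (fun x => -1 * f x + 0) = (fun x => -1 * f x) by apply/funext => x; rewrite addr0.
  have e5 : (fun x : E => -1 * (0 : R[i]) + 0) = (fun=> 0) by apply/funext => x; rewrite mulr0 addr0.
  rewrite e3 in a3; rewrite e5 in a5.
  have z0 : ae_eq_fun (T s (fun=> 0)) (fun=> 0).
    by apply: filterS a5 => x; rewrite mulN1r addNr.
  have b3 : ae_eq_fun (T s (fun x => -1 * f x)) (fun x => -1 * T s f x).
    by apply: filterS2 a3 z0 => x -> ->; rewrite addr0.
  have b2 : ae_eq_fun (T s (fun x => - (h^-1)%:C%C * u x + -1 * f x))
      (fun x => - (h^-1)%:C%C * T s u x + -1 * T s f x).
    by apply: filterS2 a2 b3 => x -> ->.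
  by apply: filterS3 a1 b2 a4 => x -> -> ->.
exact: lexx.
Qed.

(** T s commutes with the difference quotients at 0, so it preserves the domain and commutes with
    the generator. *)
Let graph_T s u f : 0 <= s -> coef_graph u f -> coef_graph (T s u) (T s f).
Proof.
move=> s0 uf; have [Lu Lf _ _] := uf.
have near0 : \forall t \near 0^'+, 0 < t :> R by exact: nbhs_right_gt.
apply/GE/(semigroup_generator GT); try exact: LT.
have H : D u f h @[h --> 0^'+] --> (0 : R) by apply/(semigroup_generator GT) => //; exact/GE.
apply: (@squeeze_cvgr _ _ _ _ (fun=> 0) (D u f)) => //; last exact: cvg_cst.
apply: filterS near0 => h h0; have h0' := ltW h0; rewrite norm_ge0/=.
apply: le_trans (quotient_le s0 h0 Lu Lf).
have sh0 : 0 <= s + h by exact: addr_ge0.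
rewrite le_eqVlt; apply/orP; left; apply/eqP.
apply: (ae_L2norm mpsi psi0).
- by apply: (L2_quotient mpsi psi0); try exact: LT; apply: LT => //; exact: LT.
- by apply: (L2_quotient mpsi psi0); exact: LT.
have a := semigroup_add GT h0' s0 Lu; rewrite [h + s]addrC in a.
by apply: filterS a => x ->.
Qed.

Let coef_right s h u f w : 0 <= s -> 0 < h -> coef_graph u f ->
  `|coef (re (T (s + h) u)) w - coef (re (T s u)) w - h * coef (re (T s f)) w| <= h * (D u f h * Num.sqrt (ipp (herm A w) (herm A w))) /\
  `|coef (im (T (s + h) u)) w - coef (im (T s u)) w - h * coef (im (T s f)) w| <= h * (D u f h * Num.sqrt (ipp (herm A w) (herm A w))).
Proof.
move=> s0 h0 [Lu Lf _ _]; have h0' := ltW h0.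
have sh0 : 0 <= s + h by exact: addr_ge0.
have Lq : L2p (fun x => (T (s + h) u x - T s u x) / h%:C%C - T s f x).
  by apply: (L2_quotient mpsi psi0); exact: LT.
set K := Num.sqrt _; have K0 : 0 <= K by exact: sqrtr_ge0.
have := coef_norm w Lq; rewrite -/K.
have /(L2P mpsi psi0)[a b] := LT sh0 Lu; have /(L2P mpsi psi0)[c d] := LT s0 Lu.
have /(L2P mpsi psi0)[e g] := LT s0 Lf.
have reE : re (fun x => (T (s + h) u x - T s u x) / h%:C%C - T s f x) =
    (fun x => h^-1 * (complex.Re (T (s + h) u x) - complex.Re (T s u x)) - complex.Re (T s f x)).
  by apply/funext => x; rewrite cReD cReN cRe_div cReD cReN.
have imE : im (fun x => (T (s + h) u x - T s u x) / h%:C%C - T s f x) =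
    (fun x => h^-1 * (complex.Im (T (s + h) u x) - complex.Im (T s u x)) - complex.Im (T s f x)).
  by apply/funext => x; rewrite cImD cImN cIm_div cImD cImN.
rewrite reE imE !coef_quotient//.
have mono (y1 y2 y3 n : R) : n <= D u f h -> `|h^-1 * (y1 - y2) - y3| <= n * K ->
    `|y1 - y2 - h * y3| <= h * (D u f h * K).
  move=> nD; have -> : y1 - y2 - h * y3 = h * (h^-1 * (y1 - y2) - y3).
    by rewrite mulrBr mulVKf// gt_eqF.
  rewrite normrM gtr0_norm// => H; rewrite ler_wpM2l//; apply: le_trans H _.
  by rewrite ler_wpM2r.
have nD := quotient_le s0 h0 Lu Lf.
by move=> [H1 H2]; split; apply: mono nD _.
Qed.

Let coef_lip s h f w : 0 <= s -> 0 <= h -> L2p f ->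
  `|coef (re (T (s + h) f)) w - coef (re (T s f)) w| <= norm (fun x => T h f x - f x) * Num.sqrt (ipp (herm A w) (herm A w)) /\
  `|coef (im (T (s + h) f)) w - coef (im (T s f)) w| <= norm (fun x => T h f x - f x) * Num.sqrt (ipp (herm A w) (herm A w)).
Proof.
move=> s0 h0 Lf; have sh0 : 0 <= s + h by exact: addr_ge0.
have Lh := LT h0 Lf; have a := semigroup_add GT s0 h0 Lf.
have [e1 e2] := ae_coefC (LT sh0 Lf) (LT s0 Lh) a.
have [H1 H2] := coefB_le w (LT s0 Lh) (LT s0 Lf).
have n := normTB s0 Lh Lf; rewrite e1 e2.
by split; [apply: le_trans H1 _|apply: le_trans H2 _]; rewrite ler_wpM2r ?sqrtr_ge0.
Qed.

(** Forward expansions uniform in the starting time give a two-sided derivative: a backward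
    difference at s is a forward one started at s + h, and g is compared at the two times. *)
Let coef_derive_gen (c g : R -> R) (d1 d2 : R -> R) (s : R) : 0 < s ->
  (forall s h : R, 0 <= s -> 0 < h -> `|c (s + h) - c s - h * g s| <= h * d1 h) ->
  (forall s h : R, 0 <= s -> 0 <= h -> `|g (s + h) - g s| <= d2 h) ->
  d1 h @[h --> 0^'+] --> (0 : R) -> d2 h @[h --> 0^'+] --> (0 : R) ->
  is_derive s (1 : R) c (g s).
Proof.
move=> s0 cg gg d10 d20; apply: is_derive_bound => e e0.
have e2 : 0 < e / 2 by rewrite divr_gt0.
have [r1 r10 H1] := cvg_at_right0_small d10 e2; have [r2 r20 H2] := cvg_at_right0_small d20 e2.
exists (Num.min s (Num.min r1 r2)); first by rewrite !lt_min s0 r10 r20.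
move=> h; rewrite !lt_min => /and3P[hs hr1 hr2].
have [h0|h0|->] := ltgtP h 0; last by rewrite addr0 subrr mul0r subrr !normr0 mulr0.
  rewrite ltr0_norm// in hs hr1 hr2 *; set k := - h.
  have k0 : 0 < k by rewrite oppr_gt0.
  have sk0 : 0 <= s - k by rewrite subr_ge0 ltW.
  have := cg (s - k) k sk0 k0; have := gg (s - k) k sk0 (ltW k0); rewrite subrK.
  have := H1 k k0 hr1; have := H2 k k0 hr2; rewrite -/k /k opprK.
  move=> a1 a2 a3 a4.
  have -> : c (s + h) - c s - h * g s = - (c s - c (s + h) - - h * g (s + h)) + - h * (g s - g (s + h)) by ring.
  apply: le_trans (ler_normD _ _) _; rewrite normrN normrM [`|- h|]gtr0_norm//.
  apply: le_trans (lerD a4 (ler_wpM2l (ltW k0) a3)) _.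
  rewrite -mulrDr mulrC ler_wpM2r//; first exact: ltW.
  by rewrite [e]splitr; exact: lerD.
rewrite gtr0_norm// in hs hr1 hr2 *.
apply: le_trans (cg s h (ltW s0) h0) _; rewrite mulrC ler_wpM2r ?(ltW h0)//.
apply: le_trans (H1 h h0 hr1) _; lra.
Qed.

(** T is any semigroup generated by G, so this is also uniqueness. On the domain the coefficients of
    one degree solve a closed linear system, to which [tflow_unique] applies. *)
Lemma semigroup_coef_graph t u f w : 0 <= t -> coef_graph u f ->
  coef (re (T t u)) w = tflow t (coef (re u)) w /\
  coef (im (T t u)) w = tflow t (coef (im u)) w.
Proof.
move=> t0 uf; have [Lu Lf _ _] := uf.
have [e1 e2] := ae_coefC (LT (lexx 0) Lu) Lu (semigroup_0 GT Lu).
move: t0; rewrite le_eqVlt => /orP[/eqP <-|t0]; first by rewrite e1 e2 !tflow0.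
pose K v := Num.sqrt (ipp (herm A v) (herm A v)).
have Du v : D u f h * K v @[h --> 0^'+] --> (0 : R).
  rewrite -[X in _ --> X](mul0r (K v)); apply: cvgMl.
  by apply/(semigroup_generator GT) => //; exact/GE.
have cont g (Lg : L2p g) v : norm (fun x => T h g x - g x) * K v @[h --> 0^'+] --> (0 : R).
  rewrite -[X in _ --> X](mul0r (K v)); apply: cvgMl; exact: (semigroup_continuous GT).
have dre (s : R) v : 0 < s -> is_derive s (1 : R) (fun s => coef (re (T s u)) v) (dtens M v (coef (re (T s u)))).
  move=> s0; have [_ _ <- _] := graph_T (ltW s0) uf.
  apply: (coef_derive_gen (g := fun s => coef (re (T s f)) v) s0 _ _ (Du v) (cont f Lf v)).
    by move=> s' h s0' h0; exact: (coef_right v s0' h0 uf).1.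
  by move=> s' h s0' h0; exact: (coef_lip v s0' h0 Lf).1.
have dim (s : R) v : 0 < s -> is_derive s (1 : R) (fun s => coef (im (T s u)) v) (dtens M v (coef (im (T s u)))).
  move=> s0; have [_ _ _ <-] := graph_T (ltW s0) uf.
  apply: (coef_derive_gen (g := fun s => coef (im (T s f)) v) s0 _ _ (Du v) (cont f Lf v)).
    by move=> s' h s0' h0; exact: (coef_right v s0' h0 uf).2.
  by move=> s' h s0' h0; exact: (coef_lip v s0' h0 Lf).2.
have wre v : {within `[0, t], continuous (fun s => coef (re (T s u)) v)}.
  apply: (within_continuous_right t0).
    by move=> s s0; case: (dre s v s0).
  apply: (cvg_at_right0 _ (cont u Lu v)).
  move=> h h0.
  have [+ _] := coef_lip v (lexx 0) h0 Lu.
  by rewrite add0r.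
have wim v : {within `[0, t], continuous (fun s => coef (im (T s u)) v)}.
  apply: (within_continuous_right t0).
    by move=> s s0; case: (dim s v s0).
  apply: (cvg_at_right0 _ (cont u Lu v)).
  move=> h h0.
  have [_ +] := coef_lip v (lexx 0) h0 Lu.
  by rewrite add0r.
have Ure := @tflow_unique _ _ M M0 (size w) (fun s v => coef (re (T s u)) v) t (ltW t0)
  (fun v _ => wre v) (fun s v s0t _ => dre s v (andP s0t).1) w erefl.
have Uim := @tflow_unique _ _ M M0 (size w) (fun s v => coef (im (T s u)) v) t (ltW t0)
  (fun v _ => wim v) (fun s v s0t _ => dim s v (andP s0t).1) w erefl.
split; first by rewrite Ure; apply: eq_tpow => v _; exact: e1.
by rewrite Uim; apply: eq_tpow => v _; exact: e2.
Qed.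

Let truncate m (r : E -> R) : E -> R := hser A 0 m (coef r).

Let truncate_graph m (r : E -> R) : exists2 g, L2r psi g &
  forall w, coef g w = dtens M w (coef (truncate m r)).
Proof.
have sb : symm (fun w => dtens M w (coef (truncate m r))) by apply: symm_dtens; exact: symm_coef.
have cT v : coef (truncate m r) v = (size v < m)%:R * coef r v.
  by rewrite (coef_hser SA Aunit Ipsi)//; exact: symm_coef.
have [|g [Lg cg _]] := @riesz_fischer _ _ S A SA Aunit Ipsi _ (hnorm 0 m (fun w => dtens M w (coef (truncate m r)))) sb.
  move=> k; have [km|mk] := leqP k m; first exact: le_hnorm0.
  rewrite (hnorm_cat _ (leq0n m) (ltnW mk)) [X in _ + X](_ : _ = 0) ?addr0//.
  rewrite /hnorm big_nat big1// => n /andP[mn _].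
  rewrite (eq_nrm (b := fun=> 0)) => [|w sw].
    by rewrite /nrm; under eq_wsum do rewrite expr0n/=; rewrite wsum0 mulr0.
  transitivity (dtens M w (fun=> 0)); last exact: dtens0.
  apply: eq_dtens => v sv.
  by rewrite cT sv sw ltnNge mn mul0r.
by exists g.
Qed.

(** Truncated Hermite series lie in the domain and approximate u, T t contracts, and the flow at w
    only sees words of the length of w, hence is unaffected by a long enough truncation. *)
Lemma semigroup_coef t u w : 0 <= t -> L2p u ->
  coef (re (T t u)) w = tflow t (coef (re u)) w /\
  coef (im (T t u)) w = tflow t (coef (im u)) w.
Proof.
move=> t0 Lu; have /(L2P mpsi psi0)[a b] := Lu.
pose Q m : fct := fun x => (truncate m (re u) x +i* truncate m (im u) x)%C.
have LQ m : L2p (Q m) by apply/(L2P mpsi psi0); split; exact: L2r_hser.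
have gQ m : exists f, coef_graph (Q m) f.
  have [g1 Lg1 cg1] := truncate_graph m (re u); have [g2 Lg2 cg2] := truncate_graph m (im u).
  have Lg : L2p (fun x => (g1 x +i* g2 x)%C) by apply/(L2P mpsi psi0); split.
  by exists (fun x => (g1 x +i* g2 x)%C); exact: And4 (LQ m) Lg cg1 cg2.
have tQ (r : E -> R) m : (size w < m)%N -> tflow t (coef (truncate m r)) w = tflow t (coef r) w.
  move=> wm; apply: eq_tpow => v vw.
  by rewrite (coef_hser SA Aunit Ipsi) ?vw ?wm ?mul1r//; exact: symm_coef.
pose K := Num.sqrt (ipp (herm A w) (herm A w)).
have n0 : (fun m => norm (fun x => u x - Q m x) * K) @ \oo --> (0 : R).
  rewrite -[X in _ --> X](mul0r K); apply: cvgMl.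
  have sq0 : (fun m => nC psi (fun x => u x - Q m x)) @ \oo --> (0 : R).
    rewrite (_ : (fun m => nC psi _) = fun m =>
       ipp (fun x => complex.Re (u x) - truncate m (re u) x) (fun x => complex.Re (u x) - truncate m (re u) x) +
       ipp (fun x => complex.Im (u x) - truncate m (im u) x) (fun x => complex.Im (u x) - truncate m (im u) x)); last first.
      by apply/funext => m; rewrite nC_B.
    rewrite -[X in _ --> X](addr0 (0 : R)); apply: cvgD.
      by under eq_fun do rewrite ip_sym; exact: (hser_cvg SA Aunit Ipsi).
    by under eq_fun do rewrite ip_sym; exact: (hser_cvg SA Aunit Ipsi).
  have : (fun m => Num.sqrt (nC psi (fun x => u x - Q m x))) @ \oo --> (0 : R).
    by rewrite -[X in _ --> X]sqrtr0; apply: cvg_comp sq0 _; exact: sqrt_continuous.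
  rewrite (_ : (fun m => norm (fun x => u x - Q m x)) = (fun m => Num.sqrt (nC psi (fun x => u x - Q m x))))//.
  by apply/funext => m; rewrite (L2normE mpsi psi0)//; exact: (L2B mpsi psi0).
have small (z : R) : (forall m, (size w < m)%N -> `|z| <= norm (fun x => u x - Q m x) * K) -> z = 0.
  move=> H; apply/eqP; rewrite -normr_le0 -(cvg_lim (@norm_hausdorff _ _) n0).
  apply: limr_ge; first exact: cvgP n0.
  by exists (size w).+1 => // m /= wm; exact: H.
have bound m : (size w < m)%N ->
    `|coef (re (T t u)) w - tflow t (coef (re u)) w| <= norm (fun x => u x - Q m x) * K /\
    `|coef (im (T t u)) w - tflow t (coef (im u)) w| <= norm (fun x => u x - Q m x) * K.
  move=> wm; have [f gf] := gQ m; have [e1 e2] := semigroup_coef_graph w t0 gf.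
  have f1 : tflow t (coef (re (Q m))) w = tflow t (coef (re u)) w by exact: tQ.
  have f2 : tflow t (coef (im (Q m))) w = tflow t (coef (im u)) w by exact: tQ.
  have [H1 H2] := coefB_le w (LT t0 Lu) (LT t0 (LQ m)).
  have nK : norm (fun x => T t u x - T t (Q m) x) * K <= norm (fun x => u x - Q m x) * K.
    by rewrite ler_wpM2r ?sqrtr_ge0//; exact: normTB t0 Lu (LQ m).
  split; apply: le_trans nK.
    exact: (eq_ind _ (fun y => `|coef (re (T t u)) w - y| <= norm (fun x => T t u x - T t (Q m) x) * K) H1 _ (etrans e1 f1)).
  exact: (eq_ind _ (fun y => `|coef (im (T t u)) w - y| <= norm (fun x => T t u x - T t (Q m) x) * K) H2 _ (etrans e2 f2)).
split; apply/eqP; rewrite -subr_eq0; apply/eqP; apply: small => m wm.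
  exact: (bound m wm).1.
exact: (bound m wm).2.
Qed.

End coefficients_of_semigroup.

End hermite_semigroup.

(** * The operator on Hermite coefficients *)

Section cutoff.
Context {R : realType} {N : nat}.
Local Notation E := 'cV[R]_N.
Implicit Types (x : E) (e : R) (g : E -> R) (B : 'M[R]_N).

Lemma tempered_norm g : tempered g -> tempered (fun x => `|g x|).
Proof.
move=> tg; have [C [k [C0 k0 H]]] := tempered_bound tg; split.
  by apply: measurableT_comp => //; exact: tempered_measurable.
by exists C, k => x; rewrite normr_id.
Qed.

(** beta m is the m-th derivative of beta 0; the factor expR 1 normalizes beta 0 to 1 at s = 0. *)
Let beta m (s : R) : R := expR 1 * bump (iter m bump_step 1) s.

Let sq x : R := \sum_i x i 0 * x i 0.

Let sq_ge0 x : 0 <= sq x.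
Proof. by apply: sumr_ge0 => i _; rewrite -expr2 sqr_ge0. Qed.

Definition chi e x : R := beta 0 (e * sq x).

Let beta_bound m : exists2 C : R, 0 <= C & forall s, `|beta m s| <= C.
Proof.
have [C [C0 HC]] := bump_bound (iter m bump_step 1 : {poly R}).
exists (expR 1 * C); first by rewrite mulr_ge0 ?expR_ge0.
by move=> s; rewrite normrM ger0_norm ?expR_ge0// ler_wpM2l ?expR_ge0.
Qed.

Let beta_derive m s : is_derive s (1 : R) (beta m) (beta m.+1 s).
Proof. exact: (derZ _ (bump_derive _ s)). Qed.

Let smooth_sq : smooth sq.
Proof. by apply: smooth_sum => i; apply: smoothM; exact: smooth_coord. Qed.

Lemma smooth_chi e : smooth (chi e).
Proof.
have s1 : smooth (fun x => e * sq x) by exact: smoothZ.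
by apply: (@smooth_comp _ _ beta).
Qed.

Let dsq x i : is_derive x (delta_mx i 0) sq (2 * x i 0).
Proof.
have H j := derM (is_derive_coord j x (delta_mx i 0)) (is_derive_coord j x (delta_mx i 0)).
apply: is_derive_eq (der_sum _ _ H) _.
rewrite (bigD1 i)//= big1 => [|j ji]; last by rewrite mxE (negbTE ji)/= mulr0 addr0.
by rewrite mxE !eqxx/= !mulr1 addr0 mulr_natl mulr2n.
Qed.

Let dbeta m e x i : is_derive x (delta_mx i 0) (fun y => beta m (e * sq y))
  (beta m.+1 (e * sq x) * (e * (2 * x i 0))).
Proof.
have s1 : smooth (fun x => e * sq x) by exact: smoothZ.
apply: (der_comp (smooth_differentiable x s1)).
  exact: beta_derive.
exact: (derZ e (dsq x i)).
Qed.

Let partial_chi e i : partial i (chi e) = fun x => beta 1 (e * sq x) * (e * (2 * x i 0)).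
Proof. by apply/funext => x; apply: is_derive_partial; exact: (dbeta 0). Qed.

Let partial2_chi e i x : partial i (partial i (chi e)) x =
  e * (e * (beta 2 (e * sq x) * (2 * x i 0) ^+ 2) + 2 * beta 1 (e * sq x)).
Proof.
rewrite partial_chi; apply: is_derive_partial.
have H := derZ e (derZ 2 (is_derive_coord i x (delta_mx i 0))).
apply: is_derive_eq (derM (dbeta 1 e x i) H) _.
by rewrite mxE !eqxx/=; ring.
Qed.

(** The terms of the product rule in which a derivative falls on [chi e], divided by e. Their bound
    by a tempered function uniformly in e makes the error of the cutoff vanish with e. *)
Definition cutoff_rest B g e x : R :=
  g x * (- (\sum_i (B *m x) i 0 * (beta 1 (e * sq x) * (2 * x i 0))) +
    \sum_i (e * (beta 2 (e * sq x) * (2 * x i 0) ^+ 2) + 2 * beta 1 (e * sq x))) +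
  2 * \sum_i partial i g x * (beta 1 (e * sq x) * (2 * x i 0)).

Lemma kolmogorov_cutoff B g e x : smooth g ->
  kolmogorov B (fun y => g y * chi e y) x =
  chi e x * kolmogorov B g x + e * cutoff_rest B g e x.
Proof.
move=> sg; have sc := smooth_chi e.
have d1 i : partial i (fun y => g y * chi e y) = fun y => partial i g y * chi e y + g y * partial i (chi e) y.
  by apply: partialM => z; exact: smooth_differentiable.
have d2 i : partial i (partial i (fun y => g y * chi e y)) x =
   partial i (partial i g) x * chi e x + 2 * (partial i g x * partial i (chi e) x) + g x * partial i (partial i (chi e)) x.
  have sgi := smooth_partial i sg; have sci := smooth_partial i sc.
  have D (f : E -> R) (sf : smooth f) z := smooth_differentiable z sf.
  rewrite d1 (partialD i (D _ (smoothM sgi sc)) (D _ (smoothM sg sci))).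
  rewrite (partialM i (D _ sgi) (D _ sc)) (partialM i (D _ sg) (D _ sci)).
  ring.
have e1 : \sum_i (B *m x) i 0 * partial i (fun y => g y * chi e y) x =
   chi e x * (\sum_i (B *m x) i 0 * partial i g x) + e * (g x * (\sum_i (B *m x) i 0 * (beta 1 (e * sq x) * (2 * x i 0)))).
  set b1 := beta 1 _; rewrite !mulr_sumr -big_split/=; apply: eq_bigr => i _.
  by rewrite d1 partial_chi /= -/b1; ring.
have e2 : \sum_i partial i (partial i (fun y => g y * chi e y)) x =
   chi e x * (\sum_i partial i (partial i g) x) + e * (2 * \sum_i partial i g x * (beta 1 (e * sq x) * (2 * x i 0))) +
   e * (g x * \sum_i (e * (beta 2 (e * sq x) * (2 * x i 0) ^+ 2) + 2 * beta 1 (e * sq x))).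
  set b1 := beta 1 _; set b2 := beta 2 _; rewrite !mulr_sumr -!big_split/=; apply: eq_bigr => i _.
  by rewrite d2 partial2_chi partial_chi /= -/b1 -/b2; ring.
rewrite /kolmogorov e1 e2 /cutoff_rest; ring.
Qed.

Lemma chi_bound : exists2 C : R, 0 <= C & forall e x, `|chi e x| <= C.
Proof. by have [C C0 H] := beta_bound 0; exists C => // e x; exact: H. Qed.

Lemma cutoff_rest_bound B g : tempered g -> (forall i, tempered (partial i g)) ->
  exists2 T : E -> R, tempered T & forall e x, 0 <= e <= 1 -> `|cutoff_rest B g e x| <= T x.
Proof.
move=> tg tdg; have [C1 C10 H1] := beta_bound 1; have [C2 C20 H2] := beta_bound 2.
have tx i : tempered (fun x : E => `|2 * x i 0|).
  by apply: tempered_norm; apply: temperedZ; exact: tempered_coord.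
have tx2 i : tempered (fun x : E => (2 * x i 0) ^+ 2).
  by under eq_fun do rewrite expr2; apply: temperedM; apply: temperedZ; exact: tempered_coord.
exists (fun x => `|g x| * (\sum_i `|(B *m x) i 0| * (C1 * `|2 * x i 0|) +
    \sum_i (C2 * (2 * x i 0) ^+ 2 + 2 * C1)) +
  2 * \sum_i `|partial i g x| * (C1 * `|2 * x i 0|)).
  apply: temperedD; last first.
    by apply: temperedZ; apply: tempered_sum => i; apply: temperedM; [exact: tempered_norm|exact: temperedZ].
  apply: temperedM; first exact: tempered_norm.
  apply: temperedD; apply: tempered_sum => i.
    by apply: temperedM; [apply: tempered_norm; exact: tempered_mulmx|exact: temperedZ].
  by apply: temperedD; [exact: temperedZ|exact: tempered_cst].
move=> e x /andP[e0 e1]; rewrite /cutoff_rest.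
apply: le_trans (ler_normD _ _) _; apply: lerD.
  rewrite normrM ler_wpM2l//; apply: le_trans (ler_normD _ _) _; rewrite normrN.
  apply: lerD; apply: le_trans (ler_norm_sum _ _ _) _; apply: ler_sum => i _.
    by rewrite normrM ler_wpM2l// normrM ler_wpM2r.
  apply: le_trans (ler_normD _ _) _; apply: lerD; last first.
    by rewrite normrM ger0_norm// ler_wpM2l.
  rewrite normrM [`|e|]ger0_norm// normrM [`|_ ^+ 2|]ger0_norm ?sqr_ge0//.
  rewrite -[leRHS]mul1r; apply: ler_pM => //; first by rewrite mulr_ge0 ?sqr_ge0.
  by rewrite ler_wpM2r ?sqr_ge0.
rewrite normrM ger0_norm// ler_wpM2l//.
apply: le_trans (ler_norm_sum _ _ _) _; apply: ler_sum => i _.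
by rewrite normrM ler_wpM2l// normrM ler_wpM2r.
Qed.

Lemma chi_cvg x : (fun k => chi (k.+1%:R^-1) x) @ \oo --> (1 : R).
Proof.
have b0 : beta 0 0 = 1.
  by rewrite /beta /= /bump ltr01 subr0 invr1 -polyC1 hornerC mul1r -expRD subrr expR0.
have C : beta 0 s @[s --> (0 : R)] --> beta 0 0.
  apply/differentiable_continuous/derivable1_diffP.
  exact: (@ex_derive _ _ _ _ _ _ _ (beta_derive 0 0)).
have H : (fun k : nat => k.+1%:R^-1 * sq x) @ \oo --> (0 : R).
  by rewrite -[X in _ --> X](mul0r (sq x)); apply: cvgMl; exact: cvg_harmonic.
by rewrite b0 in C; exact: cvg_comp H C.
Qed.

Lemma chi_support e : 0 < e -> exists r : R, forall x, chi e x != 0 -> forall i, `|x i 0| <= r.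
Proof.
move=> e0; exists (1 + e^-1) => x + i; rewrite /chi /beta /bump.
case: ifPn => [s1 _|_]; last by rewrite mulr0 eqxx.
have xi : x i 0 ^+ 2 <= e^-1.
  apply: (@le_trans _ _ (sq x)).
    rewrite /sq (bigD1 i)//= expr2 lerDl; apply: sumr_ge0 => j _.
    by rewrite -expr2 sqr_ge0.
  by rewrite -[leRHS]mul1r ler_pdivlMr// mulrC ltW.
have := sqr_ge0 (`|x i 0| - 1); rewrite -[x i 0 ^+ 2]real_normK ?num_real// in xi *.
have := normr_ge0 (x i 0); have : 0 < e^-1 by rewrite invr_gt0.
move: xi; set a := `|_|; set b := e^-1; nra.
Qed.

Lemma test_function_chi g e : smooth g -> 0 < e -> test_function (fun x => g x * chi e x).
Proof.
move=> sg e0; split; first by apply: smoothM => //; exact: smooth_chi.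
have [r Hr] := chi_support e0; apply: compact_supportP; exists r => x gx.
by apply: Hr; apply: contra_neq gx => ->; rewrite mulr0.
Qed.

End cutoff.

(** * The Langevin operator on Hermite coefficients *)

Section langevin_coefficients.
Context {R : realType} {N : nat}.
Local Notation E := 'cV[R]_N.
Local Notation fct := (E -> R[i]).
Local Notation re u := (fun x => complex.Re (u x)).
Local Notation im u := (fun x => complex.Im (u x)).
Implicit Types (x : E) (w : seq 'I_N) (u f : fct) (h g : E -> R).
Variables (S A J : 'M[R]_N).
Hypotheses (SA : S = A^T *m A) (Aunit : A \in unitmx) (Janti : antisymmetric_mx J).
Let psi := @psi_inf R N S.
Hypothesis Ipsi : \int[@lebesgue_cV R N]_x psi x = 1.
Local Notation ipp := (ip psi).
Local Notation coef := (hcoef S A).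
Local Notation herm := (herm A).
Local Notation y x i := ((A *m x) i 0).

Let mpsi : measurable_fun setT psi := measurable_psi SA.
Let psi0 x : 0 < psi x := psi_gt0 SA Aunit x.
Let rpsi : rapid psi := rapid_psi SA Aunit.

(** The drift of L_{-J} in the coordinates y. Coefficients of L_J u are computed by moving the
    operator onto Hermite functions, and the adjoint of L_J in L2(psi_inf) is L_{-J}; hence 1 - J
    for coefficients of L_J. *)
Definition hdrift : 'M[R]_N := A *m (1%:M - J) *m A^T.

Local Notation G := hdrift.
Local Notation Q := (A *m A^T).
Local Notation K := (kolmogorov (drift S (- J))).

Let hdriftE : G = Q - A *m J *m A^T.
Proof. by rewrite /hdrift mulmxBr mulmx1 mulmxBl. Qed.

Let anti_AJA : (A *m J *m A^T)^T = - (A *m J *m A^T).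
Proof. by rewrite !trmx_mul trmxK Janti mulNmx mulmxN mulmxA. Qed.

Let anti_sum (X : 'M[R]_N) (c : 'I_N -> 'I_N -> R) : X^T = - X ->
  (forall i j, c i j = c j i) -> \sum_i \sum_j X i j * c i j = 0.
Proof.
move=> aX sc; set s := \sum_i _; suff : s = - s by move=> h; lra.
rewrite /s {1}exchange_big/= -sumrN; apply: eq_bigr => i _; rewrite -sumrN; apply: eq_bigr => j _.
by rewrite sc -mulNr; congr (_ * _); rewrite -[X j i]/(X j i) -(mxE trmx_key (fun i j => X j i)) -/(trmx X) aX mxE.
Qed.

(** Antisymmetric matrices are orthogonal to symmetric ones. So H may replace A A^T in second-order
    terms, and its quadratic form and trace do not depend on J. *)
Lemma hdrift_sum (c : 'I_N -> 'I_N -> R) : (forall i j, c i j = c j i) ->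
  \sum_i \sum_j G i j * c i j = \sum_i \sum_j Q i j * c i j.
Proof.
move=> sc; transitivity (\sum_i \sum_j Q i j * c i j - \sum_i \sum_j (A *m J *m A^T) i j * c i j); last first.
  by rewrite [X in _ - X](anti_sum anti_AJA sc) subr0.
rewrite -sumrB; apply: eq_bigr => i _.
rewrite -sumrB; apply: eq_bigr => j _; rewrite -mulrBl; congr (_ * _).
by rewrite hdriftE mxE [X in _ + X]mxE.
Qed.

Let AB x : A *m (drift S (- J) *m x) = G *m (A *m x).
Proof. by rewrite /drift SA /hdrift !mulmxA. Qed.

Let sum_mul (X : 'M[R]_N) i (z : E) : (X *m z) i 0 = \sum_j X i j * z j 0.
Proof. by rewrite mxE. Qed.

Let is_derive_hermE i w x : is_derive x (delta_mx i 0) (herm w) (\sum_j A j i * dherm A j w x).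
Proof.
apply: is_derive_eq (is_derive_herm A x _ w) _; apply: eq_bigr => j _.
by rewrite -colE mxE.
Qed.

Lemma partial_herm i w : partial i (herm w) = fun x => \sum_j A j i * dherm A j w x.
Proof. by apply/funext => x; apply: is_derive_partial; exact: is_derive_hermE. Qed.

Let partial2_herm i w x : partial i (partial i (herm w)) x =
  \sum_j \sum_k (A j i * A k i) * ((count_mem j w)%:R * dherm A k (rem j w) x).
Proof.
rewrite partial_herm; apply: is_derive_partial.
have H j := derZ (A j i) (derZ (count_mem j w)%:R (is_derive_hermE i (rem j w) x)).
apply: is_derive_eq (der_sum _ _ H) _; apply: eq_bigr => j _.
rewrite !mulr_sumr; apply: eq_bigr => k _; ring.
Qed.

Let dd_sym w x i j : (count_mem i w)%:R * dherm A j (rem i w) x = (count_mem j w)%:R * dherm A i (rem j w) x.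
Proof.
have [->//|ij] := eqVneq i j.
have hr : herm (rem j (rem i w)) x = herm (rem i (rem j w)) x.
  by apply: eq_bigr => k _; rewrite !count_mem_rem subnAC.
rewrite /dherm hr !count_mem_rem (negbTE ij) eq_sym (negbTE ij) !subn0; ring.
Qed.

(** In coordinates y the drift carries H and the Laplacian A A^T; second derivatives being
    symmetric, the latter may be replaced by H, and [dtens_herm] recognizes the sum. *)
Lemma kolmogorov_herm w x : K (herm w) x = dtens (- G) w (herm^~ x).
Proof.
rewrite dtens_herm /kolmogorov.
have -> : \sum_i (drift S (- J) *m x) i 0 * partial i (herm w) x =
   \sum_i \sum_j G i j * (y x j * dherm A i w x).
  rewrite (eq_bigr (fun i => \sum_j (drift S (- J) *m x) i 0 * (A j i * dherm A j w x))) => [|i _]; last first.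
    by rewrite partial_herm mulr_sumr.
  rewrite exchange_big/=; apply: eq_bigr => j _.
  transitivity ((A *m (drift S (- J) *m x)) j 0 * dherm A j w x).
    by rewrite sum_mul mulr_suml; apply: eq_bigr => i _; ring.
  by rewrite AB sum_mul mulr_suml; apply: eq_bigr => i _; rewrite mulrA.
have -> : \sum_i partial i (partial i (herm w)) x =
   \sum_i \sum_j G i j * ((count_mem i w)%:R * dherm A j (rem i w) x).
  rewrite hdrift_sum; last by move=> i j; exact: dd_sym.
  under eq_bigr do rewrite partial2_herm.
  rewrite exchange_big/=; apply: eq_bigr => j _; rewrite exchange_big/=; apply: eq_bigr => k _.
  rewrite -mulr_suml; congr (_ * _); rewrite mxE; apply: eq_bigr => i _.
  by rewrite [A^T _ _]mxE.
rewrite -sumrN -big_split/=; apply: eq_bigr => i _.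
rewrite -sumrN -big_split/=; apply: eq_bigr => j _; rewrite !mxE; ring.
Qed.

Lemma tempered_partial_herm i w : tempered (partial i (herm w)).
Proof.
rewrite partial_herm; apply: tempered_sum => j; apply: temperedZ.
exact: tempered_dherm.
Qed.

Lemma tempered_kolmogorov_herm w : tempered (K (herm w)).
Proof.
rewrite (_ : K (herm w) = fun x => dtens (- G) w (herm^~ x)); last first.
  by apply/funext => x; exact: kolmogorov_herm.
under eq_fun do rewrite dtens_herm; apply: tempered_sum => i; apply: tempered_sum => j.
apply: temperedZ; apply: temperedB; first by apply: temperedM; [exact: tempered_mulmx|exact: tempered_dherm].
by apply: temperedZ; exact: tempered_dherm.
Qed.

Lemma ip_kolmogorov_herm (r : E -> R) w : L2r psi r ->
  ipp r (K (herm w)) = dtens (- G) w (coef r).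
Proof.
move=> Lr; have Lh v : L2r psi (herm v) by exact: L2r_herm.
rewrite dtens_count; last exact: symm_coef.
rewrite ipC (_ : K (herm w) = fun x => \sum_i \sum_j ((count_mem i w)%:R * (- G) i j) * herm (j :: rem i w) x); last first.
  apply/funext => x; rewrite kolmogorov_herm dtens_count; last exact: symm_herm.
  by apply: eq_bigr => i _; apply: eq_bigr => j _; rewrite mulrA.
rewrite (ip_suml mpsi psi0)// => [|i]; last by apply: L2r_sum => // j; exact: L2rZ.
apply: eq_bigr => i _; rewrite (ip_suml mpsi psi0)// => [|j]; last exact: L2rZ.
by apply: eq_bigr => j _; rewrite ipZl// ipC mulrA.
Qed.

Let partial_psi i x : is_derive x (delta_mx i 0) psi (- (S *m x) i 0 * psi x).
Proof.
apply: is_derive_eq (is_derive_psi SA x _) _; congr (- _ * _).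
rewrite SA -mulmxA sum_mul; apply: eq_bigr => k _.
by rewrite -colE !mxE mulrC.
Qed.

Let trJS : \sum_i (J *m S) i i = 0.
Proof.
rewrite -[LHS]/(\tr (J *m S)); suff : \tr (J *m S) = - \tr (J *m S) by move=> h; lra.
by rewrite -{1}mxtrace_tr trmx_mul Janti SA trmx_mul trmxK mulmxN raddfN/= mxtrace_mulC.
Qed.

Let sJs x : \sum_i (S *m x) i 0 * (J *m (S *m x)) i 0 = 0.
Proof.
transitivity (\sum_i \sum_j J i j * ((S *m x) i 0 * (S *m x) j 0)).
  apply: eq_bigr => i _; rewrite [(J *m _) i 0]sum_mul mulr_sumr; apply: eq_bigr => j _; ring.
by apply: anti_sum => // i j; rewrite mulrC.
Qed.

(** The duality of L_J and L_{-J} in L2(psi_inf). The flux of psi_inf reduces to its rotational part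
    J S x psi_inf, which is divergence free because tr(J S) = 0 and S x is orthogonal to J S x. *)
Lemma fokker_planck_psi h x : smooth h ->
  fokker_planck (drift S J) (fun z => h z * psi z) x = psi x * K h x.
Proof.
move=> sh; rewrite /fokker_planck.
have js z i : (drift S J *m z) i 0 = (S *m z) i 0 + (J *m S *m z) i 0.
  by rewrite /drift mulmxDl mul1mx mulmxDl mxE.
have flux i : (fun z => (drift S J *m z) i 0 * (h z * psi z) + partial i (fun z => h z * psi z) z) =
    (fun z => psi z * (partial i h z + h z * (J *m S *m z) i 0)).
  apply/funext => z; rewrite (is_derive_partial (derM (smooth_is_derive i z sh) (partial_psi i z))) js; ring.
have D i : partial i (fun z => psi z * (partial i h z + h z * (J *m S *m z) i 0)) x =
    psi x * (partial i (partial i h) x + h x * (J *m S) i i + partial i h x * (J *m S *m x) i 0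
     - (S *m x) i 0 * partial i h x) - psi x * h x * ((S *m x) i 0 * (J *m (S *m x)) i 0).
  have H1 := derM (smooth_is_derive i x sh) (is_derive_mulmx (J *m S) i x (delta_mx i 0)).
  have H2 := derD (smooth_is_derive i x (smooth_partial i sh)) H1.
  rewrite (is_derive_partial (derM (partial_psi i x) H2)) -colE [col _ _ _ _]mxE !mulmxA; ring.
under eq_bigr do rewrite flux D.
rewrite sumrB -mulr_sumr -[X in _ - X]mulr_sumr sJs mulr0 subr0; congr (_ * _).
rewrite sumrB big_split/= big_split/= -mulr_sumr trJS mulr0 addr0 /kolmogorov -addrA addrC; congr (_ + _).
rewrite -sumrB -sumrN; apply: eq_bigr => i _.
have -> : (drift S (- J) *m x) i 0 = (S *m x) i 0 - (J *m S *m x) i 0.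
  by rewrite /drift mulmxDl mul1mx mulmxDl mulNmx mulNmx !mxE.
ring.
Qed.

Lemma chi_ip_cvg (r g : E -> R) : L2r psi r -> tempered g ->
  (fun k => ipp r (fun x => g x * chi (k.+1%:R^-1) x)) @ \oo --> ipp r g.
Proof.
move=> Lr tg; have [C C0 HC] := @chi_bound R N.
have ig := itgZ C (integrable_abse (itg_ip mpsi psi0 Lr (tempered_L2r mpsi rpsi tg))).
have mr : measurable_fun setT r := L2r_measurable Lr.
have mg : measurable_fun setT g := tempered_measurable tg.
have mchi k : measurable_fun setT (@chi R N (k.+1%:R^-1)).
  by apply: continuous_measurable_cV; apply: smooth_continuous; exact: smooth_chi.
apply: (@Int_dominated_cvg _ _ (fun k x => r x * (g x * chi (k.+1%:R^-1) x) * psi x) _ _ _ _ ig).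
- by move=> k; apply: measurable_funM => //; apply: measurable_funM => //; exact: measurable_funM.
- by apply: measurable_funM => //; exact: measurable_funM.
- move=> x; apply: cvgMl; apply: cvgMr; rewrite -[X in _ --> X]mulr1; apply: cvgMr; exact: chi_cvg.
- move=> k x; rewrite (_ : r x * _ * _ = chi (k.+1%:R^-1) x * (r x * g x * psi x)); last by ring.
  by rewrite normrM ler_wpM2r.
Qed.

Let e01 k : 0 <= (k.+1%:R^-1 : R) <= 1.
Proof. by rewrite invr_ge0 ler0n/= invf_le1// ler1n. Qed.

(** By [kolmogorov_cutoff] the difference is a factor chi tending to 1 plus 1 / (k + 1) times a
    tempered remainder. It lets Hermite functions replace compactly supported test functions. *)
Lemma kolmogorov_chi_cvg (B : 'M[R]_N) (r g : E -> R) : L2r psi r -> smooth g ->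
  tempered g -> (forall i, tempered (partial i g)) -> tempered (kolmogorov B g) ->
  (fun k => ipp r (kolmogorov B (fun x => g x * chi (k.+1%:R^-1) x))) @ \oo --> ipp r (kolmogorov B g).
Proof.
move=> Lr sg tg tdg tK; have [C C0 HC] := @chi_bound R N.
have [T tT HT] := cutoff_rest_bound B tg tdg.
have sgk k : smooth (fun x => g x * chi (k.+1%:R^-1) x) by apply: smoothM => //; exact: smooth_chi.
have mK (f : E -> R) : smooth f -> measurable_fun setT (kolmogorov B f).
  move=> sf; apply: measurable_funD; [apply: measurable_funN|]; apply: measurable_sum => i.
    apply: measurable_funM; first exact: tempered_measurable (tempered_mulmx B i).
    by apply: continuous_measurable_cV; apply: smooth_continuous; exact: smooth_partial.
  by apply: continuous_measurable_cV; apply: smooth_continuous; do 2 apply: smooth_partial.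
have tG : tempered (fun x => C * `|kolmogorov B g x| + `|T x|).
  by apply: temperedD; [apply: temperedZ|]; exact: tempered_norm.
have ig := integrable_abse (itg_ip mpsi psi0 Lr (tempered_L2r mpsi rpsi tG)).
have mr : measurable_fun setT r := L2r_measurable Lr.
apply: (@Int_dominated_cvg _ _ (fun k x => r x * kolmogorov B (fun x => g x * chi (k.+1%:R^-1) x) x * psi x) _ _ _ _ ig).
- by move=> k; apply: measurable_funM => //; apply: measurable_funM => //; exact: mK.
- by apply: measurable_funM => //; apply: measurable_funM => //; exact: mK.
- move=> x; apply: cvgMl; apply: cvgMr.
  rewrite (_ : (fun k => _) = (fun k => chi (k.+1%:R^-1) x * kolmogorov B g x + k.+1%:R^-1 * cutoff_rest B g (k.+1%:R^-1) x)); last first.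
    by apply/funext => k; exact: kolmogorov_cutoff.
  rewrite -[X in _ --> X]addr0; apply: cvgD.
    by rewrite -[X in _ --> X]mul1r; apply: cvgMl; exact: chi_cvg.
  apply: norm_cvg0; apply: (@squeeze_cvgr _ _ _ _ (fun=> 0) (fun k => k.+1%:R^-1 * T x)).
  - apply: nearW => k; rewrite normr_ge0/= normrM ger0_norm ?invr_ge0// ler_wpM2l ?invr_ge0//.
    exact: HT.
  - exact: cvg_cst.
  - by rewrite -[X in _ --> X](mul0r (T x)); apply: cvgMl; exact: cvg_harmonic.
- move=> k x; rewrite kolmogorov_cutoff// !normrM ler_wpM2r// ler_wpM2l//.
  rewrite [leRHS]ger0_norm ?addr_ge0 ?mulr_ge0//.
  apply: le_trans (ler_normD _ _) _; apply: lerD; first by rewrite normrM ler_wpM2r.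
  rewrite normrM ger0_norm ?invr_ge0//; apply: le_trans (le_trans (HT _ x (e01 k)) (ler_norm _)).
  by rewrite -[leRHS]mul1r ler_wpM2r//; have /andP[] := e01 k.
Qed.

Let intC_psi u (g p : E -> R) : (forall x, p x = psi x * g x) ->
  intC (fun x => u x * (p x)%:C%C) = (ipp (re u) g +i* ipp (im u) g)%C.
Proof.
move=> pg; rewrite /intC; congr (_ +i* _)%C; apply: eq_Rintegral => x _.
  rewrite cReM /= mulr0 subr0 pg; ring.
rewrite cImM /= mulr0 add0r pg; ring.
Qed.

(** The distributional identity is tested with Hermite functions times psi_inf, cut off; duality
    gives L_{-J} on the Hermite function, and the cutoff is then removed. *)
Lemma coef_of_L_graph u f : L_graph S J u f -> coef_graph S A (- G) u f.
Proof.
move=> [Lu Lf H]; split=> // w; have /(L2P mpsi psi0)[a b] := Lu; have /(L2P mpsi psi0)[c d] := Lf.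
all: have Hk k : ipp (re u) (K (fun x => herm w x * chi (k.+1%:R^-1) x)) = ipp (re f) (fun x => herm w x * chi (k.+1%:R^-1) x) /\
     ipp (im u) (K (fun x => herm w x * chi (k.+1%:R^-1) x)) = ipp (im f) (fun x => herm w x * chi (k.+1%:R^-1) x).
1,3: have e0 : 0 < (k.+1%:R^-1 : R) by rewrite invr_gt0.
1,2: have := test_function_chi (smoothM (smooth_herm A w) (smooth_psi SA)) e0.
1,2: set phi := (fun x => _) => tphi; have := H _ tphi.
1,2: have shc : smooth (fun x => herm w x * chi (k.+1%:R^-1) x) by apply: smoothM; [exact: smooth_herm|exact: smooth_chi].
1,2: have phiE : phi = fun x => (herm w x * chi (k.+1%:R^-1) x) * psi x by apply/funext => x; rewrite /phi mulrAC.
1,2: rewrite (intC_psi u (g := K (fun x => herm w x * chi (k.+1%:R^-1) x))); last by move=> x; rewrite phiE fokker_planck_psi.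
1,2: rewrite (intC_psi f (g := fun x => herm w x * chi (k.+1%:R^-1) x)); last by move=> x; rewrite phiE mulrC.
1,2: by case.
all: rewrite -ip_kolmogorov_herm//.
all: have cv (r s : E -> R) (Lr : L2r psi r) (Ls : L2r psi s) (rs : forall k, ipp r (K (fun x => herm w x * chi (k.+1%:R^-1) x)) = ipp s (fun x => herm w x * chi (k.+1%:R^-1) x)) : coef s w = ipp r (K (herm w)).
1,3: have c1 := chi_ip_cvg Ls (tempered_herm A w).
1,2: have c2 := kolmogorov_chi_cvg (B := drift S (- J)) Lr (smooth_herm A w) (tempered_herm A w) (fun i => tempered_partial_herm i w) (tempered_kolmogorov_herm w).
1,2: have ee : (fun k => ipp r (K (fun x => herm w x * chi (k.+1%:R^-1) x))) = (fun k => ipp s (fun x => herm w x * chi (k.+1%:R^-1) x)) by apply/funext.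
1,2: rewrite ee in c2; rewrite /hcoef -(cvg_lim (@norm_hausdorff _ _) c1).
1,2: exact: (cvg_lim (@norm_hausdorff _ _) c2).
  by apply: cv => // k; have [] := Hk k.
by apply: cv => // k; have [] := Hk k.
Qed.

Section test_functions.
Variable h : E -> R.
Hypotheses (sh : smooth h) (th : tempered h) (tdh : forall i, tempered (partial i h))
  (tddh : forall i j, tempered (partial i (partial j h))).

Let fr i (g : E -> R) x : R := \sum_k invmx A k i * partial k g x.

Let derive_frame i (g : E -> R) x : smooth g -> is_derive x (frame A i) g (fr i g x).
Proof.
move=> sg; apply: DeriveDef; first exact/diff_derivable/smooth_differentiable.
have dg := smooth_differentiable x sg.
rewrite deriveE//= {1}(_ : frame A i = \sum_k invmx A k i *: delta_mx k 0).
  rewrite linear_sum/=; apply: eq_bigr => k _; rewrite linearZ/= /partial deriveE//.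
apply/colP => k; rewrite summxE (bigD1 k)//= big1 => [|j jk]; last first.
  by rewrite !mxE eq_sym (negbTE jk)/= mulr0.
by rewrite /frame -colE !mxE !eqxx/= mulr1 addr0.
Qed.

Let partial_frame i (g : E -> R) x : partial i g x = \sum_j A j i * fr j g x.
Proof.
rewrite /fr; under eq_bigr do rewrite mulr_sumr.
rewrite exchange_big/= (bigD1 i)//= [X in _ + X]big1 ?addr0 => [|k ki].
  rewrite (eq_bigr (fun j => invmx A i j * A j i * partial i g x)) => [|j _]; last by ring.
  by rewrite -mulr_suml; have := mulVmx Aunit => /matrixP/(_ i i); rewrite !mxE eqxx => ->; rewrite mul1r.
rewrite (eq_bigr (fun j => invmx A k j * A j i * partial k g x)) => [|j _]; last by ring.
by rewrite -mulr_suml; have := mulVmx Aunit => /matrixP/(_ k i); rewrite !mxE (negbTE ki) => ->; rewrite mul0r.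
Qed.

Let tfr i : tempered (fr i h).
Proof. by apply: tempered_sum => k; exact: temperedZ. Qed.

Let coef_fr i w : coef (fr i h) w = coef h (i :: w).
Proof.
by apply/esym; apply: (ip_herm_cons SA Aunit w th (tfr i)) => x; exact: derive_frame.
Qed.

Let Lt (g : E -> R) : tempered g -> L2r psi g.
Proof. by move=> tg; exact: tempered_L2r. Qed.

Let ip_laplacian w : ipp (fun x => \sum_i partial i (partial i h) x) (herm w) =
  \sum_i \sum_j Q i j * coef h (i :: j :: w).
Proof.
rewrite (ip_suml mpsi psi0) => [|i|]; [|exact: Lt|exact: L2r_herm].
transitivity (\sum_i \sum_j \sum_k (A j i * A k i) * coef h (k :: j :: w)).
  apply: eq_bigr => i _.
  have tf j : tempered (fr j (partial i h)) by apply: tempered_sum => k; exact: temperedZ.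
  rewrite (_ : partial i (partial i h) = fun x => \sum_j A j i * fr j (partial i h) x); last first.
    by apply/funext => x; exact: partial_frame.
  rewrite (ip_suml mpsi psi0) => [|j|]; [|by apply: L2rZ; exact: Lt|exact: L2r_herm].
  apply: eq_bigr => j _; rewrite ipZl//; [|exact: Lt|exact: L2r_herm].
  have -> : ipp (fr j (partial i h)) (herm w) = ipp (partial i h) (herm (j :: w)).
    by apply/esym; apply: (ip_herm_cons SA Aunit w (tdh i) (tf j)) => x; apply: derive_frame; exact: smooth_partial.
  rewrite (_ : partial i h = fun x => \sum_k A k i * fr k h x); last first.
    by apply/funext => x; exact: partial_frame.
  rewrite (ip_suml mpsi psi0) => [|k|]; [|by apply: L2rZ; exact: Lt|exact: L2r_herm].
  rewrite mulr_sumr; apply: eq_bigr => k _; rewrite ipZl//; [|exact: Lt|exact: L2r_herm].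
  by rewrite -/(hcoef S A (fr k h) (j :: w)) coef_fr mulrA.
rewrite exchange_big/= [RHS]exchange_big/=; apply: eq_bigr => j _.
rewrite exchange_big/=; apply: eq_bigr => k _.
rewrite -mulr_suml; congr (_ * _); rewrite mxE; apply: eq_bigr => i _.
by rewrite [A^T _ _]mxE mulrC.
Qed.

Let ip_drift w : ipp (fun x => \sum_i (drift S (- J) *m x) i 0 * partial i h x) (herm w) =
  \sum_i \sum_j G i j * (coef h (i :: j :: w) + (count_mem j w)%:R * coef h (i :: rem j w)).
Proof.
rewrite (_ : (fun x => _) = fun x => \sum_i \sum_j G i j * (y x j * fr i h x)); last first.
  apply/funext => x.
  rewrite (eq_bigr (fun i => \sum_j (drift S (- J) *m x) i 0 * (A j i * fr j h x))) => [|i _]; last first.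
    by rewrite partial_frame mulr_sumr.
  rewrite exchange_big/=; apply: eq_bigr => j _.
  transitivity ((A *m (drift S (- J) *m x)) j 0 * fr j h x).
    by rewrite sum_mul mulr_suml; apply: eq_bigr => i _; ring.
  by rewrite AB sum_mul mulr_suml; apply: eq_bigr => i _; rewrite mulrA.
have ty i j : tempered (fun x => y x j * fr i h x).
  by apply: temperedM => //; exact: tempered_mulmx.
rewrite (ip_suml mpsi psi0) => [|i|]; [|by apply: L2r_sum => // j; apply: L2rZ; exact: Lt|exact: L2r_herm].
apply: eq_bigr => i _.
rewrite (ip_suml mpsi psi0) => [|j|]; [|by apply: L2rZ; exact: Lt|exact: L2r_herm].
apply: eq_bigr => j _; rewrite ipZl//; [|exact: Lt|exact: L2r_herm].
congr (_ * _); rewrite -!coef_fr.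
transitivity (ipp (fun x => herm (j :: w) x + (count_mem j w)%:R * herm (rem j w) x) (fr i h)).
  by rewrite /ip; apply: eq_Rintegral => x _; rewrite herm_cons /dherm; ring.
rewrite ipDl//; [|exact: L2r_herm|by apply: L2rZ; exact: L2r_herm|exact: Lt].
rewrite ipZl//; [|exact: L2r_herm|exact: Lt].
by rewrite ipC [ipp (herm (rem j w)) _]ipC.
Qed.

(** Derivatives of h shift its coefficients and multiplication by y_j also lowers them. With A A^T
    replaced by H, the terms with two added letters cancel between Laplacian and drift; what remains
    is the derivation of the transpose. *)
Lemma coef_kolmogorov w : coef (K h) w = dtens (- G^T) w (coef h).
Proof.
have t1 : tempered (fun x => \sum_i (drift S (- J) *m x) i 0 * partial i h x).
  by apply: tempered_sum => i; apply: temperedM => //; exact: tempered_mulmx.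
have t2 : tempered (fun x => \sum_i partial i (partial i h) x) by exact: tempered_sum.
rewrite dtens_count; last exact: symm_coef.
have -> : coef (K h) w = ipp (fun x => \sum_i partial i (partial i h) x) (herm w) -
    ipp (fun x => \sum_i (drift S (- J) *m x) i 0 * partial i h x) (herm w).
  rewrite -ipBl//; [|exact: Lt|exact: Lt|exact: L2r_herm].
  by congr ipp; apply/funext => x; rewrite /kolmogorov addrC.
rewrite ip_laplacian ip_drift -hdrift_sum; last first.
  move=> i j; apply: symm_coef; apply/permP => a /=; exact: addnCA.
rewrite -sumrB [RHS]exchange_big/=; apply: eq_bigr => i _.
rewrite -sumrB; apply: eq_bigr => j _; rewrite !mxE; ring.
Qed.

End test_functions.

Lemma wsum_dtens_tr n M (a b : seq 'I_N -> R) :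
  wsum n (fun w => a w * dtens M^T w b) = wsum n (fun w => dtens M w a * b w).
Proof.
elim: n a b => [|n IH] a b /=; first by rewrite mulr0 mul0r.
under eq_bigr => i _ do under eq_wsum do rewrite mulrDr.
under eq_bigr => i _ do rewrite wsumD IH.
under [RHS]eq_bigr => i _ do under eq_wsum do rewrite mulrDl.
under [RHS]eq_bigr => i _ do rewrite wsumD.
rewrite !big_split/=; congr (_ + _).
under eq_bigr => i _ do under eq_wsum do rewrite mulr_sumr.
under eq_bigr => i _ do rewrite wsum_sum.
under [RHS]eq_bigr => i _ do under eq_wsum do rewrite mulr_suml.
under [RHS]eq_bigr => i _ do rewrite wsum_sum.
rewrite exchange_big/=; apply: eq_bigr => j _; apply: eq_bigr => i _.
by apply: eq_wsum => w _; rewrite mxE; ring.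
Qed.

Lemma smooth_psiV : smooth (fun x => (psi x)^-1).
Proof.
pose c : R := Num.sqrt (\det S) / (2 * pi) `^ (N%:R / 2).
rewrite (_ : (fun x => _) = fun x => c^-1 * expR (2^-1 * \sum_i y x i * y x i)); last first.
  apply/funext => x; rewrite /psi (psiE SA) invfM -expRN; congr (_ * expR _).
  rewrite (eq_bigr (fun i => y x i * y x i)) => [|i _]; last by rewrite expr2.
  ring.
apply: smoothZ; apply: (@smooth_comp _ _ (fun _ : nat => @expR R)).
by apply: smoothZ; apply: smooth_sum => i; apply: smoothM; exact: smooth_mulmx.
Qed.

Lemma partial_support (g : E -> R) (r : R) i : (forall x, g x != 0 -> forall i, `|x i 0| <= r) ->
  forall x, partial i g x != 0 -> forall i, `|x i 0| <= r.
Proof.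
move=> gr x gx j; rewrite leNgt; apply: contra gx => rx; apply/eqP; apply: is_derive_partial.
have cj : (fun z : E => `|z j 0|) @ x --> `|x j 0|.
  have c := smooth_continuous (@smooth_coord R N j).
  exact: (cvg_norm (c x)).
have nz : \forall z \near x, g z = 0.
  apply: filterS (cvgr_gt _ cj _ rx) => z rz; apply/eqP; apply/negPn/negP => /gr/(_ j).
  by rewrite leNgt rz.
apply: (@near_eq_is_derive _ _ _ (fun=> 0)).
by apply: filterS nz => z ->.
Qed.

Lemma tempered_of_support (g : E -> R) (r : R) : smooth g ->
  (forall x, g x != 0 -> forall i, `|x i 0| <= r) -> tempered g.
Proof.
move=> sg gr; have cg := smooth_continuous sg.
split; first exact: continuous_measurable_cV.
have := continuous_compact (continuous_subspaceT cg) (@compact_box R N r).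
move=> /compact_bounded[M [_ HM]]; exists (`|M| + 1), 0 => x; rewrite mul0r expR0 mulr1.
have [->|gx] := eqVneq (g x) 0; first by rewrite normr0 addr_ge0.
apply: (HM (`|M| + 1)); first by rewrite (le_lt_trans (ler_norm M))// ltrDl.
by exists x => //; exact: gr.
Qed.

(** A test function is h psi_inf with h smooth of bounded support, so Parseval's identity for the
    pairs (u, L_{-J} h) and (f, h) reduces the claim to moving the transposed derivation across a
    finite sum, degree by degree. *)
Lemma L_graph_of_coef u f : coef_graph S A (- G) u f -> L_graph S J u f.
Proof.
move=> [Lu Lf hr hi]; split=> // phi tphi; have [sphi _] := tphi.
have /(L2P mpsi psi0)[a b] := Lu; have /(L2P mpsi psi0)[c d] := Lf.
pose h x := phi x * (psi x)^-1.
have [r Hr] := test_function_support tphi.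
have sh : smooth h by apply: smoothM => //; exact: smooth_psiV.
have h0 x : h x != 0 -> forall i, `|x i 0| <= r.
  by move=> hx; apply: Hr; apply: contra_neq hx => p0; rewrite /h p0 mul0r.
have th : tempered h by exact: tempered_of_support h0.
have tdh i : tempered (partial i h) by apply: tempered_of_support (partial_support h0); exact: smooth_partial.
have tddh i j : tempered (partial i (partial j h)).
  by apply: tempered_of_support (partial_support (partial_support h0)); do 2 apply: smooth_partial.
have phiE : phi = fun x => h x * psi x by apply/funext => x; rewrite /h mulfVK// gt_eqF.
rewrite (intC_psi u (g := K h)); last by move=> x; rewrite phiE fokker_planck_psi.
rewrite (intC_psi f (g := h)); last by move=> x; rewrite phiE mulrC.
have tK : tempered (K h).
  apply: temperedD; [apply: temperedN|]; apply: tempered_sum => i; last exact: tddh.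
  by apply: temperedM => //; exact: tempered_mulmx.
have key (p q : E -> R) (Lp : L2r psi p) (Lq : L2r psi q) : (forall w, coef q w = dtens (- G) w (coef p)) -> ipp p (K h) = ipp q h.
  move=> pq.
  have c1 := parseval_ip SA Aunit Ipsi Lp (tempered_L2r mpsi rpsi tK).
  have c2 := parseval_ip SA Aunit Ipsi Lq (tempered_L2r mpsi rpsi th).
  have ee : (fun m => \sum_(0 <= n < m) (n`!%:R)^-1 * wsum n (fun w => coef (K h) w * coef p w)) =
      (fun m => \sum_(0 <= n < m) (n`!%:R)^-1 * wsum n (fun w => coef h w * coef q w)).
    apply/funext => m; apply: eq_bigr => n _; congr (_ * _).
    transitivity (wsum n (fun w => coef p w * dtens (- G)^T w (coef h))).
      apply: eq_wsum => w _; rewrite coef_kolmogorov// mulrC; congr (_ * dtens _ _ _).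
      by rewrite raddfN.
    by rewrite wsum_dtens_tr; apply: eq_wsum => w _; rewrite pq mulrC.
  rewrite ee in c1; rewrite -(cvg_lim (@norm_hausdorff _ _) c1).
  exact: (cvg_lim (@norm_hausdorff _ _) c2).
by rewrite (key _ _ a c hr) (key _ _ b d hi).
Qed.

Lemma L_graphE u f : L_graph S J u f <-> coef_graph S A (- G) u f.
Proof. by split; [exact: coef_of_L_graph|exact: L_graph_of_coef]. Qed.

End langevin_coefficients.

(** * The spectrum *)

Section spectrum.
Context {R : realType} {N : nat}.
Local Notation E := 'cV[R]_N.
Local Notation fct := (E -> R[i]).
Local Notation C := R[i].
Local Notation MC := (map_mx (real_complex R)).
Local Notation re u := (fun x => complex.Re (u x)).
Local Notation im u := (fun x => complex.Im (u x)).
Implicit Types (w : seq 'I_N) (u f : fct).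

Lemma real_eigenvector (H : 'M[R]_N) (r : C) : root (char_poly (MC H)) r ->
  exists a b : 'I_N -> R, [/\ 0 < \sum_i (a i ^+ 2 + b i ^+ 2),
    forall i, \sum_j H i j * a j = complex.Re r * a i - complex.Im r * b i &
    forall i, \sum_j H i j * b j = complex.Re r * b i + complex.Im r * a i].
Proof.
have -> : char_poly (MC H) = char_poly (MC H)^T.
  rewrite /char_poly -det_tr; congr (\det _); apply/matrixP => i j.
  by rewrite !mxE eq_sym.
rewrite -eigenvalue_root_char => /eigenvalueP[v vH v0].
have vE i : \sum_j (H i j)%:C%C * v 0 j = r * v 0 i.
  move/matrixP: vH => /(_ 0 i); rewrite !mxE => <-.
  by apply: eq_bigr => j _; rewrite !mxE mulrC.
exists (fun i => complex.Re (v 0 i)), (fun i => complex.Im (v 0 i)); split.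
- have [i vi] : exists i, v 0 i != 0.
    apply/existsP; apply: contraNT v0; rewrite negb_exists => /forallP h.
    by apply/eqP/rowP => i; rewrite mxE; apply/eqP; have := h i; rewrite negbK.
  rewrite (bigD1 i)//= ltr_wpDr//.
    by apply: sumr_ge0 => j _; rewrite addr_ge0 ?sqr_ge0.
  rewrite lt_neqAle addr_ge0 ?sqr_ge0// andbT eq_sym; apply: contra vi => /eqP h.
  by apply/eqP; exact: sqc_eq0.
- move=> i; rewrite -cReM -vE cRe_sum; apply: eq_bigr => j _.
  by rewrite cReM /= mul0r subr0.
- move=> i; rewrite -cImM -vE cIm_sum; apply: eq_bigr => j _.
  by rewrite cImM /= mul0r addr0.
Qed.

(** The real part of the q-weighted pairing of an eigenvector with its image; the terms with the
    imaginary part of r cancel. *)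
Lemma eigenvalue_weighted (H : 'M[R]_N) (q : 'I_N -> R) (r : C) : (forall i, 0 < q i) ->
  root (char_poly (MC H)) r ->
  exists a b : 'I_N -> R, 0 < \sum_i q i * (a i ^+ 2 + b i ^+ 2) /\
  \sum_i q i * a i * (\sum_j H i j * a j) + \sum_i q i * b i * (\sum_j H i j * b j) =
  complex.Re r * \sum_i q i * (a i ^+ 2 + b i ^+ 2).
Proof.
move=> q0 /real_eigenvector[a [b [ab0 Ha Hb]]]; exists a, b; split.
  rewrite lt_neqAle sumr_ge0 => [|i _]; last by rewrite mulr_ge0 ?addr_ge0 ?sqr_ge0// ltW.
  rewrite andbT eq_sym; apply: contraTneq ab0 => s0.
  rewrite big1 ?ltxx// => i _; apply/eqP.
  have : q i * (a i ^+ 2 + b i ^+ 2) == 0.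
    move/eqP: s0; rewrite psumr_eq0 => [/allP/(_ i (mem_index_enum i))//|j _].
    by rewrite mulr_ge0 ?addr_ge0 ?sqr_ge0// ltW.
  by rewrite mulf_eq0 gt_eqF.
rewrite -big_split/= mulr_sumr; apply: eq_bigr => i _; rewrite Ha Hb; ring.
Qed.

(** The real parts of the N roots sum to the trace, so the smallest is at most their mean. *)
Lemma exists_min_root (H : 'M[R]_N) : (0 < N)%N ->
  exists r : C, [/\ root (char_poly (MC H)) r,
    forall s, root (char_poly (MC H)) s -> complex.Re r <= complex.Re s &
    complex.Re r <= \tr H / N%:R].
Proof.
move=> N0; have [rs rsE] := closed_field_poly_normal (char_poly (MC H)).
rewrite (monicP (char_poly_monic _)) scale1r in rsE.
have srs : size rs = N.
  by have := size_char_poly (MC H); rewrite rsE size_prod_XsubC => -[].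
have trE : \sum_(s <- rs) complex.Re s = \tr H.
  have := char_poly_trace (MC H) N0; rewrite rsE -{1}srs coefPn_prod_XsubC ?srs -?lt0n// => /oppr_inj h.
  rewrite -cRe_sum h /mxtrace cRe_sum; apply: eq_bigr => i _; by rewrite mxE.
have [r rrs Hr] : exists2 r, r \in rs & forall s, s \in rs -> complex.Re r <= complex.Re s.
  have : (0 < size rs)%N by rewrite srs.
  elim: (rs) => [//|s l IH] _; case: l IH => [_|t l /(_ isT)[r rl Hr]].
    by exists s; [rewrite mem_head|move=> t; rewrite inE => /eqP ->].
  have [sr|rs'] := leP (complex.Re s) (complex.Re r).
    exists s; first by rewrite mem_head.
    by move=> t'; rewrite inE => /orP[/eqP ->//|/Hr]; exact: le_trans.
  exists r; first by rewrite inE rl orbT.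
  by move=> t'; rewrite inE => /orP[/eqP ->|/Hr//]; exact: ltW.
exists r; split.
- by rewrite rsE root_prod_XsubC.
- by move=> s; rewrite rsE root_prod_XsubC; exact: Hr.
rewrite ler_pdivlMr ?ltr0n// -trE.
have -> : complex.Re r * N%:R = \sum_(s <- rs) complex.Re r.
  by rewrite big_const_seq count_predT iter_addr_0 srs mulr_natr.
rewrite big_seq [leRHS]big_seq; apply: ler_sum => s; exact: Hr.
Qed.

Variables (S A J : 'M[R]_N).
Hypotheses (SA : S = A^T *m A) (Aunit : A \in unitmx) (Janti : antisymmetric_mx J).
Let psi := @psi_inf R N S.
Hypothesis Ipsi : \int[@lebesgue_cV R N]_x psi x = 1.
Local Notation ipp := (ip psi).
Local Notation coef := (hcoef S A).
Local Notation H := (hdrift A J).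
Local Notation G := (L_graph S J).
Local Notation norm := (L2norm psi).

Let mpsi : measurable_fun setT psi := measurable_psi SA.
Let psi0 x : 0 < psi x := psi_gt0 SA Aunit x.
Let rpsi : rapid psi := rapid_psi SA Aunit.

Lemma hdrift_form (x : 'I_N -> R) : \sum_i \sum_j x i * (H i j * x j) = \sum_k (\sum_i A i k * x i) ^+ 2.
Proof.
transitivity (\sum_i \sum_j H i j * (x i * x j)).
  by apply: eq_bigr => i _; apply: eq_bigr => j _; rewrite mulrCA.
rewrite hdrift_sum//; last by move=> i j; rewrite mulrC.
transitivity (\sum_i \sum_j \sum_k (A i k * x i) * (A j k * x j)).
  apply: eq_bigr => i _; apply: eq_bigr => j _; rewrite mxE mulr_suml.
  by apply: eq_bigr => k _; rewrite mxE; ring.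
under eq_bigr do rewrite exchange_big/=; rewrite exchange_big/=; apply: eq_bigr => k _.
rewrite expr2 mulr_suml; apply: eq_bigr => i _; rewrite mulr_sumr; exact: eq_bigr.
Qed.

(** The form of H at x is |A^T x|^2, and A^T is invertible; K is built from the squared entries of
    its inverse. *)
Lemma hdrift_coercive : exists2 l : R, 0 < l &
  forall x : 'I_N -> R, l * \sum_i x i ^+ 2 <= \sum_i \sum_j x i * (H i j * x j).
Proof.
pose B := (invmx A)^T; pose K := 1 + \sum_i \sum_k B i k ^+ 2.
have K0 : 0 < K.
  by rewrite ltr_wpDr//; do 2 (apply: sumr_ge0 => ? _); rewrite sqr_ge0.
exists K^-1; first by rewrite invr_gt0.
move=> x; rewrite mulrC ler_pdivrMr// hdrift_form.
pose y k := \sum_i A i k * x i; pose Y := \sum_k y k ^+ 2.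
have Y0 : 0 <= Y by apply: sumr_ge0 => k _; exact: sqr_ge0.
have xE i : x i = \sum_k B i k * y k.
  rewrite /y; under eq_bigr do rewrite mulr_sumr.
  rewrite exchange_big/= (bigD1 i)//= [X in _ + X]big1 ?addr0 => [|j ji].
    rewrite (eq_bigr (fun k => A i k * invmx A k i * x i)) => [|k _]; last by rewrite !mxE; ring.
    by rewrite -mulr_suml; have := mulmxV Aunit => /matrixP/(_ i i); rewrite !mxE eqxx => ->; rewrite mul1r.
  rewrite (eq_bigr (fun k => A j k * invmx A k i * x j)) => [|k _]; last by rewrite !mxE; ring.
  by rewrite -mulr_suml; have := mulmxV Aunit => /matrixP/(_ j i); rewrite !mxE (negbTE ji) => ->; rewrite mul0r.
have cs i : x i ^+ 2 <= (\sum_k B i k ^+ 2) * Y.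
  rewrite xE; have := @wsum_cauchy_schwarz R N 1 (fun w => B i (head i w)) (fun w => y (head i w)).
  by rewrite /nrm.
rewrite mulrDr mulr1; apply: (@le_trans _ _ (Y * \sum_i \sum_k B i k ^+ 2)); last by rewrite lerDr.
by rewrite mulrC mulr_suml; apply: ler_sum => i _; exact: cs.
Qed.

Lemma hdrift_ge0 (x : 'I_N -> R) : 0 <= \sum_i \sum_j x i * (H i j * x j).
Proof. by rewrite hdrift_form; apply: sumr_ge0 => k _; exact: sqr_ge0. Qed.

Lemma hdrift_le0 (x : 'I_N -> R) : \sum_i \sum_j x i * ((- H) i j * x j) <= 0.
Proof.
rewrite -oppr_ge0 -sumrN (_ : \sum_i _ = \sum_i \sum_j x i * (H i j * x j)); first exact: hdrift_ge0.
by apply: eq_bigr => i _; rewrite -sumrN; apply: eq_bigr => j _; rewrite [(- H) i j]mxE; ring.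
Qed.

Lemma root_gt0 (r : C) : root (char_poly (MC H)) r -> 0 < complex.Re r.
Proof.
have [l l0 Hl] := hdrift_coercive.
move=> /(@eigenvalue_weighted H (fun=> 1))[//|a [b [ab0 e]]].
have e' (x : 'I_N -> R) : \sum_i 1 * x i * (\sum_j H i j * x j) = \sum_i \sum_j x i * (H i j * x j).
  by apply: eq_bigr => i _; rewrite mul1r mulr_sumr.
rewrite !e' in e; rewrite -(pmulr_lgt0 _ ab0) -e.
apply: (@lt_le_trans _ _ (l * \sum_i a i ^+ 2 + l * \sum_i b i ^+ 2)); last exact: lerD.
rewrite -mulrDr mulr_gt0// -big_split/=.
by move: ab0; rewrite (eq_bigr (fun i => a i ^+ 2 + b i ^+ 2)) => [//|i _]; rewrite mul1r.
Qed.

Lemma tr_hdrift : \tr H = \tr (A *m A^T).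
Proof.
have sc (i j : 'I_N) : (i == j)%:R = (j == i)%:R :> R by rewrite eq_sym.
have := hdrift_sum A Janti sc.
have tE (X : 'M[R]_N) : \sum_i \sum_j X i j * (i == j)%:R = \tr X.
  apply: eq_bigr => i _; rewrite (bigD1 i)//= eqxx mulr1 big1 ?addr0// => j ji.
  by rewrite eq_sym (negbTE ji) mulr0.
by rewrite !tE.
Qed.

Let ccoef u w : C := (coef (re u) w +i* coef (im u) w)%C.

(** The resolvent equation of -L_J, decoupled into one finite-dimensional equation per degree. *)
Let graph_coef (z : C) u f : L2 psi u -> L2 psi f ->
  G u (fun x => - (f x + z * u x)) <->
  forall w, dtens (MC H) w (ccoef u) - z * ccoef u w = ccoef f w.
Proof.
move=> Lu Lf; have /(L2P mpsi psi0)[a b] := Lu; have /(L2P mpsi psi0)[c d] := Lf.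
have reE : re (fun x => - (f x + z * u x)) = (fun x => - complex.Re z * complex.Re (u x) + complex.Im z * complex.Im (u x) + (-1) * complex.Re (f x)).
  by apply/funext => x; rewrite !cE; ring.
have imE : im (fun x => - (f x + z * u x)) = (fun x => - complex.Re z * complex.Im (u x) + - complex.Im z * complex.Re (u x) + (-1) * complex.Im (f x)).
  by apply/funext => x; rewrite !cE; ring.
have Lfc := L2rZ (-1) c; have Lfd := L2rZ (-1) d.
rewrite (L_graphE SA Aunit Janti Ipsi); split=> [[_ _ h1 h2] w|h].
  have := h1 w; have := h2 w.
  rewrite reE imE !(coef_lin SA Aunit)// !(coefZ SA Aunit)// !dtens_oppmx.
  rewrite -(Re_dtens H w (ccoef u)) -(Im_dtens H w (ccoef u)).
  case: (dtens _ w (ccoef u)) => p q /=; case: z {reE imE h1 h2} => zr zi /= e1 e2.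
  by apply/eqP; rewrite eq_complex /=; apply/andP; split; apply/eqP; lra.
split=> //.
- apply/(L2P mpsi psi0); rewrite reE imE.
  split; (apply: L2rD => //; apply: L2rD => //; exact: L2rZ).
- move=> w; have := congr1 (fun z => complex.Re z) (h w).
  rewrite reE (coef_lin SA Aunit)// (coefZ SA Aunit)// dtens_oppmx.
  by rewrite !cE Re_dtens /=; lra.
- move=> w; have := congr1 (fun z => complex.Im z) (h w).
  rewrite imE (coef_lin SA Aunit)// (coefZ SA Aunit)// dtens_oppmx.
  by rewrite !cE Im_dtens /=; lra.
Qed.

(** An eigenvector of H, placed on words of length one, is a nonzero solution of the homogeneous
    resolvent equation, which contradicts the uniqueness required of a resolvent point. *)
Lemma eigenvalue_spectrum (z : C) : root (char_poly (MC H)) z ->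
  spectrum psi (opp_graph G) z.
Proof.
move=> /real_eigenvector[a [b [ab0 Ha Hb]]] [Mz] HM.
pose at1 (c : 'I_N -> R) (w : seq 'I_N) : R := if w is [:: i] then c i else 0.
have sat c : symm (at1 c).
  move=> w v wv; have := perm_size wv; case: w wv => [|i [|j w]]; case: v => [|k [|l v]]//= wv _.
  by have := perm_mem wv i; rewrite !inE eqxx => /esym/eqP ->.
pose u : fct := fun x => (hser A 1 2 (at1 a) x +i* hser A 1 2 (at1 b) x)%C.
have L1 c := L2r_hser SA Aunit 1 2 (at1 c).
have Lu : L2 psi u by apply/(L2P mpsi psi0); split; exact: L1.
have L0 : L2 psi (fun=> 0) by apply/(L2P mpsi psi0); split; exact: (L2r_cst mpsi rpsi).
have c1 c w : coef (hser A 1 2 (at1 c)) w = at1 c w.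
  rewrite (coef_hser SA Aunit Ipsi)//; case: w => [|i [|j w]] /=; rewrite ?mul0r ?mul1r//.
have [v [Gv _ uni]] := HM _ L0.
have Gu : G u (fun x => - (0 + z * u x)).
  apply/graph_coef => // w.
  have c0 : coef (fun=> 0) w = 0 by rewrite /hcoef /ip; under eq_Rintegral do rewrite !mul0r; exact: Int0.
  have cu v' : ccoef u v' = (at1 a v' +i* at1 b v')%C by rewrite /ccoef !c1.
  have r0 : ccoef (fun=> 0) w = 0 by rewrite /ccoef c0.
  rewrite r0; apply/eqP; rewrite subr_eq0; apply/eqP.
  rewrite (@eq_dtens _ _ _ _ _ (fun v' => (at1 a v' +i* at1 b v')%C)) => [|v' _]; last exact: cu.
  rewrite cu.
  apply/eqP; rewrite eq_complex Re_dtens Im_dtens cReM cImM /=.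
  case: w {c0 r0} => [|i [|j w]] /=; first by rewrite !mulr0 subrr addr0 eqxx.
    by rewrite !addr0 Ha Hb eqxx/= addrC eqxx.
  have d0 : \sum_j0 H i j0 * 0 + (\sum_j0 H j j0 * 0 + dtens H w (fun=> 0)) = 0.
    rewrite big1 ?add0r => [|k _]; last by rewrite mulr0.
    by rewrite big1 ?add0r ?dtens0// => k _; rewrite mulr0.
  by rewrite !d0 !mulr0 subrr addr0 eqxx.
have := uni u; have u0 := uni (fun=> 0).
have G0 : G (fun=> 0) (fun x => - (0 + z * 0)).
  apply/(graph_coef z (u := fun=> 0) (f := fun=> 0)) => // w.
  have c0 v' : coef (fun=> 0) v' = 0 by rewrite /hcoef /ip; under eq_Rintegral do rewrite !mul0r; exact: Int0.
  have cc v' : ccoef (fun=> 0) v' = 0 by rewrite /ccoef c0.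
  by rewrite cc mulr0 subr0 (@eq_dtens _ _ _ _ _ (fun=> 0)) ?dtens0// => v' _.
have gopp v' : G v' (fun x => - (0 + z * v' x)) -> opp_graph G v' (fun x => 0 + z * v' x) by [].
move=> /(_ (gopp _ Gu)) uv; have {}u0 := u0 (gopp _ G0).
have Lv : L2 psi v by case: Gv.
have [e1 e2] := ae_coefC SA Aunit Lu Lv uv; have [e3 e4] := ae_coefC SA Aunit L0 Lv u0.
have z1 c i : coef (hser A 1 2 (at1 c)) [:: i] = c i by rewrite c1.
have z0 w : coef (fun=> 0) w = 0 by rewrite /hcoef /ip; under eq_Rintegral do rewrite !mul0r; exact: Int0.
have a0 i : a i = 0 by rewrite -z1 -[LHS]/(coef (re u) [:: i]) e1 -e3 z0.
have b0 i : b i = 0 by rewrite -z1 -[LHS]/(coef (im u) [:: i]) e2 -e4 z0.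
by move: ab0; rewrite big1 ?ltxx// => i _; rewrite a0 b0 expr0n addr0.
Qed.

(** Every degree is injective: degree 0 because z != 0, the others by [dtens_spectrum]. Coercivity
    bounds the inverse by 1 from some degree on, and the finitely many lower degrees have finite
    bounds. *)
Lemma level_solve (m : R) (z : C) : (forall r, root (char_poly (MC H)) r -> m <= complex.Re r) ->
  complex.Re z < m -> z != 0 ->
  exists2 K : R, 0 <= K & forall n (f : seq 'I_N -> C), symm f -> exists b, [/\ symm b,
    forall w, size w = n -> dtens (MC H) w b - z * b w = f w &
    cnrm n b <= K * cnrm n f].
Proof.
move=> Hm zm z0; have [l l0 Hl] := hdrift_coercive.
have inj n b : (forall w, size w = n -> dtens (MC H) w b = z * b w) -> forall w, size w = n -> b w = 0.
  case: n => [|n] eig w sw; last exact: (dtens_spectrum hdrift_ge0 Hm zm eig).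
  have := eig _ sw; case: w sw => //= _ /esym/eqP; rewrite mulf_eq0 (negbTE z0)/=.
  by move/eqP.
have /choice[K HK] n := resolvent_solve (inj n).
(* For n >= n0 one has n l - Re z >= 1, as [resolvent_coercive] requires. *)
pose n0 := (Num.truncn ((1 + complex.Re z) / l)).+1.
pose KK := 1 + \sum_(n < n0) K n.
have K0 n : 0 <= K n by have [] := HK n.
have KK1 : 1 <= KK by rewrite lerDl; apply: sumr_ge0.
exists KK; first exact: le_trans KK1.
move=> n f sf; have [_ /(_ f sf)[b [sb eb nb]]] := HK n; exists b; split=> //.
have [nn0|n0n] := ltnP n n0.
  apply: le_trans nb _; rewrite ler_wpM2r ?cnrm_ge0//.
  rewrite /KK (bigD1 (Ordinal nn0))//= addrCA lerDl addr_ge0//.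
  by apply: sumr_ge0.
apply: (@le_trans _ _ (cnrm n f)); last by rewrite ler_peMl ?cnrm_ge0.
apply: (resolvent_coercive Hl) eb.
rewrite lerBrDr -ler_pdivrMr//; apply: ltW; apply: (lt_le_trans (truncnS_gt _)).
by rewrite ler_nat.
Qed.

(** The solutions of all degrees share one constant K, so Riesz-Fischer assembles them into an L2
    function whose norm is at most sqrt K times that of f. *)
Lemma resolvent_low (m : R) (z : C) : (forall r, root (char_poly (MC H)) r -> m <= complex.Re r) ->
  complex.Re z < m -> z != 0 -> resolvent_set psi (opp_graph G) z.
Proof.
move=> Hm zm z0; have [K K0 HK] := level_solve Hm zm z0.
exists (Num.sqrt K) => f Lf; have /(L2P mpsi psi0)[c d] := Lf.
have sf : symm (ccoef f) by move=> w v wv; congr (_ +i* _)%C; exact: symm_coef.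
have /choice[b Hb] n := HK n _ sf.
pose B w := b (size w) w.
have sB : symm B by move=> w v wv; rewrite /B (perm_size wv); have [s _ _] := Hb (size v); exact: s.
have sBr : symm (re B) by move=> w v wv; rewrite (sB _ _ wv).
have sBi : symm (im B) by move=> w v wv; rewrite (sB _ _ wv).
have nB n : nrm n (re B) + nrm n (im B) <= K * (nrm n (coef (re f)) + nrm n (coef (im f))).
  have [_ _ h] := Hb n; apply: le_trans h; rewrite le_eqVlt; apply/orP; left; apply/eqP.
  by congr (_ + _); apply: eq_nrm => w sw; rewrite /B sw.
have hB m' : hnorm 0 m' (re B) + hnorm 0 m' (im B) <= K * (hnorm 0 m' (coef (re f)) + hnorm 0 m' (coef (im f))).
  rewrite /hnorm -!big_split/= mulr_sumr; apply: ler_sum => n _.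
  by rewrite -!mulrDr mulrCA ler_wpM2l ?invr_ge0.
have bes m' : hnorm 0 m' (coef (re f)) + hnorm 0 m' (coef (im f)) <= nC psi f.
  by apply: lerD; exact: (bessel SA Aunit Ipsi).
have tot m' : hnorm 0 m' (re B) + hnorm 0 m' (im B) <= K * nC psi f.
  by apply: le_trans (hB m') _; rewrite ler_wpM2l.
have [m'|ur [Lr cr _]] := riesz_fischer SA Aunit Ipsi (B := K * nC psi f) sBr.
  by apply: le_trans (tot m'); rewrite lerDl hnorm_ge0.
have [m'|ui [Li ci _]] := riesz_fischer SA Aunit Ipsi (B := K * nC psi f) sBi.
  by apply: le_trans (tot m'); rewrite lerDr hnorm_ge0.
pose u : fct := fun x => (ur x +i* ui x)%C.
have Lu : L2 psi u by apply/(L2P mpsi psi0); split.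
have cu w : ccoef u w = B w.
  by rewrite /ccoef (cr w) (ci w); case: (B w).
have Bsolve w : dtens (MC H) w B - z * B w = ccoef f w.
  have [_ h _] := Hb (size w); rewrite -(h w erefl); congr (_ - _).
  by apply: eq_dtens => v vw; rewrite /B vw.
exists u; split.
- apply/(graph_coef z Lu Lf) => w; rewrite -Bsolve cu; congr (_ - _).
  by apply: eq_dtens => v _; exact: cu.
- rewrite !(L2normE mpsi psi0)// -sqrtrM//; apply: ler_wsqrtr.
  have p1 := parseval SA Aunit Ipsi Lr; have p2 := parseval SA Aunit Ipsi Li.
  have pp : hnorm 0 k (coef ur) + hnorm 0 k (coef ui) @[k --> \oo] --> ipp ur ur + ipp ui ui by exact: cvgD.
  rewrite -[nC psi u]/(ipp ur ur + ipp ui ui) -(cvg_lim (@norm_hausdorff _ _) pp).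
  apply: limr_le; first exact: cvgP pp.
  apply: nearW => m'; apply: le_trans (tot m'); rewrite le_eqVlt; apply/orP; left; apply/eqP.
  by congr (_ + _); apply: eq_bigr => n _; congr (_ * _); apply: eq_nrm => w _; rewrite ?cr ?ci.
- move=> v Gv; have Lv : L2 psi v by case: Gv.
  have hv := (graph_coef z Lv Lf).1 Gv.
  have l0 : complex.Re z < m by [].
  have inj n : forall w, size w = n -> ccoef v w - B w = 0.
    have eig w : size w = n -> dtens (MC H) w (fun w => ccoef v w - B w) = z * (ccoef v w - B w).
      move=> _; rewrite dtensB mulrBr; have := hv w; rewrite -Bsolve => /eqP.
      rewrite subr_eq => /eqP ->; ring.
    case: n eig => [|n] eig w sw; last exact: (dtens_spectrum hdrift_ge0 Hm zm eig sw).
    have := eig _ sw; case: w sw => //= _ /esym/eqP; rewrite mulf_eq0 (negbTE z0)/=.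
    by move/eqP.
  have vB w : ccoef v w = B w by apply/subr0_eq; exact: (inj (size w)).
  apply: (coefC_inj SA Aunit) => // w.
    by rewrite -[LHS]/(complex.Re (ccoef v w)) vB -cu.
  by rewrite -[LHS]/(complex.Im (ccoef v w)) vB -cu.
Qed.

Lemma spectral_gap_min_root (r : C) : root (char_poly (MC H)) r ->
  (forall s, root (char_poly (MC H)) s -> complex.Re r <= complex.Re s) ->
  spectral_gap S J (complex.Re r).
Proof.
move=> rr rmin; split.
  exists r => //; split; first exact: eigenvalue_spectrum.
  by move=> r0; have := root_gt0 rr; rewrite r0 ltxx.
move=> _ [z [zs z0] <-]; rewrite leNgt; apply/negP => zr; apply: zs.
by apply: (resolvent_low rmin zr); apply/eqP.
Qed.

End spectrum.

(** * The optimal drift and the Fokker-Planck equation *)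

Section condition_number.
Context {R : realType} {n : nat}.
Local Notation E := 'cV[R]_n.+1.

Lemma enorm_ge0 (x : E) : 0 <= enorm x. Proof. exact: sqrtr_ge0. Qed.

Lemma enormZ (c : R) (x : E) : enorm (c *: x) = `|c| * enorm x.
Proof.
rewrite /enorm -sqrtr_sqr -sqrtrM ?sqr_ge0// mulr_sumr.
by congr Num.sqrt; apply: eq_bigr => i _; rewrite mxE exprMn.
Qed.

Lemma enorm_gt0 (x : E) : x != 0 -> 0 < enorm x.
Proof.
move=> x0; rewrite sqrtr_gt0 lt_neqAle sumr_ge0 => [|i _]; last exact: sqr_ge0.
rewrite andbT eq_sym; apply: contra x0; rewrite psumr_eq0 => [/allP h|i _]; last exact: sqr_ge0.
apply/eqP/colP => i; rewrite mxE; apply/eqP; rewrite -sqrf_eq0.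
exact: h (mem_index_enum i).
Qed.

Lemma enorm_mulmx_le (M : 'M[R]_n.+1) (x : E) : enorm x <= 1 -> enorm (M *m x) <= opnorm M.
Proof.
move=> x1; apply: sup_upper_bound; last by exists x.
split; first by exists (enorm (M *m x)); exists x.
exists (Num.sqrt (\sum_i (\sum_j `|M i j|) ^+ 2)) => _ [z /= z1 <-].
apply: ler_wsqrtr; apply: ler_sum => i _.
rewrite -[leLHS]real_normK ?num_real// lerXn2r ?nnegrE// ?sumr_ge0//.
rewrite mxE; apply: le_trans (ler_norm_sum _ _ _) _; apply: ler_sum => j _.
rewrite normrM -[leRHS]mulr1 ler_wpM2l// -sqrtr_sqr; apply: le_trans z1.
apply: ler_wsqrtr; rewrite (bigD1 j)//= lerDl; apply: sumr_ge0 => k _.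
exact: sqr_ge0.
Qed.

Lemma kappa_ge1 (M : 'M[R]_n.+1) : M \in unitmx -> 1 <= kappa M.
Proof.
move=> uM; pose e : E := delta_mx 0 0; pose z := M *m e.
have e1 : enorm e = 1.
  rewrite /enorm (bigD1 ord0)//= mxE !eqxx/= big1 ?addr0 ?expr1n ?sqrtr1// => i i0.
  by rewrite mxE (negbTE i0)/= expr0n.
have z0 : z != 0.
  apply/eqP => z0; have : e = 0 by rewrite -(mulKmx uM e) -/z z0 mulmx0.
  by move/colP/(_ 0); rewrite !mxE !eqxx/= => /eqP; rewrite oner_eq0.
have nz := enorm_gt0 z0.
have h1 : enorm z <= opnorm M by apply: enorm_mulmx_le; rewrite e1.
have h2 : (enorm z)^-1 <= opnorm (invmx M).
  have : enorm ((enorm z)^-1 *: z) <= 1 by rewrite enormZ ger0_norm ?invr_ge0 ?enorm_ge0// mulVf ?gt_eqF.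
  move=> /(enorm_mulmx_le (invmx M)); rewrite -scalemxAr enormZ mulKmx// e1 mulr1.
  by rewrite ger0_norm// invr_ge0 enorm_ge0.
rewrite /kappa -(@mulfV _ (enorm z)) ?gt_eqF//.
by apply: ler_pM => //; rewrite ?invr_ge0 enorm_ge0.
Qed.

End condition_number.

(** * An antisymmetric matrix that equalizes the eigenvalues *)

Section optimal_drift.
Context {R : realType} {n : nat}.
Variables (A : 'M[R]_n.+1) (c : R).
Hypotheses (Aunit : A \in unitmx) (Ac : forall i, (A *m A^T) i i = c).

Let q (i : 'I_n.+1) : R := i.+1%:R.

(** Chosen so that q_i (A A^T - X)_il = - 2 q_i q_l (A A^T)_il / (q_i - q_l) off the diagonal, which
    is antisymmetric in i and l. Distinct weights are essential; the values 1, ..., N keep their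
    ratio at most N. *)
Let X : 'M[R]_n.+1 := \matrix_(i, l) ((A *m A^T) i l * ((q i + q l) / (q i - q l))).

(* At [i = l] the quotient is [(q i + q i) / 0 = 0]. *)
Definition optimal_drift : 'M[R]_n.+1 := invmx A *m X *m (invmx A)^T.

Let sAA i l : (A *m A^T) i l = (A *m A^T) l i.
Proof. by rewrite !mxE; apply: eq_bigr => k _; rewrite !mxE mulrC. Qed.

Let X_anti : X^T = - X.
Proof.
apply/matrixP => i l; rewrite 2![in LHS]mxE sAA [in RHS]mxE [X i l]mxE -mulrN; congr (_ * _).
by rewrite -[q i - q l]opprB invrN mulrN opprK addrC.
Qed.

Lemma optimal_drift_anti : antisymmetric_mx optimal_drift.
Proof. by rewrite /antisymmetric_mx /optimal_drift !trmx_mul trmxK X_anti mulNmx mulmxN mulmxA. Qed.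

Lemma hdrift_optimal : hdrift A optimal_drift = A *m A^T - X.
Proof.
rewrite /hdrift mulmxBr mulmx1 mulmxBl; congr (_ - _).
rewrite /optimal_drift !mulmxA mulmxV// mul1mx -mulmxA -trmx_mul mulmxV// trmx1.
by rewrite mulmx1.
Qed.

(** The terms (i, j) and (j, i) cancel for i != j, and the diagonal terms all carry the common
    diagonal value c of A A^T. *)
Lemma optimal_weighted (x : 'I_n.+1 -> R) :
  \sum_i q i * x i * (\sum_j hdrift A optimal_drift i j * x j) = c * \sum_i q i * x i ^+ 2.
Proof.
pose T i j := q i * x i * (hdrift A optimal_drift i j * x j).
have TT i j : T i j + T j i = (i == j)%:R * (2 * (c * (q i * x i ^+ 2))).
  have hE k l : hdrift A optimal_drift k l = (A *m A^T) k l * (1 - (q k + q l) / (q k - q l)).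
    by rewrite hdrift_optimal [LHS]mxE [X in _ + X]mxE [X k l]mxE mulrBr mulr1.
  rewrite /T !hE; have [->|ij] := eqVneq i j.
    rewrite subrr invr0 mulr0 subr0 Ac mul1r; ring.
  have qij : q i - q j != 0.
    by rewrite subr_eq0 /q eqr_nat eqSS; apply: contra ij => /eqP/val_inj ->.
  have qji : q j - q i != 0 by rewrite -opprB oppr_eq0.
  rewrite mul0r [(A *m A^T) j i]sAA; move: (q i) (q j) qij qji => a b ab ba.
  by field; rewrite ab ba.
have sT : \sum_i \sum_j T i j = c * \sum_i q i * x i ^+ 2.
  have : \sum_i \sum_j T i j + \sum_i \sum_j T i j = 2 * (c * \sum_i q i * x i ^+ 2).
    rewrite [X in _ + X]exchange_big/= -big_split/= !mulr_sumr; apply: eq_bigr => i _.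
    rewrite -big_split/= (bigD1 i)//= TT eqxx mul1r big1 ?addr0// => j ji.
    by rewrite TT eq_sym (negbTE ji) mul0r.
  lra.
rewrite -sT; apply: eq_bigr => i _; by rewrite mulr_sumr.
Qed.

End optimal_drift.

(** * Decay of the semigroup *)

Section decay.
Context {R : realType} {n : nat}.
Local Notation N := n.+1.
Local Notation E := 'cV[R]_N.
Local Notation fct := (E -> R[i]).
Local Notation re u := (fun x => complex.Re (u x)).
Local Notation im u := (fun x => complex.Im (u x)).
Implicit Types (w : seq 'I_N) (u f : fct).
Variables (S A J : 'M[R]_N).
Hypotheses (SA : S = A^T *m A) (Aunit : A \in unitmx) (Janti : antisymmetric_mx J).
Let psi := @psi_inf R N S.
Hypothesis Ipsi : \int[@lebesgue_cV R N]_x psi x = 1.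
Local Notation ipp := (ip psi).
Local Notation coef := (hcoef S A).
Local Notation H := (hdrift A J).
Local Notation G := (L_graph S J).
Local Notation norm := (L2norm psi).
Local Notation T := (semigroup psi G).

Let mpsi : measurable_fun setT psi := measurable_psi SA.
Let psi0 x : 0 < psi x := psi_gt0 SA Aunit x.
Let rpsi : rapid psi := rapid_psi SA Aunit.

Lemma coef_cst (m : R) w : coef (fun=> m) w = (size w == 0%N)%:R * m.
Proof.
have -> : (fun=> m) = hser A 0 1 (fun=> m).
  by apply/funext => x; rewrite /hser big_nat1 /hpart /= herm_nil mulr1 fact0 invr1 mul1r.
by rewrite (coef_hser SA Aunit Ipsi)//=; case: w.
Qed.

Lemma mean_coef u : mean S u = (coef (re u) [::] +i* coef (im u) [::])%C.
Proof.
rewrite /mean /intC; congr (_ +i* _)%C; apply: eq_Rintegral => x _.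
  by rewrite cReM /= mulr0 subr0 herm_nil mulr1.
by rewrite cImM /= mulr0 add0r herm_nil mulr1 mulrC.
Qed.

Lemma semigroupP : generates_contraction_semigroup psi G T.
Proof.
apply: (@xgetPex _ (fun _ u => u) [set T | generates_contraction_semigroup psi G T]).
exists (hflow S A (- H)).
exact: (hflow_generates SA Aunit Ipsi (hdrift_le0 A Janti) (L_graphE SA Aunit Janti Ipsi)).
Qed.

Lemma semigroupE t u w : 0 <= t -> L2 psi u ->
  coef (re (T t u)) w = tflow (- H) t (coef (re u)) w /\
  coef (im (T t u)) w = tflow (- H) t (coef (im u)) w.
Proof.
move=> t0 Lu.
exact: (semigroup_coef SA Aunit Ipsi (hdrift_le0 A Janti) (L_graphE SA Aunit Janti Ipsi) semigroupP w t0 Lu).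
Qed.

Variables (q : 'I_N -> R) (c K : R).
Hypothesis q1 : forall i, 1 <= q i <= K.
Hypothesis Hq : forall x : 'I_N -> R,
  \sum_i q i * x i * (\sum_j H i j * x j) = c * \sum_i q i * x i ^+ 2.

Let K0 : 0 <= K.
Proof. by have /andP[h1 h2] := q1 ord0; rewrite (le_trans _ (le_trans h1 h2)). Qed.

(** Subtracting the mean removes degree 0. In degree k + 1 one slot decays by [mexp_decay] and the
    others contract, so the same constant works in each degree; c is doubled because squared norms
    are compared. *)
Let decay_real t (p pT : E -> R) : 0 <= t -> L2r psi p -> L2r psi pT ->
  (forall w, coef pT w = tflow (- H) t (coef p) w) ->
  ipp (fun x => pT x - coef p [::]) (fun x => pT x - coef p [::]) <=
  K * expR (- (2 * c) * t) * ipp (fun x => p x - coef p [::]) (fun x => p x - coef p [::]).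
Proof.
move=> t0 Lp LT pE; set m := coef p [::].
have Lm : L2r psi (fun=> m) by exact: (L2r_cst mpsi rpsi).
apply: (le_ip_coef SA Aunit Ipsi); [exact: L2rB|exact: L2rB|].
have r0 : 0 <= K * expR (- (2 * c) * t) by rewrite mulr_ge0 ?expR_ge0.
case=> [|k].
  rewrite /nrm /= !(coefB SA Aunit)// !coef_cst /= mul1r pE.
  by rewrite subrr expr0n/= mulr_ge0 ?sqr_ge0.
rewrite (@eq_nrm _ _ k.+1 _ (tflow (- H) t (coef p))) => [|w sw]; last first.
  by rewrite (coefB SA Aunit)// coef_cst sw/= mul0r subr0 pE.
rewrite (@eq_nrm _ _ k.+1 (coef (fun x => p x - m)) (coef p)) => [|w sw]; last first.
  by rewrite (coefB SA Aunit)// coef_cst sw/= mul0r subr0.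
apply: le_nrm_tpowS => // x.
  by apply: mexp_contraction => //; exact: hdrift_le0.
apply: (mexp_decay q1) => // z.
rewrite mulNr -Hq -sumrN; apply: eq_bigr => i _.
have -> : \sum_j (- H) i j * z j = - \sum_j H i j * z j.
  by rewrite -sumrN; apply: eq_bigr => j _; rewrite [(- H) i j]mxE mulNr.
by rewrite mulrN.
Qed.

Lemma semigroup_mean_decay t u : 0 <= t -> L2 psi u ->
  norm (fun x => T t u x - mean S u) <= Num.sqrt K * expR (- c * t) * norm (fun x => u x - mean S u).
Proof.
move=> t0 Lu; have LT : L2 psi (T t u) := semigroup_L2 semigroupP t0 Lu.
have /(L2P mpsi psi0)[a b] := Lu; have /(L2P mpsi psi0)[a' b'] := LT.
have Lm : L2 psi (fun=> mean S u) by apply/(L2P mpsi psi0); split; exact: (L2r_cst mpsi rpsi).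
rewrite !(L2normE mpsi psi0); [|exact: (L2B mpsi psi0)..].
have -> : Num.sqrt K * expR (- c * t) = Num.sqrt (K * expR (- (2 * c) * t)).
  rewrite sqrtrM//; congr (_ * _).
  have -> : - (2 * c) * t = - c * t + - c * t by ring.
  by rewrite expRD -expr2 sqrtr_sqr ger0_norm ?expR_ge0.
rewrite -sqrtrM ?mulr_ge0 ?expR_ge0//; apply: ler_wsqrtr.
rewrite !nC_B mean_coef /= mulrDr; apply: lerD.
  by apply: decay_real => // w; have [] := semigroupE w t0 Lu.
by apply: decay_real => // w; have [] := semigroupE w t0 Lu.
Qed.

End decay.

(** * Transfer to the Fokker-Planck equation *)

Section fokker_planck.
Context {R : realType} {n : nat}.
Local Notation N := n.+1.
Local Notation E := 'cV[R]_N.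
Local Notation re u := (fun x => complex.Re (u x)).
Local Notation im u := (fun x => complex.Im (u x)).
Implicit Types (w : seq 'I_N) (p g : E -> R).
Variables (S A J : 'M[R]_N).
Hypotheses (SA : S = A^T *m A) (Aunit : A \in unitmx) (Janti : antisymmetric_mx J).
Let psi := @psi_inf R N S.
Hypothesis Ipsi : \int[@lebesgue_cV R N]_x psi x = 1.
Local Notation ipp := (ip psi).
Local Notation coef := (hcoef S A).
Local Notation H := (hdrift A J).
Local Notation psiV := (psi_inf_inv S).

Let mpsi : measurable_fun setT psi := measurable_psi SA.
Let psi0 x : 0 < psi x := psi_gt0 SA Aunit x.
Let rpsi : rapid psi := rapid_psi SA Aunit.

Lemma measurable_psiV : measurable_fun setT psiV.
Proof. by apply: continuous_measurable_cV; apply: smooth_continuous; exact: (smooth_psiV SA). Qed.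

Lemma psiV_gt0 (x : E) : 0 < psiV x.
Proof. by rewrite invr_gt0; exact: psi0. Qed.

(** Division by psi_inf, an isometry from L2(psi_inf^-1) to L2(psi_inf). It turns the Fokker-Planck
    equation for -J into the evolution generated by L_J. *)
Let h p : E -> R := fun x => p x * psiV x.

Let hpsi p x : h p x * psi x = p x.
Proof. by rewrite /h /psi_inf_inv mulfVK// gt_eqF// psi0. Qed.

Lemma L2_toC (v : E -> R) (mv : measurable_fun setT v) (v0 : forall x, 0 < v x) p :
  L2 v (toC p) <-> L2r v p.
Proof.
rewrite (L2P mv v0); split=> [[]//|Lp]; split=> //.
split; first exact: measurable_cst.
rewrite (_ : (fun x => _) = fun x => 0 * (p x ^+ 2 * v x)); last first.
  by apply/funext => x; rewrite /= expr0n/= !mul0r.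
by apply: itgZ; exact: Lp.2.
Qed.

Lemma L2norm_toC (v : E -> R) (mv : measurable_fun setT v) (v0 : forall x, 0 < v x) p :
  L2r v p -> L2norm v (toC p) = Num.sqrt (ip v p p).
Proof.
move=> Lp; rewrite (L2normE mv v0); last exact/(L2_toC mv v0).
congr Num.sqrt; rewrite /nC [X in _ + X](_ : _ = 0) ?addr0//.
by rewrite /ip /=; under eq_Rintegral do rewrite !mul0r; exact: Int0.
Qed.

Let ip_h p g : ipp (h p) (h g) = ip psiV p g.
Proof. by apply: eq_Rintegral => x _; rewrite mulrAC hpsi /h mulrA. Qed.

Let L2r_h p : L2r psiV p <-> L2r psi (h p).
Proof.
have e x : h p x ^+ 2 * psi x = p x ^+ 2 * psiV x.
  by rewrite expr2 -mulrA hpsi /h; ring.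
split=> -[mp ip]; split.
- by apply: measurable_funM => //; exact: measurable_psiV.
- by rewrite (_ : (fun x => _) = fun x => p x ^+ 2 * psiV x)//; apply/funext.
- rewrite (_ : p = fun x => h p x * psi x); last by apply/funext => x; rewrite hpsi.
  exact: measurable_funM.
- by rewrite (_ : (fun x => _) = fun x => h p x ^+ 2 * psi x)//; apply/funext => x; rewrite e.
Qed.

Variables (rho0 : E -> R) (rho : R -> E -> R).
Hypothesis sol : fokker_planck_solution S (- J) rho0 rho.

Let Lh t : 0 <= t -> L2r psi (h (rho t)).
Proof. by move=> t0; apply/L2r_h/(L2_toC measurable_psiV psiV_gt0); exact: (fp_L2 sol t0). Qed.

Let dist s t : R := Num.sqrt (ipp (fun x => h (rho s) x - h (rho t) x) (fun x => h (rho s) x - h (rho t) x)).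

Let dist_cvg t : 0 <= t -> forall e, 0 < e -> exists2 d : R, 0 < d &
  forall s, 0 <= s -> `|s - t| < d -> dist s t <= e.
Proof.
move=> t0 e e0; have /cvgrPdist_le/(_ _ e0) := fp_continuous sol t0.
move=> [d /= d0 Hd]; exists d => // s s0 st.
have := Hd s; rewrite /ball/= distrC => /(_ st s0); rewrite sub0r normrN.
have Lst : L2r psiV (fun x => rho s x - rho t x).
  apply/L2r_h; rewrite (_ : h _ = fun x => h (rho s) x - h (rho t) x); last first.
    by apply/funext => x; rewrite /h mulrBl.
  by apply: L2rB => //; exact: Lh.
rewrite (L2norm_toC measurable_psiV psiV_gt0 Lst) -ip_h ger0_norm ?sqrtr_ge0//.
rewrite (_ : h _ = fun x => h (rho s) x - h (rho t) x)//.
by apply/funext => x; rewrite /h mulrBl.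
Qed.

Let ip_dist s t g : 0 <= s -> 0 <= t -> L2r psi g ->
  `|ipp (h (rho s)) g - ipp (h (rho t)) g| <= dist s t * Num.sqrt (ipp g g).
Proof.
move=> s0 t0 Lg; have Ls := Lh s0; have Lt := Lh t0.
rewrite -ipBl// /dist -sqrtrM ?ip_ge0// -sqrtr_sqr; apply: ler_wsqrtr.
by apply: ip_cauchy_schwarz => //; exact: L2rB.
Qed.

Section coefficient.
Variable w : seq 'I_N.

Local Notation KJ := (kolmogorov (drift S (- J))).
Let phi k : E -> R := fun x => herm A w x * chi (k.+1%:R^-1) x.

Let tphi k : test_function (phi k).
Proof. by apply: test_function_chi; [exact: smooth_herm|rewrite invr_gt0]. Qed.

Let cf t := coef (h (rho t)) w.
Let cg t := dtens (- H) w (coef (h (rho t))).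

(** The images of the cut off Hermite functions are dominated by one tempered function, hence
    bounded in L2 uniformly in the cutoff. *)
Let Kphi_bound : exists2 B : R, 0 <= B & forall k, L2r psi (KJ (phi k)) /\ Num.sqrt (ipp (KJ (phi k)) (KJ (phi k))) <= B.
Proof.
have [C C0 HC] := @chi_bound R N.
have th := tempered_herm A w; have tdh i := tempered_partial_herm A i w.
have tK := tempered_kolmogorov_herm SA Janti w.
have [T tT HT] := cutoff_rest_bound (drift S (- J)) th tdh.
pose D x := C * `|KJ (herm A w) x| + `|T x|.
have tD : tempered D by apply: temperedD; [apply: temperedZ|]; exact: tempered_norm.
have LD : L2r psi D by exact: tempered_L2r.
have bD k x : `|KJ (phi k) x| <= D x.
  rewrite (kolmogorov_cutoff _ _ _ (smooth_herm A w)); apply: le_trans (ler_normD _ _) _.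
  have e01 : 0 <= (k.+1%:R^-1 : R) <= 1 by rewrite invr_ge0 ler0n/= invf_le1// ler1n.
  apply: lerD; first by rewrite normrM ler_wpM2r.
  rewrite normrM ger0_norm ?invr_ge0//; apply: le_trans (le_trans (HT _ x e01) (ler_norm _)).
  by rewrite -[leRHS]mul1r ler_wpM2r//; have /andP[] := e01.
have tKp k : tempered (KJ (phi k)).
  have [_ [B [l HB]]] := tD; split; last first.
    by exists B, l => x; apply: le_trans (bD k x) _; apply: le_trans (HB x); exact: ler_norm.
  have [sphi _] := tphi k.
  apply: measurable_funD; [apply: measurable_funN|]; apply: measurable_sum => i.
    apply: measurable_funM; first exact: tempered_measurable (tempered_mulmx _ i).
    by apply: continuous_measurable_cV; apply: smooth_continuous; exact: smooth_partial.
  by apply: continuous_measurable_cV; apply: smooth_continuous; do 2 apply: smooth_partial.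
exists (Num.sqrt (ipp D D)); first exact: sqrtr_ge0.
move=> k; have Lk : L2r psi (KJ (phi k)) := tempered_L2r mpsi rpsi (tKp k).
split=> //; apply: ler_wsqrtr; apply: le_Int; [exact: itg_ip|exact: itg_ip|] => x.
rewrite ler_wpM2r ?(ltW (psi0 x))// -!expr2 -[leLHS]real_normK ?num_real//.
by rewrite lerXn2r ?nnegrE// (le_trans _ (bD k x)).
Qed.

Let IntE g s : \int[@lebesgue_cV R N]_x (rho s x * g x) = ipp (h (rho s)) g.
Proof. by apply: eq_Rintegral => x _; rewrite mulrAC hpsi. Qed.

Let dphi k (t : R) : 0 < t -> is_derive t (1 : R) (fun s => ipp (h (rho s)) (phi k)) (ipp (h (rho t)) (KJ (phi k))).
Proof.
move=> t0; have D := fp_eq sol (tphi k) t0; rewrite IntE in D.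
by rewrite (_ : (fun s => ipp _ _) = (fun s => \int[@lebesgue_cV R N]_x (rho s x * phi k x)))//; apply/funext => s; rewrite IntE.
Qed.

(** The weak equation only accepts compactly supported test functions. For each cutoff the mean
    value theorem bounds the first-order error, uniformly in k, by the oscillation of rho between
    the two times; the bound survives the limit of the cutoffs. *)
Let increment t s : 0 < t -> 0 < s -> forall e, (forall r, 0 <= r -> `|r - t| <= `|s - t| -> dist r t <= e) ->
  forall B, (forall k, Num.sqrt (ipp (KJ (phi k)) (KJ (phi k))) <= B) -> 0 <= B -> (forall k, L2r psi (KJ (phi k))) ->
  `|cf s - cf t - (s - t) * cg t| <= `|s - t| * (e * B).
Proof.
move=> t0 s0 e He B HB B0 LK.
have e0 : 0 <= e by apply: le_trans (He t (ltW t0) _); rewrite ?sqrtr_ge0 ?subrr ?normr0.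
pose ck k r := ipp (h (rho r)) (phi k); pose gk k r := ipp (h (rho r)) (KJ (phi k)).
have fin k : `|ck k s - ck k t - (s - t) * gk k t| <= `|s - t| * (e * B).
  have gB r : 0 < r -> `|r - t| <= `|s - t| -> `|gk k r - gk k t| <= e * B.
    move=> r0 rt; apply: le_trans (ip_dist (ltW r0) (ltW t0) (LK k)) _.
    by apply: ler_pM; rewrite ?sqrtr_ge0//; exact: He (ltW r0) rt.
  have mvt a b : 0 < a -> a < b -> exists2 r, a < r < b & ck k b - ck k a = gk k r * (b - a).
    move=> a0 ab; have [||r rab E'] := @MVT R (ck k) (gk k) a b ab.
    - by move=> r; rewrite in_itv/= => /andP[ar _]; apply: dphi; exact: lt_trans ar.
    - apply: derivable_within_continuous => r; rewrite in_itv/= => /andP[ar _].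
      by case: (dphi k (lt_le_trans a0 ar)).
    by exists r => //; move: rab; rewrite in_itv.
  have [ts|ts|->] := ltgtP t s; last by rewrite !subrr mul0r subrr !normr0 mul0r.
    have [r /andP[tr rs] ->] := mvt t s t0 ts.
    rewrite [_ * (s - t)]mulrC -mulrBr normrM ler_wpM2l//; apply: gB; first exact: lt_trans tr.
    by rewrite !gtr0_norm ?subr_gt0// lerB// ltW.
  have [r /andP[sr rt] E'] := mvt s t s0 ts.
  have -> : ck k s - ck k t = gk k r * (s - t) by rewrite -opprB E' -mulrN opprB.
  rewrite [_ * (s - t)]mulrC -mulrBr normrM ler_wpM2l//; apply: gB; first exact: lt_trans sr.
  by rewrite !ltr0_norm ?subr_lt0// lerN2 lerB// ltW.
have c1 r : 0 <= r -> ck k r @[k --> \oo] --> cf r.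
  by move=> r0; apply: (chi_ip_cvg SA Aunit (Lh r0)); exact: tempered_herm.
have c2 : gk k t @[k --> \oo] --> cg t.
  rewrite /cg -(ip_kolmogorov_herm SA Aunit Janti w (Lh (ltW t0))).
  apply: (kolmogorov_chi_cvg SA Aunit (Lh (ltW t0))).
  - exact: smooth_herm.
  - exact: tempered_herm.
  - by move=> i; exact: tempered_partial_herm.
  - exact: (tempered_kolmogorov_herm SA Janti).
have cc : `|ck k s - ck k t - (s - t) * gk k t| @[k --> \oo] --> `|cf s - cf t - (s - t) * cg t|.
  apply: cvg_norm; apply: cvgB; last exact: cvgMr.
  by apply: cvgB; apply: c1; exact: ltW.
rewrite -(cvg_lim (@norm_hausdorff _ _) cc); apply: limr_le; first exact: cvgP cc.
exact: nearW.
Qed.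

Lemma fp_coef_derive (t : R) : 0 < t ->
  is_derive t (1 : R) (fun s => coef (h (rho s)) w) (dtens (- H) w (coef (h (rho t)))).
Proof.
move=> t0; have [B B0 HB] := Kphi_bound.
apply: (@is_derive_bound _ cf t (cg t)) => e e0.
have eB : 0 < e / (B + 1) by rewrite divr_gt0// ltr_wpDl.
have [d d0 Hd] := dist_cvg (ltW t0) eB.
exists (Num.min d t); first by rewrite lt_min d0 t0.
move=> k; rewrite lt_min => /andP[kd kt].
have tk : 0 < t + k by have := ler_norm (- k); rewrite normrN; lra.
have tkt : t + k - t = k by ring.
have := @increment t (t + k) t0 tk (e / (B + 1)) _ B (fun k => (HB k).2) B0 (fun k => (HB k).1).
rewrite tkt => /(_ _) H'; apply: le_trans (H' _) _.
  by move=> r r0 rk; apply: Hd => //; exact: le_lt_trans rk kd.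
rewrite mulrC ler_wpM2r// mulrAC ler_pdivrMr ?ltr_wpDl//.
by rewrite ler_wpM2l ?(ltW e0)// lerDl.
Qed.

Lemma fp_coef_cont t : 0 < t -> {within `[0, t], continuous (fun s => coef (h (rho s)) w)}.
Proof.
move=> t0; apply: within_continuous_right => //.
  by move=> s s0; case: (fp_coef_derive s0).
have Lhw : L2r psi (herm A w) by exact: (L2r_herm SA Aunit).
set Kw := Num.sqrt (ipp (herm A w) (herm A w)).
apply: (@cvg_at_right0 _ _ (fun s => dist s 0 * Kw)).
  by move=> s s0; exact: ip_dist.
rewrite -[X in _ --> X](mul0r Kw); apply: cvgMl.
apply/cvgrPdist_le => e e0; have [d d0 Hd] := dist_cvg (lexx 0) e0.
have near0 : \forall t \near 0^'+, 0 < t :> R by exact: nbhs_right_gt.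
have neard : \forall t \near 0^'+, t < d :> R by exact: nbhs_right_lt.
apply: filterS2 near0 neard => s s0 sd; rewrite sub0r normrN ger0_norm ?sqrtr_ge0//.
by apply: Hd; rewrite ?subr0 ?gtr0_norm// ltW.
Qed.

End coefficient.

Lemma fp_coef t w : 0 <= t -> coef (h (rho t)) w = tflow (- H) t (coef (h (rho 0))) w.
Proof.
rewrite le_eqVlt => /orP[/eqP <-|t0]; first by rewrite tflow0.
have Cc v : size v = size w -> {within `[0, t], continuous (fun s => coef (h (rho s)) v)}.
  by move=> _; exact: fp_coef_cont.
have D (s : R) v : 0 < s < t -> size v = size w ->
    is_derive s (1 : R) (fun s => coef (h (rho s)) v) (dtens (- H) v (coef (h (rho s)))).
  by move=> /andP[s0 _] _; exact: fp_coef_derive.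
have U := @tflow_unique _ _ (- H) (hdrift_le0 A Janti) (size w) (fun s v => coef (h (rho s)) v) t (ltW t0) Cc D w erefl.
exact: U.
Qed.

(** By [fp_coef] and completeness, rho t / psi_inf is almost everywhere the image under the
    semigroup of rho 0 / psi_inf. That initial function has mean 1, so the assumed decay to the mean
    is decay to psi_inf. *)
Lemma fp_decay t (c : R) : 0 <= t -> probability_density rho0 -> L2 psiV (toC rho0) ->
  (forall u, L2 psi u -> L2norm psi (fun x => semigroup psi (L_graph S J) t u x - mean S u) <=
     c * L2norm psi (fun x => u x - mean S u)) ->
  L2norm psiV (toC (fun x => rho t x - psi x)) <= c * L2norm psiV (toC (fun x => rho0 x - psi x)).
Proof.
move=> t0 [m0 _ I0] L0 dec.
have Lr0 := (L2_toC measurable_psiV psiV_gt0 rho0).1 L0.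
have Lpsi : L2r psiV psi.
  apply/L2r_h; rewrite (_ : h psi = fun=> 1); first exact: (L2r_cst mpsi rpsi).
  by apply/funext => x; rewrite /h /psi_inf_inv mulfV// gt_eqF// psi0.
have subL p : L2r psiV p -> L2r psiV (fun x => p x - psi x).
  by move=> Lp; apply: (L2rB measurable_psiV psiV_gt0).
have hsub p : h (fun x => p x - psi x) = fun x => h p x - 1.
  by apply/funext => x; rewrite /h mulrBl /psi_inf_inv mulfV// gt_eqF// psi0.
have Lrt s : 0 <= s -> L2r psiV (rho s) by move=> s0; apply/L2r_h; exact: Lh.
have normh p : L2r psiV p -> L2norm psiV (toC (fun x => p x - psi x)) = L2norm psi (toC (fun x => h p x - 1)).
  move=> Lp; rewrite (L2norm_toC measurable_psiV psiV_gt0 (subL _ Lp)) -ip_h hsub.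
  rewrite (L2norm_toC mpsi psi0)// -hsub; apply/L2r_h; exact: subL.
pose u := toC (h (rho 0)).
have Lu : L2 psi u by apply/(L2_toC mpsi psi0); exact: Lh.
have ae0 : {ae @lebesgue_cV R N, forall x, rho 0 x = rho0 x} := fp_init sol.
have mu1 : mean S u = 1.
  have c0 : coef (im u) [::] = 0.
    by rewrite /hcoef /ip /=; under eq_Rintegral do rewrite !mul0r; exact: Int0.
  rewrite (mean_coef S A u) c0; apply/eqP; rewrite eq_complex/= eqxx andbT; apply/eqP.
  transitivity (\int[@lebesgue_cV R N]_x rho 0 x).
    by apply: eq_Rintegral => x _; rewrite herm_nil mulr1 hpsi.
  rewrite (ae_eq_Int _ _ ae0); last 2 first.
  - exact: (Lrt 0 (lexx 0)).1.
  - exact: Lr0.1.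
  by rewrite /Rintegral I0.
have Tt : ae_eq_fun (semigroup psi (L_graph S J) t u) (toC (h (rho t))).
  have LT : L2 psi (semigroup psi (L_graph S J) t u).
    exact: (semigroup_L2 (semigroupP SA Aunit Janti Ipsi) t0 Lu).
  have Lt : L2 psi (toC (h (rho t))) by apply/(L2_toC mpsi psi0); exact: Lh.
  apply: (coefC_inj SA Aunit) => // w; have [e1 e2] := semigroupE SA Aunit Janti Ipsi w t0 Lu.
    by rewrite e1 -[RHS]/(coef (h (rho t)) w) (fp_coef _ t0).
  rewrite e2; have z (v : seq 'I_N) : coef (fun=> 0) v = 0.
    by rewrite /hcoef /ip; under eq_Rintegral do rewrite !mul0r; exact: Int0.
  rewrite -[coef (im u)]/(coef (fun=> 0)) -[RHS]/(coef (fun=> 0) w) z.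
  rewrite /tflow (@eq_tpow _ _ _ _ _ (fun=> 0)) ?tpow0// => v _; exact: z.
have L1 : L2 psi (fun=> 1) by apply/(L2P mpsi psi0); split; exact: (L2r_cst mpsi rpsi).
have lhs : L2norm psi (fun x => semigroup psi (L_graph S J) t u x - mean S u) = L2norm psi (toC (fun x => h (rho t) x - 1)).
  have e : toC (fun x => h (rho t) x - 1) = fun x => toC (h (rho t)) x - 1.
    by apply/funext => x; rewrite /toC rmorphB rmorph1.
  rewrite e mu1; apply: (ae_L2norm mpsi psi0).
  - apply: (L2B mpsi psi0) => //; exact: (semigroup_L2 (semigroupP SA Aunit Janti Ipsi) t0 Lu).
  - by apply: (L2B mpsi psi0) => //; apply/(L2_toC mpsi psi0); exact: Lh.
  - by apply: filterS Tt => x ->.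
have rhs : L2norm psi (fun x => u x - mean S u) = L2norm psi (toC (fun x => h (rho 0) x - 1)).
  by congr (L2norm psi _); apply/funext => x; rewrite mu1 /u /toC rmorphB rmorph1.
have := dec u Lu; rewrite lhs rhs -!normh; [|exact: Lrt..].
have L1' : L2 psiV (toC (fun x => rho 0 x - psi x)).
  by apply/(L2_toC measurable_psiV psiV_gt0); apply: subL; exact: Lrt.
have L2' : L2 psiV (toC (fun x => rho0 x - psi x)).
  by apply/(L2_toC measurable_psiV psiV_gt0); exact: subL.
have ae' : ae_eq_fun (toC (fun x => rho 0 x - psi x)) (toC (fun x => rho0 x - psi x)).
  by apply: filterS ae0 => x; rewrite /toC => ->.
have E' := ae_L2norm measurable_psiV psiV_gt0 L1' L2' ae'.
by rewrite E'.
Qed.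

End fokker_planck.

Theorem corollary1 (R : realType) (N : nat) (hN : (0 < N)%N) :
  exists C : R, forall S : 'M[R]_N, sym_posdef S ->
    (exists Jopt : 'M[R]_N, optimal C S Jopt) /\
    (forall Jopt : 'M[R]_N, optimal C S Jopt ->
      forall (psi0 : 'cV[R]_N -> R) (psi : R -> 'cV[R]_N -> R),
        probability_density psi0 -> L2 (psi_inf_inv S) (toC psi0) ->
        fokker_planck_solution S (- Jopt) psi0 psi ->
        forall t : R, 0 <= t ->
          L2norm (psi_inf_inv S) (toC (fun x => psi t x - psi_inf S x))
          <= C * kappa S `^ (7 / 2) * expR (- (\tr S / N%:R) * t)
             * L2norm (psi_inf_inv S) (toC (fun x => psi0 x - psi_inf S x))).
Proof.
(* The weights q_i = i + 1 lie between 1 and N, which gives the constant N on squared norms and sqrt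
   N on norms. *)
case: N hN => // n _; exists (Num.sqrt n.+1%:R) => S posS.
have Ipsi := Int_psi posS; have [symS pS] := posS.
have [A [SA Aunit Ac]] := equidiagonal_factor symS pS.
split; last first.
  move=> J [[Janti _ _] dec] rho0 rho prob L0 sol t t0.
  by apply: (fp_decay SA Aunit Janti Ipsi sol t0 prob L0) => u Lu; exact: dec.
pose J := optimal_drift A; have Janti : antisymmetric_mx J := optimal_drift_anti A.
have Hq := optimal_weighted Aunit Ac; rewrite -/J in Hq.
have trH J' : antisymmetric_mx J' -> \tr (hdrift A J') = \tr S.
  by move=> J'a; rewrite (tr_hdrift A J'a) mxtrace_mulC -SA.
exists J; split; first split=> //.
- have [r [rr rmin _]] := exists_min_root (hdrift A J) (ltn0Sn n).
  (* With the weights q the form of H is c = tr S / N times the weighted square, so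
     [eigenvalue_weighted] gives this real part for an arbitrary eigenvalue, hence for one of least
     real part. *)
  have <- : complex.Re r = \tr S / n.+1%:R; last exact: (spectral_gap_min_root SA Aunit Janti Ipsi rr rmin).
  have [|a [b [ab0 e]]] := eigenvalue_weighted (q := fun i : 'I_n.+1 => i.+1%:R) _ rr.
    by move=> i; rewrite ltr0n.
  rewrite !Hq -mulrDr -big_split/= in e.
  have ab1 : \sum_(i < n.+1) i.+1%:R * (a i ^+ 2 + b i ^+ 2) != 0 by rewrite gt_eqF.
  apply: (mulIf ab1); rewrite -e; congr (_ * _).
  by apply: eq_bigr => i _; rewrite mulrDr.
(* For any antisymmetric J' the trace of the drift matrix is still tr S, and the least real part is
   at most the mean tr S / N. *)
- move=> J' J'a; have [r [rr rmin rtr]] := exists_min_root (hdrift A J') (ltn0Sn n).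
  by exists (complex.Re r); [exact: (spectral_gap_min_root SA Aunit J'a Ipsi rr rmin)|rewrite -(trH _ J'a)].
move=> u t Lu t0.
have q1 : forall i : 'I_n.+1, ((1 : R) <= (i.+1%:R : R)) && ((i.+1%:R : R) <= (n.+1%:R : R)).
  by move=> i; rewrite ler1n ler_nat ltn_ord.
have D := semigroup_mean_decay (q := fun i : 'I_n.+1 => i.+1%:R) SA Aunit Janti Ipsi q1 Hq t0 Lu.
apply: (le_trans D).
(* It remains to see that kappa S to the power 7 / 2 is at least 1. *)
rewrite ler_wpM2r ?sqrtr_ge0// ler_wpM2r ?expR_ge0// ler_peMr ?sqrtr_ge0//.
have Sunit : S \in unitmx by rewrite SA unitmx_mul unitmx_tr Aunit.
have p0 : (0 : R) <= 7 / 2 by lra.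
by have := ler_powR (kappa_ge1 Sunit) p0; rewrite powRr0.
Qed.
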